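(* Suppose $m, n$ are positive integers, $m \leq n$, $U$ is an open subset of $\mathbf{R}^n$, $V$ is an $m$ dimensional rectifiable varifold in $U$, and $\| \delta V \|$ is a Radon measure. Then there exists a decomposition of $V$.
   Context: Measures over $X$ are outer measures (defined on all subsets of $X$). $\mathbf{G}(n,m)$ is the set of $m$ dimensional linear subspaces of $\mathbf{R}^n$; $P_\natural$ is the orthogonal projection of $\mathbf{R}^n$ onto $P$; $\sigma \bullet \tau = \operatorname{trace}(\sigma^\ast \circ \tau)$ for linear maps $\sigma,\tau : \mathbf{R}^n \to \mathbf{R}^n$. $\mathscr{D}(U,\mathbf{R}^n)$ is the space of smooth compactly supported functions $U \to \mathbf{R}^n$ and $\mathscr{K}(X)$ is the space of continuous real valued functions with compact support on $X$. An $m$ dimensional varifold in $U$ is a Radon measure $V$ over $U \times \mathbf{G}(n,m)$; $\mathbf{V}_m(U)$ is the set of these; $\|V\|(A) = V(A \times \mathbf{G}(n,m))$. $V$ is rectifiable if there are a countably $(\mathscr{H}^m,m)$ rectifiable, $\mathscr{H}^m$ measurable set $M \subset U$ and a positive $\mathscr{H}^m$ measurable function $\vartheta$ on $M$ such that $V(k) = \int_M k(x,T_x)\,\vartheta(x)\, d\mathscr{H}^m x$ for $k \in \mathscr{K}(U\times\mathbf{G}(n,m))$, where $T_x$ is the $m$ dimensional approximate tangent plane of $M$ at $x$. The first variation is $\delta V(\theta) = \int P_\natural \bullet D\theta(x)\, dV(x,P)$ for $\theta \in \mathscr{D}(U,\mathbf{R}^n)$. For a linear functional $S : \mathscr{D}(U,\mathbf{R}^n)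 \to \mathbf{R}$, $\|S\|$ is the largest Borel regular measure over $U$ with $\|S\|(G) = \sup\{ S(\theta) : \theta \in \mathscr{D}(U,\mathbf{R}^n),\ \operatorname{spt}\theta \subset G,\ |\theta| \leq 1 \}$ for open $G \subset U$. If $\|S\|$ is a Radon measure, $S$ also denotes its unique $\mathbf{L}_1$-continuous extension to $\mathbf{L}_1(\|S\|,\mathbf{R}^n)$ and, for $\|S\|$ measurable $A$, $(S \llcorner A)(\theta) = S(\theta_A)$, where $\theta_A = \theta$ on $A$ and $\theta_A = 0$ on $U \setminus A$. If $\|\delta V\|$ is a Radon measure and $E$ is $\|V\|+\|\delta V\|$ measurable, the distributional $V$ boundary of $E$ is $V\partial E = (\delta V)\llcorner E - \delta( V \llcorner (E \times \mathbf{G}(n,m)) )$. $V$ (with $\|\delta V\|$ Radon) is called indecomposable if there is no $\|V\|+\|\delta V\|$ measurable set $E$ with $\|V\|(E)>0$, $\|V\|(U\setminus E)>0$ and $V\partial E = 0$. $W$ is a component of $V$ if and only if $0 \neq W \in \mathbf{V}_m(U)$ is indecomposable and there is a $\|V\|+\|\delta V\|$ measurable set $E$ with $W = V\llcorner (E\times\mathbf{G}(n,m))$ and $V\partial E = 0$. A set $\Xi \subset \mathbf{V}_m(U)$ is a decomposition of $V$ if and only if: (1) each member of $\Xi$ is a component of $V$; (2) whenever $W$ and $X$ are distinct members of $\Xi$ there are disjoint $\|V\|+\|\delta V\|$ measurable sets $E$ and $F$ with $V\partial E = 0 = V\partial F$, $W = V\llcorner (E\times\mathbf{G}(n,m))$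 and $X = V\llcorner (F\times\mathbf{G}(n,m))$; (3) $V(k) = \sum_{W\in\Xi} W(k)$ for $k \in \mathscr{K}(U\times\mathbf{G}(n,m))$. *)

(* Defs.v *)
From HB Require Import structures.
From mathcomp Require Import all_boot all_order all_algebra.
From mathcomp Require Import all_classical all_reals all_analysis.

Set Implicit Arguments.
Unset Strict Implicit.
Unset Printing Implicit Defensive.

Import Order.TTheory GRing.Theory Num.Theory.
Import numFieldNormedType.Exports.

Local Open Scope classical_set_scope.
Local Open Scope ring_scope.

(* Conventions.
   - R^n is 'rV[R]_n and linear maps are matrices acting on row vectors on the
     right.  The norm that the library puts on 'rV[R]_n is the sup norm: it is
     used only through the topology and the derivatives it induces, every
     metric notion below uses the Euclidean norm [enorm].
   - A measure over an open subset O of a space X is an outer measure on X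
     which vanishes on the complement of O, i.e. an outer measure on O is
     identified with its extension A |-> mu (A `&` O).  Functions with compact
     support in O are likewise extended by 0 to X.
   - [Kspace O], [test_fields U], [L1_fields mu], [grassmann n m], [varifold U],
     [weight V], [variation U S] and [dist_boundary U V A] stand for K(O),
     D(U, R^n), L_1(mu, R^n), G(n,m), V_m(U), ||V||, ||S|| and the
     distributional V boundary of A; [orestr mu A] is mu restricted to A and
     [vrestr V A] is V restricted to A x G(n,m). *)

HB.instance Definition _ (R : realType) (T : Type) :=
  gen_eqMixin (outer_measure R T).
HB.instance Definition _ (R : realType) (T : Type) :=
  gen_choiceMixin (outer_measure R T).

Section outer_measures.
Context (R : realType) (T : Type).
Local Open Scope ereal_scope.

Definition ozero (_ : set T) : \bar R := 0.

Let ozero0 : ozero set0 = 0. Proof. by []. Qed.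
Let ozero_ge0 A : 0 <= ozero A. Proof. by []. Qed.
Let le_ozero : {homo ozero : A B / A `<=` B >-> A <= B}. Proof. by []. Qed.
Let ozero_sub : sigma_subadditive ozero.
Proof. by move=> F; apply: nneseries_ge0. Qed.

HB.instance Definition _ :=
  isOuterMeasure.Build R T ozero ozero0 ozero_ge0 le_ozero ozero_sub.

Definition orestr (mu : {outer_measure set T -> \bar R}) (A B : set T) :=
  mu (A `&` B).

Section orestr_instance.
Variables (mu : {outer_measure set T -> \bar R}) (A : set T).

Let orestr0 : orestr mu A set0 = 0.
Proof. by rewrite /orestr setI0 outer_measure0. Qed.
Let orestr_ge0 B : 0 <= orestr mu A B. Proof. exact: outer_measure_ge0. Qed.
Let le_orestr : {homo orestr mu A : B C / B `<=` C >-> B <= C}.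
Proof. by move=> B C BC; apply: le_outer_measure; apply: setIS. Qed.
Let orestr_sub : sigma_subadditive (orestr mu A).
Proof.
move=> F; rewrite /orestr setI_bigcupr.
exact: outer_measure_sigma_subadditive.
Qed.

HB.instance Definition _ := isOuterMeasure.Build R T (orestr mu A)
  orestr0 orestr_ge0 le_orestr orestr_sub.
End orestr_instance.

(* Caratheodory's construction from a gauge [zeta] and a class [C] of
   covering sets. *)
Section covering.
Variables (C : set (set T)) (zeta : set T -> \bar R).

Definition coverings (A : set T) : set (nat -> set T) :=
  [set F | (forall i, C (F i)) /\ A `<=` \bigcup_i F i].

Definition cover_outer (A : set T) : \bar R :=
  ereal_inf [set \sum_(i <oo) zeta (F i) | F in coverings A].

Hypotheses (C0 : C set0) (zeta0 : zeta set0 = 0) (zeta_ge0 : forall A, 0 <= zeta A).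

Lemma cover_outer_ge0 A : 0 <= cover_outer A.
Proof. by apply: le_ereal_inf_tmp => _ [F _ <-]; apply: nneseries_ge0. Qed.

Lemma cover_outer0 : cover_outer set0 = 0.
Proof.
apply/eqP; rewrite eq_le cover_outer_ge0 andbT.
apply: ereal_inf_lbound; exists (fun=> set0); first by split.
by apply: eseries0 => i _ _; rewrite zeta0.
Qed.

Lemma le_cover_outer : {homo cover_outer : A B / A `<=` B >-> A <= B}.
Proof.
move=> A B AB; apply/ereal_inf_le_tmp => x [F [CF BF]] <-{x}.
by exists F => //; split => //; apply: subset_trans AB BF.
Qed.

Lemma cover_outer_sigma_subadditive : sigma_subadditive cover_outer.
Proof.
move=> A; have [[i ioo]|] := pselect (exists i, cover_outer (A i) = +oo).
  rewrite (eseries_pinfty _ _ ioo) ?leey// => n _.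
  by rewrite -ltNye (lt_le_trans _ (cover_outer_ge0 _)).
rewrite -forallNE => Aoo.
suff add2e (e : {posnum R}) :
    cover_outer (\bigcup_n A n) <= \sum_(i <oo) cover_outer (A i) + e%:num%:E.
  by apply/lee_addgt0Pr => _/posnumP[].
rewrite (le_trans _ (epsilon_trick _ _ _))//; last first.
  by move=> n; exact: cover_outer_ge0.
pose P n (B : nat -> set T) := coverings (A n) B /\
  \sum_(k <oo) zeta (B k) <= cover_outer (A n) + (e%:num / (2 ^ n.+1)%:R)%:E.
have [G PG] : {G : nat -> nat -> set T & forall n, P n (G n)}.
  apply: (@choice _ _ P) => n; rewrite /P.
  set S := [set \sum_(i <oo) zeta (F i) | F in coverings (A n)].
  rewrite -/(cover_outer _) /cover_outer -/S.
  move infS : (ereal_inf S) => iS.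
  case: iS infS => [r Sr|Soo|Soo].
  - have en1 : (0 < e%:num / (2 ^ n.+1)%:R)%R by [].
    have /(lb_ereal_inf_adherent en1) : ereal_inf S \is a fin_num by rewrite Sr.
    move=> [x [B [mB AnB] muBx] xS].
    by exists B; split => //; rewrite muBx -Sr; exact/ltW.
  - by have := Aoo n; rewrite /cover_outer -/S Soo.
  - suff : lbound S 0 by move/le_ereal_inf_tmp; rewrite Soo.
    by move=> /= _ [B [mB AnB] <-]; exact: nneseries_ge0.
have zG_ge0 x : 0 <= (zeta \o uncurry G) x by exact: zeta_ge0.
apply: (@le_trans _ _ (\esum_(i in setT) (zeta \o uncurry G) i)).
  apply: ereal_inf_lbound => /=.
  have /card_esym/ppcard_eqP[f] := card_nat2.
  exists (uncurry G \o f).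
    split => [i|]; first by rewrite /= /uncurry; case: (f i) => a b; exact: (PG a).1.1.
    apply: (@subset_trans _  (\bigcup_n \bigcup_k G n k)) => [t [i _]|].
      by move=> /((PG i).1.2) -[j _ ?]; exists i => //; exists j.
    move=> t [i _ [j _ Bijt]]; exists (f^-1%FUN (i, j)) => //=.
    by rewrite invK ?inE.
  rewrite -(esum_pred_image (zeta \o uncurry G) _ xpredT) ?[fun=> _]set_true//.
  by rewrite image_eq.
rewrite (_ : esum _ _ = \sum_(i <oo) \sum_(j <oo ) zeta (G i j)); last first.
  pose J : nat -> set (nat * nat) := fun i => [set (i, j) | j in setT].
  rewrite (_ : setT = \bigcup_k J k); last first.
    by rewrite predeqE => -[a b]; split => // _; exists a => //; exists b.
  rewrite esum_bigcupT /=; last 2 first.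
    - apply/trivIsetP => i j _ _ ij.
      rewrite predeqE => -[n m] /=; split => //= -[] [_] _ [<-{n} _].
      by move=> [m' _] [] /esym/eqP; rewrite (negbTE ij).
    - by move=> /= [n m]; apply: zeta_ge0.
  rewrite -(image_id [set: nat]) -fun_true esum_pred_image//; last first.
    by move=> n _; exact: esum_ge0.
  apply: eq_eseriesr => /= j _.
  rewrite -(esum_pred_image (zeta \o uncurry G) (pair j) predT)//=; last first.
    by move=> ? ? _ _; exact: (@can_inj _ _ _ snd).
  by congr esum; rewrite predeqE => -[a b]; split; move=> [i _ <-]; exists i.
apply: lee_lim.
- apply: is_cvg_nneseries => n *.
  by apply: nneseries_ge0 => m *; exact: (zG_ge0 (n, m)).
- by apply: is_cvg_nneseries => n *; apply: adde_ge0 => //; exact: cover_outer_ge0.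
- by near=> n; apply: lee_sum => i _; exact: (PG i).2.
Unshelve. all: by end_near. Qed.

End covering.
End outer_measures.

Section integration.
Context (R : realType).

Definition cmeas (T : pointedType) (mu : {outer_measure set T -> \bar R})
    : {measure set (caratheodory_type mu) -> \bar R} :=
  [the {measure set (caratheodory_type mu) -> \bar R} of
     (mu : set (caratheodory_type mu) -> \bar R)].

Definition ointegral (T : pointedType) (mu : {outer_measure set T -> \bar R})
  (f : T -> R) : R := Rintegral (cmeas mu) setT f.

Definition radon_over (X : topologicalType) (O : set X)
    (mu : {outer_measure set X -> \bar R}) : Prop :=
  [/\ mu (~` O) = 0%E,
      forall K, compact K -> K `<=` O -> (mu K < +oo)%E,
      forall G, open G -> G `<=` O -> mu.-caratheodory G,
      forall G, open G -> G `<=` O ->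
        mu G = ereal_sup [set mu K | K in [set K | compact K /\ K `<=` G]] &
      forall A, A `<=` O ->
        mu A = ereal_inf
          [set mu G | G in [set G | [/\ open G, A `<=` G & G `<=` O]]]].

Definition borel_regular_over (X : topologicalType) (O : set X)
    (mu : {outer_measure set X -> \bar R}) : Prop :=
  [/\ mu (~` O) = 0%E,
      forall G, open G -> G `<=` O -> mu.-caratheodory G &
      forall A, A `<=` O ->
        exists B, [/\ <<s open >> B, A `<=` B, B `<=` O & mu A = mu B]].

Definition spt (X : topologicalType) (W : nmodType) (f : X -> W) : set X :=
  closure [set x | f x != 0].

Definition Kspace (X : topologicalType) (O : set X) : set (X -> R) :=
  [set k | [/\ continuous k, compact (spt k) & spt k `<=` O]].

(* The sum of a real family over an arbitrary index set, in the sense of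
   unconditional summation: sum of positive parts minus sum of negative
   parts. *)
Definition numsum (I : choiceType) (D : set I) (f : I -> R) : \bar R :=
  (\esum_(i in D) (Num.max (f i) 0)%:E - \esum_(i in D) (Num.max (- f i) 0)%:E)%E.

End integration.

Section euclidean.
Context (R : realType).

Definition enorm (n : nat) (x : 'rV[R]_n) : R :=
  Num.sqrt (\sum_(i < n) x ord0 i ^+ 2).

Definition eball (n : nat) (a : 'rV[R]_n) (r : R) : set 'rV[R]_n :=
  [set x | enorm (x - a) <= r].

Definition ediam (n : nat) (S : set 'rV[R]_n) : \bar R :=
  ereal_sup [set (enorm (xy.1 - xy.2))%:E | xy in S `*` S].

(* The Lebesgue measure of the unit ball of R^m, by the recursion
   alpha (m + 2) = 2 pi / (m + 2) * alpha m. *)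
Fixpoint alpha (m : nat) : R :=
  match m with
  | 0 => 1
  | 1 => 2
  | (k.+1 as l).+1 => 2 * pi / l.+1%:R * alpha k
  end.

(* The sets of infinite diameter, on which [fine] is 0, are never used as
   covering sets in [hausdorff]. *)
Definition hgauge (n m : nat) (S : set 'rV[R]_n) : \bar R :=
  if S == set0 then 0%E else (alpha m / 2 ^+ m * fine (ediam S) ^+ m)%:E.

Definition hausdorff (n m : nat) (A : set 'rV[R]_n) : \bar R :=
  ereal_sup [set cover_outer [set S | (ediam S <= d%:E)%E] (hgauge m) A
            | d in [set d : R | 0 < d]].

Lemma alpha_ge0 m : 0 <= alpha m.
Proof.
suff : 0 <= alpha m /\ 0 <= alpha m.+1 by case.
elim: m => [|m [IH1 IH2]]; first by split => /=.
split=> //; rewrite [alpha _]/=; apply: mulr_ge0 => //.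
by apply: divr_ge0 => //; apply: mulr_ge0 => //; exact: pi_ge0.
Qed.

Lemma hgauge0 n m : hgauge m (set0 : set 'rV[R]_n) = 0%E.
Proof. by rewrite /hgauge eqxx. Qed.

Lemma hgauge_ge0 n m (S : set 'rV[R]_n) : (0 <= hgauge m S)%E.
Proof.
rewrite /hgauge; case: ifPn => // /set0P[x Sx].
rewrite lee_fin; apply: mulr_ge0.
  by apply: divr_ge0; rewrite ?alpha_ge0// exprn_ge0.
apply/exprn_ge0/fine_ge0; apply: ereal_sup_ge.
by exists (enorm (x - x))%:E; [exists (x, x)|rewrite lee_fin sqrtr_ge0].
Qed.

Lemma ediam0 n (d : R) : (ediam (set0 : set 'rV[R]_n) <= d%:E)%E.
Proof.
rewrite /ediam (_ : [set _ | _ in _] = set0) ?ereal_sup0 ?leNye//.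
by rewrite set0X image_set0.
Qed.

Section hausdorff_instance.
Variables (n m : nat).
Local Notation H := (@hausdorff n m).
Local Open Scope ereal_scope.

Let H_ge0 A : 0 <= H A.
Proof.
apply: ereal_sup_ge.
exists (cover_outer [set S | (ediam S <= 1%:E)%E] (hgauge m) A) => //.
  by exists 1%R => //=.
exact/cover_outer_ge0/hgauge_ge0.
Qed.

Let H0 : H set0 = 0.
Proof.
apply/eqP; rewrite eq_le H_ge0 andbT; apply: ge_ereal_sup => _ [d _ <-].
by rewrite cover_outer0//; [exact: ediam0|exact: hgauge0|exact: hgauge_ge0].
Qed.

Let le_H : {homo H : A B / A `<=` B >-> A <= B}.
Proof.
move=> A B AB; apply: ge_ereal_sup => _ [d d0 <-]; apply: ereal_sup_ge.
exists (cover_outer [set S | (ediam S <= d%:E)%E] (hgauge m) B).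
  by exists d.
exact: le_cover_outer.
Qed.

Let H_sub : sigma_subadditive H.
Proof.
move=> F; apply: ge_ereal_sup => _ [d d0 <-].
apply: le_trans.
  by apply: cover_outer_sigma_subadditive; exact: hgauge_ge0.
apply: lee_nneseries => [i _ _|i _]; first exact/cover_outer_ge0/hgauge_ge0.
by apply: ereal_sup_ubound; exists d.
Qed.

HB.instance Definition _ :=
  isOuterMeasure.Build R 'rV[R]_n H H0 H_ge0 le_H H_sub.
End hausdorff_instance.

(* Countable (H^m, m) rectifiability: up to an H^m null set, M is covered by
   countably many Lipschitz images of bounded subsets of R^m. *)
Definition rectifiable_set (n m : nat) (M : set 'rV[R]_n) : Prop :=
  exists (A : nat -> set 'rV[R]_m) (f : nat -> 'rV[R]_m -> 'rV[R]_n),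
    [/\ forall i, exists b : R, forall x, A i x -> enorm x <= b,
        forall i, exists L : R, forall x y, A i x -> A i y ->
          enorm (f i x - f i y) <= L * enorm (x - y) &
        hausdorff m (M `\` \bigcup_i (f i @` A i)) = 0%E].

Definition tangent_cone (n : nat) (S : set 'rV[R]_n) (a : 'rV[R]_n)
    : set 'rV[R]_n :=
  [set v | forall e : R, 0 < e -> exists x (r : R),
     [/\ S x, 0 < r, enorm (x - a) < e & enorm (r *: (x - a) - v) < e]].

(* Federer's Tan^m(phi, a): the intersection of the tangent cones at a of the
   sets S whose complement has m dimensional phi density 0 at a. *)
Definition approx_tangent_cone (n m : nat) (phi : set 'rV[R]_n -> \bar R)
    (a : 'rV[R]_n) : set 'rV[R]_n :=
  [set v | forall S : set 'rV[R]_n,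
     (fun r : R => (phi (eball a r `&` ~` S) * ((alpha m * r ^+ m)^-1)%:E)%E)
        @ 0^'+ --> (0 : \bar R)%E ->
     tangent_cone S a v].

End euclidean.

Section grassmannian.
Context (R : realType).

Definition subspaces (n : nat) : Type := {vspace 'rV[R]_n}.

HB.instance Definition _ n := Choice.copy (subspaces n) {vspace 'rV[R]_n}.
HB.instance Definition _ n := isPointed.Build (subspaces n) (0%VS : {vspace 'rV[R]_n}).

Definition basis_mx (n : nat) (P : {vspace 'rV[R]_n}) : 'M[R]_(\dim P, n) :=
  \matrix_(i < \dim P) tnth (vbasis P) i.

(* The orthogonal projection of R^n onto P; the row space of [kermx B^T] is
   the orthogonal complement of the row space of B. *)
Definition orthoproj (n : nat) (P : subspaces n) : 'M[R]_n :=
  proj_mx <<basis_mx P>>%MS (kermx (basis_mx P)^T).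

(* Subspaces are topologised by P |-> orthoproj P, so that [grassmann n m]
   carries its usual topology and is open and closed in [subspaces n]. *)
HB.instance Definition _ n :=
  Topological.copy (subspaces n) (initial_topology (@orthoproj n)).

Definition grassmann (n m : nat) : set (subspaces n) :=
  [set P | \dim (P : {vspace 'rV[R]_n}) = m].

End grassmannian.

Section varifolds.
Context (R : realType) (n m : nat).
Local Notation E := 'rV[R]_n.
Local Notation X := ('rV[R]_n * subspaces R n)%type.
Local Notation G := (@grassmann R n m).
Implicit Types (U A : set E) (V W : {outer_measure set X -> \bar R}).

Definition varifold U V : Prop := radon_over (U `*` G) V.

Definition weight V A : \bar R := V (A `*` G).

Section weight_instance.
Variable V : {outer_measure set X -> \bar R}.
Local Open Scope ereal_scope.

Let weight0 : weight V set0 = 0.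
Proof. by rewrite /weight set0X outer_measure0. Qed.
Let weight_ge0 A : 0 <= weight V A. Proof. exact: outer_measure_ge0. Qed.
Let le_weight : {homo weight V : A B / A `<=` B >-> A <= B}.
Proof. by move=> A B AB; apply: le_outer_measure => -[x P] [/= /AB]. Qed.
Let weight_sub : sigma_subadditive (weight V).
Proof.
move=> F; rewrite /weight.
rewrite (_ : _ `*` _ = \bigcup_i (F i `*` G)).
  exact: outer_measure_sigma_subadditive.
apply/seteqP; split => -[x P] /=; first by move=> [[i _ Fx] GP]; exists i.
by move=> [i _ [Fx GP]]; split => //; exists i.
Qed.

HB.instance Definition _ := isOuterMeasure.Build R E (weight V)
  weight0 weight_ge0 le_weight weight_sub.
End weight_instance.

(* T x is the approximate tangent plane of M at x for H^m almost all x in M.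
   A countably (H^m, m) rectifiable set M may have locally infinite H^m
   measure, in which case Tan^m(H^m restricted to M, x) need not be a plane;
   the plane is therefore prescribed by the H^m measurable subsets of M of
   finite measure.  If H^m(M) is finite this says that
   Tan^m(H^m restricted to M, x) = T x for H^m almost all x in M. *)
Definition approx_tangent_planes (M : set E) (T : E -> subspaces R n) : Prop :=
  (forall x, M x -> G (T x)) /\
  forall S, S `<=` M -> (@hausdorff R n m).-caratheodory S ->
    (hausdorff m S < +oo)%E ->
    hausdorff m [set x | S x /\
      approx_tangent_cone m (orestr (@hausdorff R n m) S) x
        <> [set v | v \in (T x : {vspace E})]] = 0%E.

Definition rectifiable_varifold U V : Prop :=
  varifold U V /\
  exists (M : set E) (theta : E -> R) (T : E -> subspaces R n),
    [/\ M `<=` U, rectifiable_set m M & (@hausdorff R n m).-caratheodory M] /\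
    [/\ forall x, M x -> 0 < theta x,
        measurable_fun (M : set (caratheodory_type (@hausdorff R n m))) theta,
        approx_tangent_planes M T &
        forall k : X -> R, Kspace (U `*` G) k ->
          (ointegral V k)%:E =
            (\int[cmeas (@hausdorff R n m)]_(x in M) (k (x, T x) * theta x)%:E)%E].

Fixpoint iter_derive (f : E -> E) (vs : seq E) : E -> E :=
  if vs is v :: vs' then fun x => 'D_v (iter_derive f vs') x else f.

Definition smooth (f : E -> E) : Prop :=
  forall vs : seq E, continuous (iter_derive f vs) /\
    forall x v, derivable (iter_derive f vs) x v.

Definition test_fields U : set (E -> E) :=
  [set theta | [/\ smooth theta, compact (spt theta) & spt theta `<=` U]].

Definition bullet (s t : 'M[R]_n) : R := \tr (t *m s^T).

Definition first_variation V (theta : E -> E) : R :=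
  ointegral V (fun xP : X => bullet (orthoproj xP.2) (jacobian theta xP.1)).

(* Functionals on test fields are functions (E -> E) -> R, of which only the
   values on [test_fields U] matter. *)
Definition variation_formula U (S : (E -> E) -> R)
    (mu : {outer_measure set E -> \bar R}) : Prop :=
  forall O, open O -> O `<=` U ->
    mu O = ereal_sup [set (S theta)%:E | theta in
      [set theta | [/\ test_fields U theta, spt theta `<=` O &
                       forall x, enorm (theta x) <= 1]]].

Definition variation U (S : (E -> E) -> R) : {outer_measure set E -> \bar R} :=
  xget [the {outer_measure set E -> \bar R} of @ozero R E]
    [set mu : {outer_measure set E -> \bar R} |
      [/\ borel_regular_over U mu, variation_formula U S mu &
          forall nu : {outer_measure set E -> \bar R},
            borel_regular_over U nu -> variation_formula U S nu ->
            forall A, (nu A <= mu A)%E]].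

Definition L1_fields (mu : {outer_measure set E -> \bar R}) : set (E -> E) :=
  [set f | (forall O, open O -> mu.-caratheodory (f @^-1` O)) /\
           (\int[cmeas mu]_x (enorm (f x))%:E < +oo)%E].

Definition is_L1_extension U (S S' : (E -> E) -> R) : Prop :=
  let mu := variation U S in
  [/\ forall theta, test_fields U theta -> S' theta = S theta,
      forall (a : R) f g, L1_fields mu f -> L1_fields mu g ->
        S' (fun x => a *: f x + g x) = a * S' f + S' g &
      forall f, L1_fields mu f -> forall e : R, 0 < e ->
        exists2 d : R, 0 < d & forall g, L1_fields mu g ->
          (\int[cmeas mu]_x (enorm (g x - f x))%:E < d%:E)%E ->
          `|S' g - S' f| < e].

(* The L_1(||S||, R^n)-continuous extension of S; meaningful, and unique on
   L_1(||S||, R^n), when ||S|| is a Radon measure. *)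
Definition L1_extension U (S : (E -> E) -> R) : (E -> E) -> R :=
  xget (fun=> 0) [set S' | is_L1_extension U S S'].

Definition functional_restr U (S : (E -> E) -> R) A (theta : E -> E) : R :=
  L1_extension U S (fun x => if x \in A then theta x else 0).

Definition vrestr V A : {outer_measure set X -> \bar R} :=
  [the {outer_measure set X -> \bar R} of orestr V (A `*` G)].

Definition dist_boundary U V A (theta : E -> E) : R :=
  functional_restr U (first_variation V) A theta
  - first_variation (vrestr V A) theta.

Definition vmeasurable U V A : Prop :=
  A `<=` U /\
  (fun B => weight V B + variation U (first_variation V) B)%E.-caratheodory A.

Definition zero_boundary U V A : Prop :=
  forall theta, test_fields U theta -> dist_boundary U V A theta = 0.

Definition radon_variation U V : Prop :=
  radon_over U (variation U (first_variation V)).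

Definition indecomposable U V : Prop :=
  radon_variation U V /\
  ~ exists A, [/\ vmeasurable U V A, (0 < weight V A)%E,
                  (0 < weight V (U `\` A))%E & zero_boundary U V A].

Definition component U V W : Prop :=
  [/\ varifold U W, (exists B, W B <> 0%E), indecomposable U W &
      exists A, [/\ vmeasurable U V A, W = vrestr V A & zero_boundary U V A]].

Definition decomposition U V (Xi : set {outer_measure set X -> \bar R}) : Prop :=
  [/\ forall W, Xi W -> component U V W,
      forall W Y, Xi W -> Xi Y -> W <> Y ->
        exists A B, [/\ vmeasurable U V A /\ vmeasurable U V B,
                        A `&` B = set0,
                        zero_boundary U V A /\ zero_boundary U V B,
                        W = vrestr V A & Y = vrestr V B] &
      forall k : X -> R, Kspace (U `*` G) k ->
        (ointegral V k)%:E = numsum Xi (fun W => ointegral W k)].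

End varifolds.

(* Main.v *)
(* Call a Borel set E a part if V∂E = 0. As a function of E, V∂E is finitely
   additive and passes to monotone limits, so the parts are closed under
   proper differences and decreasing intersections. Testing V∂E = 0 against a cut-off of
   the radial field |x - a|^{-m} (x - a) gives a monotonicity inequality for
   r |-> r^{-m} ||V||(E ∩ B(a,r)), with an error term controlled by ||δV|| on
   dyadic balls around a. At H^m almost all points of the carrier these balls
   are thin enough for the error to be summable, and ||V|| = θ H^m then forces
   a lower bound: there are sets C_i exhausting ||V||, compact sets N_i and
   numbers δ_i > 0 such that ||V||(E ∩ N_i) >= δ_i for each part E with
   ||V||(E ∩ C_i) > 0. Hence a part of positive weight can be split only
   finitely often into parts charging C_i, and a part that cannot be split in
   this way contains a minimal one, an atom. A greedy choice of disjoint
   atoms exhausts ||V||, and the restriction of V to an atom is indecomposable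
   because a part of the restriction is, up to null sets, a part of V. *)

From HB Require Import structures.
Require Import Defs.
From mathcomp Require Import all_boot all_order all_algebra.
From mathcomp Require Import all_classical all_reals all_analysis.
From mathcomp Require Import measurable_realfun finmap zify ring lra.

Set Implicit Arguments.
Unset Strict Implicit.
Unset Printing Implicit Defensive.

Import Order.TTheory GRing.Theory Num.Theory.
Import numFieldNormedType.Exports.
Local Open Scope classical_set_scope.
Local Open Scope ring_scope.

(** Parts do not form an algebra. For six half lines issuing from a point of the plane at equal
    angles, a line and a triple of alternate half lines are parts, but their intersection, a single
    half line, is not. So minimal parts are sought with proper differences and monotone limits
    alone. Both ||δV|| and the extension of δV to L_1 fields are defined by choice from their
    characterisations. Before V∂E can be computed their existence has to be proved; it rests on an
    estimate of S(θ) by 16 times the integral of |θ| with respect to ||S||, where any constant would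
    do. V, ||V||, ||δV|| and the restrictions of these have different Caratheodory sigma-algebras,
    which share the Borel sets; hence parts are Borel. The ratio 3/4 in the definition of thin balls
    lies between 1/2 and 1: above 1/2, points thick at infinitely many scales are H^m null by a
    packing argument; below 1, the error of the monotonicity inequality is summable. *)

Section orthogonal_projections.
Variables (R : realType) (n : nat).
Implicit Types (P : subspaces R n) (u : 'rV[R]_n) (Q : 'M[R]_n).

Lemma dotmx_eq0 u : (u *m u^T) 0 0 = 0 -> u = 0.
Proof.
rewrite mxE => /psumr_eq0P h.
apply/rowP => j; rewrite [RHS]mxE.
have /h : forall i : 'I_n, true -> 0 <= u 0 i * u^T i 0.
  by move=> i _; rewrite mxE -expr2 sqr_ge0.
move=> /(_ j isT)/eqP; rewrite mxE -expr2 sqrf_eq0 => /eqP.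
by [].
Qed.

Lemma mem_basis_mx P u : (u \in (P : {vspace 'rV[R]_n})) = (u <= basis_mx P)%MS.
Proof.
apply/idP/submxP => [uP|[D ->]].
  exists (\row_i coord (vbasis P) i u).
  rewrite {1}(coord_vbasis uP) mulmx_sum_row; apply: eq_bigr => i _.
  rewrite mxE; congr (_ *: _); apply/rowP => j.
  by rewrite !mxE (tnth_nth 0).
rewrite mulmx_sum_row; apply: memv_suml => i _; apply: memvZ.
rewrite rowK; apply: vbasis_mem; exact: mem_tnth.
Qed.

Lemma basis_mx_free P : row_free (basis_mx P).
Proof.
rewrite -kermx_eq0; apply/eqP/row_matrixP => i; rewrite row0.
set c := row i _.
have : c *m basis_mx P = 0 by rewrite /c -row_mul mulmx_ker row0.
rewrite mulmx_sum_row => h.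
have /freeP := basis_free (vbasisP (P : {vspace 'rV[R]_n})).
move=> /(_ (fun j => c 0 j)) h'.
apply/rowP => j; rewrite [RHS]mxE; apply: h'.
rewrite -[RHS]h; apply: eq_bigr => k _; rewrite rowK (tnth_nth 0) //.
Qed.

(** A row u lying in both spaces is a combination of the basis and orthogonal to it, hence u u^T =
    0. *)
Lemma basis_mx_cap P : (<<basis_mx P>> :&: kermx (basis_mx P)^T)%MS = 0.
Proof.
apply/eqP; rewrite -submx0; apply/row_subP => i.
set u := row i _.
have : (u <= <<basis_mx P>> :&: kermx (basis_mx P)^T)%MS by exact: row_sub.
rewrite sub_capmx genmxE => /andP[/submxP[D uD] /sub_kermxP uk].
suff -> : u = 0 by exact: sub0mx.
by apply: dotmx_eq0; rewrite {2}uD trmx_mul mulmxA uk mul0mx mxE.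
Qed.

Lemma basis_mx_sum P : (1%:M <= <<basis_mx P>> + kermx (basis_mx P)^T)%MS.
Proof.
rewrite sub1mx -col_leq_rank.
rewrite mxrank_disjoint_sum ?basis_mx_cap// genmxE mxrank_ker mxrank_tr.
rewrite subnKC//; exact: rank_leq_col.
Qed.

Lemma orthoproj_mem P u : (u \in (P : {vspace 'rV[R]_n})) <-> u *m orthoproj P = u.
Proof.
rewrite mem_basis_mx -(genmxE (basis_mx P)); split => [h|<-]; last exact: proj_mx_sub.
exact: (proj_mx_id (basis_mx_cap P) h).
Qed.

Lemma orthoproj_idem P : orthoproj P *m orthoproj P = orthoproj P.
Proof. exact/proj_mx_proj/basis_mx_cap. Qed.

(** The rows of 1 - Q are orthogonal to P and those of Q lie in P. Hence (1 - Q) Q^T = 0, and Q^T =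
    Q Q^T is symmetric. *)
Lemma orthoproj_sym P : (orthoproj P)^T = orthoproj P.
Proof.
set Q := orthoproj P.
have /submxP[D QD] : (Q <= basis_mx P)%MS.
  by rewrite -(genmxE (basis_mx P)) -[Q]mul1mx; exact: proj_mx_sub.
have : (1%:M - Q) *m (basis_mx P)^T = 0.
  apply/sub_kermxP; rewrite -[X in _ - X]mul1mx.
  by apply: (proj_mx_compl_sub); exact: basis_mx_sum.
move=> h.
have : (1%:M - Q) *m Q^T = 0 by rewrite QD trmx_mul mulmxA -QD h mul0mx.
rewrite mulmxBl mul1mx => /eqP; rewrite subr_eq0 => /eqP e.
by have := congr1 trmx e; rewrite trmxK trmx_mul trmxK -e.
Qed.

Lemma orthoproj_rank P : \rank (orthoproj P) = \dim (P : {vspace 'rV[R]_n}).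
Proof.
transitivity (\rank (basis_mx P)); last exact/eqP/basis_mx_free.
rewrite -(genmxE (basis_mx P)); apply/eqmx_rank; apply/andP; split.
  by rewrite -[X in (X <= _)%MS]mul1mx; exact: proj_mx_sub.
rewrite -{1}(proj_mx_id (basis_mx_cap P) (submx_refl _)).
exact: submxMl.
Qed.

(** Write Q = C R with C = [col_base Q] of full column rank and R = [row_base Q] of full row rank.
    Cancelling C on the left and R on the right in C (R C) R = C R gives R C = 1, and the trace of C
    R is that of R C. *)
Lemma mxtrace_idem Q : Q *m Q = Q -> \tr Q = (\rank Q)%:R.
Proof.
move=> QQ; rewrite -{1}(mulmx_base Q) mxtrace_mulC.
suff -> : row_base Q *m col_base Q = 1%:M by rewrite mxtrace1.
have /row_freeP[B RB] := row_base_free Q.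
have := col_base_full Q; rewrite /row_full -mxrank_tr => /eqP cr.
have /row_freeP[C HC] : row_free (col_base Q)^T by rewrite /row_free cr.
have : (C^T *m col_base Q) *m (row_base Q *m col_base Q) *m (row_base Q *m B) =
  (C^T *m col_base Q) *m (row_base Q *m B).
  have := QQ; rewrite -{1 2 3}(mulmx_base Q) => e.
  have := congr1 (fun X => C^T *m X *m B) e.
  by rewrite !mulmxA.
have -> : C^T *m col_base Q = 1%:M by rewrite -[col_base Q]trmxK -trmx_mul HC trmx1.
by rewrite RB !mulmx1 mul1mx.
Qed.

Lemma orthoproj_trace P : \tr (orthoproj P) = (\dim (P : {vspace 'rV[R]_n}))%:R.
Proof. by rewrite mxtrace_idem ?orthoproj_rank//; exact: orthoproj_idem. Qed.

(** Describes the image of [orthoproj] by closed conditions, from which compactness of the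
    Grassmannian follows. For P spanned by the rows of Q, the projection Q' satisfies Q Q' = Q and
    Q' Q = Q'; transposing the second identity gives Q' = Q Q' = Q. *)
Lemma orthoproj_surj Q : Q^T = Q -> Q *m Q = Q -> exists P, orthoproj P = Q.
Proof.
move=> Qs QQ.
pose P : subspaces R n := (<<[seq row i Q | i <- enum 'I_n]>>)%VS.
exists P; set Q' := orthoproj P.
have h1 : Q *m Q' = Q.
  apply/row_matrixP => i; rewrite row_mul; apply/orthoproj_mem.
  by apply/memv_span/mapP; exists i => //; rewrite mem_enum.
have h2 : Q' *m Q = Q'.
  have PQ v : v \in (P : {vspace 'rV[R]_n}) -> v *m Q = v.
    move=> vP; pose f : 'End('rV[R]_n) := linfun (mulmxr Q).
    have : (P <= fixedSpace f)%VS.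
      apply/span_subvP => w /mapP[i _ ->].
      by apply/fixedSpaceP; rewrite lfunE /= -row_mul QQ.
    by move=> /subvP/(_ v vP)/fixedSpaceP; rewrite lfunE.
  apply/row_matrixP => i; rewrite row_mul PQ//.
  by apply/orthoproj_mem; rewrite -row_mul orthoproj_idem.
by rewrite -h2 -[LHS]trmxK trmx_mul Qs orthoproj_sym h1.
Qed.

Lemma dot_orthoproj P u :
  (u *m orthoproj P *m u^T) 0 0 = \sum_i (u *m orthoproj P) 0 i ^+ 2.
Proof.
transitivity ((u *m orthoproj P *m (u *m orthoproj P)^T) 0 0).
  rewrite trmx_mul orthoproj_sym -(mulmxA u _ (_ *m _)).
  by rewrite (mulmxA (orthoproj P)) orthoproj_idem mulmxA.
by rewrite mxE; apply: eq_bigr => i _; rewrite [in LHS]mxE expr2 ?mxE.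
Qed.

Lemma dot_orthoproj_ge0 P u : 0 <= (u *m orthoproj P *m u^T) 0 0.
Proof. by rewrite dot_orthoproj; apply: sumr_ge0 => i _; exact: sqr_ge0. Qed.

Lemma dot_orthoproj_le P u :
  (u *m orthoproj P *m u^T) 0 0 <= \sum_i u 0 i ^+ 2.
Proof.
have := orthoproj_sym P; have := orthoproj_idem P.
move: (orthoproj P) => Q QQ Qs.
have : 0 <= ((u - u *m Q) *m (u - u *m Q)^T) 0 0.
  by rewrite mxE; apply: sumr_ge0 => i _; rewrite [X in _ * X]mxE -expr2 sqr_ge0.
have -> : (u - u *m Q) *m (u - u *m Q)^T = u *m u^T - u *m Q *m u^T.
  rewrite linearB /= trmx_mul Qs mulmxBr !mulmxBl !mulmxA.
  by rewrite -(mulmxA u Q Q) QQ subrr subr0.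
rewrite mxE [X in _ + X]mxE subr_ge0 => h; apply: (le_trans h).
by rewrite mxE le_eqVlt; apply/orP; left; apply/eqP/eq_bigr => i _; rewrite mxE expr2.
Qed.

(** Row i is the image of the i-th unit vector, and a projection does not increase length. *)
Lemma orthoproj_entry P i j : `|orthoproj P i j| <= 1.
Proof.
have h : \sum_j (orthoproj P i j) ^+ 2 <= 1.
  have := dot_orthoproj_le P (delta_mx 0 i); rewrite dot_orthoproj.
  have -> : \sum_i0 (delta_mx 0 i : 'rV[R]_n) 0 i0 ^+ 2 = 1.
    rewrite (bigD1 i)//= mxE !eqxx expr1n big1 ?addr0// => k /negPf ki.
    by rewrite mxE eqxx ki expr0n.
  by rewrite -rowE; under eq_bigr do rewrite mxE.
rewrite -(@ler_pXn2r _ 2)// ?nnegrE// expr1n real_normK ?num_real//.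
apply: le_trans h; rewrite (bigD1 j)//= lerDl.
by apply: sumr_ge0 => k _; exact: sqr_ge0.
Qed.
End orthogonal_projections.

(** * Continuity of sums, products and matrix valued maps *)

Section matrix_continuity.
Variable R : realType.

Lemma continuous_bigsum (T : topologicalType) (V : normedModType R) (I : Type) (r : seq I)
    (f : I -> T -> V) : (forall i, continuous (f i)) ->
  continuous (fun x => \sum_(i <- r) f i x).
Proof.
move=> fc x; elim: r => [|i r IH].
  by under eq_fun do rewrite big_nil; exact: cvg_cst.
have -> : (fun x => \sum_(j <- i :: r) f j x) = f i \+ (fun x => \sum_(j <- r) f j x).
  by apply/funext => y; rewrite big_cons.
by apply: continuousD; [exact: fc|exact: IH].
Qed.

Section operations.
Variables (T : topologicalType) (V : normedModType R).
Implicit Types (f g : T -> V) (k : T -> R).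

Lemma continuous_funD f g : continuous f -> continuous g ->
  continuous (fun x => f x + g x).
Proof. by move=> fc gc x; apply: continuousD; [exact: fc|exact: gc]. Qed.

Lemma continuous_funB f g : continuous f -> continuous g ->
  continuous (fun x => f x - g x).
Proof. by move=> fc gc x; apply: continuousB; [exact: fc|exact: gc]. Qed.

Lemma continuous_funZ k f : continuous k -> continuous f ->
  continuous (fun x => k x *: f x).
Proof. by move=> fc gc x; apply: continuousZ; [exact: fc|exact: gc]. Qed.

Lemma continuous_funM k (l : T -> R) : continuous k -> continuous l ->
  continuous (fun x => k x * l x).
Proof. by move=> fc gc x; apply: continuousM; [exact: fc|exact: gc]. Qed.

Lemma continuous_fun_cst (a : V) : continuous (fun _ : T => a).
Proof. by move=> x; exact: cst_continuous. Qed.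
End operations.

Lemma continuous_mx (T : topologicalType) k l (f : T -> 'M[R]_(k, l)) :
  (forall i j, continuous (fun x => f x i j)) -> continuous f.
Proof.
move=> fc x; apply/cvg_ballP => e e0.
suff : \forall y \near x, forall i j, ball (f x i j) e (f y i j).
  by apply: filterS => y h; split.
apply: filter_forall => i; apply: filter_forall => j.
by have /cvg_ballP := fc i j x; exact.
Qed.

Lemma continuous_comp_fun (S T W : topologicalType) (f : S -> T) (g : T -> W) :
  continuous f -> continuous g -> continuous (fun x => g (f x)).
Proof. by move=> fc gc x; apply: continuous_comp; [exact: fc|exact: gc]. Qed.
End matrix_continuity.

(** * The Euclidean norm and the topology of R^n *)

Section euclidean_norm.
Variables (R : realType) (n : nat).
Local Notation E := 'rV[R]_n.
Implicit Types (x y a : E).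

Definition sqn x : R := \sum_(i < n) x 0 i ^+ 2.

Lemma sqn_ge0 x : 0 <= sqn x.
Proof. by apply: sumr_ge0 => i _; exact: sqr_ge0. Qed.

Lemma enorm_ge0 x : 0 <= enorm x.
Proof. exact: sqrtr_ge0. Qed.

Lemma sqr_enorm x : enorm x ^+ 2 = sqn x.
Proof. by rewrite sqr_sqrtr ?sqn_ge0. Qed.

Lemma sqnN x : sqn (- x) = sqn x.
Proof. by apply: eq_bigr => i _; rewrite mxE sqrrN. Qed.

Lemma enormN x : enorm (- x) = enorm x.
Proof. by congr Num.sqrt; exact: sqnN. Qed.

Lemma enormB x y : enorm (x - y) = enorm (y - x).
Proof. by rewrite -enormN opprB. Qed.

Lemma sqnZ (k : R) x : sqn (k *: x) = k ^+ 2 * sqn x.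
Proof. by rewrite /sqn mulr_sumr; apply: eq_bigr => i _; rewrite mxE exprMn. Qed.

Lemma enormZ (k : R) x : enorm (k *: x) = `|k| * enorm x.
Proof.
by rewrite /enorm -/(sqn _) sqnZ sqrtrM ?sqr_ge0// sqrtr_sqr.
Qed.

Lemma sqn0 : sqn (0 : E) = 0.
Proof. by apply: big1 => i _; rewrite mxE expr0n. Qed.

Lemma enorm0 : enorm (0 : E) = 0.
Proof. by rewrite /enorm -/(sqn _) sqn0 sqrtr0. Qed.

(** With A = |x|^2, B = |y|^2 and C the scalar product, the sum of the squares of B x_i - C y_i
    equals B (A B - C^2). This settles B > 0, while B = 0 forces y = 0 and C = 0. *)
Lemma cauchy_schwarz x y : \sum_i x 0 i * y 0 i <= enorm x * enorm y.
Proof.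
set C := \sum_i _.
have [C0|C0] := leP C 0; first exact: (le_trans C0 (mulr_ge0 (enorm_ge0 _) (enorm_ge0 _))).
rewrite -(@ler_pXn2r _ 2)// ?nnegrE ?mulr_ge0 ?enorm_ge0 ?(ltW C0)//.
rewrite exprMn !sqr_enorm; set A := sqn x; set B := sqn y.
have : 0 <= \sum_i (B * x 0 i - C * y 0 i) ^+ 2.
  by apply: sumr_ge0 => i _; exact: sqr_ge0.
have -> : \sum_i (B * x 0 i - C * y 0 i) ^+ 2 = B * (A * B - C ^+ 2).
  transitivity (B ^+ 2 * A - 2 * B * C * C + C ^+ 2 * B); last by ring.
  rewrite [in X in X - _]/A /sqn mulr_sumr [X in _ - X]mulr_sumr [X in _ + X]mulr_sumr -sumrB -big_split /=.
  by apply: eq_bigr => i _; ring.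
have [B0|B0] := leP B 0.
  have y0 i : y 0 i = 0.
    have /psumr_eq0P/(_ i isT) : B = 0 by apply/eqP; rewrite eq_le B0 sqn_ge0.
    by move=> /(_ (fun _ _ => sqr_ge0 _))/eqP; rewrite sqrf_eq0 => /eqP.
  have : C = 0 by apply: big1 => i _; rewrite y0 mulr0.
  by move=> c0; rewrite c0 ltxx in C0.
by rewrite pmulr_rge0// subr_ge0.
Qed.

Lemma sqnD x y : sqn (x + y) = sqn x + 2 * (\sum_i x 0 i * y 0 i) + sqn y.
Proof.
rewrite /sqn mulr_sumr -!big_split; apply: eq_bigr => i _ /=.
by rewrite mxE; ring.
Qed.

Lemma ler_enormD x y : enorm (x + y) <= enorm x + enorm y.
Proof.
rewrite -(@ler_pXn2r _ 2)// ?nnegrE ?addr_ge0 ?enorm_ge0//.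
rewrite sqr_enorm sqnD sqrrD !sqr_enorm lerD2r lerD2l mulrC -[leRHS]mulr_natr.
by rewrite ler_pM2r// cauchy_schwarz.
Qed.

Lemma ler_enormB x y z : enorm (x - z) <= enorm (x - y) + enorm (y - z).
Proof. by rewrite -[x - z](subrKA y); exact: ler_enormD. Qed.

Lemma coord_le_enorm x i : `|x 0 i| <= enorm x.
Proof.
rewrite -(@ler_pXn2r _ 2)// ?nnegrE ?enorm_ge0// real_normK ?num_real//.
rewrite sqr_enorm /sqn (bigD1 i)//= lerDl.
by apply: sumr_ge0 => k _; exact: sqr_ge0.
Qed.

Lemma coord_le_norm x i : `|x 0 i| <= `|x|.
Proof.
have -> : `|x| = mx_norm x by [].
by rewrite mx_normrE; apply: (le_bigmax _ (fun k : 'I_1 * 'I_n => `|x k.1 k.2|) (0, i)).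
Qed.

Lemma norm_le_coord x (e : R) : 0 <= e -> (forall i, `|x 0 i| <= e) -> `|x| <= e.
Proof.
move=> e0 h; have -> : `|x| = mx_norm x by [].
rewrite mx_normrE; apply/bigmax_leP; split => // -[i j] _ /=.
by rewrite (ord1 i).
Qed.

Lemma norm_le_enorm x : `|x| <= enorm x.
Proof. by apply: norm_le_coord => [|i]; [exact: enorm_ge0|exact: coord_le_enorm]. Qed.

Lemma enorm_le_norm x : enorm x <= n%:R * `|x|.
Proof.
rewrite -(@ler_pXn2r _ 2)// ?nnegrE ?enorm_ge0 ?mulr_ge0//.
rewrite sqr_enorm exprMn /sqn.
apply: (@le_trans _ _ (\sum_(i < n) `|x| ^+ 2)).
  apply: ler_sum => i _; rewrite -real_normK ?num_real//.
  by rewrite lerXn2r ?nnegrE// coord_le_norm.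
rewrite sumr_const card_ord -[leLHS]mulr_natl ler_wpM2r ?sqr_ge0//.
by rewrite -natrX ler_nat; case: (n) => // k; rewrite -[leqLHS]expn1 leq_pexp2l.
Qed.

(** Bridge between the sup norm, which carries the topology, and [enorm]. The norms differ by a
    factor of at most n, enlarged to n + 1 so that it can be divided by when n = 0. *)
Lemma nbhs_enormP a (S : set E) :
  nbhs a S <-> exists2 r, 0 < r & forall x, enorm (x - a) < r -> S x.
Proof.
split=> [/nbhs_ballP[r r0 rS]|[r r0 rS]].
  exists r => // x xa; apply: rS; rewrite -ball_normE /= distrC.
  exact: le_lt_trans (norm_le_enorm _) xa.
apply/nbhs_ballP; exists (r / n.+1%:R) => /=; first by rewrite divr_gt0.
move=> x; rewrite -ball_normE /= distrC => xa; apply: rS.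
apply: le_lt_trans (enorm_le_norm _) _.
apply: (@le_lt_trans _ _ (n.+1%:R * `|x - a|)); first by rewrite ler_wpM2r// ler_nat.
by rewrite mulrC -ltr_pdivlMr.
Qed.

Lemma continuous_sqn : continuous (sqn : E -> R).
Proof.
rewrite /sqn; apply: continuous_bigsum => i.
apply: (@continuous_comp_fun _ _ _ (fun x : E => x 0 i) (fun t => t ^+ 2)).
  exact: coord_continuous.
exact: exprn_continuous.
Qed.

Lemma continuous_enorm : continuous (@enorm R n).
Proof.
apply: (@continuous_comp_fun _ _ _ sqn Num.sqrt).
  exact: continuous_sqn.
exact: sqrt_continuous.
Qed.

Lemma continuous_dist a : continuous (fun x => enorm (x - a)).
Proof.
apply: (@continuous_comp_fun _ _ _ (fun x => x - a) (@enorm R n)).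
  by apply: continuous_funB; [move=> x; exact: cvg_id|exact: continuous_fun_cst].
exact: continuous_enorm.
Qed.

Lemma open_eball a (r : R) : open [set x | enorm (x - a) < r].
Proof.
rewrite (_ : [set x | _] = (fun x => enorm (x - a)) @^-1` [set t | t < r])//.
by apply: open_comp => [x _|]; [exact: continuous_dist|exact: open_lt].
Qed.

Lemma closed_eball a (r : R) : closed (eball a r).
Proof.
rewrite (_ : eball a r = (fun x => enorm (x - a)) @^-1` [set t | t <= r])//.
by apply: preimage_closed => [x _|]; [exact: continuous_dist|exact: closed_le].
Qed.

Lemma enorm_compact (S : set E) (r : R) :
  closed S -> (forall x, S x -> enorm x <= r) -> compact S.
Proof.
move=> cS bS; apply: bounded_closed_compact => //.
exists r; split; first exact: num_real.
move=> r' rr' x Sx; apply: (le_trans (norm_le_enorm _)).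
exact: le_trans (bS _ Sx) (ltW rr').
Qed.

Lemma compact_eball a (r : R) : compact (eball a r).
Proof.
apply: (@enorm_compact _ (r + enorm a)); first exact: closed_eball.
move=> x xa.
rewrite -[x](subrK a); apply: le_trans (ler_enormD _ _) _.
by rewrite lerD2r.
Qed.

End euclidean_norm.

(** * Exhaustion of an open set by compact sets *)

Section exhaustion.
Variables (R : realType) (n : nat).
Local Notation E := 'rV[R]_n.

(** [near_covering] is applied with the filter of large indices: around each point of K the
    inclusion holds for all large indices, hence for one index on all of K. *)
Lemma compact_bigcup_nondecreasing (T : topologicalType) (K : set T)
    (F : nat -> set T) : compact K -> (forall i, open (F i)) ->
  (forall i j, (i <= j)%N -> F i `<=` F j) -> K `<=` \bigcup_i F i ->
  exists i, K `<=` F i.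
Proof.
move=> cK oF hF KF.
have : near_covering K by apply/compact_near_coveringP.
move=> /(_ nat \oo (fun i x => F i x) _).
case=> [x Kx|N _ KN]; last by exists N => x Kx; exact: (KN N (leqnn _) x Kx).
have [i _ Fx] := KF x Kx.
exists (F i, [set j | (i <= j)%N]).
  split; first by apply: open_nbhs_nbhs; split; [exact: oF|].
  by exists i.
by move=> [y j] [/= Fy ij]; exact: hF ij _ Fy.
Qed.

Variable U : set E.
Hypothesis oU : open U.

(** The distance to the complement of U enters pointwise rather than through an infimum, so that the
    condition is vacuous when U is the whole space. *)
Definition kex (N : nat) : set E :=
  [set x | enorm x <= N%:R /\ forall z, ~ U z -> 2^-N <= enorm (x - z)].

Lemma closed_kex N : closed (kex N).
Proof.
rewrite (_ : kex N = eball 0 N%:R `&`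
    \bigcap_(z in ~` U) [set x | 2^-N <= enorm (x - z)]).
  apply: closedI; first exact: closed_eball.
  apply: closed_bigI => z _.
  rewrite (_ : [set x | _] = (fun x => enorm (x - z)) @^-1` [set t | 2^-N <= t])//.
  by apply: preimage_closed => [x _|]; [exact: continuous_dist|exact: closed_ge].
apply/seteqP; split => x /=.
  by move=> [xN h]; split => //; rewrite /eball /= subr0.
by rewrite /eball /= subr0 => -[xN h]; split.
Qed.

Lemma compact_kex N : compact (kex N).
Proof. by apply: (@enorm_compact _ _ _ N%:R); [exact: closed_kex|move=> x []]. Qed.

Lemma kex_sub N : kex N `<=` U.
Proof.
move=> x [_ h]; apply: contrapT => /h; rewrite subrr enorm0.
by rewrite leNgt invr_gt0 exprn_gt0.
Qed.

Lemma le_kex i j : (i <= j)%N -> kex i `<=` kex j.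
Proof.
move=> ij x [xi h]; split; first by rewrite (le_trans xi)// ler_nat.
move=> z Uz; apply: le_trans (h _ Uz).
by rewrite lef_pV2 ?posrE ?exprn_gt0// ler_weXn2l// ler1n.
Qed.

(** Since 2^-N is twice 2^-(N+1), half of the distance to the complement survives the move from x to
    y; since 2^-(N+1) <= 1, the norm grows by at most 1. All balls used later are kept inside U by
    this lemma. *)
Lemma kexS_eball N x y : kex N x -> enorm (y - x) <= 2^-N.+1 -> kex N.+1 y.
Proof.
move=> [xN h] yx; split.
  have := ler_enormD (y - x) x; rewrite subrK => h'.
  rewrite (le_trans h')// -[leRHS]natr1 [leRHS]addrC.
  apply: lerD => //; apply: (le_trans yx).
  by rewrite invf_le1// ?exprn_gt0// -natrX ler1n expn_gt0.
move=> z Uz; have := h z Uz; have := ler_enormB x y z.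
have -> : 2^-N = 2^-N.+1 + 2^-N.+1 :> R by rewrite [in RHS]exprS invfM; field.
by rewrite (enormB x y) => h1 h2; rewrite -(lerD2r (2^-N.+1)); lra.
Qed.

Lemma kex_interior N : kex N `<=` (kex N.+1)°.
Proof.
move=> x xN; apply/nbhs_enormP; exists (2^-N.+1); first by rewrite invr_gt0 exprn_gt0.
by move=> y /ltW yx; exact: kexS_eball xN yx.
Qed.

Lemma bigcup_kex : \bigcup_N kex N = U.
Proof.
apply/seteqP; split => [x [N _ /kex_sub]//|x Ux].
have /nbhs_enormP[r r0 rU] : nbhs x U by exact: open_nbhs_nbhs.
have [N1 hN1] : exists N, enorm x <= N%:R.
  exists (Num.truncn (enorm x)).+1; apply: ltW; exact: truncnS_gt.
have [N2 hN2] : exists N, 2^-N <= r.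
  exists (Num.truncn r^-1).+1.
  rewrite -[leRHS]invrK lef_pV2 ?posrE ?exprn_gt0 ?invr_gt0//.
  apply: ltW; apply: lt_le_trans (truncnS_gt _) _.
  by rewrite -natrX ler_nat ltnW// ltn_expl.
exists (maxn N1 N2) => //; split.
  by rewrite (le_trans hN1)// ler_nat leq_maxl.
move=> z Uz; apply: (@le_trans _ _ (2^-N2)).
  by rewrite lef_pV2 ?posrE ?exprn_gt0// ler_weXn2l ?ler1n// leq_maxr.
apply: (le_trans hN2); rewrite leNgt; apply/negP => xz.
by apply: Uz; apply: rU; rewrite enormB.
Qed.

Lemma compact_sub_kex K : compact K -> K `<=` U -> exists N, K `<=` kex N.
Proof.
move=> cK KU.
have [||x Kx|N KN] := @compact_bigcup_nondecreasing _ K (fun N => (kex N)°) cK.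
- by move=> i; exact: open_interior.
- by move=> i j ij; apply: interiorS; exact: le_kex.
- have := KU x Kx; rewrite -{1}bigcup_kex => -[N _ xN].
  by exists N.+1 => //; exact: kex_interior.
- by exists N; apply: subset_trans KN _; exact: interior_subset.
Qed.
End exhaustion.

(** * The Grassmannian is compact, open and closed among all subspaces *)

Section grassmannian_topology.
Variables (R : realType) (n m : nat).
Local Notation G := (@grassmann R n m).

Lemma continuous_orthoproj : continuous (@orthoproj R n).
Proof. exact: initial_continuous. Qed.

Lemma continuous_orthoproj_entry i j :
  continuous (fun P : subspaces R n => orthoproj P i j).
Proof.
move=> P; apply: (@continuous_comp _ _ _ (@orthoproj R n) (fun A => A i j)).
  exact: continuous_orthoproj.
exact: coord_continuous.
Qed.

Lemma continuous_mxtrace : continuous (fun A : 'M[R]_n => \tr A).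
Proof.
by rewrite /mxtrace; apply: continuous_bigsum => i; exact: coord_continuous.
Qed.

Let trP : continuous (fun P : subspaces R n => \tr (orthoproj P)).
Proof.
move=> P; apply: (@continuous_comp _ _ _ (@orthoproj R n) (fun A => \tr A)).
  exact: continuous_orthoproj.
exact: continuous_mxtrace.
Qed.

(** The trace is a continuous substitute for the dimension. It gives closedness at once and, having
    integer values, also openness. *)
Lemma grassmannE : G = (fun P => \tr (orthoproj P)) @^-1` [set m%:R].
Proof.
apply/seteqP; split => P; rewrite /grassmann /= orthoproj_trace; first by move=> ->.
by move=> /eqP; rewrite eqr_nat => /eqP.
Qed.

Lemma closed_grassmann : closed G.
Proof.
rewrite grassmannE; apply: preimage_closed => [P _|]; first exact: trP.
exact: closed_eq.
Qed.

Lemma open_grassmann : open G.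
Proof.
rewrite (_ : G = (fun P => \tr (orthoproj P)) @^-1`
    ([set t | m%:R - 1 < t] `&` [set t | t < m%:R + 1])).
  apply: open_comp => [P _|]; first exact: trP.
  by apply: openI; [exact: open_gt|exact: open_lt].
rewrite grassmannE; apply/seteqP; split => P /=; rewrite orthoproj_trace.
  by move=> ->; split; [rewrite ltrBlDr ltrDl|rewrite ltrDl].
move=> [h1 h2]; apply/eqP; rewrite eqr_nat eqn_leq.
rewrite -ltnS -(ltr_nat R) -natr1 h2 /=.
by rewrite -ltnS -(ltr_nat R) -[ltRHS]natr1 -ltrBlDr.
Qed.

Lemma compact_grassmann : compact G.
Proof.
pose C : set 'M[R]_n := [set A | [/\ A^T = A, A *m A = A, \tr A = m%:R &
   forall i j, `|A i j| <= 1]].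
have cC : compact C.
  (* Closed bounded sets of row vectors are compact; [vec_mx] carries this over to matrices. *)
  pose D : set 'rV[R]_(n * n) := vec_mx @^-1` C.
  have -> : C = vec_mx @` D.
    apply/seteqP; split => [A CA|_ [v Dv <-]//].
    by exists (mxvec A); rewrite /D /= mxvecK.
  have cv : continuous (vec_mx : 'rV[R]_(n * n) -> 'M[R]_n).
    apply: continuous_mx => i j; under eq_fun do rewrite mxE.
    exact: coord_continuous.
  apply: continuous_compact; first exact: continuous_subspaceT.
  apply: bounded_closed_compact.
    exists 1; split; first exact: num_real.
    move=> r r1 v [_ _ _ h]; apply: norm_le_coord; first by rewrite ltW// (lt_trans _ r1).
    move=> k; apply: le_trans (ltW r1).
    case/mxvec_indexP: k => i j; have := h i j; by rewrite mxE.
  apply: preimage_closed => [v _|]; first exact: cv.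
  have -> : C = (\bigcap_(p in [set: 'I_n * 'I_n])
      ((fun A : 'M[R]_n => A p.2 p.1 - A p.1 p.2) @^-1` [set 0])) `&`
    (\bigcap_(p in [set: 'I_n * 'I_n])
      ((fun A : 'M[R]_n => \sum_k A p.1 k * A k p.2 - A p.1 p.2) @^-1` [set 0])) `&`
    ((fun A : 'M[R]_n => \tr A) @^-1` [set m%:R]) `&`
    (\bigcap_(p in [set: 'I_n * 'I_n])
      ((fun A : 'M[R]_n => `|A p.1 p.2|) @^-1` [set t | t <= 1])).
    apply/seteqP; split => A.
      move=> [h1 h2 h3 h4]; split; last by move=> p _; exact: h4.
      split; last by [].
      split=> -[i j] _ /=; first by rewrite -{1}h1 mxE subrr.
      by rewrite -{3}h2 mxE subrr.
    move=> [[[h1 h2] h3] h4]; split => //.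
    - apply/matrixP => i j; rewrite mxE; apply/eqP; rewrite -subr_eq0; apply/eqP.
      exact: (h1 (i, j)).
    - apply/matrixP => i j; rewrite mxE; apply/eqP; rewrite -subr_eq0; apply/eqP.
      exact: (h2 (i, j)).
    - by move=> i j; exact: (h4 (i, j)).
  have ce i j : continuous (fun A : 'M[R]_n => A i j) by exact: coord_continuous.
  apply: closedI; [apply: closedI; [apply: closedI|]|].
  - apply: closed_bigI => -[i j] _; apply: preimage_closed => [A _|]; last exact: closed_eq.
    by apply: continuous_funB; exact: ce.
  - apply: closed_bigI => -[i j] _; apply: preimage_closed => [A _|]; last exact: closed_eq.
    apply: continuous_funB; last exact: ce.
    by apply: continuous_bigsum => k; apply: continuous_funM; exact: ce.
  - by apply: preimage_closed => [A _|]; [exact: continuous_mxtrace|exact: closed_eq].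
  - apply: closed_bigI => -[i j] _; apply: preimage_closed => [A _|]; last exact: closed_le.
    apply: (@continuous_comp_fun _ _ _ (fun A : 'M[R]_n => A i j) Num.norm); first exact: ce.
    exact: norm_continuous.
(* As [subspaces] has the initial topology of [orthoproj], it is enough to find a cluster point q of
   the image filter in C and to lift q by [orthoproj_surj]. *)
move=> F FF FG.
have FC : F (@orthoproj R n @^-1` C).
  apply: filterS FG => P GP; split.
  - exact: orthoproj_sym.
  - exact: orthoproj_idem.
  - by rewrite orthoproj_trace GP.
  - by move=> i j; exact: orthoproj_entry.
have [q [[q1 q2 q3 _] qF]] := cC (@orthoproj R n @ F) _ FC.
have [P Pq] := orthoproj_surj q1 q2.
exists P; split.
  by rewrite grassmannE /= Pq.
move=> A B FA; rewrite nbhsE => -[Q [[Q' oQ' Q'Q] QP] QB].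
have FA' : (@orthoproj R n @ F) (@orthoproj R n @` A).
  by change (F (@orthoproj R n @^-1` (@orthoproj R n @` A))); apply: filterS FA; exact: preimage_image.
have nQ : nbhs q Q'.
  by apply: open_nbhs_nbhs; split => //; rewrite -Pq; move: QP; rewrite -Q'Q.
have [_ [[y Ay <-] Q'y]] := qF _ _ FA' nQ.
by exists y; split => //; apply: QB; rewrite -Q'Q.
Qed.
End grassmannian_topology.

(** * Functions of class C^k in terms of directional derivatives *)

Section differentiability_classes.
Variable R : realType.

(** Directional derivatives are used as in [smooth], with arbitrary source and target, so that
    fields, scalar functions and functions of one variable obey common rules. The recursion on the
    order lets the product and chain rules be proved by induction. *)
Fixpoint Ck (V W : normedModType R) (k : nat) (f : V -> W) : Prop :=
  continuous f /\
  if k is k'.+1 then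
    (forall x v, derivable f x v) /\ forall v, Ck k' (fun x => 'D_v f x)
  else True.

Lemma CkS (V W : normedModType R) (k : nat) (f : V -> W) : Ck k.+1 f <->
  [/\ continuous f, forall x v, derivable f x v &
      forall v, Ck k (fun x => 'D_v f x)].
Proof. by split=> [[? [? ?]]|[]]. Qed.

Lemma Ck0 (V W : normedModType R) (f : V -> W) : Ck 0 f <-> continuous f.
Proof. by split=> [[]|]. Qed.

Opaque Ck.

Definition Cinf (V W : normedModType R) (f : V -> W) := forall k, Ck k f.

Lemma Ck_continuous (V W : normedModType R) k (f : V -> W) : Ck k f -> continuous f.
Proof. by case: k => [|k]; [move=> /Ck0|move=> /CkS[]]. Qed.

Lemma CkW (V W : normedModType R) k (f : V -> W) : Ck k.+1 f -> Ck k f.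
Proof.
elim: k f => [|k IH] f /CkS[fc fd fD]; first exact/Ck0.
by apply/CkS; split => // v; apply: IH; exact: fD.
Qed.

Lemma Cinf_continuous (V W : normedModType R) (f : V -> W) : Cinf f -> continuous f.
Proof. by move=> /(_ 0%N) /Ck_continuous. Qed.

Lemma Cinf_derivable (V W : normedModType R) (f : V -> W) x v :
  Cinf f -> derivable f x v.
Proof. by move=> /(_ 1%N) /CkS[_ + _]; exact. Qed.

Lemma Cinf_derive (V W : normedModType R) (f : V -> W) v :
  Cinf f -> Cinf (fun x => 'D_v f x).
Proof. by move=> fC k; have /CkS[_ _] := fC k.+1; exact. Qed.

Lemma Ck_cst (V W : normedModType R) k (a : W) : Ck k (fun _ : V => a).
Proof.
elim: k a => [|k IH] a; first by apply/Ck0; exact: continuous_fun_cst.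
apply/CkS; split=> [|x v|v]; [exact: continuous_fun_cst|exact: derivable_cst|].
have -> : 'D_v (fun _ : V => a) = (fun=> 0) by apply/funext => x; exact: derive_cst.
exact: IH.
Qed.

Lemma Ck_id (V : normedModType R) k : Ck k (fun x : V => x).
Proof.
case: k => [|k]; first by apply/Ck0 => x; exact: cvg_id.
apply/CkS; split=> [x|x v|v]; [exact: cvg_id|exact: derivable_id|].
rewrite (_ : (fun x => _) = (fun=> v)); first exact: Ck_cst.
by apply/funext => x; exact: derive_id.
Qed.

Lemma Ck_add (V W : normedModType R) k (f g : V -> W) :
  Ck k f -> Ck k g -> Ck k (fun x => f x + g x).
Proof.
elim: k f g => [|k IH] f g.
  by move=> /Ck0 fc /Ck0 gc; apply/Ck0; exact: continuous_funD.
move=> /CkS[fc fd fD] /CkS[gc gd gD].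
apply/CkS; split=> [|x v|v]; [exact: continuous_funD|exact: derivableD|].
rewrite (_ : (fun x => _) = (fun x => 'D_v f x + 'D_v g x)).
  exact: IH.
by apply/funext => x; apply: deriveD.
Qed.

Lemma is_derive_scale (V W : normedModType R) (k : V -> R) (f : V -> W) x v :
  {for x, continuous k} -> derivable k x v -> derivable f x v ->
  is_derive x v (fun x => k x *: f x) (k x *: 'D_v f x + 'D_v k x *: f x).
Proof.
move=> kc kd fd.
have h : (fun h => h^-1 *: ((fun x => k x *: f x) (h *: v + x) - k x *: f x)) @ 0^'
    --> (k x *: 'D_v f x + 'D_v k x *: f x).
  have -> : (fun h : R => h^-1 *: ((fun x => k x *: f x) (h *: v + x) - k x *: f x)) =
    (fun h => k (h *: v + x) *: (h^-1 *: (f (h *: v + x) - f x)) +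
              (h^-1 *: (k (h *: v + x) - k x)) *: f x).
    apply/funext => h; rewrite !scalerBr scalerBl !scalerA.
    rewrite (mulrC (k _)) addrA -[RHS]addrA -[in RHS]scalerA -/(_ *: _).
    by rewrite [X in _ = _ + X]addrC -!scalerA addrA addrAC subrK.
  apply: cvgD.
    apply: cvgZ; last exact: fd.
    apply: continuous_cvg => //.
    rewrite -[X in _ --> X]add0r -(scale0r v).
    apply: cvgD; last exact: cvg_cst.
    apply: cvgZr_tmp. apply: cvg_within.
  apply: cvgZr_tmp; exact: kd.
apply: DeriveDef; first by apply/cvg_ex; eexists; exact: h.
exact: cvg_lim h.
Qed.

Lemma Ck_scale (V W : normedModType R) m (k : V -> R) (f : V -> W) :
  Ck m k -> Ck m f -> Ck m (fun x => k x *: f x).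
Proof.
elim: m k f => [|m IH] k f.
  by move=> /Ck0 fc /Ck0 gc; apply/Ck0; exact: continuous_funZ.
move=> Hk Hf; have /CkS[kc kd kD] := Hk; have /CkS[fc fd fD] := Hf.
have D x v := is_derive_scale (kc x) (kd x v) (fd x v).
apply/CkS; split=> [|x v|v]; first exact: continuous_funZ.
  by apply: ex_derive; exact: D.
rewrite (_ : (fun x => _) = (fun x => k x *: 'D_v f x + 'D_v k x *: f x)).
  by apply: Ck_add; apply: IH => //; exact: CkW.
by apply/funext => x; apply: derive_val; exact: D.
Qed.

Lemma derive_line (V W : normedModType R) (f : V -> W) x v :
  'D_1 (fun h : R => f (h *: v + x)) 0 = 'D_v f x.
Proof.
rewrite /derive; set g1 := (fun _ => _); set g2 := (fun _ => _).
suff -> : g1 = g2 by [].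
by apply/funext => h; rewrite /g1 /g2 /= addr0 scale0r add0r [_%:A]mulr1.
Qed.

Lemma is_derive_comp1 (V : normedModType R) (f : V -> R) (g : R -> R) x v :
  derivable f x v -> derivable g (f x) 1 ->
  is_derive x v (fun x => g (f x)) ('D_1 g (f x) * 'D_v f x).
Proof.
move=> fd gd.
have fd1 : is_derive (0 : R) 1 (fun h : R => f (h *: v + x)) ('D_v f x).
  by apply: DeriveDef; [move/derivable1P: fd|exact: derive_line].
have gd1 : is_derive ((fun h : R => f (h *: v + x)) 0) 1 g ('D_1 g (f x)).
  by rewrite scale0r add0r; exact: derivableP.
have h := is_derive1_comp gd1 fd1.
apply: DeriveDef.
  apply/derivable1P; exact: (@ex_derive _ _ _ _ _ _ _ h).
have <- := @derive_val _ _ _ _ _ _ _ h.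
by rewrite -(derive_line (fun x => g (f x))).
Qed.

Lemma Ck_comp (V : normedModType R) m (f : V -> R) (g : R -> R) :
  Ck m f -> Ck m g -> Ck m (fun x => g (f x)).
Proof.
elim: m f g => [|m IH] f g.
  by move=> /Ck0 fc /Ck0 gc; apply/Ck0; exact: continuous_comp_fun.
move=> Hf Hg; have /CkS[fc fd fD] := Hf; have /CkS[gc gd gD] := Hg.
have D x v := is_derive_comp1 (fd x v) (gd (f x) 1).
apply/CkS; split=> [|x v|v]; first exact: continuous_comp_fun.
  by apply: ex_derive; exact: D.
rewrite (_ : (fun x => _) = (fun x => 'D_1 g (f x) *: 'D_v f x)).
  by apply: Ck_scale => //; apply: (IH _ (fun t => 'D_1 g t)) => //; exact: CkW.
by apply/funext => x; apply: derive_val; exact: D.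
Qed.

(** The exponent is quantified inside the induction because differentiation lowers it by 1. *)
Lemma Ck_powR (V : normedModType R) m (u : V -> R) (p : R) :
  (forall x, 0 < u x) -> Ck m u -> Ck m (fun x => u x `^ p).
Proof.
move=> u0; elim: m p => [|m IH] p.
  move=> /Ck0 uc; apply/Ck0 => x.
  apply: (@continuous_comp _ _ _ u (fun t => t `^ p)); first exact: uc.
  have h := is_derive1_powR p (u0 x).
  apply: differentiable_continuous; apply/derivable1_diffP.
  exact: (@ex_derive _ _ _ _ _ _ _ h).
move=> Hu; have /CkS[uc ud uD] := Hu.
have D x v : is_derive x v (fun x => u x `^ p) ((p * u x `^ (p - 1)) * 'D_v u x).
  have h := is_derive1_powR p (u0 x).
  have := is_derive_comp1 (ud x v) (@ex_derive _ _ _ _ _ _ _ h).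
  by rewrite (@derive_val _ _ _ _ _ _ _ h).
apply/CkS; split=> [|x v|v]; first exact: Ck_continuous (IH p (CkW Hu)).
  by apply: ex_derive; exact: D.
rewrite (_ : (fun x => _) = (fun x => (p *: u x `^ (p - 1)) *: 'D_v u x)).
  apply: Ck_scale => //; apply: Ck_scale; first exact: Ck_cst.
  by apply: IH; exact: CkW.
by apply/funext => x; apply: derive_val; exact: D.
Qed.

Lemma CinfD (V W : normedModType R) (f g : V -> W) :
  Cinf f -> Cinf g -> Cinf (fun x => f x + g x).
Proof. by move=> fC gC k; exact: Ck_add. Qed.

Lemma CinfZ (V W : normedModType R) (k : V -> R) (f : V -> W) :
  Cinf k -> Cinf f -> Cinf (fun x => k x *: f x).
Proof. by move=> fC gC k'; exact: Ck_scale. Qed.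

Lemma Cinf_cst (V W : normedModType R) (a : W) : Cinf (fun _ : V => a).
Proof. by move=> k; exact: Ck_cst. Qed.

Lemma Cinf_id (V : normedModType R) : Cinf (fun x : V => x).
Proof. by move=> k; exact: Ck_id. Qed.

Lemma Cinf_comp (V : normedModType R) (f : V -> R) (g : R -> R) :
  Cinf f -> Cinf g -> Cinf (fun x => g (f x)).
Proof. by move=> fC gC k; exact: Ck_comp. Qed.

Lemma Cinf_powR (V : normedModType R) (u : V -> R) (p : R) :
  (forall x, 0 < u x) -> Cinf u -> Cinf (fun x => u x `^ p).
Proof. by move=> u0 uC k; exact: Ck_powR. Qed.

Lemma CinfB (V W : normedModType R) (f g : V -> W) :
  Cinf f -> Cinf g -> Cinf (fun x => f x - g x).
Proof.
move=> fC gC; rewrite (_ : (fun x => _) = (fun x => f x + (-1) *: g x)).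
  by apply: CinfD => //; apply: CinfZ => //; exact: Cinf_cst.
by apply/funext => x; rewrite scaleN1r.
Qed.

Lemma Cinf_sum (V W : normedModType R) (I : Type) (r : seq I) (f : I -> V -> W) :
  (forall i, Cinf (f i)) -> Cinf (fun x => \sum_(i <- r) f i x).
Proof.
move=> fC; elim: r => [|i r IH].
  by under eq_fun do rewrite big_nil; exact: Cinf_cst.
rewrite (_ : (fun x => _) = (fun x => f i x + \sum_(j <- r) f j x)).
  exact: CinfD.
by apply/funext => x; rewrite big_cons.
Qed.

Lemma Cinf_prod (V : normedModType R) (I : Type) (r : seq I) (f : I -> V -> R) :
  (forall i, Cinf (f i)) -> Cinf (fun x => \prod_(i <- r) f i x).
Proof.
move=> fC; elim: r => [|i r IH].
  by under eq_fun do rewrite big_nil; exact: Cinf_cst.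
rewrite (_ : (fun x => _) = (fun x => f i x *: \prod_(j <- r) f j x)).
  exact: CinfZ.
by apply/funext => x; rewrite big_cons.
Qed.

Lemma Cinf_coord (n : nat) (i : 'I_n) : Cinf (fun x : 'rV[R]_n => x 0 i).
Proof.
move=> k.
have D (x v : 'rV[R]_n) : is_derive x v (fun x : 'rV[R]_n => x 0 i) (v 0 i).
  have h : \forall t \near (0 : R)^',
      t^-1 *: ((t *: v + x) 0 i - x 0 i) = v 0 i.
    apply: filterS (nbhs_dnbhs_neq (0 : R)) => t t0.
    by rewrite !mxE addrK /GRing.scale /= mulKf.
  apply: DeriveDef; first exact: is_cvg_near_cst h.
  exact: lim_near_cst h.
case: k => [|k]; first by apply/Ck0; exact: coord_continuous.
apply/CkS; split=> [|x v|v]; first exact: coord_continuous.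
  by apply: ex_derive; exact: D.
rewrite (_ : (fun x => _) = (fun=> v 0 i)); first exact: Ck_cst.
by apply/funext => x; apply: derive_val; exact: D.
Qed.

Lemma is_derive_coord (V : normedModType R) (m : nat) (f : V -> 'rV[R]_m) x v j :
  derivable f x v -> is_derive x v (fun x => f x 0 j) ('D_v f x 0 j).
Proof.
move=> fd.
have h : (fun h => h^-1 *: (((fun x => f x 0 j) \o shift x) (h *: v) - f x 0 j)) @ 0^'
   --> 'D_v f x 0 j.
  have -> : (fun h => h^-1 *: (((fun x => f x 0 j) \o shift x) (h *: v) - f x 0 j)) =
    (fun A : 'rV[R]_m => A 0 j) \o (fun h => h^-1 *: ((f \o shift x) (h *: v) - f x)).
    by apply/funext => h /=; rewrite !mxE.
  apply: (@cvg_comp _ _ _ _ (fun A : 'rV[R]_m => A 0 j) _ _ _ fd).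
  exact: coord_continuous.
apply: DeriveDef; first by apply/cvg_ex; eexists; exact: h.
exact: cvg_lim h.
Qed.

Lemma Ck_coord_comp (V : normedModType R) (n : nat) k (f : V -> 'rV[R]_n) i :
  Ck k f -> Ck k (fun x => f x 0 i).
Proof.
elim: k f => [|k IH] f.
  move=> /Ck0 fc; apply/Ck0.
  by apply: (@continuous_comp_fun _ _ _ f (fun A : 'rV[R]_n => A 0 i) fc); exact: coord_continuous.
move=> /CkS[fc fd fD]; apply/CkS; split=> [|x v|v].
- by apply: (@continuous_comp_fun _ _ _ f (fun A : 'rV[R]_n => A 0 i) fc); exact: coord_continuous.
- by apply: ex_derive; apply: is_derive_coord.
- rewrite (_ : (fun x => _) = (fun x => 'D_v f x 0 i)); first exact: IH.
  by apply/funext => x; apply: derive_val; exact: is_derive_coord.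
Qed.

Lemma Cinf_coord_comp (V : normedModType R) (n : nat) (f : V -> 'rV[R]_n) i :
  Cinf f -> Cinf (fun x => f x 0 i).
Proof. by move=> fC k; exact: Ck_coord_comp. Qed.

Lemma Cinf_sqn (n : nat) (a : 'rV[R]_n) : Cinf (fun x => sqn (x - a)).
Proof.
rewrite /sqn; apply: Cinf_sum => i.
rewrite (_ : (fun x => _) = (fun x : 'rV[R]_n => (x 0 i - a 0 i) *: (x 0 i - a 0 i))).
  by apply: CinfZ; apply: CinfB; [exact: Cinf_coord|exact: Cinf_cst|exact: Cinf_coord|exact: Cinf_cst].
by apply/funext => x; rewrite !mxE expr2.
Qed.

Lemma smooth_Cinf (n : nat) (f : 'rV[R]_n -> 'rV[R]_n) : smooth f <-> Cinf f.
Proof.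
split=> [fs k|fC vs].
  suff : forall vs, Ck k (iter_derive f vs) by move=> /(_ [::]).
  elim: k => [|k IH] vs; first by apply/Ck0; exact: (fs vs).1.
  apply/CkS; split=> [|x v|v]; [exact: (fs vs).1|exact: (fs vs).2|].
  exact: IH (v :: vs).
have : Cinf (iter_derive f vs).
  by elim: vs => //= v vs IH; exact: Cinf_derive.
by move=> h; split; [exact: Cinf_continuous|move=> x v; exact: Cinf_derivable].
Qed.
End differentiability_classes.

(** * A smooth nonincreasing cut-off function *)

Section cutoff.
Variable R : realType.
Implicit Types (p : {poly R}) (t u : R).

(* The functions p(1/t) exp(-1/t) are closed under differentiation, hence smooth. *)
Definition flat p t : R := if 0 < t then p.[t^-1] * expR (- t^-1) else 0.

(** Each monomial is dominated by u^k <= k! exp(u). The summand 1 in the constant only makes it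
    positive. *)
Lemma horner_expR_bounded p : exists2 C, 0 < C &
  forall u, 0 < u -> `|p.[u]| * expR (- u) <= C.
Proof.
have mono k u : 0 < u -> u ^+ k * expR (- u) <= k`!%:R.
  move=> u0; rewrite expRN ler_pdivrMr ?expR_gt0//.
  case: k => [|k]; first by rewrite expr0 fact0 mul1r -expR0 ler_expR ltW.
  rewrite mulrC -ler_pdivrMr ?ltr0n ?fact_gt0//.
  by apply: le_trans (expR_ge1Dxn k (ltW u0)); rewrite lerDr.
exists (1 + \sum_(i < size p) `|p`_i| * i`!%:R).
  by rewrite ltr_pwDl// sumr_ge0// => i _; rewrite mulr_ge0.
move=> u u0; rewrite horner_coef.
apply: (@le_trans _ _ ((\sum_(i < size p) `|p`_i * u ^+ i|) * expR (- u))).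
  by rewrite ler_wpM2r ?expR_ge0// ler_norm_sum.
rewrite mulr_suml; apply: (@le_trans _ _ (\sum_(i < size p) `|p`_i| * i`!%:R)); last by rewrite lerDr.
apply: ler_sum => i _; rewrite normrM -mulrA ler_wpM2l// ger0_norm ?exprn_ge0 ?(ltW u0)//.
exact: mono.
Qed.

(** The previous bound for p X^2 at u = 1/t. A quadratic bound forces the difference quotients at 0
    to tend to 0. *)
Lemma flat_sqr_bound p : exists2 C, 0 < C & forall t, `|flat p t| <= C * t ^+ 2.
Proof.
have [C C0 hC] := horner_expR_bounded (p * 'X^2).
exists C => // t; rewrite /flat; case: ifPn => t0; last first.
  by rewrite normr0 mulr_ge0 ?sqr_ge0// ltW.
have ti : 0 < t^-1 by rewrite invr_gt0.
rewrite -ler_pdivrMr ?exprn_gt0// -exprVn.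
have := hC _ ti; rewrite hornerM hornerXn normrM (ger0_norm (exprn_ge0 _ (ltW ti))).
by rewrite normrM (ger0_norm (expR_ge0 _)) mulrAC.
Qed.

(** With u = 1/t, the derivative in t of p(u) exp(-u) is u^2 (p(u) - p'(u)) exp(-u). *)
Definition dflat p : {poly R} := 'X^2 * (p - p^`()).

Lemma is_derive_flat p t : is_derive t 1 (flat p) (flat (dflat p) t).
Proof.
have [t0|t0|->] := ltgtP t 0; last first.
- have -> : flat (dflat p) 0 = 0 by rewrite /flat ltxx.
  have [C C0 hC] := flat_sqr_bound p.
  have h : (fun h => h^-1 *: (flat p (h *: 1 + 0) - flat p 0)) @ 0^' --> (0 : R).
    apply/cvgrPdist_le => e e0; near=> s.
    rewrite sub0r normrN [flat p 0]/flat ltxx subr0 addr0 [_%:A]mulr1.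
    have s0 : s != 0 by near: s; exact: nbhs_dnbhs_neq.
    rewrite normrM normfV ler_pdivrMl ?normr_gt0//.
    apply: le_trans (hC _) _; rewrite -(real_normK (num_real s)) expr2 mulrA.
    rewrite [leRHS]mulrC ler_wpM2r// -ler_pdivlMl//.
    by near: s; apply: dnbhs0_le; rewrite mulr_gt0// invr_gt0.
  apply: DeriveDef; first by apply/cvg_ex; exists 0.
  exact: cvg_lim h.
- have h : is_derive t 1 (fun t => p.[t^-1] * expR (- t^-1)) (flat (dflat p) t).
    have dV : is_derive t 1 (fun t : R => t^-1) (- t ^- 2).
      apply: DeriveDef; first by apply: derivableV; [rewrite gt_eqF|exact: derivable_id].
      by rewrite deriveV ?gt_eqF// derive_id /GRing.scale /= mulr1.
    have dp : is_derive (t^-1) 1 (horner p) (p^`().[t^-1]).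
      exact: is_derive_poly.
    have dpV := is_derive1_comp dp dV.
    have dN := is_deriveN dV.
    have de : is_derive (- t^-1) 1 (@expR R) (expR (- t^-1)) by exact: is_derive_expR.
    have deV := @is_derive1_comp _ (@expR R) (fun t : R => - t^-1) t _ _ de dN.
    apply: (is_derive_eq (is_deriveM dpV deV)).
    rewrite /flat t0 /dflat !hornerE /GRing.scale /= opprK exprVn.
    by ring.
  apply: near_eq_is_derive h.
  near=> s; rewrite /flat ifT//.
  by near: s; exact: lt_nbhsr.
- have h : is_derive t 1 (fun _ => 0) (flat (dflat p) t).
    have -> : flat (dflat p) t = 0 by rewrite /flat ltNge (ltW t0).
    exact: is_derive_cst.
  apply: near_eq_is_derive h.
  near=> s; rewrite /flat ifF//; apply/negbTE; rewrite -leNgt.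
  by near: s; exact: lt_le_nbhsl.
Unshelve. all: by end_near. Qed.

Lemma flat_bounded p : exists2 C, 0 < C & forall t, `|flat p t| <= C.
Proof.
have [C C0 hC] := horner_expR_bounded p; exists C => // t; rewrite /flat.
case: ifPn => t0; last by rewrite normr0 ltW.
by rewrite normrM (ger0_norm (expR_ge0 _)) hC// invr_gt0.
Qed.

Lemma Cinf_flat p : Cinf (flat p).
Proof.
move=> k; elim: k p => [|k IH] p.
  apply/Ck0 => t; apply: differentiable_continuous; apply/derivable1_diffP.
  exact: (@ex_derive _ _ _ _ _ _ _ (is_derive_flat p t)).
apply/CkS; split=> [t|t v|v].
- apply: differentiable_continuous; apply/derivable1_diffP.
  exact: (@ex_derive _ _ _ _ _ _ _ (is_derive_flat p t)).
- apply: diff_derivable; apply/derivable1_diffP.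
  exact: (@ex_derive _ _ _ _ _ _ _ (is_derive_flat p t)).
- rewrite (_ : (fun x => _) = (fun t => v *: flat (dflat p) t)).
    by apply: Ck_scale; [exact: Ck_cst|exact: IH].
  apply/funext => t.
  have dt : differentiable (flat p) t.
    apply/derivable1_diffP.
    exact: (@ex_derive _ _ _ _ _ _ _ (is_derive_flat p t)).
  rewrite -(@derive_val _ _ _ _ _ _ _ (is_derive_flat p t)) !deriveE//.
  by rewrite -[in LHS](mulr1 v) -[v * 1]/(v *: (1 : R^o)) linearZ.
Qed.

Definition flat1 := flat 1.

Lemma flat1_ge0 t : 0 <= flat1 t.
Proof. by rewrite /flat1 /flat; case: ifP => // _; rewrite hornerC mul1r expR_ge0. Qed.

Lemma flat1_gt0 t : 0 < t -> 0 < flat1 t.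
Proof. by move=> t0; rewrite /flat1 /flat t0 hornerC mul1r expR_gt0. Qed.

Lemma flat1_le0 t : t <= 0 -> flat1 t = 0.
Proof. by move=> t0; rewrite /flat1 /flat ltNge t0. Qed.

Lemma le_flat1 s t : s <= t -> flat1 s <= flat1 t.
Proof.
move=> st; have [s0|s0] := leP s 0; first by rewrite flat1_le0 ?flat1_ge0.
have t0 : 0 < t by exact: lt_le_trans st.
by rewrite /flat1 /flat s0 t0 !hornerC !mul1r ler_expR lerN2 lef_pV2 ?posrE.
Qed.

Lemma derive_flat1_ge0 t : 0 <= 'D_1 flat1 t.
Proof.
rewrite (@derive_val _ _ _ _ _ _ _ (is_derive_flat 1 t)) /flat.
case: ifP => // _; rewrite /dflat derivC subr0 mulr1 hornerXn.
by rewrite mulr_ge0 ?expR_ge0 ?sqr_ge0.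
Qed.

(* Flat composed with flat: constant near [t <= 1/4], vanishing for [t >= 1]. *)
Definition cutoff t : R :=
  (flat1 (flat1 (3 / 4)))^-1 * flat1 (flat1 (3 / 4) - flat1 (t - 1 / 4)).

Let c0 : 0 < flat1 (flat1 (3 / 4)).
Proof. by apply/flat1_gt0/flat1_gt0; lra. Qed.

Lemma cutoff_eq1 t : t <= 1 / 4 -> cutoff t = 1.
Proof.
by move=> t1; rewrite /cutoff (@flat1_le0 (t - _)) ?subr_le0// subr0 mulVf// gt_eqF.
Qed.

Lemma cutoff_eq0 t : 1 <= t -> cutoff t = 0.
Proof.
move=> t1; rewrite /cutoff [X in _ * X]flat1_le0 ?mulr0// subr_le0.
by apply: le_flat1; lra.
Qed.

Lemma cutoff_ge0 t : 0 <= cutoff t.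
Proof. by rewrite mulr_ge0 ?flat1_ge0// invr_ge0 ltW. Qed.

Lemma cutoff_le1 t : cutoff t <= 1.
Proof.
rewrite /cutoff ler_pdivrMl// mulr1; apply: le_flat1.
by rewrite gerBl flat1_ge0.
Qed.

Lemma Cinf_cutoff : Cinf cutoff.
Proof.
apply: (@CinfZ _ _ _ (fun=> _) (fun t => flat1 (flat1 (3 / 4) - flat1 (t - 1 / 4)))); first exact: Cinf_cst.
apply: (Cinf_comp _ (Cinf_flat 1)); apply: CinfB; first exact: Cinf_cst.
apply: (Cinf_comp _ (Cinf_flat 1)); apply: CinfB; first exact: Cinf_id.
exact: Cinf_cst.
Qed.

Let df (t : R) : derivable flat1 t 1.
Proof. exact: Cinf_derivable (Cinf_flat 1). Qed.

Lemma derive_cutoff t : 'D_1 cutoff t =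
  - ((flat1 (flat1 (3 / 4)))^-1 * 'D_1 flat1 (flat1 (3 / 4) - flat1 (t - 1 / 4))
     * 'D_1 flat1 (t - 1 / 4)).
Proof.
set c := (flat1 _)^-1; set d := flat1 (3 / 4).
have h1 : is_derive t 1 (fun t : R => t - 1 / 4) 1.
  by apply: is_derive_eq; rewrite subr0.
have h2 := is_derive_comp1 (@ex_derive _ _ _ _ _ _ _ h1) (@df (t - 1 / 4)).
have h3 : is_derive t 1 (fun t => d - flat1 (t - 1 / 4)) (- 'D_1 flat1 (t - 1 / 4)).
  apply: (is_derive_eq (is_deriveB (is_derive_cst d t 1) h2)).
  by rewrite (@derive_val _ _ _ _ _ _ _ h1) sub0r mulr1.
have h4 := is_derive_comp1 (@ex_derive _ _ _ _ _ _ _ h3) (@df (d - flat1 (t - 1 / 4))).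
have h5 := is_deriveZ c h4.
rewrite (@derive_val _ _ _ _ _ _ _ h5) (@derive_val _ _ _ _ _ _ _ h3).
by rewrite /GRing.scale /= mulrN mulrN mulrA.
Qed.

Lemma derive_cutoff_le0 t : 'D_1 cutoff t <= 0.
Proof.
by rewrite derive_cutoff oppr_le0 !mulr_ge0 ?derive_flat1_ge0// invr_ge0 ltW.
Qed.

Let dflatE t : 'D_1 flat1 t = flat (dflat 1) t.
Proof. exact: (@derive_val _ _ _ _ _ _ _ (is_derive_flat 1 t)). Qed.

Lemma derive_cutoff_bound : exists2 L, 0 < L & forall t, `|'D_1 cutoff t| <= L.
Proof.
have [C C0 hC] := flat_bounded (dflat 1).
exists ((flat1 (flat1 (3 / 4)))^-1 * C * C); first by rewrite !mulr_gt0// invr_gt0.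
move=> t; rewrite derive_cutoff normrN !normrM normfV (gtr0_norm c0) !dflatE.
apply: ler_pM => //; first by rewrite mulr_ge0// invr_ge0 ltW.
by rewrite ler_wpM2l// invr_ge0 ltW.
Qed.

Lemma derive_cutoff_eq0 t : t <= 1 / 4 \/ 1 <= t -> 'D_1 cutoff t = 0.
Proof.
rewrite derive_cutoff !dflatE => -[t1|t1].
  by rewrite [flat _ (t - _)]/flat ltNge subr_le0 t1 /= mulr0 oppr0.
rewrite [flat _ (flat1 _ - _)]/flat ltNge subr_le0 le_flat1 /=; last lra.
by rewrite mulr0 mul0r oppr0.
Qed.
End cutoff.

(** * From directional derivatives to the differential *)

Section differentiability.
Variables (R : realType) (n m : nat).
Local Notation E := 'rV[R]_n.

Lemma ball0_norm (V : normedModType R) (d : R) (z : V) : ball 0 d z <-> `|z| < d.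
Proof. by rewrite -ball_normE /= sub0r normrN. Qed.

Lemma ball_shift (V : normedModType R) (x : V) (d : R) (z : V) :
  ball 0 d z -> ball x d (x + z).
Proof. by move=> /ball0_norm zd; rewrite -ball_normE /= opprD addNKr normrN. Qed.

Lemma is_derive_line (V W : normedModType R) (f : V -> W) (z v : V) (t : R) :
  derivable f (z + t *: v) v ->
  is_derive t 1 (fun t => f (z + t *: v)) ('D_v f (z + t *: v)).
Proof.
move=> fd.
have e : (fun h : R => h^-1 *: (((fun t => f (z + t *: v)) \o shift t) (h *: 1) - f (z + t *: v)))
    = (fun h => h^-1 *: ((f \o shift (z + t *: v)) (h *: v) - f (z + t *: v))).
  apply/funext => h /=; congr (_ *: (f _ - _)).
  by rewrite [_%:A]mulr1 scalerDl addrCA.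
by apply: DeriveDef; rewrite /derivable /derive e.
Qed.

Definition trunc_row (h : E) (k : nat) : E := \row_i (if (i < k)%N then h 0 i else 0).

Lemma trunc_rowS h (k : 'I_n) : trunc_row h k.+1 = trunc_row h k + h 0 k *: delta_mx 0 k.
Proof.
apply/rowP => i; rewrite !mxE eqxx /= ltnS leq_eqVlt.
have [->|ik] := eqVneq i k; first by rewrite eqxx ltnn add0r mulr1.
by rewrite (negbTE (_ : val i != val k)) //= mulr0 addr0.
Qed.

(** Connects [jacobian], which is built on the differential, with [smooth], which speaks of
    directional derivatives. The increment from x to x + h is telescoped along the coordinate axes
    through the points x + [trunc_row h k]; each step is a mean value in one variable for one
    coordinate of f, and continuity of the partial derivatives controls the error. *)
Lemma C1_differentiable (f : E -> 'rV[R]_m) x : Ck 1 f -> differentiable f x.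
Proof.
move=> /CkS[fc fd fD].
pose J : 'M[R]_(n, m) := \matrix_(i, j) 'D_(delta_mx 0 i) f x 0 j.
suff H : f \o shift x = cst (f x) + mulmxr J +o_ (0 : E) id.
  have cJ : continuous (mulmxr J : E -> 'rV[R]_m).
    apply: continuous_mx => i j; rewrite (_ : (fun x => _) = (fun y : E => \sum_k y i k * J k j)).
      apply: continuous_bigsum => k; apply: continuous_funM; first exact: coord_continuous.
      exact: continuous_fun_cst.
    by apply/funext => y; rewrite !mxE.
  have dE := @diff_unique _ _ _ f _ x cJ H.
  by apply/diff_locallyP; rewrite dE.
apply/eqaddoP => e e0.
(* There will be n errors of this size; the denominator n + 1 also covers n = 0. *)
have e'0 : 0 < e / n.+1%:R by rewrite divr_gt0.
have hd : \forall z \near (0 : E), forall i : 'I_n,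
    `|'D_(delta_mx 0 i) f x - 'D_(delta_mx 0 i) f (x + z)| <= e / n.+1%:R.
  apply: (@filter_forall _ _ (fun i z => `|'D_(delta_mx 0 i) f x - 'D_(delta_mx 0 i) f (x + z)|
     <= e / n.+1%:R) (nbhs (0 : E)) _) => i.
  have /Ck0 /(_ x) /cvgrPdist_le /(_ _ e'0) /nbhs_ballP[d d0 hd] := fD (delta_mx 0 i).
  apply/nbhs_ballP; exists d; first exact: d0.
  by move=> z /(ball_shift x) /hd.
have /nbhs_ballP[d d0 hd'] := hd.
apply/nbhs_ballP; exists d; first exact: d0.
move=> h /ball0_norm hdl.
rewrite !fctE /=.
apply: norm_le_coord; first by rewrite mulr_ge0// ltW.
move=> j.
have step (k : 'I_n) : `|f (x + trunc_row h k.+1) 0 j - f (x + trunc_row h k) 0 j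
    - h 0 k * J k j| <= e / n.+1%:R * `|h|.
  set z := x + trunc_row h k; set v : E := delta_mx 0 k.
  pose G (t : R) : R := f (z + t *: v) 0 j.
  have dG (t : R) : is_derive t 1 G ('D_v f (z + t *: v) 0 j).
    have h1 := is_derive_line (fd (z + t *: v) v).
    have h2 := is_derive_coord j (@ex_derive _ _ _ _ _ _ _ h1).
    by move: h2; rewrite (@derive_val _ _ _ _ _ _ _ h1).
  (* Parametrising the step by [0, 1] makes the mean value theorem independent of the sign of
     [h 0 k]. *)
  pose g (s : R) : R := G (s * h 0 k).
  have dg (s : R) : is_derive s 1 g ('D_v f (z + (s * h 0 k) *: v) 0 j * h 0 k).
    have h0 : is_derive s 1 (fun s : R => s * h 0 k) (h 0 k).
      have := is_deriveZ (h 0 k) (is_derive_id s (1 : R)).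
      by rewrite /GRing.scale /= mulr1; apply: near_eq_is_derive; near=> u; rewrite mulrC.
    exact: (@is_derive1_comp _ G (fun s : R => s * h 0 k) s _ _ (dG _) h0).
  have [|s] := @MVT_segment _ g _ 0 1 ler01 (fun s _ => dg s).
    apply: continuous_subspaceT => s; apply: differentiable_continuous.
    apply/derivable1_diffP; exact: (@ex_derive _ _ _ _ _ _ _ (dg s)).
  rewrite in_itv /= => /andP[s0 s1].
  rewrite /g mul1r mul0r subr0 mulr1 /G scale0r addr0 => gE.
  rewrite trunc_rowS addrA -/z -/v gE mxE mulrC -mulrBr normrM mulrC.
  apply: ler_pM => //; last exact: coord_le_norm.
  pose w := trunc_row h k + (s * h 0 k) *: v.
  have -> : z + (s * h 0 k) *: v = x + w by rewrite /z /w addrA.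
  have wd : ball (0 : E) d w.
    apply/ball0_norm; apply: le_lt_trans hdl.
    apply: norm_le_coord => // i; rewrite !mxE eqxx /=.
    have [->|ik] := eqVneq i k.
      rewrite ltnn add0r mulr1 normrM ger0_norm//.
      by rewrite -[leRHS]mul1r ler_pM// coord_le_norm.
    rewrite mulr0 addr0; case: ifP => _; first exact: coord_le_norm.
    by rewrite normr0.
  apply: le_trans (hd' _ wd k).
  by rewrite distrC; apply: le_trans (coord_le_norm _ j); rewrite !mxE.
have tn : trunc_row h n = h by apply/rowP => i; rewrite mxE ltn_ord.
have t0 : trunc_row h 0 = 0 by apply/rowP => i; rewrite !mxE.
have -> : (f (h + x) - (f x + h *m J)) 0 j =
    \sum_(k < n) (f (x + trunc_row h k.+1) 0 j - f (x + trunc_row h k) 0 j - h 0 k * J k j).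
  rewrite sumrB -(big_mkord xpredT (fun k => f (x + trunc_row h k.+1) 0 j - f (x + trunc_row h k) 0 j)).
  rewrite telescope_sumr// tn t0 addr0 !mxE opprD addrA.
  by rewrite (addrC h x).
apply: (le_trans (ler_norm_sum _ _ _)).
apply: (@le_trans _ _ (\sum_(k < n) e / n.+1%:R * `|h|)); first exact: ler_sum.
rewrite sumr_const card_ord -[leLHS]mulr_natl mulrA ler_wpM2r//.
rewrite mulrCA -[leRHS]mulr1 ler_wpM2l ?(ltW e0)// ler_pdivrMr// mul1r ler_nat.
exact: leqnSn.
Unshelve. all: by end_near. Qed.
End differentiability.

(** * Smooth functions separating a compact set from a closed one *)

Section smooth_urysohn.
Variables (R : realType) (n : nat).
Local Notation E := 'rV[R]_n.

(** The squared distance keeps the function smooth at a. The threshold 1/4 of [cutoff] becomes the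
    radius r/2 and the threshold 1 becomes r. *)
Definition sbump (a : E) (r : R) (x : E) : R := cutoff (r ^- 2 * sqn (x - a)).

Lemma Cinf_sbump a r : Cinf (sbump a r).
Proof.
apply: (Cinf_comp _ (@Cinf_cutoff R)).
by apply: (@CinfZ _ _ _ (fun=> _) (fun x => sqn (x - a))); [exact: Cinf_cst|exact: Cinf_sqn].
Qed.

Lemma sbump_eq1 a r x : 0 < r -> enorm (x - a) <= r / 2 -> sbump a r x = 1.
Proof.
move=> r0 xa; apply: cutoff_eq1; rewrite ler_pdivrMl ?exprn_gt0//.
rewrite -sqr_enorm; apply: (@le_trans _ _ ((r / 2) ^+ 2)).
  by rewrite ler_pXn2r// ?nnegrE ?enorm_ge0 ?divr_ge0// ltW.
by rewrite exprMn exprVn; lra.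
Qed.

Lemma sbump_eq0 a r x : 0 < r -> r <= enorm (x - a) -> sbump a r x = 0.
Proof.
move=> r0 xa; apply: cutoff_eq0; rewrite ler_pdivlMl ?exprn_gt0// mulr1.
by rewrite -sqr_enorm ler_pXn2r// ?nnegrE ?enorm_ge0// ltW.
Qed.

Lemma spt_sub (X : topologicalType) (W : nmodType) (f : X -> W) (C : set X) :
  closed C -> (forall x, ~ C x -> f x = 0) -> spt f `<=` C.
Proof.
move=> cC fC; rewrite /spt; apply: (@subset_trans _ (closure C)).
  apply: closureS => x /= fx; apply: contrapT => /fC f0.
  by rewrite f0 eqxx in fx.
by rewrite -(closure_id C).1.
Qed.

Lemma spt_eq0 (X : topologicalType) (W : nmodType) (f : X -> W) x :
  ~ spt f x -> f x = 0.
Proof.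
move=> sx; apply/eqP/negPn/negP => fx; apply: sx.
exact: subset_closure.
Qed.

Lemma smooth_urysohn (K O : set E) : compact K -> open O -> K `<=` O ->
  exists phi : E -> R, [/\ Cinf phi, forall x, 0 <= phi x <= 1,
    exists2 N, open N & K `<=` N /\ forall x, N x -> phi x = 1,
    compact (spt phi) & spt phi `<=` O].
Proof.
move=> cK oO KO.
pose D := [set p : E * R | 0 < p.2 /\ eball p.1 p.2 `<=` O].
pose f (p : E * R) := [set x | enorm (x - p.1) < p.2 / 2].
have : cover_compact K by rewrite -compact_cover.
move=> /(_ (E * R)%type D f).
case=> [p _|x Kx|D' D'D KD'].
- exact: open_eball.
- have /nbhs_enormP[r r0 rO] : nbhs x O by apply: open_nbhs_nbhs; split => //; exact: KO.
  exists (x, r / 2).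
    split; first by rewrite divr_gt0.
    move=> y xy; apply: rO; apply: (le_lt_trans xy).
    by rewrite ltr_pdivrMr// ltr_pMr// ltr1n.
  by rewrite /f /= subrr enorm0 !divr_gt0.
have DP p : p \in D' -> D p by move=> /D'D; rewrite in_setE.
(* Equal to 1 as soon as one bump is 1, to 0 where all of them vanish, and between 0 and 1
   everywhere. *)
pose phi x := 1 - \prod_(p <- enum_fset D') (1 - sbump p.1 p.2 x).
pose C := \bigcup_(p in [set` D']) eball p.1 p.2.
have cC : compact C.
  rewrite /C bigcup_fset; apply: (@bigsetU_compact _ _ (fun p : E * R => eball p.1 p.2)).
  by move=> p _; exact: compact_eball.
have phi0 x : ~ C x -> phi x = 0.
  move=> Cx; rewrite /phi big_seq big1 ?subrr// => p pD.
  rewrite sbump_eq0 ?subr0//; first by have [] := DP p pD.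
  rewrite leNgt; apply/negP => px; apply: Cx; exists p => //; exact: ltW.
have sC : spt phi `<=` C.
  apply: spt_sub => //; apply: compact_closed => //; exact: norm_hausdorff.
exists phi; split.
- apply: CinfB; first exact: Cinf_cst.
  apply: Cinf_prod => p; apply: CinfB; first exact: Cinf_cst.
  exact: Cinf_sbump.
- move=> x; have : 0 <= \prod_(p <- enum_fset D') (1 - sbump p.1 p.2 x) <= 1.
    apply: (big_ind (fun y : R => 0 <= y <= 1)); first by rewrite ler01 lexx.
      by move=> y z /andP[y0 y1] /andP[z0 z1]; rewrite mulr_ge0 ?mulr_ile1.
    move=> p _; by rewrite subr_ge0 cutoff_le1 /= gerBl cutoff_ge0.
  by move=> /andP[p0 p1]; rewrite subr_ge0 p1 /= gerBl.
- exists (\bigcup_(p in [set` D']) f p).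
    by apply: bigcup_open => p _; exact: open_eball.
  split => // x [p /= pD fx].
  rewrite /phi (big_rem p)//= sbump_eq1 ?subrr ?mul0r ?subr0//; last exact: ltW.
  by have [] := DP p pD.
- apply: (subclosed_compact _ cC sC); exact: closed_closure.
- apply: (subset_trans sC) => x [p /= pD px].
  by have [_] := DP p pD; exact.
Qed.
End smooth_urysohn.

HB.instance Definition _ (A B : ptopologicalType) := Topological.on (A * B)%type.

(** * Caratheodory measurable sets of an outer measure *)

Section caratheodory_sets.
Variables (R : realType) (T : pointedType) (mu : {outer_measure set T -> \bar R}).
Implicit Types A B N X : set T.
Local Open Scope ereal_scope.

Lemma null_subset A N : A `<=` N -> mu N = 0 -> mu A = 0.
Proof.
move=> AN N0; apply/eqP; rewrite eq_le outer_measure_ge0 andbT -N0.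
exact: le_outer_measure.
Qed.

Lemma null_setU A B : mu A = 0 -> mu B = 0 -> mu (A `|` B) = 0.
Proof.
move=> A0 B0; apply/eqP; rewrite eq_le outer_measure_ge0 andbT.
by apply: le_trans (outer_measureU2 _ _ _) _; rewrite A0 B0 adde0.
Qed.

Lemma null_bigcup (F : nat -> set T) : (forall i, mu (F i) = 0) ->
  mu (\bigcup_i F i) = 0.
Proof.
move=> F0; apply/eqP; rewrite eq_le outer_measure_ge0 andbT.
apply: le_trans (outer_measure_sigma_subadditive mu F) _.
by rewrite eseries0.
Qed.

Lemma null_caratheodory N : mu N = 0 -> mu.-caratheodory N.
Proof.
move=> N0; apply: le_caratheodory_measurable => X.
rewrite (null_subset (@subIsetr _ X N))// add0e.
by apply: le_outer_measure; exact: subIsetl.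
Qed.

Lemma eq_outer_measure_ae A B : mu (A `\` B) = 0 -> mu (B `\` A) = 0 ->
  forall X, mu (A `&` X) = mu (B `&` X).
Proof.
have le C D X : mu (C `\` D) = 0 -> mu (C `&` X) <= mu (D `&` X).
  move=> CD; apply: (@le_trans _ _ (mu ((D `&` X) `|` (C `\` D)))).
    apply: le_outer_measure => x [Cx Xx].
    by have [Dx|nDx] := pselect (D x); [left|right].
  by apply: le_trans (outer_measureU2 _ _ _) _; rewrite CD adde0.
by move=> AB BA X; apply/eqP; rewrite eq_le !le.
Qed.

Lemma caratheodoryD A X : mu.-caratheodory A -> A `<=` X -> mu A < +oo ->
  mu (X `\` A) = mu X - mu A.
Proof.
move=> cA AX Aoo; rewrite (cA X) (setIidr AX) -setDE addeAC subee ?add0e//.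
by rewrite ge0_fin_numE// outer_measure_ge0.
Qed.

Lemma caratheodoryU A B : mu.-caratheodory A -> A `&` B = set0 ->
  mu (A `|` B) = mu A + mu B.
Proof.
move=> cA AB; rewrite (cA (A `|` B)); congr (mu _ + mu _).
  by rewrite setIUl setIid setIC AB setU0.
rewrite setIUl setICr set0U; apply/setIidPl => x Bx Ax.
by have : (A `&` B) x by []; rewrite AB.
Qed.

Lemma caratheodory_restr A B : mu.-caratheodory B -> (orestr mu A).-caratheodory B.
Proof. by move=> cB X; rewrite /orestr !setIA; exact: cB. Qed.

Lemma caratheodory_sigma_algebra : sigma_algebra setT mu.-caratheodory.
Proof.
split; first exact: caratheodory_measurable_set0.
- by move=> A cA; rewrite setTD; exact: caratheodory_measurable_setC.
- by move=> F cF; exact: caratheodory_measurable_bigcup.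
Qed.

Lemma nondecreasing_outer_measure (F : nat -> set T) (A : set T) :
  (forall i, mu.-caratheodory (F i)) -> (forall i j, (i <= j)%N -> F i `<=` F j) ->
  mu (A `&` \bigcup_i F i) <= ereal_sup [set mu (A `&` F i) | i in setT].
Proof.
move=> cF hF.
pose nu : {outer_measure set T -> \bar R} := [the {outer_measure set T -> \bar R} of orestr mu A].
have cF' i : nu.-caratheodory (F i) by exact: caratheodory_restr.
rewrite -[mu (A `&` _)]/(cmeas nu (\bigcup_i F i)).
have /cvg_lim <- // : (cmeas nu \o F) x @[x --> \oo] --> cmeas nu (\bigcup_n F n).
  apply: (@nondecreasing_cvg_mu _ _ _ (cmeas nu)) => //.
    exact: (@caratheodory_measurable_bigcup _ _ nu).
  by move=> i j ij; apply/subsetPset; exact: hF.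
apply: lime_le; last by apply: nearW => i; apply: ereal_sup_ubound; exists i.
apply/cvg_ex; exists (cmeas nu (\bigcup_n F n)).
apply: (@nondecreasing_cvg_mu _ _ _ (cmeas nu)) => //.
  exact: (@caratheodory_measurable_bigcup _ _ nu).
by move=> i j ij; apply/subsetPset; exact: hF.
Qed.
End caratheodory_sets.

Lemma outer_measure_eq (R : realType) (T : Type) (mu nu : {outer_measure set T -> \bar R}) :
  (forall A, mu A = nu A) -> mu = nu.
Proof.
case: mu nu => f [[f1 f2 f3 f4]] [g [[g1 g2 g3 g4]]] /= fg.
have e : f = g by apply/funext.
subst g; congr (OuterMeasure.Pack (OuterMeasure.Class _)).
by congr isOuterMeasure.Axioms_; exact: Prop_irrelevance.
Qed.

(** * Integration with respect to outer measures and their restrictions *)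

Section integration.
Variables (R : realType).
Local Open Scope ereal_scope.

Lemma measurable_fun_gt (T : pointedType) (mu : {outer_measure set T -> \bar R})
    (f : T -> R) : (forall a, mu.-caratheodory [set x | (a < f x)%R]) ->
  measurable_fun setT (f : caratheodory_type mu -> R).
Proof.
move=> fa; apply: (measurability _ (RGenOInfty.measurableE R)).
move=> _ [_ [a ->] <-]; rewrite setTI.
have -> : f @^-1` `]a, +oo[ = [set x | (a < f x)%R].
  by apply/seteqP; split => x /=; rewrite in_itv /= andbT.
exact: fa.
Qed.

Lemma continuous_caratheodory (T : ptopologicalType) (mu : {outer_measure set T -> \bar R})
    (f : T -> R) : (forall G, open G -> mu.-caratheodory G) -> continuous f ->
  measurable_fun setT (f : caratheodory_type mu -> R).
Proof.
move=> oG fc; apply: measurable_fun_gt => a; apply: oG.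
rewrite (_ : [set x | _] = f @^-1` [set t | (a < t)%R])//.
by apply: open_comp => [x _|]; [exact: fc|exact: open_gt].
Qed.

Lemma borel_caratheodory (T : ptopologicalType) (mu : {outer_measure set T -> \bar R}) B :
  (forall G, open G -> mu.-caratheodory G) -> <<s open >> B -> mu.-caratheodory B.
Proof.
move=> oG; apply: (@smallest_sub _ _ _ mu.-caratheodory) => //.
exact: caratheodory_sigma_algebra.
Qed.

Lemma integral_mrestr d (T : measurableType d) (mu : {measure set T -> \bar R})
    (D : set T) (mD : measurable D) (f : T -> \bar R) : measurable_fun setT f ->
  \int[mrestr mu mD]_x f x = \int[mu]_(x in D) f x.
Proof.
have ge0 (g : T -> \bar R) : measurable_fun setT g -> (forall x, 0 <= g x) ->
    \int[mrestr mu mD]_x g x = \int[mu]_(x in D) g x.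
  move=> mg g0.
  have N0 : mrestr mu mD (~` D) = 0 by rewrite /mrestr setICl measure0.
  rewrite (@ge0_negligible_integral _ _ _ (mrestr mu mD) setT (~` D) g
    (measurableC mD) measurableT mg (fun x _ => g0 x) N0).
  rewrite setDE setCK setTI; apply: eq_measure_integral => A mA AD.
  by change (mu (A `&` D) = mu A); rewrite (setIidl AD).
move=> mf; rewrite [LHS]integralE [RHS]integralE !ge0 //.
- exact: measurable_funeneg.
- exact: measurable_funepos.
Qed.

(** The two integrals refer to different Caratheodory sigma-algebras. Sets measurable for [mu] are
    measurable for its restriction, so the identity is measurable in that direction and the
    left-hand side becomes the integral for an image measure. *)
Lemma integral_orestr (T : pointedType) (mu : {outer_measure set T -> \bar R})
    (A : set T) (f : T -> \bar R) : mu.-caratheodory A ->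
  measurable_fun setT (f : caratheodory_type mu -> \bar R) ->
  \int[cmeas [the {outer_measure set T -> \bar R} of orestr mu A]]_x f x
    = \int[cmeas mu]_(x in A) f x.
Proof.
move=> cA mf; set nu := [the {outer_measure set T -> \bar R} of orestr mu A].
have mid : measurable_fun setT (id : caratheodory_type nu -> caratheodory_type mu).
  by move=> _ B mB; rewrite setTI; exact: caratheodory_restr.
have mA : measurable (A : set (caratheodory_type mu)) by [].
have ge0 (g : T -> \bar R) : measurable_fun setT (g : caratheodory_type mu -> \bar R) ->
    (forall x, 0 <= g x) ->
    \int[cmeas nu]_x g x = \int[cmeas mu]_(x in A) g x.
  move=> mg g0.
  have := @ge0_integral_pushforward _ _ _ _ _ _ mid (cmeas nu) setT g measurableT mg (fun x _ => g0 x).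
  rewrite preimage_setT => <-.
  rewrite -(integral_mrestr (cmeas mu) mA mg); apply: eq_measure_integral => B mB _.
  by change (mu (A `&` B) = mu (B `&` A)); rewrite setIC.
rewrite [LHS]integralE [RHS]integralE !ge0 //.
- exact: measurable_funeneg.
- exact: measurable_funepos.
Qed.
End integration.

(** * Approximation of measurable sets for Radon measures *)

Section radon.
Variables (R : realType) (T : ptopologicalType) (O : set T).
Hypothesis oO : open O.
Variable K : nat -> set T.
Hypotheses (cK : forall N, compact (K N)) (clK : forall N, closed (K N)).
Hypotheses (KO : \bigcup_N K N = O) (leK : forall i j, (i <= j)%N -> K i `<=` K j).
Local Open Scope ereal_scope.

Let KsubO N : K N `<=` O.
Proof. by rewrite -KO => x Kx; exists N. Qed.

Variable mu : {outer_measure set T -> \bar R}.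
Hypothesis rmu : radon_over O mu.

Lemma radon_open G : open G -> mu.-caratheodory G.
Proof.
case: rmu => mu0 _ h _ _ oG.
have -> : G = (G `&` O) `|` (G `\` O).
  by rewrite -setIUr setUCr setIT.
apply: caratheodory_measurable_setU.
  by apply: h; [exact: openI|exact: subIsetr].
by apply: null_caratheodory; apply: null_subset mu0 => x [].
Qed.

Lemma radon_closed F : closed F -> mu.-caratheodory F.
Proof.
move=> cF; rewrite -(setCK F); apply: caratheodory_measurable_setC.
by apply: radon_open; exact: closed_openC.
Qed.

Lemma radon_borel B : <<s open >> B -> mu.-caratheodory B.
Proof. by apply: borel_caratheodory; exact: radon_open. Qed.

Lemma radon_ltoo C : compact C -> C `<=` O -> mu C < +oo.
Proof. by case: rmu => _ + _ _ _; exact. Qed.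

Lemma radon_outer A (e : R) : A `<=` O -> mu A < +oo -> (0 < e)%R ->
  exists G, [/\ open G, A `<=` G, G `<=` O & mu G <= mu A + e%:E].
Proof.
case: rmu => _ _ _ _ h AO Aoo e0.
have fA : mu A \is a fin_num by rewrite ge0_fin_numE// outer_measure_ge0.
move: (fA); rewrite h// => fA'.
have [_ [G [oG AG GO] <-] /ltW Ge] := lb_ereal_inf_adherent e0 fA'.
by exists G; split => //; rewrite h.
Qed.

(** A may have infinite measure; the pieces in K j have finite measure and are approximated with
    errors e / 2^(j+1). *)
Lemma radon_outerD A (e : R) : mu.-caratheodory A -> A `<=` O -> (0 < e)%R ->
  exists G, [/\ open G, A `<=` G, G `<=` O & mu (G `\` A) <= e%:E].
Proof.
move=> cA AO e0.
have cAK j : mu.-caratheodory (A `&` K j).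
  by apply: caratheodory_measurable_setI => //; exact: radon_closed.
have oAK j : mu (A `&` K j) < +oo.
  apply: le_lt_trans (radon_ltoo (@cK j) (@KsubO j)).
  by apply: le_outer_measure; exact: subIsetr.
have : forall j, exists G, [/\ open G, A `&` K j `<=` G, G `<=` O &
    mu (G `\` (A `&` K j)) <= (e / (2 ^ j.+1)%:R)%:E].
  move=> j; have ej : (0 < e / (2 ^ j.+1)%:R)%R by rewrite divr_gt0// ltr0n expn_gt0.
  have [|G [oG AG GO mG]] := @radon_outer (A `&` K j) _ _ (oAK j) ej.
    by move=> x [/AO].
  exists G; split => //; rewrite (caratheodoryD (cAK j) AG)// leeBlDl//.
  by rewrite ge0_fin_numE// outer_measure_ge0.
move=> /choice[G hG]; exists (\bigcup_j G j); split.
- by apply: bigcup_open => j _; have [] := hG j.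
- move=> x Ax; have := AO _ Ax; rewrite -KO => -[j _ Kx].
  by exists j => //; have [_ + _ _] := hG j; apply.
- by move=> x [j _]; have [_ _ + _] := hG j; apply.
- apply: (@le_trans _ _ (\sum_(j <oo) mu (G j `\` (A `&` K j)))).
    apply: le_trans (outer_measure_sigma_subadditive mu _).
    apply: le_outer_measure => x [[j _ Gx] nAx]; exists j => //; split => //.
    by move=> -[].
  apply: le_trans (epsilon_trick0 _ (ltW e0)).
  apply: lee_nneseries => [j _ _|j _]; first exact: outer_measure_ge0.
  by have [] := hG j.
Qed.

(** If G is an open set around O \ A with small excess, K N \ G is a compact subset of A. The index
    N is chosen so that little of A lies outside K N. *)
Lemma radon_inner A (e : R) : mu.-caratheodory A -> A `<=` O -> mu A < +oo ->
  (0 < e)%R -> exists C, [/\ compact C, closed C, C `<=` A & mu (A `\` C) <= e%:E].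
Proof.
move=> cA AO Aoo e0.
have e20 : (0 < e / 2)%R by rewrite divr_gt0.
have cOA : mu.-caratheodory (O `\` A).
  by apply: caratheodory_measurable_setD => //; exact: radon_open.
have [G [oG AG _ Ge]] := radon_outerD cOA (@subDsetl _ _ _) e20.
have [N hN] : exists N, mu (A `\` K N) <= (e / 2)%:E.
  have fA : mu A \is a fin_num by rewrite ge0_fin_numE// outer_measure_ge0.
  have := @nondecreasing_outer_measure _ _ mu K A (fun i => radon_closed (@clK i)) leK.
  rewrite KO (setIidl AO) => h.
  have fs : ereal_sup [set mu (A `&` K i) | i in setT] \is a fin_num.
    rewrite ge0_fin_numE; last first.
      by apply: le_trans h; exact: outer_measure_ge0.
    apply: le_lt_trans Aoo; apply: ge_ereal_sup => _ [i _ <-].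
    by apply: le_outer_measure; exact: subIsetl.
  have [_ [N _ <-] hN] := ub_ereal_sup_adherent e20 fs.
  exists N.
  have fK : mu (A `&` K N) \is a fin_num.
    rewrite ge0_fin_numE ?outer_measure_ge0//; apply: le_lt_trans Aoo.
    by apply: le_outer_measure; exact: subIsetl.
  have := @radon_closed _ (@clK N) A; rewrite -setDE => AE.
  rewrite -(@leeD2lE _ (mu (A `&` K N)))// -AE; apply: (le_trans h).
  by rewrite -leeBlDr// ltW.
exists (K N `&` ~` G); split.
- exact: compact_closedI (@cK N) (open_closedC oG).
- by apply: closedI => //; exact: open_closedC.
- move=> x [Kx Gx]; apply: contrapT => nAx; apply: Gx; apply: AG; split => //.
  exact: KsubO Kx.
- rewrite setDIr; apply: le_trans (outer_measureU2 _ _ _) _.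
  rewrite [X in _ <= X%:E](splitr e) EFinD; apply: leeD => //.
  apply: le_trans Ge; apply: le_outer_measure => x [Ax /contrapT Gx].
  by split => // -[_]; exact.
Qed.

Lemma radon_hull A : mu.-caratheodory A -> A `<=` O ->
  exists B, [/\ <<s open >> B, A `<=` B, B `<=` O & mu (B `\` A) = 0].
Proof.
move=> cA AO.
have : forall j : nat, exists G, [/\ open G, A `<=` G, G `<=` O & mu (G `\` A) <= (j.+1%:R^-1)%:E].
  by move=> j; apply: radon_outerD.
move=> /choice[G hG]; exists (\bigcap_j G j); split.
- have -> : \bigcap_j G j = ~` (\bigcup_j ~` G j) by rewrite setC_bigcup; apply: eq_bigcapr => j _; rewrite setCK.
  apply: sigma_algebraC; apply: sigma_algebra_bigcup => j; apply: sigma_algebraC.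
  by apply: sub_sigma_algebra; have [] := hG j.
- by move=> x Ax j _; have [_ + _ _] := hG j; apply.
- by move=> x /(_ 0%N I); have [_ _ + _] := hG 0%N; apply.
- apply/eqP; rewrite eq_le outer_measure_ge0 andbT.
  apply/lee_addgt0Pr => e e0; rewrite add0e.
  pose j := Num.truncn e^-1.
  have [_ _ _ h] := hG j.
  apply: (@le_trans _ _ (mu (G j `\` A))).
    by apply: le_outer_measure => x [+ nAx] => /(_ j I).
  apply: (le_trans h); rewrite lee_fin -[leRHS]invrK lef_pV2 ?posrE ?invr_gt0//.
  by rewrite ltW// truncnS_gt.
Qed.

(** Makes the restriction of a varifold to a measurable cylinder a varifold. For outer regularity at
    B, an open set around A [&] B is joined to an open set around O \ A whose excess, the portion
    inside A, is small. *)
Lemma radon_orestr A : mu.-caratheodory A ->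
  radon_over O [the {outer_measure set T -> \bar R} of orestr mu A].
Proof.
move=> cA; have [mu0 muK muG muGK muA] := rmu; split => /=.
- by apply: null_subset mu0; exact: subIsetr.
- move=> C cC CO; apply: le_lt_trans (muK C cC CO).
  by apply: le_outer_measure; exact: subIsetr.
- by move=> G oG GO; apply: caratheodory_restr; exact: muG.
- move=> G oG GO; apply/eqP; rewrite eq_le; apply/andP; split; last first.
    apply: ge_ereal_sup => _ [C [cC CG] <-]; exact: le_outer_measure.
  have cAG : mu.-caratheodory (A `&` G).
    by apply: caratheodory_measurable_setI => //; exact: radon_open.
  have {1}-> : G = G `&` \bigcup_i K i by rewrite KO (setIidl GO).
  rewrite /orestr setIA.
  apply: le_trans (nondecreasing_outer_measure _ (fun i => radon_closed (@clK i)) leK) _.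
  apply: ge_ereal_sup => _ [N _ <-]; apply/lee_addgt0Pr => e e0.
  have [|||C [cC clC CA Ce]] := @radon_inner (A `&` G `&` K N) e _ _ _ e0.
  + by apply: caratheodory_measurable_setI => //; exact: radon_closed.
  + by move=> x [[_ /GO]].
  + apply: le_lt_trans (muK _ (@cK N) (@KsubO N)).
    by apply: le_outer_measure; exact: subIsetr.
  rewrite (radon_closed clC (A `&` G `&` K N)) (setIidr CA) -setDE; apply: leeD => //.
  have -> : C = A `&` C by apply/esym/setIidr => x /CA [[]].
  apply: ereal_sup_ubound; exists C => //; split => //.
  by move=> x /CA [[]].
- move=> B BO; apply/eqP; rewrite eq_le; apply/andP; split.
    apply: le_ereal_inf_tmp => _ [G [oG BG GO] <-].
    exact: le_outer_measure.
  have [Boo|Boo] := boolP (mu (A `&` B) < +oo); last first.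
    by move: Boo; rewrite ltNge negbK leye_eq => /eqP E; rewrite [leRHS]E leey.
  apply/lee_addgt0Pr => e e0.
  have e20 : (0 < e / 2)%R by rewrite divr_gt0.
  have [|G1 [oG1 AG1 G1O G1e]] := @radon_outer (A `&` B) _ _ Boo e20.
    by move=> x [_ /BO].
  have cOA : mu.-caratheodory (O `\` A).
    by apply: caratheodory_measurable_setD => //; exact: radon_open.
  have [G2 [oG2 AG2 G2O G2e]] := radon_outerD cOA (@subDsetl _ _ _) e20.
  apply: (@le_trans _ _ (mu (A `&` (G1 `|` G2)))).
    apply: ereal_inf_lbound; exists (G1 `|` G2) => //; split.
    + exact: openU.
    + move=> x Bx; have [Ax|nAx] := pselect (A x); [left|right]; first exact: AG1.
      by apply: AG2; split => //; exact: BO.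
    + by move=> x [/G1O|/G2O].
  apply: (@le_trans _ _ (mu (G1 `|` (G2 `\` (O `\` A))))).
    apply: le_outer_measure => x [Ax [G1x|G2x]]; [by left|right; split => //].
    by move=> -[_]; exact.
  apply: le_trans (outer_measureU2 _ _ _) _.
  by rewrite [X in _ <= _ + X%:E](splitr e) EFinD addeA; apply: leeD.
Qed.
End radon.

Section open_inner_regularity.
Variables (R : realType) (n : nat).
Local Notation E := 'rV[R]_n.
Local Open Scope ereal_scope.

Lemma closed_borel (X : topologicalType) (C : set X) : closed C -> <<s open >> C.
Proof.
move=> cC; rewrite -(setCK C) -setTD; apply: sigma_algebraCD.
by apply: sub_sigma_algebra; exact: closed_openC.
Qed.

(** Continuity from below along the compact sets [kex O i]. *)
Lemma open_sup_compact (mu : {outer_measure set E -> \bar R}) (O : set E) :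
  (forall G, open G -> mu.-caratheodory G) -> open O ->
  mu O = ereal_sup [set mu K | K in [set K | compact K /\ K `<=` O]].
Proof.
move=> oG oO; apply/eqP; rewrite eq_le; apply/andP; split; last first.
  apply: ge_ereal_sup => _ [K [cK KO] <-]; exact: le_outer_measure.
have cK i : mu.-caratheodory (kex O i).
  by apply: borel_caratheodory => //; apply: closed_borel; exact: closed_kex.
have := @nondecreasing_outer_measure _ _ mu _ setT cK (@le_kex _ _ O).
rewrite setTI bigcup_kex// => /le_trans; apply.
apply: ge_ereal_sup => _ [i _ <-]; rewrite setTI.
apply: ereal_sup_ubound; exists (kex O i) => //; split; first exact: compact_kex.
exact: kex_sub.
Qed.

End open_inner_regularity.

(** * The weight of a varifold is a Radon measure *)

Section weights.
Variables (R : realType) (n m : nat).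
Local Notation E := 'rV[R]_n.
Local Notation X := ('rV[R]_n * subspaces R n)%type.
Local Notation G := (@grassmann R n m).
Variable U : set E.
Hypothesis oU : open U.
Local Open Scope ereal_scope.

Definition kexG N : set X := kex U N `*` G.

Lemma compact_kexG N : compact (kexG N).
Proof. by apply: compact_setX; [exact: compact_kex|exact: compact_grassmann]. Qed.

Lemma setXE (A : set E) : A `*` G = fst @^-1` A `&` (snd @^-1` G : set X).
Proof. by []. Qed.

Lemma closed_kexG N : closed (kexG N).
Proof.
apply: closedI.
  by apply: preimage_closed => [x _|]; [exact: cvg_fst|exact: closed_kex].
by apply: preimage_closed => [x _|]; [exact: cvg_snd|exact: closed_grassmann].
Qed.

Lemma open_setXG (A : set E) : open A -> open (A `*` G).
Proof.
move=> oA; apply: openI.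
  by apply: open_comp => [x _|//]; exact: cvg_fst.
by apply: open_comp => [x _|]; [exact: cvg_snd|exact: open_grassmann].
Qed.

Lemma bigcup_kexG : \bigcup_N kexG N = U `*` G.
Proof.
apply/seteqP; split => -[x P].
  by move=> [N _ [/kex_sub Ux GP]].
by move=> [/=]; rewrite -{1}(bigcup_kex oU) => -[N _ xN] GP; exists N.
Qed.

Lemma le_kexG i j : (i <= j)%N -> kexG i `<=` kexG j.
Proof. by move=> ij [x P] [/(le_kex ij) xj GP]. Qed.

Variable V : {outer_measure set X -> \bar R}.
Hypothesis rV : radon_over (U `*` G) V.

Let oUG : open (U `*` G). Proof. exact: open_setXG. Qed.

Lemma varifold_open Q : open Q -> V.-caratheodory Q.
Proof. exact: (radon_open oUG rV). Qed.

Lemma cylinder_caratheodory (B : set E) : <<s open >> B -> V.-caratheodory (B `*` G).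
Proof.
move=> bB; rewrite setXE; apply: caratheodory_measurable_setI; last first.
  apply: varifold_open; apply: open_comp => [x _|]; first exact: cvg_snd.
  exact: open_grassmann.
move: B bB; apply: smallest_sub; last first.
  move=> A oA; apply: varifold_open; apply: open_comp => [x _|//]; exact: cvg_fst.
split; first exact: caratheodory_measurable_set0.
- by move=> A cA; rewrite setTD preimage_setC; exact: caratheodory_measurable_setC.
- by move=> F cF; rewrite preimage_bigcup; exact: caratheodory_measurable_bigcup.
Qed.

Lemma weight_caratheodory (A : set E) : V.-caratheodory (A `*` G) ->
  (weight m V).-caratheodory A.
Proof.
move=> cA Q; rewrite /weight (cA (Q `*` G)); congr (V _ + V _).
  by apply/seteqP; split => -[x P] /=; [move=> [[? ?] []]|move=> [[? ?] ?]].
apply/seteqP; split => -[x P] /=; last by move=> [[? ?] ?]; split => // -[].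
by move=> [[Qx GP] h]; split => //; split => // Ax; apply: h.
Qed.

Lemma weight_open O : open O -> (weight m V).-caratheodory O.
Proof. by move=> oO; apply: weight_caratheodory; apply: varifold_open; exact: open_setXG. Qed.

(** Tube lemma, from compactness of the fibre [G]. It converts outer regularity of V on cylinders
    into outer regularity of ||V||. *)
Lemma tube (A : set E) (Q : set X) : open Q -> A `*` G `<=` Q ->
  exists O, [/\ open O, A `<=` O & O `*` G `<=` Q].
Proof.
move=> oQ AQ; exists [set x | forall P, G P -> Q (x, P)]; split.
- rewrite openE => x hx; rewrite /interior /=.
  have : near_covering G by apply/compact_near_coveringP; exact: compact_grassmann.
  move=> /(_ E (nbhs x) (fun y P => Q (y, P)) _); apply => P GP.
  have : nbhs (x, P) Q by apply: open_nbhs_nbhs; split => //; exact: hx.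
  move=> [[A1 A2] /= [nA1 nA2] AQ']; exists (A2, A1) => //=.
  by move=> [p y] /= [A2p A1y]; apply: AQ'.
- by move=> x Ax P GP; exact: AQ.
- by move=> [x P] [/= h GP]; exact: h.
Qed.

Lemma radon_weight : radon_over U [the {outer_measure set E -> \bar R} of weight m V].
Proof.
have [V0 VK VG VGK VA] := rV; split => /=.
- rewrite /weight; apply: null_subset V0 => -[x P] /= [Ux _] [/= ? _]; exact: Ux.
- move=> K cK KU; apply: VK; first exact: compact_setX cK (@compact_grassmann _ _ _).
  by move=> [x P] /= [/KU Ux GP].
- by move=> O oO _; exact: weight_open.
- by move=> O oO _; apply: open_sup_compact => //; exact: weight_open.
- move=> A AU; apply/eqP; rewrite eq_le; apply/andP; split.
    apply: le_ereal_inf_tmp => _ [Q [oQ AQ QU] <-]; exact: le_outer_measure.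
  rewrite {2}/weight VA; last by move=> [x P] [/AU].
  apply: le_ereal_inf_tmp => _ [Q [oQ AQ QU] <-].
  have [D [oD AD DQ]] := tube oQ AQ.
  apply: (@le_trans _ _ (weight m V (D `&` U))).
    apply: ereal_inf_lbound; exists (D `&` U) => //; split => //.
    - exact: openI.
    - by move=> x Ax; split; [exact: AD|exact: AU].
  by apply: le_outer_measure => -[x P] [[Dx _] GP]; apply: DQ.
Qed.
End weights.

(** * Test fields *)

Section test_fields.
Variables (R : realType) (n : nat).
Local Notation E := 'rV[R]_n.
Variable U : set E.
Implicit Types (th : E -> E) (phi : E -> R).

Lemma closed_spt (W : nmodType) (f : E -> W) : closed (spt f).
Proof. exact: closed_closure. Qed.

Lemma test_fieldP th : test_fields U th <->
  [/\ Cinf th, compact (spt th) & spt th `<=` U].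
Proof. by split=> -[h1 h2 h3]; split => //; apply/smooth_Cinf. Qed.

Lemma test_field_sub th (C : set E) : Cinf th -> compact C -> C `<=` U ->
  (forall x, ~ C x -> th x = 0) -> test_fields U th.
Proof.
move=> ch cC CU C0.
have sC : spt th `<=` C.
  by apply: spt_sub => //; apply: compact_closed => //; exact: norm_hausdorff.
apply/test_fieldP; split => //; last exact: subset_trans sC CU.
exact: (subclosed_compact (@closed_spt _ _) cC sC).
Qed.

Lemma test_field0 : test_fields U (fun _ : E => 0 : E).
Proof.
apply: (@test_field_sub _ set0) => //; first exact: Cinf_cst.
exact: compact0.
Qed.

Lemma test_field_lin (a : R) th1 th2 : test_fields U th1 -> test_fields U th2 ->
  test_fields U (fun x => a *: th1 x + th2 x).
Proof.
move=> /test_fieldP[s1 c1 u1] /test_fieldP[s2 c2 u2].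
apply: (@test_field_sub _ (spt th1 `|` spt th2)).
- apply: CinfD => //; apply: (@CinfZ _ _ _ (fun=> a)) => //; exact: Cinf_cst.
- exact: compactU.
- by move=> x [/u1|/u2].
- move=> x h; have -> : th1 x = 0 by apply: spt_eq0 => hx; apply: h; left.
  have -> : th2 x = 0 by apply: spt_eq0 => hx; apply: h; right.
  by rewrite scaler0 addr0.
Qed.

Lemma test_fieldZ (a : R) th : test_fields U th -> test_fields U (fun x => a *: th x).
Proof.
move=> h; rewrite (_ : (fun x => _) = (fun x => a *: th x + 0)).
  by apply: (test_field_lin a h); exact: test_field0.
by apply/funext => x; rewrite addr0.
Qed.

Lemma test_fieldD th1 th2 : test_fields U th1 -> test_fields U th2 ->
  test_fields U (fun x => th1 x + th2 x).
Proof.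
move=> h1 h2; rewrite (_ : (fun x => _) = (fun x => 1 *: th1 x + th2 x)).
  exact: test_field_lin.
by apply/funext => x; rewrite scale1r.
Qed.

Lemma test_field_mul phi th : Cinf phi -> test_fields U th ->
  test_fields U (fun x => phi x *: th x).
Proof.
move=> cphi /test_fieldP[s c u]; apply: (@test_field_sub _ (spt th)) => //.
  exact: CinfZ.
by move=> x /spt_eq0 ->; rewrite scaler0.
Qed.

Lemma spt_mul_subl phi th : spt (fun x => phi x *: th x) `<=` spt phi.
Proof. by apply: spt_sub => [|x /spt_eq0 ->]; [exact: closed_spt|rewrite scale0r]. Qed.

Lemma test_field_bounded th : test_fields U th -> exists M : R, forall x, enorm (th x) <= M.
Proof.
move=> /test_fieldP[s c u].
have cc : continuous (fun x => enorm (th x)).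
  apply: (continuous_comp_fun (Cinf_continuous s)); exact: continuous_enorm.
have /compact_bounded[M [_ hM]] : compact ((fun x => enorm (th x)) @` spt th).
  by apply: continuous_compact => //; exact: continuous_subspaceT.
exists (Num.max 0 (M + 1)) => x; have [sx|/spt_eq0->] := pselect (spt th x).
  rewrite le_max; apply/orP; right; rewrite -[leLHS]ger0_norm ?enorm_ge0//.
  by apply: hM; [rewrite ltrDl|exists x].
by rewrite enorm0 le_max lexx.
Qed.
End test_fields.

(** * Construction of the variation measure of a linear functional *)

Section variation_existence.
Variables (R : realType) (n : nat).
Local Notation E := 'rV[R]_n.
Variable U : set E.
Hypothesis oU : open U.
Variable S : (E -> E) -> R.
Hypothesis Slin : forall (a : R) th1 th2, test_fields U th1 -> test_fields U th2 ->
  S (fun x => a *: th1 x + th2 x) = a * S th1 + S th2.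
Local Open Scope ereal_scope.

Definition unit_fields (Q : set E) : set (E -> E) :=
  [set th | [/\ test_fields U th, spt th `<=` Q & forall x, (enorm (th x) <= 1)%R]].

Definition vsup (Q : set E) : \bar R := ereal_sup [set (S th)%:E | th in unit_fields Q].

Let S0 : S (fun=> 0%R) = 0%R.
Proof.
have t0 := @test_field0 R n U.
have := Slin 1 t0 t0; rewrite mul1r.
rewrite (_ : (fun x : E => 1 *: 0 + 0)%R = (fun=> 0%R)); last by apply/funext => x; rewrite scaler0 addr0.
by move=> /eqP; rewrite addrC -subr_eq subrr => /eqP.
Qed.

Let unit0 Q : unit_fields Q (fun=> 0%R).
Proof.
split; first exact: test_field0.
- apply: (@subset_trans _ set0) => //; apply: spt_sub => //; exact: closed0.
- by move=> x; rewrite enorm0.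
Qed.

Lemma vsup_ge0 Q : 0 <= vsup Q.
Proof. by apply: ereal_sup_ubound; exists (fun=> 0%R); rewrite ?S0. Qed.

Lemma le_vsup Q1 Q2 : Q1 `<=` Q2 -> vsup Q1 <= vsup Q2.
Proof.
move=> Q12; apply: ge_ereal_sup => _ [th [t1 t2 t3] <-].
apply: ereal_sup_ubound; exists th => //; split => //; exact: subset_trans Q12.
Qed.

Lemma vsup0 : vsup set0 = 0.
Proof.
apply/eqP; rewrite eq_le vsup_ge0 andbT; apply: ge_ereal_sup => _ [th [_ t2 _] <-].
have -> : th = (fun=> 0%R) by apply/funext => x; apply: spt_eq0 => /t2.
by rewrite S0.
Qed.

Let SD th1 th2 : test_fields U th1 -> test_fields U th2 ->
  S (fun x => th1 x + th2 x)%R = (S th1 + S th2)%R.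
Proof.
move=> h1 h2; rewrite -(mul1r (S th1)) -Slin//.
by congr S; apply/funext => x; rewrite scale1r.
Qed.

(** The support of th outside Q2 is a compact subset of Q1. A cut-off phi supported in Q1 and equal
    to 1 near this set splits th into phi th, supported in Q1, and (1 - phi) th, supported in Q2. *)
Lemma vsupU Q1 Q2 : open Q1 -> open Q2 -> vsup (Q1 `|` Q2) <= vsup Q1 + vsup Q2.
Proof.
move=> o1 o2; apply: ge_ereal_sup => _ [th [t1 t2 t3] <-].
have [sth cth uth] := (test_fieldP U th).1 t1.
have cK : compact (spt th `&` ~` Q2).
  by apply: compact_closedI => //; exact: open_closedC.
have KQ : spt th `&` ~` Q2 `<=` Q1.
  by move=> x [/t2 [] // ? ?].
have [phi [cphi phi01 [N oN [KN N1]] c1 s1]] := smooth_urysohn cK o1 KQ.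
have cphi' : Cinf (fun x => 1 - phi x)%R by apply: CinfB => //; exact: Cinf_cst.
pose th1 x := phi x *: th x; pose th2 x := (1 - phi x) *: th x.
have tt1 : test_fields U th1 by exact: test_field_mul.
have tt2 : test_fields U th2 by exact: test_field_mul.
have -> : th = (fun x => th1 x + th2 x)%R.
  by apply/funext => x; rewrite /th1 /th2 -scalerDl addrC subrK scale1r.
rewrite SD// EFinD; apply: leeD; apply: ereal_sup_ubound.
- exists th1 => //; split => //; first by apply: subset_trans s1; exact: spt_mul_subl.
  move=> x; have /andP[p0 p1] := phi01 x.
  by rewrite enormZ ger0_norm// mulr_ile1// enorm_ge0.
- exists th2 => //; split => //.
    apply: (@subset_trans _ (spt th `&` ~` N)).
      apply: spt_sub => [|x h]; first by apply: closedI; [exact: closed_spt|exact: open_closedC].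
      rewrite /th2; have [sx|/spt_eq0->] := pselect (spt th x); last by rewrite scaler0.
      have [Nx|nNx] := pselect (N x); first by rewrite N1// subrr scale0r.
      by exfalso; apply: h.
    move=> x [sx nNx]; apply: contrapT => nQ2; apply: nNx; exact: KN.
  move=> x; have /andP[p0 p1] := phi01 x.
  rewrite enormZ ger0_norm ?subr_ge0// mulr_ile1 ?enorm_ge0 ?subr_ge0//.
  by rewrite gerBl.
Qed.

(** A field has compact support, so finitely many of the sets suffice and [vsupU] applies. *)
Lemma vsup_bigcup (F : nat -> set E) : (forall i, open (F i)) ->
  vsup (\bigcup_i F i) <= \sum_(i <oo) vsup (F i).
Proof.
move=> oF; apply: ge_ereal_sup => _ [th [t1 t2 t3] <-].
have [sth cth uth] := (test_fieldP U th).1 t1.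
pose G N := \bigcup_(i < N) F i.
have [||x /t2 [i _ Fx]|N KN] := @compact_bigcup_nondecreasing _ (spt th) G cth.
- by move=> N; apply: bigcup_open => i _.
- by move=> i j ij x [k /= ki Fk]; exists k => //=; exact: leq_trans ij.
- by exists i.+1 => //; exists i => /=.
apply: (@le_trans _ _ (vsup (G N))).
  by apply: ereal_sup_ubound; exists th.
apply: (@le_trans _ _ (\sum_(0 <= i < N) vsup (F i))); last first.
  by apply: nneseries_lim_ge => i _ _; exact: vsup_ge0.
elim: N {KN} => [|N IH].
  by rewrite big_geq// /G bigcup_mkord big_ord0 vsup0.
rewrite big_nat_recr//= /G bigcup_mkord big_ord_recr /= -bigcup_mkord.
apply: le_trans (vsupU _ _) _ => //; first by apply: bigcup_open => i _.
by apply: leeD.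
Qed.

Definition vclass : set (set E) := [set Q | open Q /\ Q `<=` U].

Let vclass0 : vclass set0. Proof. by split => //; exact: open0. Qed.

Definition vouter : {outer_measure set E -> \bar R} :=
  HB.pack_for {outer_measure set E -> \bar R} (cover_outer vclass vsup)
   (isOuterMeasure.Build R E (cover_outer vclass vsup)
     (cover_outer0 vclass0 vsup0 vsup_ge0) (@cover_outer_ge0 _ _ vclass vsup vsup_ge0)
     (@le_cover_outer _ _ vclass vsup) (@cover_outer_sigma_subadditive _ _ vclass vsup vsup_ge0)).

(** Sets not contained in U have no covering by members of [vclass], so [vouter] is infinite there;
    intersecting with U gives the value 0 on the complement of U. *)
Definition voute : {outer_measure set E -> \bar R} :=
  [the {outer_measure set E -> \bar R} of orestr vouter U].

(** By [vsup_bigcup] a countable covering costs at least as much as its union, which is again an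
    open subset of U. *)
Lemma vouteE A : voute A = ereal_inf [set vsup Q | Q in
  [set Q | [/\ open Q, A `&` U `<=` Q & Q `<=` U]]].
Proof.
rewrite /voute /= /orestr /= setIC /cover_outer.
apply/eqP; rewrite eq_le; apply/andP; split.
  apply: le_ereal_inf_tmp => _ [Q [oQ AQ QU] <-].
  pose F (i : nat) : set E := if (i == 0)%N then Q else set0.
  apply: (@le_trans _ _ (\sum_(i <oo) vsup (F i))).
    apply: ereal_inf_lbound; exists F => //.
    split; first by case=> [|i] //; split.
    by move=> x /AQ Qx; exists 0%N.
  rewrite nneseries_recl//; last by move=> *; exact: vsup_ge0.
  rewrite [X in _ + X]eseries0 ?adde0// => -[|i] // _ _; exact: vsup0.
apply: le_ereal_inf_tmp => _ [F [cF AF] <-].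
apply: le_trans (vsup_bigcup (fun i => (cF i).1)).
apply: ereal_inf_lbound; exists (\bigcup_i F i) => //; split => //.
  by apply: bigcup_open => i _; exact: (cF i).1.
by move=> x [i _ /(cF i).2].
Qed.

Lemma voute_open Q : open Q -> Q `<=` U -> voute Q = vsup Q.
Proof.
move=> oQ QU; rewrite vouteE; apply/eqP; rewrite eq_le; apply/andP; split.
  by apply: ereal_inf_lbound; exists Q => //; split => // x [].
apply: le_ereal_inf_tmp => _ [Q' [_ QQ' _] <-]; apply: le_vsup => x Qx.
by apply: QQ'; split => //; exact: QU.
Qed.

(** For th supported in Q [&] G, the open set Q \ spt th contains Q \ G. Fields supported there do
    not overlap th, so the sum still has length at most 1. This is the measurability of open
    sets. *)
Lemma vsup_split Q G : open Q -> Q `<=` U -> open G -> vsup (Q `&` G) + voute (Q `\` G) <= vsup Q.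
Proof.
move=> oQ QU oG.
have h th : unit_fields (Q `&` G) th -> (S th)%:E + voute (Q `\` G) <= vsup Q.
  move=> [t1 t2 t3]; have [sth cth uth] := (test_fieldP U th).1 t1.
  have oD : open (Q `\` spt th) by apply: openI => //; apply: closed_openC; exact: closed_spt.
  have DU : Q `\` spt th `<=` U by move=> x [/QU].
  apply: (@le_trans _ _ ((S th)%:E + vsup (Q `\` spt th))).
    rewrite leeD2l// -(voute_open oD DU); apply: le_outer_measure => x [Qx nGx].
    by split => // /t2[].
  rewrite -leeBrDl//; apply: ge_ereal_sup => _ [th' [t1' t2' t3'] <-].
  rewrite leeBrDl// -EFinD -SD//; apply: ereal_sup_ubound.
  exists (fun x => th x + th' x)%R => //.
  split; first exact: test_fieldD.
  - apply: (@subset_trans _ (spt th `|` spt th')); last by move=> x [/t2[]|/t2'[]].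
    apply: spt_sub => [|x h]; first by apply: closedU; exact: closed_spt.
    have -> : th x = 0%R by apply: spt_eq0 => hx; apply: h; left.
    have -> : th' x = 0%R by apply: spt_eq0 => hx; apply: h; right.
    by rewrite addr0.
  - move=> x; have [sx|/spt_eq0->] := pselect (spt th x); last by rewrite add0r.
    rewrite [th' x]spt_eq0 ?addr0// => /t2' [_]; exact.
have [voo|voo] := boolP (voute (Q `\` G) \is a fin_num).
  rewrite -leeBrDr//; apply: ge_ereal_sup => _ [th hth <-].
  by rewrite leeBrDr//; exact: h.
have := h _ (@unit0 _); rewrite S0 add0e => h0.
move: voo; rewrite ge0_fin_numE ?outer_measure_ge0// -leNgt leye_eq => /eqP voo.
by move: h0; rewrite voo leye_eq => /eqP ->; rewrite leey.
Qed.

Lemma voute_caratheodory G : open G -> voute.-caratheodory G.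
Proof.
move=> oG; apply: le_caratheodory_measurable => A.
rewrite [leRHS]vouteE; apply: le_ereal_inf_tmp => _ [Q [oQ AQ QU] <-].
apply: le_trans (vsup_split oQ QU oG); apply: leeD.
  have oQG : open (Q `&` G) by exact: openI.
  have QGU : Q `&` G `<=` U by move=> x [/QU].
  rewrite vouteE; apply: ereal_inf_lbound; exists (Q `&` G) => //; split => //.
  by move=> x [[Ax Gx] Ux]; split => //; apply: AQ.
rewrite !vouteE; apply: ereal_inf_le_tmp => _ [Q' [oQ' AQ' Q'U] <-].
by exists Q' => //; split => // x [[Ax nGx] Ux]; apply: AQ' => //; split => //; split => //; exact: AQ.
Qed.

Lemma voute_compl : voute (~` U) = 0.
Proof. by change (vouter (U `&` ~` U) = 0); rewrite setICr; exact: outer_measure0. Qed.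

Lemma voute_borel_regular : borel_regular_over U voute.
Proof.
split; first exact: voute_compl.
  by move=> G oG _; exact: voute_caratheodory.
move=> A AU; have [Aoo|Aoo] := boolP (voute A \is a fin_num); last first.
  exists U; split => //; first exact: sub_sigma_algebra.
  move: Aoo; rewrite ge0_fin_numE ?outer_measure_ge0// -leNgt leye_eq => /eqP Aoo.
  apply/esym/eqP; rewrite Aoo -leye_eq -Aoo; exact: le_outer_measure.
have : forall j : nat, exists Q, [/\ open Q, A `<=` Q, Q `<=` U & voute Q <= voute A + (j.+1%:R^-1)%:E].
  move=> j; have j0 : (0 < j.+1%:R^-1 :> R)%R by [].
  move: (Aoo); rewrite vouteE => fA'.
  have [_ [Q [oQ AQ QU] <-] /ltW Qe] := lb_ereal_inf_adherent j0 fA'.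
  exists Q; split => //; first by move=> x Ax; apply: AQ; split => //; exact: AU.
  by rewrite voute_open.
move=> /choice[Q hQ]; exists (\bigcap_j Q j); split.
- have -> : \bigcap_j Q j = ~` (\bigcup_j ~` Q j) by rewrite setC_bigcup; apply: eq_bigcapr => j _; rewrite setCK.
  rewrite -setTD; apply: sigma_algebraCD; apply: sigma_algebra_bigcup => j.
  by rewrite -setTD; apply: sigma_algebraCD; apply: sub_sigma_algebra; have [] := hQ j.
- by move=> x Ax j _; have [_ + _ _] := hQ j; apply.
- by move=> x /(_ 0%N I); have [_ _ + _] := hQ 0%N; apply.
- apply/eqP; rewrite eq_le; apply/andP; split.
    by apply: le_outer_measure => x Ax j _; have [_ + _ _] := hQ j; apply.
  apply/lee_addgt0Pr => e e0; pose j := Num.truncn e^-1.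
  have [_ _ _ h] := hQ j.
  apply: (@le_trans _ _ (voute (Q j))).
    by apply: le_outer_measure => x /(_ j I).
  apply: (le_trans h); rewrite leeD2l// lee_fin -[leRHS]invrK lef_pV2 ?posrE ?invr_gt0//.
  by rewrite ltW// truncnS_gt.
Qed.

Lemma voute_formula : variation_formula U S voute.
Proof. by move=> Q oQ QU; rewrite voute_open. Qed.

Lemma voute_max (nu : {outer_measure set E -> \bar R}) :
  borel_regular_over U nu -> variation_formula U S nu -> forall A, nu A <= voute A.
Proof.
move=> [nu0 nuG _] nuS A; rewrite vouteE.
apply: le_ereal_inf_tmp => _ [Q [oQ AQ QU] <-].
apply: (@le_trans _ _ (nu (Q `|` ~` U))).
  apply: le_outer_measure => x Ax; have [Ux|nUx] := pselect (U x); [left|right] => //.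
  exact: AQ.
by apply: le_trans (outer_measureU2 _ _ _) _; rewrite nu0 adde0 nuS.
Qed.

(** [xget] returns some largest admissible measure; [voute] is admissible and largest too, so each
    dominates the other. *)
Lemma variationE A : Defs.variation U S A = voute A.
Proof.
have : exists mu : {outer_measure set E -> \bar R},
    [/\ borel_regular_over U mu, variation_formula U S mu &
          forall nu : {outer_measure set E -> \bar R},
            borel_regular_over U nu -> variation_formula U S nu ->
            forall A, (nu A <= mu A)%E].
  exists voute; split; first exact: voute_borel_regular.
    exact: voute_formula.
  exact: voute_max.
move=> /(xgetPex [the {outer_measure set E -> \bar R} of @ozero R E]) [v1 v2 v3].
apply/eqP; rewrite eq_le; apply/andP; split; first exact: voute_max v1 v2 A.
exact: (v3 _ voute_borel_regular voute_formula A).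
Qed.

Lemma variation_unit th Q : open Q -> Q `<=` U -> unit_fields Q th ->
  (S th)%:E <= Defs.variation U S Q.
Proof.
move=> oQ QU hth; rewrite variationE voute_open//.
by apply: ereal_sup_ubound; exists th.
Qed.

Lemma radon_variationP :
  (forall K, compact K -> K `<=` U -> Defs.variation U S K < +oo) ->
  radon_over U (Defs.variation U S).
Proof.
have -> : Defs.variation U S = voute by apply: outer_measure_eq => A; exact: variationE.
move=> Koo; split => //.
- exact: voute_compl.
- by move=> G oG _; exact: voute_caratheodory.
- by move=> G oG _; apply: open_sup_compact => //; exact: voute_caratheodory.
- move=> A AU; rewrite vouteE (setIidl AU); congr ereal_inf.
  apply/seteqP; split => _ [Q [oQ AQ QU] <-]; exists Q => //.
    by rewrite voute_open.
  by rewrite voute_open.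
Qed.
End variation_existence.

(** * A functional is bounded by the integral against its variation *)

Section variation_bound.
Variables (R : realType) (n : nat).
Local Notation E := 'rV[R]_n.
Variable U : set E.
Hypothesis oU : open U.
Variable S : (E -> E) -> R.
Hypothesis Slin : forall (a : R) th1 th2, test_fields U th1 -> test_fields U th2 ->
  S (fun x => a *: th1 x + th2 x) = a * S th1 + S th2.
Variable mu : {outer_measure set E -> \bar R}.
Hypothesis rmu : radon_over U mu.
Hypothesis Smu : forall th Q, open Q -> Q `<=` U -> unit_fields U Q th -> ((S th)%:E <= mu Q)%E.

(** For y <= 1/8 the first term vanishes and the remaining ones are half of the sum for 2 y, so
    induction applies. For y > 1/8 the whole geometric sum is at most 2. *)
Lemma dyadic_layers (N : nat) (y : R) : 0 <= y ->
  \sum_(k < N) 2 ^- k * (2 ^- k.+3 < y)%R%:R <= 16 * y.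
Proof.
elim: N y => [|N IH] y y0; first by rewrite big_ord0 mulr_ge0.
have [y8|y8] := leP y (2 ^- 3).
  rewrite big_ord_recl ltNge y8 /= mulr0 add0r.
  have -> : \sum_(i < N) 2 ^- bump 0 i * (2 ^- (bump 0 i).+3 < y)%R%:R =
     2^-1 * \sum_(i < N) 2 ^- i * (2 ^- i.+3 < 2 * y)%R%:R :> R.
    rewrite mulr_sumr; apply: eq_bigr => i _; rewrite /bump leq0n add1n.
    rewrite mulrA -invfM -exprS; congr (_ * _); congr (nat_of_bool _)%:R.
    by rewrite -ltr_pdivrMl// mulrC -invfM -exprSr.
  rewrite ler_pdivrMl//; apply: le_trans (IH _ _) _; first by rewrite mulr_ge0.
  by rewrite mulrCA.
apply: (@le_trans _ _ (\sum_(k < N.+1) 2 ^- k)).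
  apply: ler_sum => k _; rewrite -[leRHS]mulr1 ler_wpM2l ?invr_ge0 ?exprn_ge0//.
  by rewrite lern1 leq_b1.
apply: (@le_trans _ _ 2); last first.
  by move: y8; rewrite -[2 ^- 3]/((2 ^+ 3)^-1) -natrX; lra.
have -> : \sum_(k < N.+1) 2 ^- k = 2 - 2 ^- N :> R.
  elim: N {IH} => [|N IH]; first by rewrite big_ord1 expr0 invr1; lra.
  rewrite big_ord_recr IH /= exprS invfM; lra.
by rewrite gerBl invr_ge0 exprn_ge0.
Qed.

Definition L1norm (f : E -> E) : \bar R := (\int[cmeas mu]_x (enorm (f x))%:E)%E.

Lemma L1norm_ge0 f : (0 <= L1norm f)%E.
Proof. by apply: integral_ge0 => x _; rewrite lee_fin enorm_ge0. Qed.

Let oG G : open G -> mu.-caratheodory G. Proof. exact: (radon_open oU rmu). Qed.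

Lemma measurable_enorm (th : E -> E) : continuous th ->
  measurable_fun setT ((fun x : E => enorm (th x)) : caratheodory_type mu -> R).
Proof.
move=> ct; apply: continuous_caratheodory => //.
by apply: (continuous_comp_fun ct); exact: continuous_enorm.
Qed.

Let kint_open j : exists Q, [/\ open Q, kex U j `<=` Q, Q `<=` U & (mu Q < +oo)%E].
Proof.
exists (kex U j.+1)°; split.
- exact: open_interior.
- exact: kex_interior.
- by apply: subset_trans (@interior_subset _ _) _; exact: kex_sub.
- apply: le_lt_trans (radon_ltoo rmu (@compact_kex _ _ U j.+1) (@kex_sub _ _ _ _)).
  by apply: le_outer_measure; exact: interior_subset.
Qed.

(** Equal to 1 where |th| <= 2^-(k+1) and to 0 where |th| >= 2^-k, by the thresholds 1/4 and 1 of
    [cutoff]. *)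
Definition level (th : E -> E) (k : nat) (x : E) : R := cutoff (4 ^+ k * sqn (th x)).

Let S0 : S (fun=> 0) = 0.
Proof.
have t0 := @test_field0 R n U.
have := Slin 1 t0 t0; rewrite mul1r.
rewrite (_ : (fun x : E => 1 *: 0 + 0) = (fun=> 0)); last by apply/funext => x; rewrite scaler0 addr0.
by move=> /eqP; rewrite addrC -subr_eq subrr => /eqP.
Qed.

Let SZ (a : R) th : test_fields U th -> S (fun x => a *: th x) = a * S th.
Proof.
move=> h; rewrite -[RHS]addr0 -S0 -Slin//; last exact: test_field0.
by congr S; apply/funext => x; rewrite addr0.
Qed.

Lemma Cinf_level th k : test_fields U th -> Cinf (level th k).
Proof.
move=> /test_fieldP[sth _ _]; apply: (Cinf_comp _ (@Cinf_cutoff R)).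
apply: (@CinfZ _ _ _ (fun=> _) (fun x => sqn (th x))); first exact: Cinf_cst.
apply: Cinf_sum => i.
rewrite (_ : (fun x => _) = (fun x : E => th x 0 i *: th x 0 i)).
  suff h : Cinf (fun x => th x 0 i) by exact: CinfZ.
  exact: Cinf_coord_comp.
by apply/funext => x; rewrite expr2.
Qed.

Lemma level_eq1 th k x : enorm (th x) <= 2 ^- k.+1 -> level th k x = 1.
Proof.
move=> h; apply: cutoff_eq1; rewrite -ler_pdivlMl ?exprn_gt0// -sqr_enorm.
apply: (@le_trans _ _ ((2 ^- k.+1) ^+ 2)).
  by rewrite ler_pXn2r// ?nnegrE ?enorm_ge0 ?invr_ge0 ?exprn_ge0.
rewrite exprVn -exprM mulnC exprM (_ : 2 ^+ 2 = 4 :> R); last by rewrite -natrX.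
by rewrite exprSr invfM mul1r.
Qed.

(* th is a telescoping sum of differences of smooth truncations of th at the
   levels 2^-k of |th|: the k-th difference has norm at most 2^-k and lives on
   the open set where |th| > 2^-(k+3). *)
Lemma variation_le_half th : test_fields U th -> (forall x, enorm (th x) <= 1 / 2) ->
  ((S th)%:E <= 16%:E * L1norm th)%E.
Proof.
move=> tth th12; have [sth cth uth] := (test_fieldP U th).1 tth.
pose T k x := level th k x *: th x.
have tT k : test_fields U (T k) by apply: test_field_mul => //; exact: Cinf_level.
have T0 : T 0%N = th.
  apply/funext => x; rewrite /T /level cutoff_eq1 ?scale1r// expr0 mul1r -sqr_enorm.
  apply: (@le_trans _ _ ((1 / 2) ^+ 2)); last lra.
  by rewrite ler_pXn2r// ?nnegrE ?enorm_ge0.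
have small k x : level th k x != 0 -> enorm (th x) <= 2 ^- k.
  apply: contraNT; rewrite -ltNge => h; apply/eqP/cutoff_eq0.
  rewrite -ler_pdivrMl ?exprn_gt0// mulr1 -sqr_enorm (_ : 4 = 2 ^+ 2); last by rewrite -natrX.
  rewrite -exprM mulnC exprM -exprVn ler_pXn2r// ?nnegrE ?enorm_ge0 ?invr_ge0 ?exprn_ge0//.
  exact: ltW.
pose D k x := T k x + (-1) *: T k.+1 x.
have DE k x : D k x = (level th k x - level th k.+1 x) *: th x.
  by rewrite /D /T scaleN1r scalerBl.
have tD k : test_fields U (D k).
  rewrite (_ : D k = (fun x => (-1) *: T k.+1 x + T k x)); first exact: test_field_lin.
  by apply/funext => x; rewrite /D addrC.
pose Q k := [set x | 2 ^- k.+3 < enorm (th x)].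
have oQ k : open (Q k).
  rewrite (_ : Q k = (fun x => enorm (th x)) @^-1` [set t | 2 ^- k.+3 < t])//.
  apply: open_comp => [x _|]; last exact: open_gt.
  by apply: (continuous_comp_fun (Cinf_continuous sth)); exact: continuous_enorm.
have QU k : Q k `<=` U.
  move=> x Qx; apply: uth; apply: contrapT => /spt_eq0 x0.
  by move: Qx; rewrite /Q /= x0 enorm0 ltNge invr_ge0 exprn_ge0.
have SD k : ((S (D k))%:E <= (2 ^- k)%:E * mu (Q k))%E.
  have h : ((S (fun x => 2 ^+ k *: D k x))%:E <= mu (Q k))%E.
    apply: Smu => //; split; first exact: test_fieldZ.
    - apply: (@subset_trans _ [set x | 2 ^- k.+2 <= enorm (th x)]).
        apply: spt_sub => [|x /= /negP].
          rewrite (_ : [set x | _] = (fun x => enorm (th x)) @^-1` [set t | 2 ^- k.+2 <= t])//.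
          apply: preimage_closed => [x _|]; last exact: closed_ge.
          by apply: (continuous_comp_fun (Cinf_continuous sth)); exact: continuous_enorm.
        rewrite -ltNge => xk; rewrite DE.
        have e1 j : (j <= k.+1)%N -> level th j x = 1.
          move=> jk; apply: level_eq1; apply: (le_trans (ltW xk)).
          by rewrite lef_pV2 ?posrE ?exprn_gt0// ler_weXn2l// ler1n.
        by rewrite !e1 ?leqnn ?leqnSn// subrr scale0r scaler0.
      move=> x /= h; rewrite /Q /=; apply: lt_le_trans h.
      by rewrite ltf_pV2 ?posrE ?exprn_gt0// ltr_eXn2l// ltr1n.
    - move=> x; rewrite DE scalerA enormZ.
      (* A point where the level k+1 does not vanish has |th| <= 2^-(k+1), so the level k is 1
         there. Hence a vanishing level k makes the level k+1, and with it the difference,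
         vanish. *)
      have [z|z] := eqVneq (level th k x) 0.
        have z' : level th k.+1 x = 0.
          apply/eqP/negPn/negP => nz.
          have := @level_eq1 th k x (small _ _ nz).
          by rewrite z => /eqP; rewrite eq_sym oner_eq0.
        by rewrite z z' subrr mulr0 normr0 mul0r.
      have := small _ _ z => h.
      rewrite normrM (ger0_norm (exprn_ge0 _ _))// -mulrA -ler_pdivlMl ?exprn_gt0// mulr1.
      rewrite -[leRHS]mul1r; apply: ler_pM => //; first exact: enorm_ge0.
      have lv j' : 0 <= level th j' x <= 1 by rewrite cutoff_ge0 cutoff_le1.
      move: (lv k) (lv k.+1) => /andP[a0 a1] /andP[b0 b1].
      rewrite ler_norml; apply/andP; split.
        by rewrite lerBrDr (le_trans _ a0)// addrC subr_le0.
      by rewrite lerBlDr (le_trans a1)// lerDl.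
  by rewrite lee_pdivlMl ?exprn_gt0// -EFinM -SZ.
have tele N : S th = \sum_(k < N) S (D k) + S (T N).
  elim: N => [|N IH]; first by rewrite big_ord0 add0r T0.
  rewrite big_ord_recr /= -addrA IH; congr (_ + _).
  rewrite (_ : D N = (fun x => (-1) *: T N.+1 x + T N x)); last first.
    by apply/funext => x; rewrite /D addrC.
  by rewrite (Slin (-1) (tT N.+1) (tT N)) mulN1r addrAC addNr add0r.
have sumQ N : (\sum_(k < N) (2 ^- k)%:E * mu (Q k) <= 16%:E * L1norm th)%E.
  pose g (k : 'I_N) (x : E) : \bar R := ((2 ^- k)%:E * (\1_(Q k) x)%:E)%E.
  have mQ k : measurable (Q k : set (caratheodory_type mu)) by exact: oG.
  have mg k : measurable_fun setT (g k : caratheodory_type mu -> \bar R).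
    apply/measurable_EFinP; apply: measurable_funM => //.
  have g0 k x : (0 <= g k x)%E by rewrite /g -EFinM lee_fin mulr_ge0 ?invr_ge0 ?exprn_ge0.
  have -> : (\sum_(k < N) (2 ^- k)%:E * mu (Q k) = \int[cmeas mu]_x \sum_(k < N) g k x)%E.
    rewrite ge0_integral_sum//; apply: eq_bigr => k _.
    rewrite ge0_integralZl_EFin ?invr_ge0 ?exprn_ge0//.
    + by rewrite integral_indic// setIT.
    + by apply/measurable_EFinP.
  rewrite /L1norm -ge0_integralZl_EFin//; last 2 first.
  - by move=> x _; rewrite lee_fin enorm_ge0.
  - by apply/measurable_EFinP; apply: measurable_enorm; exact: Cinf_continuous.
  apply: ge0_le_integral => //.
  - by move=> x _; apply: sume_ge0.
  - by apply: emeasurable_sum.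
  - apply/measurable_EFinP; apply: measurable_funM => //.
    by apply: measurable_enorm; exact: Cinf_continuous.
  - move=> x _; rewrite /g -EFinM.
    under eq_bigr do rewrite -EFinM.
    rewrite sumEFin lee_fin; apply: le_trans (dyadic_layers N (enorm_ge0 (th x))).
    apply: ler_sum => k _; rewrite ler_wpM2l ?invr_ge0 ?exprn_ge0//.
    by rewrite indicE mem_setE.
(* The remainder of the telescoping sum is a field of length at most 2^-N supported in a fixed open
   set Q0 of finite measure, so it contributes at most e for large N. *)
apply/lee_addgt0Pr => e e0.
have [j sj] := compact_sub_kex oU cth uth.
have [Q0 [oQ0 KQ0 QU0 Q0oo]] := kint_open j.
have fQ0 : mu Q0 \is a fin_num by rewrite ge0_fin_numE// outer_measure_ge0.
have [N hN] : exists N, 2 ^- N * fine (mu Q0) <= e.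
  exists (Num.truncn (fine (mu Q0) / e)).+1.
  rewrite ler_pdivrMl ?exprn_gt0// -ler_pdivrMr//.
  apply: ltW; apply: lt_le_trans (truncnS_gt _) _.
  by rewrite -natrX ler_nat ltnW// ltn_expl.
rewrite (tele N) EFinD; apply: leeD.
  apply: le_trans (sumQ N); rewrite -sumEFin; apply: lee_sum => k _; exact: SD.
apply: (@le_trans _ _ ((2 ^- N)%:E * mu Q0)%E); last first.
  by rewrite -(fineK fQ0) -EFinM lee_fin.
rewrite lee_pdivlMl ?exprn_gt0// -EFinM -SZ//; apply: Smu => //; split.
- exact: test_fieldZ.
- apply: subset_trans KQ0; apply: subset_trans sj.
  apply: spt_sub => [|x hx]; first exact: closed_spt.
  by rewrite /T (spt_eq0 hx) !scaler0.
- move=> x; rewrite enormZ /T enormZ ger0_norm ?exprn_ge0//.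
  have [z|z] := eqVneq (level th N x) 0; first by rewrite z normr0 mul0r mulr0.
  rewrite -ler_pdivlMl ?exprn_gt0// mulr1 -[leRHS]mul1r.
  apply: ler_pM => //; [exact: enorm_ge0| |exact: small].
  by rewrite ger0_norm ?cutoff_ge0// cutoff_le1.
Qed.

(** Both sides are homogeneous, so th may be scaled to length at most 1/2. *)
Lemma variation_le_L1norm th : test_fields U th -> ((S th)%:E <= 16%:E * L1norm th)%E.
Proof.
move=> tth; have [M hM] := test_field_bounded tth.
pose t := (2 * (1 + `|M|))^-1.
have t0 : 0 < t by rewrite invr_gt0 mulr_gt0// ltr_pwDl.
have h1 : test_fields U (fun x => t *: th x) by exact: test_fieldZ.
have h2 x : enorm (t *: th x) <= 1 / 2.
  rewrite enormZ ger0_norm ?(ltW t0)// /t invfM mul1r -mulrA ler_piMr ?invr_ge0//.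
  rewrite ler_pdivrMl ?ltr_pwDl// mulr1; apply: (le_trans (hM x)).
  by apply: (le_trans (ler_norm _)); rewrite lerDr.
have := variation_le_half h1 h2; rewrite SZ// /L1norm.
under eq_integral do rewrite enormZ ger0_norm ?(ltW t0)// EFinM.
have [sth cth uth] := (test_fieldP U th).1 tth.
rewrite ge0_integralZl_EFin ?(ltW t0)//; last 2 first.
- by move=> x _; rewrite lee_fin enorm_ge0.
- by apply/measurable_EFinP; apply: measurable_enorm; exact: Cinf_continuous.
by rewrite EFinM muleCA lee_pmul2l// lte_fin.
Qed.
End variation_bound.

(** * Test fields are dense in the L_1 fields *)

Section L1_density.
Variables (R : realType) (n : nat).
Local Notation E := 'rV[R]_n.
Variable U : set E.
Hypothesis oU : open U.
Variable mu : {outer_measure set E -> \bar R}.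
Hypothesis rmu : radon_over U mu.
Local Notation N := (L1norm mu).
Implicit Types (f g h : E -> E) (A B : set E).

Let oG G : open G -> mu.-caratheodory G. Proof. exact: (radon_open oU rmu). Qed.

Lemma half_frac (a e : R) : 0 <= a -> 0 <= e -> a * (e / (2 * (1 + a))) <= e / 2.
Proof.
move=> a0 e0; rewrite mulrA ler_pdivrMr ?mulr_gt0 ?ltr_pwDl//.
rewrite (_ : e / 2 * (2 * (1 + a)) = e + a * e); last by field.
by rewrite lerDr.
Qed.

Lemma caratheodory_indic A : mu.-caratheodory A ->
  measurable_fun setT ((\1_A : E -> R) : caratheodory_type mu -> R).
Proof. by move=> cA; have mA : measurable (A : set (caratheodory_type mu)) by []. Qed.

Definition mfield f := forall i,
  measurable_fun setT ((fun x : E => f x 0 i) : caratheodory_type mu -> R).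

Lemma L1_mfield f : L1_fields mu f -> mfield f.
Proof.
move=> [fo _] i; apply: measurable_fun_gt => a.
rewrite (_ : [set x | _] = f @^-1` [set y : E | a < y 0 i])//; apply: fo.
rewrite (_ : [set y : E | _] = (fun y : E => y 0 i) @^-1` [set t | a < t])//.
by apply: open_comp => [x _|]; [exact: coord_continuous|exact: open_gt].
Qed.

Lemma continuous_mfield f : continuous f -> mfield f.
Proof.
move=> cf i; apply: continuous_caratheodory => //.
by apply: (@continuous_comp_fun _ _ _ f (fun A : E => A 0 i) cf); exact: coord_continuous.
Qed.

Lemma mfield_lin (a : R) f g : mfield f -> mfield g -> mfield (fun x => a *: f x + g x).
Proof.
move=> mf mg i.
rewrite (_ : (fun x => _) = (fun x => a * f x 0 i + g x 0 i)); last first.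
  by apply/funext => x; rewrite !mxE.
by apply: measurable_funD => //; apply: measurable_funM.
Qed.

Lemma mfieldB f g : mfield f -> mfield g -> mfield (fun x => f x - g x).
Proof.
move=> mf mg; rewrite (_ : (fun x => _) = (fun x => -1 *: g x + f x)).
  exact: mfield_lin.
by apply/funext => x; rewrite scaleN1r addrC.
Qed.

Lemma mfield_indic A (v : E -> E) : mu.-caratheodory A -> mfield v ->
  mfield (fun x => if x \in A then v x else 0).
Proof.
move=> cA mv i.
rewrite (_ : (fun x => _) = (fun x : E => \1_A x * v x 0 i)); last first.
  by apply/funext => x; rewrite indicE; case: ifP => _; rewrite ?mul1r ?mul0r// mxE.
by apply: measurable_funM => //; exact: caratheodory_indic.
Qed.

Lemma mfield_enorm f : mfield f ->
  measurable_fun setT ((fun x : E => enorm (f x)) : caratheodory_type mu -> R).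
Proof.
move=> mf.
have ms : measurable_fun setT (@Num.sqrt R) by apply: continuous_measurable_fun; exact: sqrt_continuous.
have mq : measurable_fun setT
    ((fun x : E => \sum_(i < n) f x 0 i ^+ 2) : caratheodory_type mu -> R).
  by apply: measurable_sum => i; exact: measurable_funX.
exact: (measurableT_comp ms mq).
Qed.

Lemma mfield_enormE f : mfield f ->
  measurable_fun setT ((fun x : E => (enorm (f x))%:E) : caratheodory_type mu -> \bar R).
Proof. by move=> mf; apply/measurable_EFinP; exact: mfield_enorm. Qed.

Lemma L1norm_le f g : mfield f -> mfield g -> (forall x, enorm (f x) <= enorm (g x)) ->
  (N f <= N g)%E.
Proof.
move=> mf mg fg; apply: ge0_le_integral => //.
- by move=> x _; rewrite lee_fin enorm_ge0.
- exact: mfield_enormE.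
- exact: mfield_enormE.
- by move=> x _; rewrite lee_fin.
Qed.

Lemma L1normZ (a : R) f : mfield f -> N (fun x => a *: f x) = (`|a|%:E * N f)%E.
Proof.
move=> mf; rewrite /L1norm; under eq_integral do rewrite enormZ EFinM.
rewrite ge0_integralZl_EFin//; first by move=> x _; rewrite lee_fin enorm_ge0.
exact: mfield_enormE.
Qed.

Lemma L1normD f g : mfield f -> mfield g -> (N (fun x => (f x + g x)%R) <= N f + N g)%E.
Proof.
move=> mf mg; rewrite /L1norm -ge0_integralD//; last 4 first.
- by move=> x _; rewrite lee_fin enorm_ge0.
- exact: mfield_enormE.
- by move=> x _; rewrite lee_fin enorm_ge0.
- exact: mfield_enormE.
have mfg : mfield (fun x => f x + g x).
  rewrite (_ : (fun x => _) = (fun x => 1 *: f x + g x)); first exact: mfield_lin.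
  by apply/funext => x; rewrite scale1r.
apply: ge0_le_integral => //.
- by move=> x _; rewrite lee_fin enorm_ge0.
- exact: mfield_enormE.
- by apply: emeasurable_funD; exact: mfield_enormE.
- by move=> x _; rewrite -EFinD lee_fin ler_enormD.
Qed.

Lemma L1norm_lin (a : R) f g : mfield f -> mfield g ->
  (N (fun x => (a *: f x + g x)%R) <= `|a|%:E * N f + N g)%E.
Proof.
move=> mf mg; rewrite -L1normZ//; apply: L1normD => //.
rewrite (_ : (fun x => _) = (fun x => a *: f x + (fun=> 0) x)).
  by apply: mfield_lin => //; apply: continuous_mfield; exact: continuous_fun_cst.
by apply/funext => x; rewrite addr0.
Qed.

Lemma L1normBC f g : N (fun x => f x - g x) = N (fun x => g x - f x).
Proof. by apply: eq_integral => x _; rewrite enormB. Qed.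

Lemma L1norm_triangle f g h : mfield f -> mfield g -> mfield h ->
  (N (fun x => (f x - h x)%R) <= N (fun x => (f x - g x)%R) + N (fun x => (g x - h x)%R))%E.
Proof.
move=> mf mg mh; rewrite (_ : (fun x => f x - h x) = (fun x => (f x - g x) + (g x - h x))).
  by apply: L1normD; exact: mfieldB.
by apply/funext => x; rewrite subrKA.
Qed.

Lemma test_mfield th : test_fields U th -> mfield th.
Proof. by move=> /test_fieldP[s _ _]; apply: continuous_mfield; exact: Cinf_continuous. Qed.

Lemma L1norm_test th : test_fields U th -> (N th < +oo)%E.
Proof.
move=> tth; have [M hM] := test_field_bounded tth.
have [s c u] := (test_fieldP U th).1 tth.
have cs : mu.-caratheodory (spt th) by apply: (radon_closed oU rmu); exact: closed_spt.
apply: (@le_lt_trans _ _ (\int[cmeas mu]_x (`|M|%:E * (\1_(spt th) x)%:E))%E).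
  apply: ge0_le_integral => //.
  - by move=> x _; rewrite lee_fin enorm_ge0.
  - by apply: mfield_enormE; exact: test_mfield.
  - by apply/measurable_EFinP; apply: measurable_funM => //;
      exact: caratheodory_indic.
  move=> x _; rewrite -EFinM lee_fin indicE.
  have [sx|sx] := boolP (x \in spt th); first by rewrite mulr1 (le_trans (hM x))// ler_norm.
  rewrite mulr0 (@spt_eq0 _ _ th x) ?enorm0// => /mem_set; exact/negP.
rewrite ge0_integralZl_EFin//; last by apply/measurable_EFinP; exact: caratheodory_indic.
rewrite integral_indic// setIT; apply: lte_mul_pinfty => //.
by change (mu (spt th) < +oo)%E; apply: (radon_ltoo rmu).
Qed.

Definition approximable f := forall e : R, 0 < e ->
  exists2 th, test_fields U th & (N (fun x => (f x - th x)%R) <= e%:E)%E.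

Lemma approximable_test th : test_fields U th -> approximable th.
Proof.
move=> tth e e0; exists th => //; rewrite /L1norm.
under eq_integral do rewrite subrr enorm0.
by rewrite integral0 lee_fin ltW.
Qed.

Lemma approximable_lin (a : R) f g : mfield f -> mfield g ->
  approximable f -> approximable g -> approximable (fun x => a *: f x + g x).
Proof.
move=> mf mg af ag e e0.
have e1 : 0 < e / (2 * (1 + `|a|)) by rewrite divr_gt0// mulr_gt0// ltr_pwDl.
have e2 : 0 < e / 2 by rewrite divr_gt0.
have [t1 tt1 h1] := af _ e1; have [t2 tt2 h2] := ag _ e2.
exists (fun x => a *: t1 x + t2 x); first exact: test_field_lin.
rewrite (_ : (fun x => _ - _) = (fun x => a *: (f x - t1 x) + (g x - t2 x))); last first.
  by apply/funext => x; rewrite scalerBr opprD addrACA.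
apply: le_trans (L1norm_lin _ _ _) _; try (by apply: mfieldB => //; exact: test_mfield).
apply: (@le_trans _ _ ((`|a| * (e / (2 * (1 + `|a|))))%:E + (e / 2)%:E)%E).
  by apply: leeD => //; rewrite EFinM lee_wpmul2l.
by rewrite -EFinD lee_fin [leRHS](splitr e) lerD2r half_frac// ltW.
Qed.

Lemma approximable_close f : mfield f ->
  (forall e : R, 0 < e -> exists g, [/\ mfield g, approximable g &
     (N (fun x => (f x - g x)%R) <= e%:E)%E]) -> approximable f.
Proof.
move=> mf h e e0; have e2 : 0 < e / 2 by rewrite divr_gt0.
have [g [mg ag fg]] := h _ e2; have [t tt gt] := ag _ e2.
exists t => //; apply: le_trans (L1norm_triangle mf mg (test_mfield tt)) _.
by rewrite [e]splitr EFinD leeD.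
Qed.

(** A compact C inside A [&] U and an open Q around it, both up to e', leave room for a smooth
    function equal to 1 on C and supported in Q. *)
Lemma approximable_indic A (v : E) : mu.-caratheodory A -> (mu A < +oo)%E ->
  approximable (fun x => \1_A x *: v).
Proof.
move=> cA Aoo e e0.
pose e' := e / (2 * (1 + enorm v)).
have v0 : 0 < 1 + enorm v by rewrite ltr_pwDl// enorm_ge0.
have e'0 : 0 < e' by rewrite divr_gt0// mulr_gt0.
have cAU : mu.-caratheodory (A `&` U) by apply: caratheodory_measurable_setI => //; exact: oG.
have AUoo : (mu (A `&` U) < +oo)%E.
  by apply: le_lt_trans Aoo; apply: le_outer_measure; exact: subIsetl.
have [C [cC clC CA Ce]] := radon_inner oU (@compact_kex _ _ U) (@closed_kex _ _ U)
   (bigcup_kex oU) (@le_kex _ _ U) rmu cAU (@subIsetr _ _ _) AUoo e'0.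
have [Q [oQ AQ QU Qe]] := radon_outerD oU (@compact_kex _ _ U) (@closed_kex _ _ U)
   (bigcup_kex oU) rmu cAU (@subIsetr _ _ _) e'0.
have [phi [cphi phi01 [N' oN [KN N1]] c1 s1]] := smooth_urysohn cC oQ (subset_trans CA AQ).
exists (fun x => phi x *: v).
  apply/test_fieldP; split.
  - by apply: CinfZ => //; exact: Cinf_cst.
  - by apply: subclosed_compact c1 (@spt_mul_subl _ _ phi (fun=> v)); exact: closed_spt.
  - by apply: subset_trans (@spt_mul_subl _ _ phi (fun=> v)) _; exact: subset_trans s1 QU.
(* Off B the indicator of A and phi agree; the complement of U is included because it is a null
   set. *)
pose B := (((A `&` U) `\` C) `|` (Q `\` (A `&` U))) `|` ~` U.
have cB : mu.-caratheodory B.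
  apply: caratheodory_measurable_setU; last by apply: caratheodory_measurable_setC; exact: oG.
  apply: caratheodory_measurable_setU; apply: caratheodory_measurable_setD => //.
    by apply: (radon_closed oU rmu).
  exact: oG.
have muB : (mu B <= (2 * e')%:E)%E.
  apply: le_trans (outer_measureU2 _ _ _) _.
  have -> : mu (~` U) = 0%E by case: rmu.
  rewrite adde0; apply: le_trans (outer_measureU2 _ _ _) _.
  by rewrite mulr2n mulrDl !mul1r EFinD leeD.
have mi : measurable_fun setT ((\1_A : E -> R) : caratheodory_type mu -> R).
  exact: caratheodory_indic.
have mB : measurable_fun setT ((\1_B : E -> R) : caratheodory_type mu -> R).
  exact: caratheodory_indic.
apply: (@le_trans _ _ (\int[cmeas mu]_x ((enorm v)%:E * (\1_B x)%:E))%E).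
  apply: ge0_le_integral => //.
  - by move=> x _; rewrite lee_fin enorm_ge0.
  - apply: mfield_enormE; apply: mfieldB.
      move=> i; rewrite (_ : (fun x => _) = (fun x : E => \1_A x * v 0 i)).
        exact: measurable_funM.
      by apply/funext => x; rewrite mxE.
    apply: continuous_mfield; apply: continuous_funZ; last exact: continuous_fun_cst.
    exact: Cinf_continuous.
  - by apply/measurable_EFinP; apply: measurable_funM.
  - move=> x _; rewrite -EFinM lee_fin -scalerBl enormZ mulrC ler_wpM2l ?enorm_ge0//.
    rewrite [in leRHS]indicE; have [xB|xB] := boolP (x \in B).
      rewrite indicE; have /andP[p0 p1] := phi01 x.
      case: (x \in A); rewrite /= ?mulr1n ?mulr0n ler_norml; apply/andP; split; lra.
    suff -> : \1_A x = phi x by rewrite subrr normr0.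
    have nB : ~ B x by move=> /mem_set; exact/negP.
    have Ux : U x by apply: contrapT => nU; apply: nB; right.
    rewrite indicE; have [xA|xA] := boolP (x \in A).
      have xC : C x.
        apply: contrapT => nC; apply: nB; left; left; split => //.
        by split => //; exact: set_mem.
      by rewrite N1//; exact: KN.
    rewrite (@spt_eq0 _ _ phi x)// => /s1 Qx; apply: nB; left; right; split => //.
    by move=> [Ax _]; move/negP: xA; apply; exact: mem_set.
rewrite ge0_integralZl_EFin ?enorm_ge0//; last exact/measurable_EFinP.
rewrite integral_indic// setIT; apply: (@le_trans _ _ ((enorm v)%:E * (2 * e')%:E)%E).
  by rewrite lee_wpmul2l// lee_fin enorm_ge0.
rewrite -EFinM lee_fin mulrCA -ler_pdivlMl// mulrC.
by rewrite mulrC [leRHS]mulrC half_frac ?enorm_ge0// ltW.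
Qed.

Lemma approximable0 : approximable (fun=> 0).
Proof. by apply: approximable_test; exact: test_field0. Qed.

Lemma continuous_mfield_cst (v : E) : mfield (fun=> v).
Proof. by apply: continuous_mfield; exact: continuous_fun_cst. Qed.

Lemma approximable_sum (I : Type) (r : seq I) (F : I -> E -> E) :
  (forall i, mfield (F i)) -> (forall i, approximable (F i)) ->
  mfield (fun x => \sum_(i <- r) F i x) /\ approximable (fun x => \sum_(i <- r) F i x).
Proof.
move=> mF aF; elim: r => [|i r [IH1 IH2]].
  rewrite (_ : (fun x => _) = (fun=> 0)); last by apply/funext => x; rewrite big_nil.
  by split; [exact: continuous_mfield_cst|exact: approximable0].
rewrite (_ : (fun x => _) = (fun x => 1 *: F i x + \sum_(j <- r) F j x)); last first.
  by apply/funext => x; rewrite big_cons scale1r.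
by split; [exact: mfield_lin|exact: approximable_lin].
Qed.

Import HBSimple.

Lemma approximable_sfun (g : {sfun (caratheodory_type mu) >-> R}) (v : E) :
  (cmeas mu).-integrable setT (EFin \o g) ->
  mfield (fun x => g x *: v) /\ approximable (fun x => g x *: v).
Proof.
move=> ig.
have mgy (y : R) : mu.-caratheodory (g @^-1` [set y]).
  by have : measurable (g @^-1` [set y]) by exact: measurable_funPTI.
have -> : (fun x => g x *: v) =
    (fun x => \sum_(y <- enum_fset (fset_set (range g))) y *: (\1_(g @^-1` [set y]) x *: v)).
  apply/funext => x; rewrite {1}(fimfunE g x) fsbig_finite//= scaler_suml.
  by apply: eq_bigr => y _; rewrite scalerA.
have h (y : R) : mfield (fun x => y *: (\1_(g @^-1` [set y]) x *: v)) /\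
    approximable (fun x => y *: (\1_(g @^-1` [set y]) x *: v)).
  have m1 : mfield (fun x => \1_(g @^-1` [set y]) x *: v).
    move=> i; rewrite (_ : (fun x => _) = (fun x : E => \1_(g @^-1` [set y]) x * v 0 i)).
      by apply: measurable_funM => //; exact: caratheodory_indic.
    by apply/funext => x; rewrite mxE.
  have e1 : (fun x => y *: (\1_(g @^-1` [set y]) x *: v)) =
      (fun x => y *: (\1_(g @^-1` [set y]) x *: v) + (fun=> 0) x).
    by apply/funext => x; rewrite addr0.
  have [->|y0] := eqVneq y 0.
    rewrite (_ : (fun x => _) = (fun=> 0)); last by apply/funext => x; rewrite scale0r.
    by split; [exact: continuous_mfield_cst|exact: approximable0].
  split; rewrite e1.
    by apply: mfield_lin => //; exact: continuous_mfield_cst.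
  apply: (approximable_lin y m1 (@continuous_mfield_cst 0) _ approximable0).
  apply: approximable_indic => //.
  (* Chebyshev's inequality: |y| times the measure of the level set is at most the integral of |g|,
     so the level sets of nonzero values have finite measure. *)
  have /integrableP[mg goo] := ig.
  have : ((`|y|)%:E * mu (g @^-1` [set y]) < +oo)%E.
    apply: le_lt_trans goo.
    rewrite -[mu _]/(cmeas mu (g @^-1` [set y])) -[X in cmeas mu X]setIT -integral_indic//.
    rewrite -ge0_integralZl_EFin//; last by apply/measurable_EFinP; exact: caratheodory_indic.
    apply: ge0_le_integral => //.
    - by apply/measurable_EFinP; apply: measurable_funM => //; exact: caratheodory_indic.
    - by apply: measurableT_comp.
    - move=> x _; rewrite -EFinM /= lee_fin indicE.
      have [/set_mem /= ->|] := boolP (x \in _); first by rewrite mulr1.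
      by rewrite mulr0.
  case: (mu (g @^-1` [set y])) => [r _|+|//]; first by rewrite ltry.
  by rewrite gt0_muley// lte_fin normr_gt0.
by apply: approximable_sum => y; have [] := h y.
Qed.

Lemma approximable_L1 f : mfield f -> (N f < +oo)%E -> approximable f.
Proof.
move=> mf foo.
pose F (i : 'I_n) (x : E) : E := f x 0 i *: delta_mx 0 i.
have mF i : mfield (F i).
  move=> j; rewrite (_ : (fun x => _) = (fun x : E => f x 0 i * (delta_mx 0 i : E) 0 j)).
    by apply: measurable_funM => //; exact: mf.
  by apply/funext => x; rewrite mxE.
have -> : f = (fun x => \sum_(i <- index_enum 'I_n) F i x).
  by apply/funext => x; rewrite {1}(row_sum_delta (f x)).
suff aF i : approximable (F i) by have [] := approximable_sum (index_enum 'I_n) mF aF.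
have ifi : (cmeas mu).-integrable setT (fun x : E => (f x 0 i)%:E).
  apply/integrableP; split; first by apply/measurable_EFinP; exact: mf.
  apply: le_lt_trans foo; apply: ge0_le_integral => //.
  - by apply: measurableT_comp => //; apply/measurable_EFinP; exact: mf.
  - exact: mfield_enormE.
  - by move=> x _; rewrite /= lee_fin coord_le_enorm.
have [g [ig _ g0]] := approximation_sfun_integrable measurableT ifi.
apply: approximable_close => // e e0.
have /fine_cvgP[fg /cvgrPdist_le /(_ _ e0)] := g0.
move=> /(filterI fg) [k _ /(_ k (leqnn k))] [/= fk].
rewrite sub0r normrN ger0_norm; last by apply/fine_ge0/integral_ge0.
move=> ke; exists (fun x => g k x *: delta_mx 0 i).
have [mgk agk] := approximable_sfun (delta_mx 0 i) (ig k).
split => //.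
apply: (@le_trans _ _ (\int[cmeas mu]_x `|(f x 0 i)%:E - (g k x)%:E|)%E); last first.
  by rewrite -(fineK fk) lee_fin.
apply: ge0_le_integral => //.
- by move=> x _; rewrite lee_fin enorm_ge0.
- by apply: mfield_enormE; exact: mfieldB.
- apply: measurableT_comp => //; apply: emeasurable_funB; apply/measurable_EFinP; first exact: mf.
  exact: measurable_funP.
- move=> x _; rewrite -EFinB /= lee_fin -scalerBl enormZ ler_piMr//.
  rewrite /enorm (bigD1 i)//= big1 ?addr0; last first.
    by move=> j /negPf ji; rewrite mxE eqxx ji expr0n.
  by rewrite mxE !eqxx expr1n sqrtr1.
Qed.
End L1_density.

Lemma ler_dist_lin (R : realDomainType) (a s1 s2 x y z p q : R) :
  `|s1 - x| <= p -> `|s2 - y| <= p -> `|a * s1 + s2 - z| <= q ->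
  `|z - (a * x + y)| <= q + (`|a| * p + p).
Proof.
move=> h1 h2 h3.
have -> : z - (a * x + y) = - (a * s1 + s2 - z) + (a * (s1 - x) + (s2 - y)) by ring.
apply: le_trans (ler_normD _ _) _; rewrite normrN; apply: lerD => //.
by apply: le_trans (ler_normD _ _) _; rewrite normrM lerD// ler_wpM2l.
Qed.

Lemma ler_dist_dist (R : realDomainType) (s x y : R) : `|y - x| <= `|s - x| + `|s - y|.
Proof. by rewrite (_ : y - x = (s - x) - (s - y)) ?ler_normB//; ring. Qed.

Lemma ext_budget (R : realFieldType) (e : R) : 0 < e ->
  16 * (e / 64) + 16 * (e / 64 + e / 64) < e.
Proof. lra. Qed.

(** * Existence of the L_1 continuous extension *)

Section L1_extension.
Variables (R : realType) (n : nat).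
Local Notation E := 'rV[R]_n.
Variable U : set E.
Hypothesis oU : open U.
Variable S : (E -> E) -> R.
Hypothesis Slin : forall (a : R) th1 th2, test_fields U th1 -> test_fields U th2 ->
  S (fun x => a *: th1 x + th2 x) = a * S th1 + S th2.
Hypothesis rS : radon_over U (Defs.variation U S).
Let mu := Defs.variation U S.
Local Notation N := (L1norm mu).
Implicit Types (f g h th : E -> E).

Let SB th1 th2 : test_fields U th1 -> test_fields U th2 ->
  S (fun x => th1 x - th2 x) = S th1 - S th2.
Proof.
move=> h1 h2; rewrite (_ : (fun x => _) = (fun x => (-1) *: th2 x + th1 x)).
  by rewrite (Slin (-1) h2 h1) mulN1r addrC.
by apply/funext => x; rewrite scaleN1r addrC.
Qed.

Lemma abs_variation_le th (r : R) : test_fields U th -> (N th <= r%:E)%E ->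
  `|S th| <= 16 * r.
Proof.
move=> tth Nr.
have bnd th' : test_fields U th' -> (N th' <= r%:E)%E -> S th' <= 16 * r.
  move=> tth' Nr'; rewrite -lee_fin EFinM.
  apply: le_trans (_ : (16%:E * N th' <= _)%E); last by rewrite lee_wpmul2l.
  by apply: (variation_le_L1norm oU Slin rS) => // th'' Q oQ QU; exact: variation_unit.
rewrite ler_norml bnd// andbT lerNl -mulN1r.
have h0 := @test_field0 R n U.
have -> : -1 * S th = S (fun x => -1 *: th x + 0).
  rewrite (Slin (-1) tth h0).
  have -> : S (fun=> 0) = 0.
    have e0 : (fun x : E => (0 : E) - 0) = (fun=> 0) by apply/funext => x; rewrite subr0.
    by have := SB h0 h0; rewrite e0 subrr.
  by rewrite addr0.
apply: bnd; first exact: test_field_lin.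
rewrite (_ : (fun x => -1 *: th x + 0) = (fun x => -1 *: th x)).
  by rewrite L1normZ ?normrN1 ?mul1e//; exact: (test_mfield oU rS).
by apply/funext => x; rewrite addr0.
Qed.

(* 16 is the constant of [variation_le_L1norm]. *)
Definition ext_value f (c : R) := forall th (r : R), test_fields U th ->
  (N (fun x => (f x - th x)%R) <= r%:E)%E -> `|S th - c| <= 16 * r.

(** Each test field th within r of f confines the value to the interval of radius 16 r about S th.
    By [abs_variation_le] every left end lies below every right end, so the supremum of the left
    ends belongs to all the intervals. *)
Lemma ext_value_ex f : mfield mu f -> approximable U mu f -> exists c, ext_value f c.
Proof.
move=> mf af.
pose A := [set c : R | exists th (r : R), [/\ test_fields U th,
  (N (fun x => (f x - th x)%R) <= r%:E)%E & c = S th - 16 * r]].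
have ub th (r : R) : test_fields U th -> (N (fun x => (f x - th x)%R) <= r%:E)%E ->
    ubound A (S th + 16 * r).
  move=> tth Nr _ [th' [r' [tth' Nr' ->]]].
  rewrite lerBlDr -addrA -lerBlDl -mulrDr -SB//; apply: le_trans (ler_norm _) _.
  apply: abs_variation_le.
    rewrite (_ : (fun x => _) = (fun x => (-1) *: th x + th' x)); first exact: test_field_lin.
    by apply/funext => x; rewrite scaleN1r addrC.
  have mt := test_mfield oU rS tth; have mt' := test_mfield oU rS tth'.
  apply: le_trans (L1norm_triangle mt' mf mt) _.
  by rewrite L1normBC addeC EFinD leeD// L1normBC.
exists (sup A) => th r tth Nr.
have hA : has_sup A.
  split; last by exists (S th + 16 * r); exact: ub.
  by exists (S th - 16 * r); exists th, r.
rewrite ler_distl; apply/andP; split.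
  rewrite lerBlDr; apply: ge_sup => //; first by have [] := hA.
  exact: ub.
rewrite -lerBlDr; apply: ub_le_sup; first by have [] := hA.
by exists th, r.
Qed.

Definition ext f : R := xget 0 [set c | ext_value f c].

Lemma extP f : mfield mu f -> approximable U mu f -> ext_value f (ext f).
Proof. by move=> mf /(ext_value_ex mf); exact: xgetPex. Qed.

(** All three properties are checked on test fields near the given fields, where S is known to be
    linear; [extP] bounds the discrepancies by 16 times the L_1 errors. *)
Lemma is_L1_extension_ext : is_L1_extension U S ext.
Proof.
have L1m f : L1_fields mu f -> mfield mu f by exact: L1_mfield.
have L1a f : L1_fields mu f -> approximable U mu f.
  by move=> hf; apply: (approximable_L1 oU rS (L1m f hf)); have [] := hf.
split.
- move=> th tth.
  have mth := test_mfield oU rS tth; have ath := approximable_test mu tth.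
  have := extP mth ath tth (r := 0); rewrite mulr0 normr_le0 subr_eq0 => h.
  apply/esym/eqP/h; rewrite /L1norm.
  by under eq_integral do rewrite subrr enorm0; rewrite integral0.
- move=> a f g hf hg; have mf := L1m f hf; have mg := L1m g hg.
  have af := L1a f hf; have ag := L1a g hg.
  have mh := mfield_lin a mf mg; have ah := approximable_lin oU rS a mf mg af ag.
  apply/eqP; rewrite -subr_eq0 -normr_le0; apply/ler_addgt0Pl => e e0; rewrite addr0.
  pose e' := e / (2 * (1 + (`|a| + 1) * 16)) / 2.
  have d0 : 0 < 1 + (`|a| + 1) * 16 :> R by rewrite ltr_pwDl// mulr_ge0// addr_ge0.
  have e'0 : 0 < e' by rewrite !divr_gt0// mulr_gt0.
  have [t1 tt1 h1] := af _ e'0; have [t2 tt2 h2] := ag _ e'0.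
  have tt := test_field_lin a tt1 tt2.
  have h3 : (N (fun x => ((a *: f x + g x) - (a *: t1 x + t2 x))%R) <= (`|a| * e' + e')%:E)%E.
    rewrite (_ : (fun x => _) = (fun x => a *: (f x - t1 x) + (g x - t2 x))%R); last first.
      by apply/funext => x; rewrite scalerBr opprD addrACA.
    apply: le_trans (L1norm_lin _ _ _) _; try (by apply: mfieldB => //; exact: (test_mfield oU rS)).
    by rewrite EFinD EFinM; apply: leeD => //; rewrite lee_wpmul2l.
  have k1 := extP mf af tt1 h1; have k2 := extP mg ag tt2 h2; have k3 := extP mh ah tt h3.
  rewrite (Slin a tt1 tt2) in k3.
  apply: le_trans (ler_dist_lin k1 k2 k3) _.
  have -> : 16 * (`|a| * e' + e') + (`|a| * (16 * e') + 16 * e') =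
     ((`|a| + 1) * 16) * (e / (2 * (1 + (`|a| + 1) * 16))) * (2 / 2).
    by rewrite /e'; field; rewrite gt_eqF//.
  rewrite divff// mulr1; apply: le_trans (half_frac _ (ltW e0)) _; first by rewrite mulr_ge0// addr_ge0.
  by rewrite ler_pdivrMr// ler_pMr// ler1n.
- move=> f hf e e0; exists (e / 64); first by rewrite divr_gt0.
  move=> g hg hfg; have mf := L1m f hf; have mg := L1m g hg.
  have af := L1a f hf; have ag := L1a g hg.
  have e10 : 0 < e / 64 by rewrite divr_gt0.
  have [th tth h1] := af _ e10.
  have mt := test_mfield oU rS tth.
  have h2 : (N (fun x => (g x - th x)%R) <= (e / 64 + e / 64)%:E)%E.
    apply: le_trans (L1norm_triangle mg mf mt) _.
    by rewrite EFinD; apply: leeD; [exact: ltW|].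
  have k1 := extP mf af tth h1; have k2 := extP mg ag tth h2.
  apply: le_lt_trans (ler_dist_dist (S th) _ _) _; apply: le_lt_trans (lerD k1 k2) _.
  exact: ext_budget.
Qed.

Lemma L1_extension_is : is_L1_extension U S (L1_extension U S).
Proof. by apply: xgetPex; exists ext; exact: is_L1_extension_ext. Qed.
End L1_extension.

Lemma exp2N_small (R : realType) (e : R) : 0 < e -> exists N, 2^-N <= e.
Proof.
move=> e0; exists (Num.truncn e^-1).+1.
rewrite -[leRHS]invrK lef_pV2 ?posrE ?invr_gt0 ?exprn_gt0//.
apply: ltW; apply: lt_le_trans (truncnS_gt _) _.
by rewrite -natrX ler_nat ltnW// ltn_expl.
Qed.

Lemma alpha_gt0 (R : realType) m : 0 < alpha R m.
Proof.
suff : 0 < alpha R m /\ 0 < alpha R m.+1 by case.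
elim: m => [|m [IH1 IH2]]; first by split => /=.
split=> //; rewrite [alpha _ _]/=; apply: mulr_gt0 => //.
by apply: divr_gt0 => //; apply: mulr_gt0 => //; exact: pi_gt0.
Qed.

(** * Hausdorff measure: measurability of open sets and Borel hulls *)

Section hausdorff_measure.
Variables (R : realType) (n m : nat).
Local Notation E := 'rV[R]_n.
Local Notation H := (@hausdorff R n m).
Local Open Scope ereal_scope.
Implicit Types (A B S : set E).

Definition hcover (d : R) : set E -> \bar R :=
  cover_outer [set S | ediam S <= d%:E] (@hgauge R n m).

Lemma hcover_le d A : (0 < d)%R -> hcover d A <= H A.
Proof. by move=> d0; apply: ereal_sup_ubound; exists d. Qed.

Lemma le_hcover d d' A : (d <= d')%R -> hcover d' A <= hcover d A.
Proof.
move=> dd'; apply: ereal_inf_le_tmp => _ [F [CF AF] <-]; exists F => //; split => // i.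
by apply: le_trans (CF i) _; rewrite lee_fin.
Qed.

Lemma hausdorff_le A (b : \bar R) : (forall k, hcover (2^-k) A <= b) -> H A <= b.
Proof.
move=> h; apply: ge_ereal_sup => _ [d d0 <-].
have [k kd] := exp2N_small d0; apply: le_trans (h k); exact: le_hcover.
Qed.

Lemma hausdorff0_le A : (forall k, hcover (2^-k) A <= 0) -> H A = 0.
Proof. by move=> h; apply/eqP; rewrite eq_le outer_measure_ge0 andbT hausdorff_le. Qed.

(** A covering set of diameter at most d < e cannot meet both A and B, so every covering of the
    union splits into one of A and one of B. *)
Lemma hcover_sep A B (e d : R) : (d < e)%R ->
  (forall x y, A x -> B y -> (e <= enorm (x - y))%R) ->
  hcover d A + hcover d B <= hcover d (A `|` B).
Proof.
move=> de sep; apply: le_ereal_inf_tmp => _ [F [CF AF] <-].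
pose G (P : set E) i := if pselect (F i `&` P !=set0) then F i else set0.
have hG P : P `<=` A `|` B -> hcover d P <= \sum_(i <oo) hgauge m (G P i).
  move=> PAB; apply: ereal_inf_lbound; exists (G P) => //; split => [i|x Px].
    by rewrite /G; case: (pselect _) => ? /=; [exact: CF|exact: ediam0].
  have [i _ Fx] := AF _ (PAB _ Px); exists i => //.
  by rewrite /G; case: (pselect _) => [//|[]]; exists x.
apply: le_trans (leeD (hG A _) (hG B _)) _; [by move=> x; left|by move=> x; right|].
rewrite -nneseriesD; last 2 first.
- by move=> i _ _; exact: hgauge_ge0.
- by move=> i _ _; exact: hgauge_ge0.
apply: lee_nneseries => i _; first by rewrite adde_ge0// hgauge_ge0.
rewrite /G; case: (pselect (F i `&` A !=set0)) => [[x [Fx Ax]]|_] /=; last first.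
  by rewrite hgauge0 add0e; case: (pselect _) => _ //=; rewrite hgauge0 hgauge_ge0.
case: (pselect _) => [[y [Fy By]]|_] /=; last by rewrite hgauge0 adde0.
have := CF i; rewrite /= => /(le_trans _)-/(_ (enorm (x - y))%:E).
rewrite lee_fin => h; exfalso.
have /h : (enorm (x - y))%:E <= ediam (F i).
  by apply: ereal_sup_ubound; exists (x, y).
by move=> /(le_trans (sep _ _ Ax By)); rewrite leNgt de.
Qed.

Lemma hausdorff_sep A B (e : R) : (0 < e)%R ->
  (forall x y, A x -> B y -> (e <= enorm (x - y))%R) -> H A + H B <= H (A `|` B).
Proof.
move=> e0 sep.
have [->|ABoo] := eqVneq (H (A `|` B)) +oo; first by rewrite leey.
have fin C : C `<=` A `|` B -> H C \is a fin_num.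
  move=> CAB; rewrite ge0_fin_numE ?outer_measure_ge0//.
  by apply: le_lt_trans (le_outer_measure _ _ _ CAB) _; rewrite ltey.
have fB := fin B (@subsetUr _ _ _); have fAB := fin _ (@subset_refl _ _).
have ge0c d P : 0 <= hcover d P by apply: cover_outer_ge0; exact: hgauge_ge0.
rewrite -leeBrDr//; apply: hausdorff_le => k1.
have fc : hcover (2^-k1) A \is a fin_num.
  rewrite ge0_fin_numE//; apply: le_lt_trans (hcover_le _ _) _; first by rewrite invr_gt0 exprn_gt0.
  by have := fin A (@subsetUl _ _ _); rewrite ge0_fin_numE// outer_measure_ge0.
rewrite leeBrDr// addeC -leeBrDr//; apply: hausdorff_le => k2.
rewrite leeBrDr// addeC.
have [k3 hk3] := exp2N_small (divr_gt0 e0 (ltr0n R 2)).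
(* One scale finer than both given ones and than the separation e. *)
pose d := Num.min (2^-k1) (Num.min (2^-k2) (2^-k3 : R))%R.
have d0 : (0 < d)%R by rewrite /d !lt_min !invr_gt0 !exprn_gt0.
apply: le_trans (hcover_le _ d0).
apply: le_trans (_ : hcover d A + hcover d B <= _).
  by apply: leeD; apply: le_hcover; rewrite /d !ge_min lexx ?orbT.
apply: (@hcover_sep _ _ e) => //.
apply: (@le_lt_trans _ _ (e / 2)%R); last by rewrite ltr_pdivrMr// ltr_pMr// ltr1n.
by rewrite /d !ge_min hk3 !orbT.
Qed.

Section open_sets.
Variable O : set E.
Hypothesis oO : open O.
Let K k : set E := [set x | forall z, ~ O z -> (2^-k <= enorm (x - z))%R].

Let K_sub k : K k `<=` O.
Proof.
move=> x Kx; apply: contrapT => /Kx; rewrite subrr enorm0 leNgt.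
by rewrite invr_gt0 exprn_gt0.
Qed.

Let le_K i j : (i <= j)%N -> K i `<=` K j.
Proof.
move=> ij x Kx z Oz; apply: le_trans (Kx z Oz).
by rewrite lef_pV2 ?posrE ?exprn_gt0// ler_weXn2l// ler1n.
Qed.

Let bigcup_K : \bigcup_k K k = O.
Proof.
apply/seteqP; split => [x [k _]|x Ox]; first exact: K_sub.
have [r r0 rO] := (nbhs_enormP x O).1 (open_nbhs_nbhs (conj oO Ox)).
have [k kr] := exp2N_small r0; exists k => // z Oz.
apply: le_trans kr _; rewrite leNgt; apply/negP => h; apply: Oz; apply: rO.
by rewrite enormB.
Qed.

Let K_sep k x y : K k x -> ~ K k.+1 y -> (2^-k.+1 <= enorm (x - y))%R.
Proof.
move=> Kx /existsNP[z /not_implyP[Oz /negP]]; rewrite -ltNge => yz.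
have := Kx z Oz; have := ler_enormB x y z => h1 h2.
have e2 : (2^-k = 2^-k.+1 + 2^-k.+1 :> R)%R by rewrite [in RHS]exprS invfM; field.
rewrite e2 in h2; have := le_trans h2 h1; rewrite -(lerD2r (2^-k.+1)%R).
by move: yz; lra.
Qed.

Variable X : set E.
Hypothesis Xoo : H X < +oo.
Let D j := X `&` K j.+1 `\` K j.

(* Rings whose indices differ by 2 are at positive distance: both the even and
   the odd rings have a finite total measure. *)
Let sum_D p N : \sum_(0 <= j < N) H (D (2 * j + p).+1) <= H X.
Proof.
suff : \sum_(0 <= j < N) H (D (2 * j + p).+1) <= H (X `&` K (2 * N + p)%N).
  by move=> /le_trans; apply; apply: le_outer_measure; exact: subIsetl.
elim: N => [|N IH]; first by rewrite big_geq// outer_measure_ge0.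
rewrite big_nat_recr//=; apply: le_trans (leeD2r _ IH) _.
apply: le_trans (@hausdorff_sep _ _ (2^-(2 * N + p).+1) _ _) _.
- by rewrite invr_gt0 exprn_gt0.
- by move=> x y [_ Kx] [_ /(K_sep Kx)].
apply: le_outer_measure => x [[Xx Kx]|[[Xx Kx] _]]; split => //.
  by apply: le_K Kx; lia.
by apply: le_K Kx; lia.
Qed.

Let tail_D p : \sum_(M <= j <oo) H (D (2 * j + p).+1) @[M --> \oo] --> 0.
Proof.
apply: (@nneseries_tail_cvg _ _ xpredT) => [|j _]; last exact: outer_measure_ge0.
apply: le_lt_trans Xoo; apply: lime_le; first by apply: is_cvg_nneseries => j _ _; exact: outer_measure_ge0.
by apply: nearW => N; exact: sum_D.
Qed.

(** Caratheodory's criterion for metric outer measures. X [&] K (2M+1) has positive distance from X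
    \ O, and what is left of X [&] O lies in rings whose total measure is a tail of two convergent
    series. *)
Lemma open_split : H (X `&` O) + H (X `\` O) <= H X.
Proof.
have key M : H (X `&` O) + H (X `\` O) <= H X +
    (\sum_(M <= j <oo) H (D (2 * j + 0).+1) + \sum_(M <= j <oo) H (D (2 * j + 1).+1)).
  have sep : H (X `&` K (2 * M).+1) + H (X `\` O) <= H X.
    apply: le_trans (@hausdorff_sep _ _ (2^-(2 * M).+1) _ _) _.
    - by rewrite invr_gt0 exprn_gt0.
    - by move=> x y [_ Kx] [_ /Kx].
    by apply: le_outer_measure => x [[]|[]].
  apply: le_trans (leeD2r _ sep); rewrite addeAC; apply: leeD2r.
  pose F p i := if (M <= i)%N then D (2 * i + p).+1 else set0.
  have sub : X `&` O `<=` (X `&` K (2 * M).+1) `|` (\bigcup_i F 0%N i `|` \bigcup_i F 1%N i).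
    move=> x [Xx]; rewrite -bigcup_K => -[k _ Kx].
    have [Kx1|Kx1] := pselect (K (2 * M).+1 x); [by left|right].
    (* The first index i with x in K i puts x in the ring D (i-1). As i > 2M + 1 the ring belongs to
       a tail, and the parity of i tells which series it is in. *)
    have ex : exists k, `[< K k x >] by exists k; apply/asboolP.
    case: (ex_minnP ex) => i /asboolP Ki mi.
    have ltMi : ((2 * M).+1 < i)%N.
      by rewrite ltnNge; apply/negP => /le_K /(_ _ Ki).
    have Di : D i.-1 x.
      rewrite /D prednK ?(leq_ltn_trans _ ltMi)//; split => //.
      by move=> /asboolP /mi; lia.
    have [e|e] := boolP (odd i); [right|left]; exists (i./2.-1) => //; rewrite /F.
      rewrite ifT; last by lia.
      by rewrite (_ : _.+1 = i.-1)//; lia.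
    rewrite ifT; last by lia.
    by rewrite (_ : _.+1 = i.-1)//; lia.
  have bF p : H (\bigcup_i F p i) <= \sum_(M <= j <oo) H (D (2 * j + p).+1).
    apply: le_trans (outer_measure_sigma_subadditive _ _) _.
    rewrite [leRHS]eseries_cond [leRHS]eseries_mkcond; apply: lee_nneseries => [i _ _|i _]; first exact: outer_measure_ge0.
    by rewrite /F; case: ifP => //; rewrite outer_measure0.
  apply: le_trans (le_outer_measure _ _ _ sub) _.
  apply: le_trans (outer_measureU2 _ _ _) _; apply: leeD => //.
  by apply: le_trans (outer_measureU2 _ _ _) _; exact: (leeD (bF 0%N) (bF 1%N)).
have : H X + (\sum_(M <= j <oo) H (D (2 * j + 0).+1) +
    \sum_(M <= j <oo) H (D (2 * j + 1).+1)) @[M --> \oo] --> H X + (0 + 0).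
  by apply: cvgeD => //; [rewrite adde0 fin_num_adde_defl|exact: cvg_cst|apply: cvgeD].
rewrite !adde0 => cv; rewrite -(cvg_lim _ cv)//; apply: lime_ge; last exact: nearW.
by apply/cvg_ex; eexists; exact: cv.
Qed.
End open_sets.

Lemma hausdorff_open O : open O -> H.-caratheodory O.
Proof.
move=> oO; apply: le_caratheodory_measurable => X.
have [e|Xoo] := eqVneq (H X) +oo; first by change (H (X `&` O) + H (X `\` O) <= H X); rewrite e leey.
by apply: open_split => //; rewrite ltey.
Qed.

Lemma ediam_closure S : ediam (closure S) = ediam S.
Proof.
apply/eqP; rewrite eq_le; apply/andP; split; last first.
  apply: ge_ereal_sup => _ [[x y] [Sx Sy] <-]; apply: ereal_sup_ubound.
  by exists (x, y) => //; split; apply: subset_closure.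
case e : (ediam S) => [d| |]; last 2 first.
- by rewrite leey.
- suff S0 : S = set0 by rewrite -e S0 closure0.
  apply/seteqP; split => // x Sx.
  have : (enorm (x - x))%:E <= ediam S by apply: ereal_sup_ubound; exists (x, x).
  by rewrite e leeNy_eq.
have h1 x y : S x -> S y -> (enorm (x - y) <= d)%R.
  by move=> Sx Sy; rewrite -lee_fin -e; apply: ereal_sup_ubound; exists (x, y).
have cl (y : E) : closed [set x | enorm (x - y) <= d]%R.
  exact: closed_eball.
have h2 x y : closure S x -> S y -> (enorm (x - y) <= d)%R.
  by move=> cx Sy; apply: (cl y); apply: closureS cx => z Sz; exact: h1.
have h3 x y : closure S x -> closure S y -> (enorm (x - y) <= d)%R.
  move=> cx cy; rewrite enormB; apply: (cl x); apply: closureS cy => z Sz.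
  by rewrite /= enormB; exact: h2.
by apply: ge_ereal_sup => _ [[x y] [cx cy] <-]; rewrite lee_fin; exact: h3.
Qed.

Lemma hgauge_closure S : hgauge m (closure S) = hgauge m S.
Proof.
rewrite /hgauge ediam_closure; have [->|S0] := eqVneq S set0; first by rewrite closure0 eqxx.
have [cS0|//] := eqVneq (closure S) set0; exfalso; move/eqP: S0; apply.
by apply/seteqP; split => // x /subset_closure; rewrite cS0.
Qed.

(** Closing the members of a covering does not change their gauge, so nearly optimal coverings at
    all scales 2^-k may be taken closed. The intersection of their unions is the hull. *)
Lemma hausdorff_hull A : H A < +oo -> exists B, [/\ <<s open >> B, A `<=` B & H B = H A].
Proof.
move=> Aoo.
have Afin : H A \is a fin_num by rewrite ge0_fin_numE// outer_measure_ge0.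
have p0 k : (0 < 2^-k :> R)%R by rewrite invr_gt0 exprn_gt0.
have [F hF] : exists F : nat -> nat -> set E, forall k,
    coverings [set S | ediam S <= (2^-k)%:E] A (F k) /\
    \sum_(i <oo) hgauge m (F k i) <= H A + (2^-k)%:E.
  suff /choice[F hF] : forall k, exists F : nat -> set E,
    coverings [set S | ediam S <= (2^-k)%:E] A F /\
    \sum_(i <oo) hgauge m (F i) <= H A + (2^-k)%:E by exists F.
  move=> k; have cfin : hcover (2^-k) A \is a fin_num.
    rewrite ge0_fin_numE; first by apply: le_lt_trans (hcover_le _ _) Aoo.
    by apply: cover_outer_ge0; exact: hgauge_ge0.
  have [_ [F CF <-] hF] := lb_ereal_inf_adherent (p0 k) cfin.
  by exists F; split => //; apply: le_trans (ltW hF) _; apply: leeD2r; exact: hcover_le.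
pose B := \bigcap_k \bigcup_i closure (F k i).
have AB : A `<=` B.
  move=> x Ax k _; have [[_ AF] _] := hF k; have [i _ Fx] := AF x Ax.
  by exists i => //; exact: subset_closure.
exists B; split => //.
  rewrite /B -[X in <<s _ >> X]setCK setC_bigcap.
  apply: sigma_algebraC; apply: sigma_algebra_bigcup => k.
  apply: sigma_algebraC; apply: sigma_algebra_bigcup => i.
  by apply: closed_borel; exact: closed_closure.
apply/eqP; rewrite eq_le; apply/andP; split; last exact: le_outer_measure.
apply/lee_addgt0Pr => e e0; apply: hausdorff_le => k.
have [l le] := exp2N_small e0.
have [[CF AF] sF] := hF (maxn k l).
have le2 i j : (i <= j)%N -> (2^-j <= 2^-i :> R)%R.
  by move=> ij; rewrite lef_pV2 ?posrE ?exprn_gt0// ler_weXn2l// ler1n.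
apply: le_trans (_ : \sum_(i <oo) hgauge m (closure (F (maxn k l) i)) <= _).
  apply: ereal_inf_lbound; exists (fun i => closure (F (maxn k l) i)) => //; split.
    move=> i; rewrite /= ediam_closure; apply: le_trans (CF i) _.
    by rewrite lee_fin le2// leq_maxl.
  by move=> x Bx; exact: (Bx (maxn k l)).
under eq_eseriesr do rewrite hgauge_closure.
apply: le_trans sF _; apply: leeD2l; rewrite lee_fin; apply: le_trans le.
by rewrite le2// leq_maxr.
Qed.

End hausdorff_measure.

(** * Density and packing estimates for Hausdorff measure *)

Section hausdorff_covering.
Variables (R : realType) (n m : nat).
Hypothesis m_gt0 : (0 < m)%N.
Local Notation E := 'rV[R]_n.
Local Notation H := (@hausdorff R n m).
Implicit Types (A S Z : set E) (mu nu : {outer_measure set E -> \bar R}).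

(** At a fixed scale the content is an outer measure too, so subadditivity can be used before the
    supremum over the scales is taken. *)
HB.instance Definition _ (d : R) := isOuterMeasure.Build R E (@hcover R n m d)
  (cover_outer0 (@ediam0 R n d) (@hgauge0 R n m) (@hgauge_ge0 R n m))
  (@cover_outer_ge0 _ _ _ _ (@hgauge_ge0 R n m))
  (@le_cover_outer _ _ _ _) (@cover_outer_sigma_subadditive _ _ _ _ (@hgauge_ge0 R n m)).

Lemma ediam_ge0 S x : S x -> (0 <= ediam S)%E.
Proof.
move=> Sx; apply: le_ereal_sup_tmp; exists (enorm (x - x))%:E; first by exists (x, x).
by rewrite lee_fin enorm_ge0.
Qed.

Lemma ediam_fin S x (d : R) : S x -> (ediam S <= d%:E)%E -> ediam S \is a fin_num.
Proof. by move=> Sx Sd; rewrite ge0_fin_numE ?(ediam_ge0 Sx)// (le_lt_trans Sd) ?ltry. Qed.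

Lemma enorm_ediam S x y (d : R) : S x -> S y -> (ediam S <= d%:E)%E ->
  enorm (x - y) <= fine (ediam S).
Proof.
move=> Sx Sy Sd; rewrite -lee_fin fineK ?(ediam_fin Sx Sd)//.
by apply: ereal_sup_ubound; exists (x, y).
Qed.

(** The part of A in a covering set lies in the ball about any of its points whose radius is the
    diameter of that set. The gauge is built on half the diameter; hence the factor 2^m. *)
Lemma hausdorff_density nu A (t s0 : R) : 0 < t -> 0 < s0 ->
  (forall a (s : R), A a -> 0 < s -> s < s0 -> (nu (eball a s) <= (t * s ^+ m)%:E)%E) ->
  (nu A <= (t * 2 ^+ m / alpha R m)%:E * H A)%E.
Proof.
move=> t0 s00 hA; set c := t * 2 ^+ m / alpha R m.
have c0 : 0 < c by rewrite divr_gt0 ?alpha_gt0// mulr_gt0// exprn_gt0.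
have d0 : 0 < s0 / 2 by rewrite divr_gt0.
have ds : s0 / 2 < s0 by rewrite ltr_pdivrMr// ltr_pMr// ltr1n.
apply: (@le_trans _ _ (c%:E * hcover m (s0 / 2) A)%E); last first.
  by rewrite lee_wpmul2l ?lee_fin ?(ltW c0)//; exact: hcover_le.
rewrite -lee_pdivrMl//; apply: le_ereal_inf_tmp => _ [F [CF AF] <-].
rewrite lee_pdivrMl// -nneseriesZl; last by move=> i _; exact: hgauge_ge0.
rewrite -(setIidl AF); apply: le_trans (outer_measure_bigcup_lim _ _ _) _.
apply: lee_nneseries => [i _ _|i _]; first exact: outer_measure_ge0.
have [->|/set0P[a [Aa Fa]]] := eqVneq (A `&` F i) set0.
  by rewrite outer_measure0 mule_ge0 ?lee_fin ?(ltW c0)// hgauge_ge0.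
have F0 : F i != set0 by apply/set0P; exists a.
set dl := fine (ediam (F i)).
have dl0 : 0 <= dl by exact/fine_ge0/(ediam_ge0 Fa).
have dls : dl < s0.
  by apply: le_lt_trans ds; rewrite -lee_fin fineK ?(ediam_fin Fa (CF i))//; exact: CF.
have sub : A `&` F i `<=` eball a dl.
  by move=> x [_ Fx]; exact: enorm_ediam (CF i).
rewrite /hgauge (negPf F0) -EFinM -/dl.
have -> : c * (alpha R m / 2 ^+ m * dl ^+ m) = t * dl ^+ m.
  by rewrite /c; field; rewrite expf_neq0//= gt_eqF ?alpha_gt0.
have [dl1|] := ltP 0 dl; first by apply: le_trans (hA a dl _ _ _) => //; exact: le_outer_measure.
move=> dl1; have {}dl1 : dl = 0 by apply/eqP; rewrite eq_le dl1.
rewrite dl1 expr0n gtn_eqF// mulr0; apply/lee_addgt0Pr => e e0; rewrite add0e.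
(* A covering set of diameter 0 has gauge 0 because m > 0. Its mass is at most e for every e > 0,
   since t s^m <= t s <= e when s <= 1 and s <= e / t. *)
pose s := Num.min (s0 / 2) (Num.min 1 (e / t)).
have s_gt0 : 0 < s by rewrite !lt_min d0 ltr01 divr_gt0.
have ss : s < s0 by apply: le_lt_trans ds; rewrite ge_min lexx.
apply: le_trans (_ : (nu (eball a s) <= _)%E).
  apply: le_outer_measure; apply: subset_trans sub _ => x; rewrite /eball /= dl1 => h.
  exact: le_trans h (ltW s_gt0).
apply: le_trans (hA a s Aa s_gt0 ss) _; rewrite lee_fin -ler_pdivlMl// mulrC.
apply: (@le_trans _ _ s); last by rewrite !ge_min lexx !orbT.
by rewrite -[leRHS]expr1 ler_wiXn2l// ?(ltW s_gt0)// !ge_min lexx orbT.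
Qed.

(** Balls of radius rho about points of mutual distance more than 2 rho are disjoint, so their
    number is bounded by the mass of K. A family of maximal size covers Z after doubling the
    radii. *)
Lemma finite_packing mu Z K (rho c : R) : 0 < rho -> 0 < c ->
  (forall F, closed F -> mu.-caratheodory F) -> (mu K < +oo)%E ->
  (forall a, Z a -> eball a rho `<=` K) ->
  (forall a, Z a -> (c%:E <= mu (eball a rho))%E) ->
  exists s : seq E, Z `<=` [set x | exists2 a, a \in s & eball a (2 * rho) x] /\
    (((size s)%:R * c)%:E <= mu K)%E.
Proof.
move=> rho0 c0 cF Koo ZK Zc.
pose far (x y : E) : bool := 2 * rho < enorm (x - y).
pose P s := (forall a, a \in s -> Z a) /\ pairwise far s.
have main s : P s -> (((size s)%:R * c)%:E <= mu K)%E.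
  move=> Ps; apply: (@le_trans _ _ (mu [set x | exists2 a, a \in s & eball a rho x])).
    elim: s Ps => [|a s IH] [Zs /=]; first by rewrite mul0r outer_measure_ge0.
    move=> /andP[/allP fs ps].
    have e1 : [set x | exists2 b, b \in a :: s & eball b rho x] =
        eball a rho `|` [set x | exists2 b, b \in s & eball b rho x].
      apply/seteqP; split => x /=.
        by move=> [b]; rewrite inE => /orP[/eqP->|bs] bx; [left|right; exists b].
      by move=> [ax|[b bs bx]]; [exists a|exists b] => //; rewrite inE ?eqxx// bs orbT.
    rewrite e1 caratheodoryU; last 2 first.
    - by apply: cF; exact: closed_eball.
    - apply/seteqP; split => // x [ax [b bs bx]]; have := fs _ bs; rewrite /far ltNge => /negP; apply.
      apply: le_trans (ler_enormB a x b) _; rewrite enormB.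
      by rewrite (_ : 2 * rho = rho + rho)//; [exact: lerD|ring].
    rewrite -natr1 mulrDl mul1r EFinD addeC; apply: leeD; last first.
      by apply: IH; split => // b bs; apply: Zs; rewrite inE bs orbT.
    by apply: Zc; apply: Zs; rewrite inE eqxx.
  apply: le_outer_measure => x [a sa]; apply: ZK; by have [h _] := Ps; exact: h.
have Kfin : mu K \is a fin_num by rewrite ge0_fin_numE// outer_measure_ge0.
pose Q k := `[< exists s, P s /\ size s = k >].
have Q0 : exists k, Q k by exists 0%N; apply/asboolP; exists [::]; split => //; split.
have Qb k : Q k -> (k <= (Num.truncn (fine (mu K) / c)).+1)%N.
  move=> /asboolP[s [Ps <-]]; rewrite -(ler_nat R); apply: ltW.
  apply: le_lt_trans (truncnS_gt _); rewrite ler_pdivlMr// -lee_fin fineK//; exact: main.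
case: (ex_maxnP Q0 Qb) => k /asboolP[s [Ps sk]] mx.
exists s; split; last exact: main.
move=> z Zz /=; apply: contrapT => nz.
have : Q k.+1.
  apply/asboolP; exists (z :: s); split; last by rewrite /= sk.
  split => [a|/=]; first by rewrite inE => /orP[/eqP->//|sa]; apply: Ps.1.
  rewrite Ps.2 andbT; apply/allP => a sa; rewrite /far ltNge; apply/negP => h.
  by apply: nz; exists a.
by move=> /mx; rewrite ltnn.
Qed.

Lemma hgauge_eball (a : E) (r : R) : 0 <= r ->
  (ediam (eball a r) <= (2 * r)%:E)%E /\
  (hgauge m (eball a r) <= (alpha R m * r ^+ m)%:E)%E.
Proof.
move=> r0; have h : (ediam (eball a r) <= (2 * r)%:E)%E.
  apply: ge_ereal_sup => _ [[x y] [ax ay] <-]; rewrite lee_fin.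
  apply: le_trans (ler_enormB x a y) _; rewrite (enormB a y).
  by rewrite (_ : 2 * r = r + r)//; [exact: lerD|ring].
split => //; rewrite /hgauge; case: ifP => _.
  by rewrite lee_fin mulr_ge0 ?alpha_ge0// exprn_ge0.
have aa : eball a r a by rewrite /eball /= subrr enorm0.
rewrite lee_fin (_ : alpha R m * r ^+ m = alpha R m / 2 ^+ m * (2 * r) ^+ m); last first.
  by rewrite exprMn; field; rewrite expf_neq0.
rewrite ler_wpM2l ?divr_ge0 ?alpha_ge0 ?exprn_ge0// lerXn2r// ?nnegrE ?mulr_ge0//.
  exact/fine_ge0/(ediam_ge0 aa).
by rewrite -lee_fin fineK// (ediam_fin aa h).
Qed.

Lemma hcover_le_gauge d S : (ediam S <= d%:E)%E -> (hcover m d S <= hgauge m S)%E.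
Proof.
move=> Sd; apply: ereal_inf_lbound.
exists (fun i => if (i == 0)%N then S else set0).
  split => [i|x Sx]; last by exists 0%N.
  by case: ifP => _ //; exact: ediam0.
rewrite (nneseries_split 0%N 1%N) => [|i _]; last by exact: hgauge_ge0.
rewrite add0n big_nat1 /= eseries0 ?adde0// => -[//|i] _ _ /=.
by rewrite hgauge0.
Qed.

Lemma hcover_packing mu Z K (rho c d : R) : 0 < rho -> 0 < c -> 4 * rho <= d ->
  (forall F, closed F -> mu.-caratheodory F) -> (mu K < +oo)%E ->
  (forall a, Z a -> eball a rho `<=` K) ->
  (forall a, Z a -> (c%:E <= mu (eball a rho))%E) ->
  (hcover m d Z <= (fine (mu K) / c * (alpha R m * (2 * rho) ^+ m))%:E)%E.
Proof.
move=> rho0 c0 rd cF Koo ZK Zc.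
have [s [Zs sc]] := finite_packing rho0 c0 cF Koo ZK Zc.
have Kfin : mu K \is a fin_num by rewrite ge0_fin_numE// outer_measure_ge0.
set g := alpha R m * (2 * rho) ^+ m.
have r20 : 0 <= 2 * rho by rewrite mulr_ge0// ltW.
have g0 : 0 <= g by rewrite mulr_ge0 ?alpha_ge0// exprn_ge0.
have h1 : (hcover m d Z <= ((size s)%:R * g)%:E)%E.
  apply: le_trans (le_outer_measure (hcover m d) _ _ Zs) _.
  elim: (s) => [|a l IH].
    rewrite (_ : [set x | _] = set0); first by rewrite outer_measure0 mul0r.
    by apply/seteqP; split => // x [].
  have sub : [set x | exists2 b, b \in a :: l & eball b (2 * rho) x] `<=`
      eball a (2 * rho) `|` [set x | exists2 b, b \in l & eball b (2 * rho) x].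
    by move=> x [b]; rewrite inE => /orP[/eqP->|bs] bx; [left|right; exists b].
  apply: le_trans (le_outer_measure _ _ _ sub) _.
  apply: le_trans (outer_measureU2 _ _ _) _.
  have -> : (size (a :: l))%:R * g = g + (size l)%:R * g.
    by rewrite /= -natr1 mulrDl mul1r addrC.
  rewrite EFinD; apply: leeD => //.
  have [e1 e2] := hgauge_eball a r20.
  apply: le_trans e2; apply: hcover_le_gauge; apply: le_trans e1 _.
  by rewrite lee_fin mulrA; apply: le_trans rd; rewrite ler_wpM2r ?(ltW rho0)//; lra.
apply: (le_trans h1); rewrite lee_fin ler_wpM2r// ler_pdivlMr// -lee_fin fineK//.
Qed.

Lemma geometric23 (C : R) : 0 <= C ->
  (\sum_(0 <= k <oo) (C * (2 / 3) ^+ k)%:E < +oo)%E.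
Proof.
move=> C0; apply: (@le_lt_trans _ _ (C * 3)%:E); last by rewrite ltry.
apply: lime_le.
  apply: is_cvg_nneseries => k _ _; rewrite lee_fin mulr_ge0// exprn_ge0//.
apply: nearW => N; rewrite sumEFin lee_fin -mulr_sumr ler_wpM2l//.
suff -> : \sum_(0 <= k < N) (2 / 3) ^+ k = 3 * (1 - (2 / 3) ^+ N) :> R.
  by rewrite ler_piMr// gerBl exprn_ge0.
elim: N => [|N IH]; first by rewrite big_geq// expr0 subrr mulr0.
by rewrite big_nat_recr//= IH exprS; field.
Qed.

(** Borel-Cantelli at each fixed scale: A lies in the union of the Z k with k >= j for every j, and
    the tails of the series tend to 0. The threshold k0 allows the estimate to start later for finer
    scales. *)
Lemma hausdorff_limsup (Z : nat -> set E) (A : set E) (C : R) (k0 : nat -> nat) : 0 <= C ->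
  (forall l k, (k0 l <= k)%N -> (hcover m (2^-l) (Z k) <= (C * (2 / 3) ^+ k)%:E)%E) ->
  (forall x, A x -> forall j, exists2 k, (j <= k)%N & Z k x) -> H A = 0%E.
Proof.
move=> C0 hZ hA; apply: hausdorff0_le => l.
have ge0 k : xpredT k -> (0 <= (C * (2 / 3) ^+ k)%:E)%E.
  by move=> _; rewrite lee_fin mulr_ge0// exprn_ge0.
have cv := nneseries_tail_cvg (geometric23 C0) ge0.
rewrite -(cvg_lim _ cv)//; apply: lime_ge; first by apply/cvg_ex; eexists; exact: cv.
exists (k0 l) => // j /= lj.
pose F k := if (j <= k)%N then Z k else set0.
have sub : A `<=` \bigcup_k F k.
  by move=> x /hA /(_ j) [k jk Zk]; exists k => //; rewrite /F jk.
apply: le_trans (le_outer_measure (hcover m (2^-l)) _ _ sub) _.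
apply: le_trans (outer_measure_sigma_subadditive _ _) _.
rewrite [leRHS]eseries_cond [leRHS]eseries_mkcond.
apply: lee_nneseries => [i _ _|i _]; first exact: outer_measure_ge0.
rewrite /F /=; case: ifP => ji; last by rewrite outer_measure0.
by apply: hZ; exact: leq_trans ji.
Qed.

Variable U : set E.
Hypothesis oU : open U.
Variable mu : {outer_measure set E -> \bar R}.
Hypothesis rmu : radon_over U mu.

(* A packing at scale 2^-k bounds the H^m content of the points thick at that
   scale by a multiple of (2/3)^k, whereas the error term of the monotonicity
   inequality at a thin point is a sum of powers of 3/4. *)
Definition thick (k : nat) (a : E) : Prop :=
  (((3 / 4) ^+ k * (2^-k) ^+ m.-1)%:E < mu (eball a (2^-k)))%E.

Lemma hausdorff_thick :
  H [set a | U a /\ forall j, exists2 k, (j <= k)%N & thick k a] = 0%E.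
Proof.
apply: null_subset (_ : H (\bigcup_i [set a | kex U i a /\
    forall j, exists2 k, (j <= k)%N & thick k a]) = 0%E).
  move=> a [Ua h]; have [i _ ai] : (\bigcup_N kex U N) a by rewrite bigcup_kex.
  by exists i.
apply: null_bigcup => i.
have Koo : (mu (kex U i.+1) < +oo)%E.
  by apply: (radon_ltoo rmu); [exact: compact_kex|exact: kex_sub].
set M := fine (mu (kex U i.+1)).
have M0 : 0 <= M by apply/fine_ge0/outer_measure_ge0.
(* From k = i + 1 on, balls of radius 2^-k about points of [kex U i] stay in [kex U i.+1]; before
   that the sets are taken empty. The threshold l + 2 expresses 4 * 2^-k <= 2^-l. *)
apply: (@hausdorff_limsup (fun k => if (i.+1 <= k)%N then [set a | kex U i a /\ thick k a] else set0)
  _ (M * alpha R m * 2 ^+ m) (fun l => l.+2)).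
- by rewrite !mulr_ge0 ?alpha_ge0// exprn_ge0.
- move=> l k lk; case: ifP => ik; last first.
    by rewrite outer_measure0 lee_fin !mulr_ge0 ?alpha_ge0// exprn_ge0.
  have p0 (j : nat) : 0 < 2^-j :> R by rewrite invr_gt0 exprn_gt0.
  have le2 (a b : nat) : (a <= b)%N -> 2^-b <= 2^-a :> R.
    by move=> ab; rewrite lef_pV2 ?posrE ?exprn_gt0// ler_weXn2l// ler1n.
  apply: le_trans (@hcover_packing mu _ (kex U i.+1) (2^-k)
     ((3 / 4) ^+ k * (2^-k) ^+ m.-1) _ _ _ _ _ _ _ _) _ => //.
  + rewrite (_ : 4 * 2^-k = 2^-(k.-2)); first by apply: le2; lia.
    have -> : k = k.-2.+2 by lia.
    by rewrite /= !exprS !invfM; field.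
  + by move=> F cF; exact: (radon_closed oU rmu).
  + by move=> a [ai _] x xa; apply: kexS_eball ai _; apply: le_trans xa _; exact: le2.
  + by move=> a [_ /ltW].
  (* At most M / ((3/4)^k 2^(-k(m-1))) balls, each counted as alpha 2^m 2^(-km): the surplus 2^-k
     turns (4/3)^k into (2/3)^k. *)
  + rewrite lee_fin -/M; rewrite le_eqVlt; apply/orP; left; apply/eqP.
    have e1 : (2 * 2^-k) ^+ m = 2 ^+ m * (2^-k) ^+ m.-1 * 2^-k :> R.
      by rewrite exprMn -mulrA -exprSr prednK.
    rewrite e1; set q := (2^-k : R) ^+ m.-1.
    have q0 : q != 0 by rewrite expf_neq0// gt_eqF.
    have -> : (2 / 3) ^+ k = (3 / 4) ^- k * 2^-k :> R.
      by rewrite -exprVn -[in RHS]exprVn -exprMn; congr (_ ^+ _); field.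
    by field; rewrite q0/= !expf_neq0.
- move=> x [xi hx] j; have [k jk tk] := hx (maxn j i.+1).
  exists k; first by apply: leq_trans jk; exact: leq_maxl.
  by rewrite ifT//; apply: leq_trans jk; exact: leq_maxr.
Qed.

End hausdorff_covering.

Lemma continuous_indic_clopen (R : realType) (T : topologicalType) (A : set T) :
  open A -> closed A -> continuous (\1_A : T -> R).
Proof.
move=> oA cA x.
have [xA|xA] := pselect (A x).
  apply: cvg_near_cst; have /nbhs_interior : nbhs x A by exact: open_nbhs_nbhs.
  by apply: filterS => y /interior_subset Ay; rewrite !indicE !mem_set.
apply: cvg_near_cst.
have : nbhs x (~` A) by apply: open_nbhs_nbhs; split => //; exact: closed_openC.
by apply: filterS => y Ay; rewrite !indicE !memNset.
Qed.

(** * The weight as a density times Hausdorff measure *)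

Section weight_density.
Variables (R : realType) (n m : nat).
Local Notation E := 'rV[R]_n.
Local Notation X := ('rV[R]_n * subspaces R n)%type.
Local Notation G := (@grassmann R n m).
Local Notation H := (@hausdorff R n m).
Variable U : set E.
Hypothesis oU : open U.
Variable V : {outer_measure set X -> \bar R}.
Hypothesis rV : varifold m U V.
Variables (M : set E) (theta : E -> R) (T : E -> subspaces R n).
Hypotheses (MU : M `<=` U) (cM : H.-caratheodory M).
Hypothesis theta0 : forall x, M x -> 0 < theta x.
Hypothesis mtheta : measurable_fun (M : set (caratheodory_type H)) theta.
Hypothesis TG : forall x, M x -> G (T x).
Hypothesis VE : forall k : X -> R, Kspace (U `*` G) k ->
  (ointegral V k)%:E = (\int[cmeas H]_(x in M) (k (x, T x) * theta x)%:E)%E.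
Implicit Types (A B K O Z : set E).

Local Notation w := (weight m V).
Let rw : radon_over U [the {outer_measure set E -> \bar R} of weight m V].
Proof. exact: (radon_weight oU rV). Qed.

Definition theta_mass A : \bar R := (\int[cmeas H]_(x in A `&` M) (theta x)%:E)%E.

Let oH O : open O -> H.-caratheodory O. Proof. exact: hausdorff_open. Qed.
Let bH B : <<s open >> B -> H.-caratheodory B.
Proof. by apply: borel_caratheodory => O; exact: oH. Qed.

Let mthetaE A : measurable_fun (A `&` M : set (caratheodory_type H)) (fun x => (theta x)%:E).
Proof.
apply/measurable_EFinP; apply: measurable_funS mtheta => //; exact: subIsetr.
Qed.

Let cAM A : H.-caratheodory A -> H.-caratheodory (A `&` M).
Proof. by move=> cA; exact: caratheodory_measurable_setI. Qed.

Lemma theta_massU A B : H.-caratheodory A -> H.-caratheodory B -> A `&` B = set0 ->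
  theta_mass (A `|` B) = (theta_mass A + theta_mass B)%E.
Proof.
move=> cA cB AB; rewrite /theta_mass setIUl; apply: (ge0_integral_setU (cmeas H) (cAM cA) (cAM cB)).
- by rewrite -setIUl; exact: mthetaE.
- by move=> x [] [_ /theta0/ltW]; rewrite lee_fin.
- by apply/disj_setPS => x [[Ax _] [Bx _]]; rewrite -AB.
Qed.

Lemma theta_mass_null A : H.-caratheodory A -> H (A `&` M) = 0%E -> theta_mass A = 0%E.
Proof. by move=> cA A0; apply: null_set_integral => //; exact: cAM. Qed.

Lemma theta_mass_bigcup (F : nat -> set E) : (forall i, H.-caratheodory (F i)) ->
  (forall i j, (i <= j)%N -> F i `<=` F j) ->
  (theta_mass (\bigcup_i F i) <= ereal_sup (range (theta_mass \o F)))%E.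
Proof.
move=> cF ndF; rewrite /theta_mass setI_bigcupl.
have cv := @ge0_nondecreasing_set_cvg_integral _ _ _ (fun i => F i `&` M : set (caratheodory_type H))
  (fun x => (theta x)%:E) (cmeas H).
rewrite -(cvg_lim _ (cv _ _ _ _))//.
- apply: lime_le.
    apply/cvg_ex; eexists; apply: cv => //.
    + by move=> i j ij; apply/subsetPset; apply: setSI; exact: ndF.
    + by move=> i; exact: cAM.
    + by move=> i x [_ /theta0/ltW]; rewrite lee_fin.
  by apply: nearW => i; apply: ereal_sup_ubound; exists i.
- by move=> i j ij; apply/subsetPset; apply: setSI; exact: ndF.
- by move=> i; exact: cAM.
- by move=> i x [_ /theta0/ltW]; rewrite lee_fin.
Qed.

(** The function phi(x) times the indicator of G, with phi equal to 1 on K and supported in O, is an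
    admissible test function because G is open and closed. The integral formula for it compares both
    measures. *)
Lemma weight_sandwich K O : compact K -> closed K -> open O -> K `<=` O -> O `<=` U ->
  (w K <= theta_mass O)%E /\ (theta_mass K <= w O)%E.
Proof.
move=> cK clK oO KO OU.
have [phi [sphi phi01 [N oN [KN N1]] cphi phiO]] := smooth_urysohn cK oO KO.
have cf : continuous phi by exact: Cinf_continuous.
pose g (x : X) : R := \1_G x.2.
have g01 x : 0 <= g x <= 1 by rewrite /g indicE; case: (_ \in _) => /=; rewrite ler01 ?lexx.
pose k (x : X) : R := phi x.1 * g x.
have clG : closed G by exact: closed_grassmann.
have ck : continuous k.
  apply: continuous_funM; first by apply: continuous_comp_fun cf => // x; exact: cvg_fst.
  apply: (@continuous_comp_fun _ _ _ snd (\1_G : subspaces R n -> R)) => [x|].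
    exact: cvg_snd.
  by apply: continuous_indic_clopen => //; exact: open_grassmann.
have sk : spt k `<=` spt phi `*` G.
  have clS : closed (spt phi `*` G).
    rewrite setXE; apply: closedI.
      by apply: preimage_closed => [x _|]; [exact: cvg_fst|exact: closed_spt].
    by apply: preimage_closed => [x _|]; [exact: cvg_snd|].
  rewrite ((closure_id _).1 clS); apply: closureS => -[x P] /=.
  rewrite /k mulf_eq0 negb_or => /andP[p0 g0]; split => /=; first exact: subset_closure.
  move: g0; rewrite /g /= indicE.
  by have [/set_mem|] := boolP (P \in G) => //=; rewrite eqxx.
have csk : compact (spt phi `*` G).
  by apply: compact_setX => //; exact: compact_grassmann.
have Kk : Kspace (U `*` G) k.
  split => //; first by apply: (subclosed_compact _ csk sk); exact: closed_closure.
  move=> x /sk[/= /phiO/OU ? ?]; split => //.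
have k0 x : 0 <= k x.
  by have /andP[a _] := phi01 x.1; have /andP[b _] := g01 x; exact: mulr_ge0.
have mk : measurable_fun setT (k : caratheodory_type V -> R).
  by apply: continuous_caratheodory => // Q oQ; exact: (varifold_open oU rV).
have cX A : open A \/ closed A -> V.-caratheodory (A `*` G).
  move=> [oA|clA]; apply: (cylinder_caratheodory oU rV); last exact: closed_borel.
  exact: sub_gen_smallest.
have kint A : V.-caratheodory (A `*` G) -> (\int[cmeas V]_x (\1_(A `*` G) x)%:E)%E = w A.
  by move=> cA; rewrite integral_indic ?setIT.
have mi A : V.-caratheodory (A `*` G) ->
   measurable_fun setT ((\1_(A `*` G) : X -> R) : caratheodory_type V -> R).
  by move=> cA; apply: measurable_indic.
have up A : V.-caratheodory (A `*` G) -> spt phi `<=` A ->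
    (\int[cmeas V]_x (k x)%:E <= w A)%E.
  move=> cA sA; rewrite -(kint A)//; apply: ge0_le_integral => //.
  - by move=> x _; rewrite lee_fin.
  - exact/measurable_EFinP.
  - by apply/measurable_EFinP; exact: mi.
  move=> [x P] _; rewrite lee_fin indicE.
  have /andP[_ p1] := phi01 x; have /andP[q0 q1] := g01 (x, P).
  have [xA|xA] := boolP ((x, P) \in A `*` G); first by rewrite /k /= mulr_ile1// ?(andP (phi01 x)).1.
  rewrite [leLHS](_ : _ = 0)//; apply/eqP; rewrite /k mulf_eq0.
  apply: contraNT xA; rewrite negb_or => /andP[p0 g0]; apply/mem_set; split => /=.
    by apply: sA; exact: subset_closure.
  move: g0; rewrite /g /= indicE.
  by have [/set_mem|] := boolP (P \in G) => //=; rewrite eqxx.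
have fin : (\int[cmeas V]_x (k x)%:E)%E \is a fin_num.
  rewrite ge0_fin_numE; last by apply: integral_ge0 => x _; rewrite lee_fin.
  apply: le_lt_trans (up (spt phi) _ _) _ => //; first by apply: cX; right; exact: closed_spt.
  by apply: (radon_ltoo rw) => //; exact: subset_trans phiO OU.
have oE : (\int[cmeas V]_x (k x)%:E)%E = (\int[cmeas H]_(x in M) (phi x * theta x)%:E)%E.
  rewrite -(fineK fin) [in LHS](_ : fine _ = ointegral V k)// VE//.
  apply: eq_integral => x /set_mem Mx; rewrite /k /g indicE mem_set ?mulr1//.
  exact: TG.
have mphi : measurable_fun (M : set (caratheodory_type H)) (fun x => phi x * theta x).
  apply: measurable_funM => //; apply: measurable_funTS; exact: continuous_caratheodory.
have KG : V.-caratheodory (K `*` G) by apply: cX; right.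
split.
  apply: (@le_trans _ _ (\int[cmeas V]_x (k x)%:E)%E).
    rewrite -(kint K)//; apply: ge0_le_integral => //.
    - by apply/measurable_EFinP; exact: mi.
    - exact/measurable_EFinP.
    move=> [x P] _; rewrite lee_fin indicE.
    have [/set_mem[/= Kx GP]|_] := boolP (_ \in _); last exact: k0.
    by rewrite /k /g /= N1 ?indicE ?mem_set// ?mulr1//; exact: KN.
  rewrite oE /theta_mass setIC integral_mkcondr; apply: (ge0_le_integral (cmeas H) cM).
  - by move=> x /theta0/ltW t0; rewrite lee_fin mulr_ge0//; have /andP[] := phi01 x.
  - exact/measurable_EFinP.
  - have mO : measurable (O : set (caratheodory_type H)) by exact: oH.
    have mM : measurable (M : set (caratheodory_type H)) by exact: cM.
    apply/(measurable_restrict _ mO mM).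
    by rewrite setIC; exact: mthetaE.
  move=> x Mx; rewrite patchE; have /ltW t0 := theta0 Mx; have /andP[_ p1] := phi01 x.
  case: ifPn => xO; first by rewrite lee_fin ler_piMl.
  rewrite lee_fin (@spt_eq0 _ _ phi x) ?mul0r// => /phiO/mem_set.
  exact/negP.
apply: (@le_trans _ _ (\int[cmeas V]_x (k x)%:E)%E).
  rewrite oE /theta_mass setIC integral_mkcondr; apply: (ge0_le_integral (cmeas H) cM).
  - by move=> x /theta0/ltW t0; rewrite patchE; case: ifP; rewrite lee_fin.
  - have mK : measurable (K : set (caratheodory_type H)) by apply: bH; exact: closed_borel.
    have mM : measurable (M : set (caratheodory_type H)) by exact: cM.
    apply/(measurable_restrict _ mK mM).
    by rewrite setIC; exact: mthetaE.
  - exact/measurable_EFinP.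
  move=> x Mx; rewrite patchE; have /ltW t0 := theta0 Mx; have /andP[p0 _] := phi01 x.
  case: ifPn => xK; last by rewrite lee_fin mulr_ge0.
  by rewrite N1 ?mul1r//; apply: KN; exact: set_mem.
by apply: up => //; apply: cX; left.
Qed.

Lemma weight_openE O : open O -> O `<=` U -> w O = theta_mass O.
Proof.
move=> oO OU.
have clk := @closed_kex _ _ O; have ck := @compact_kex _ _ O.
have sub N : kex O N `<=` O by exact: kex_sub.
have sw N := weight_sandwich (ck N) (clk N) oO (sub N) OU.
apply/eqP; rewrite eq_le; apply/andP; split.
  rewrite -[X in (w X <= _)%E]setIid -{2}(bigcup_kex oO).
  apply: le_trans (nondecreasing_outer_measure _ _ _) _.
  - by move=> i; apply: (radon_closed oU rw).
  - by move=> i j; exact: le_kex.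
  apply: ge_ereal_sup => _ [N _ <-]; apply: le_trans (sw N).1.
  by apply: le_outer_measure; exact: subIsetr.
rewrite -{1}(bigcup_kex oO); apply: le_trans (theta_mass_bigcup _ _) _.
- by move=> i; apply: bH; exact: closed_borel.
- by move=> i j; exact: le_kex.
by apply: ge_ereal_sup => _ [N _ <-]; exact: (sw N).2.
Qed.

(** K is the difference of the open sets O and O \ K, which have finite weight and are covered by
    [weight_openE]. *)
Lemma weight_compactE K : compact K -> closed K -> K `<=` U -> w K = theta_mass K.
Proof.
move=> cK clK KU; have [j Kj] := compact_sub_kex oU cK KU.
pose O := (kex U j.+1)°.
have KO : K `<=` O by apply: subset_trans Kj _; exact: kex_interior.
have oO : open O by exact: open_interior.
have OU : O `<=` U by apply: subset_trans (@interior_subset _ _) _; exact: kex_sub.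
have Ooo : (w O < +oo)%E.
  apply: (@le_lt_trans _ _ (w (kex U j.+1))); first by apply: le_outer_measure; exact: interior_subset.
  by apply: (radon_ltoo rw); [exact: compact_kex|exact: kex_sub].
have oOK : open (O `\` K) by rewrite setDE; apply: openI => //; exact: closed_openC.
have OKE : K `|` O `\` K = O.
  by apply/seteqP; split => x; [move=> [/KO|[]]|have [|] := pselect (K x); [left|right]].
have d0 : K `&` (O `\` K) = set0 by apply/seteqP; split => // x [? []].
have h1 : w O = (w K + w (O `\` K))%E.
  by rewrite -{1}OKE; apply: caratheodoryU => //; exact: (radon_closed oU rw).
have h2 : theta_mass O = (theta_mass K + theta_mass (O `\` K))%E.
  by rewrite -{1}OKE theta_massU//; apply: bH; [exact: closed_borel|exact: sub_gen_smallest].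
have fOK : w (O `\` K) \is a fin_num.
  rewrite ge0_fin_numE ?outer_measure_ge0//; apply: le_lt_trans Ooo.
  by apply: le_outer_measure; exact: subDsetl.
move: h1; rewrite (weight_openE oO OU) h2 (weight_openE oOK (subset_trans (@subDsetl _ _ _) OU)).
have fOK' : theta_mass (O `\` K) \is a fin_num.
  by rewrite -weight_openE//; exact: subset_trans (@subDsetl _ _ _) OU.
move=> /(congr1 (fun z => z - theta_mass (O `\` K))%E).
by rewrite !addeK.
Qed.

Lemma weight_null_borel B : w.-caratheodory B -> B `<=` U ->
  H (B `&` M) = 0%E -> w B = 0%E.
Proof.
move=> cB BU B0; rewrite -(setIidl BU) -(bigcup_kex oU) setI_bigcupr.
apply: null_bigcup => j.
have ckj : w.-caratheodory (kex U j) by apply: (radon_closed oU rw); exact: closed_kex.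
have cBj : w.-caratheodory (B `&` kex U j) by exact: caratheodory_measurable_setI.
have Bjoo : (w (B `&` kex U j) < +oo)%E.
  apply: (@le_lt_trans _ _ (w (kex U j))); first by apply: le_outer_measure; exact: subIsetr.
  by apply: (radon_ltoo rw); [exact: compact_kex|exact: kex_sub].
apply/eqP; rewrite eq_le outer_measure_ge0 andbT; apply/lee_addgt0Pr => e e0.
have BjU : B `&` kex U j `<=` U by move=> x [/BU].
have [C [cC clC CB Ce]] := radon_inner oU (@compact_kex _ _ U) (@closed_kex _ _ U)
   (bigcup_kex oU) (@le_kex _ _ U) rw cBj BjU Bjoo e0.
have -> : B `&` kex U j = C `|` ((B `&` kex U j) `\` C).
  by apply/seteqP; split => x; [have [|] := pselect (C x); [left|right]|move=> [/CB|[]]].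
apply: le_trans (outer_measureU2 _ _ _) _; apply: leeD => //.
change (w C <= 0)%E; rewrite weight_compactE//; last exact: subset_trans CB BjU.
rewrite theta_mass_null//; first by apply: bH; exact: closed_borel.
by apply: null_subset B0; apply: setSI => x /CB[].
Qed.

Lemma weight_null Z : H Z = 0%E -> w Z = 0%E.
Proof.
move=> Z0; have [|B [bB ZB HB]] := @hausdorff_hull _ _ m Z; first by rewrite [H Z]Z0.
have cB : w.-caratheodory B by exact: (radon_borel oU rw).
have cU : w.-caratheodory U by exact: (radon_open oU rw).
apply: (@null_subset _ _ _ _ ((B `&` U) `|` ~` U)).
  by move=> x /ZB Bx; have [Ux|Ux] := pselect (U x); [left|right].
apply: null_setU; last by case: rw.
apply: weight_null_borel; [exact: caratheodory_measurable_setI|exact: subIsetr|].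
by apply: null_subset (_ : H B = 0%E); [move=> x [[]]|rewrite HB].
Qed.

(** A is arbitrary, so the integral estimate is made on open sets around A and passes to A by outer
    regularity of ||V||. *)
Lemma hausdorff_le_weight A (c : R) : 0 < c -> A `<=` [set x | M x /\ c <= theta x] ->
  (c%:E * H A <= w A)%E.
Proof.
move=> c0 AM.
have -> : w A = ereal_inf [set w O | O in [set O | [/\ open O, A `<=` O & O `<=` U]]].
  by case: rw => _ _ _ _ /(_ A); apply => x /AM[/MU].
apply: le_ereal_inf_tmp => _ [P [oP AP PU] <-].
rewrite weight_openE//.
pose Mc := [set x | M x /\ c <= theta x].
have cMc : H.-caratheodory Mc.
  rewrite (_ : Mc = M `&` theta @^-1` `[c, +oo[); last first.
    by apply/seteqP; split => x [Mx]; rewrite /= in_itv/= andbT.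
  exact: mtheta.
have cPM : H.-caratheodory (P `&` Mc) by apply: caratheodory_measurable_setI => //; exact: oH.
apply: (@le_trans _ _ (c%:E * H (P `&` Mc))%E).
  by rewrite lee_wpmul2l ?lee_fin ?(ltW c0)//; apply: le_outer_measure => x Ax; split; [exact: AP|exact: AM].
rewrite -[H _]/(cmeas H (P `&` Mc)) -integral_cst//.
apply: (@le_trans _ _ (\int[cmeas H]_(x in P `&` Mc) (theta x)%:E)%E).
  apply: (ge0_le_integral (cmeas H) cPM).
  - by move=> x _; rewrite lee_fin ltW.
  - exact: measurable_cst.
  - apply/measurable_EFinP; apply: measurable_funS mtheta => //.
    by move=> x [_ []].
  - by move=> x [_ [_ ct]]; rewrite lee_fin.
apply: ge0_subset_integral => //; first exact: cAM (oH oP).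
  by move=> x [_ /theta0/ltW]; rewrite lee_fin.
by move=> x [Px [Mx _]].
Qed.

(** From a Borel hull of A one removes a Borel hull of its null excess over A. *)
Lemma hausdorff_core A : H.-caratheodory A -> (H A < +oo)%E ->
  exists B, [/\ <<s open >> B, B `<=` A & H (A `\` B) = 0%E].
Proof.
move=> cA Aoo; have [B [bB AB HB]] := hausdorff_hull Aoo.
have BA0 : H (B `\` A) = 0%E.
  transitivity (H B - H A)%E; first exact: caratheodoryD.
  rewrite HB subee//.
  by rewrite ge0_fin_numE// outer_measure_ge0.
have [|N [bN BAN HN]] := @hausdorff_hull _ _ m (B `\` A); first by rewrite [H _]BA0.
have [s0 sD sU] := smallest_sigma_algebra (@setT E) (@open E).
exists (B `\` N); split.
- rewrite setDE -[X in <<s _ >> X]setCK setCI setCK.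
  rewrite -setTD; apply: (sD); rewrite -bigcup2E; apply: sU => -[|[|i]] //=.
  by rewrite -setTD; exact: sD.
- by move=> x [Bx Nx]; apply: contrapT => Ax; apply: Nx; exact: BAN.
- apply: null_subset (_ : H N = 0%E); last by rewrite HN.
  by move=> x [Ax /not_andP[/(_ (AB _ Ax))//|/contrapT]].
Qed.

(** A priori U \ M need not be ||V|| measurable, so it is enlarged to the complement of a Borel
    subset of M with full H^m measure. That subset comes from the pieces [Mj j], of finite H^m
    measure because theta is bounded below on them and [kex U j] has finite weight. *)
Lemma weight_compl : w (U `\` M) = 0%E.
Proof.
pose Mj (j : nat) := [set x | M x /\ j.+1%:R^-1 <= theta x] `&` kex U j.
have cMj j : H.-caratheodory (Mj j).
  apply: caratheodory_measurable_setI; last by apply: bH; apply: closed_borel; exact: closed_kex.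
  rewrite (_ : [set _ | _] = M `&` theta @^-1` `[j.+1%:R^-1, +oo[); last first.
    by apply/seteqP; split => x [Mx]; rewrite /= in_itv/= andbT.
  exact: mtheta.
have Mjoo j : (H (Mj j) < +oo)%E.
  have j0 : 0 < j.+1%:R^-1 :> R by rewrite invr_gt0.
  have := @hausdorff_le_weight (Mj j) _ j0 (@subIsetl _ _ _).
  have : (w (Mj j) < +oo)%E.
    apply: (@le_lt_trans _ _ (w (kex U j))); first by apply: le_outer_measure; exact: subIsetr.
    by apply: (radon_ltoo rw); [exact: compact_kex|exact: kex_sub].
  move=> /[swap] /le_lt_trans/[apply].
  case: (H (Mj j)) => [r _|+|//]; first by rewrite ltry.
  by rewrite gt0_muley ?lte_fin.
have /choice[N hN] : forall j, exists B, [/\ <<s open >> B, B `<=` Mj j & H (Mj j `\` B) = 0%E].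
  by move=> j; exact: hausdorff_core.
have bN : <<s open >> (\bigcup_j N j).
  by apply: sigma_algebra_bigcup => j; have [] := hN j.
apply: (@null_subset _ _ _ _ (U `\` \bigcup_j N j)).
  move=> x [Ux nM]; split => // -[j _ Nx]; apply: nM.
  by have [_ h _] := hN j; have [[]] := h x Nx.
apply: weight_null_borel; [|exact: subDsetl|].
  apply: caratheodory_measurable_setD; first exact: (radon_open oU rw).
  exact: (radon_borel oU rw).
apply: (@null_subset _ _ _ _ (\bigcup_j (Mj j `\` N j))); last first.
  by apply: null_bigcup => j; have [] := hN j.
move=> x [[Ux nN] Mx].
have [i _ xi] : (\bigcup_N kex U N) x by rewrite bigcup_kex.
have t0 := theta0 Mx.
pose j := maxn i (Num.truncn (theta x)^-1).
exists j => //; split; last by move=> Nx; apply: nN; exists j.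
split; last by apply: le_kex xi; exact: leq_maxl.
split => //; rewrite -[leRHS]invrK lef_pV2 ?posrE ?invr_gt0//.
apply: ltW; apply: lt_le_trans (truncnS_gt _) _.
by rewrite ler_nat ltnS leq_maxr.
Qed.

Variable mu : {outer_measure set E -> \bar R}.
Hypothesis rmu : radon_over U mu.
Hypothesis m_gt0 : (0 < m)%N.

(** The sets C_i of the overview: one index bounds theta from below, locates the point in U and
    fixes the scale from which on the balls about it are thin. *)
Definition core (i : nat) : set E := [set a | [/\ M a, i.+1%:R^-1 <= theta a, kex U i a &
  forall k, (i <= k)%N -> ~ thick m mu k a]].

Lemma weight_core : w (U `\` \bigcup_i core i) = 0%E.
Proof.
apply: (@null_subset _ _ _ _ ((U `\` M) `|`
  [set a | U a /\ forall j, exists2 k, (j <= k)%N & thick m mu k a])); last first.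
  apply: null_setU; first exact: weight_compl.
  by apply: weight_null; apply: hausdorff_thick.
move=> x [Ux nx]; have [Mx|Mx] := pselect (M x); [right|by left].
split => // j; apply: contrapT => nj; apply: nx.
have [i _ xi] : (\bigcup_N kex U N) x by rewrite bigcup_kex.
have t0 := theta0 Mx.
pose l := maxn i (maxn j (Num.truncn (theta x)^-1)).
exists l => //; split => //.
- rewrite -[leRHS]invrK lef_pV2 ?posrE ?invr_gt0//.
  apply: ltW; apply: lt_le_trans (truncnS_gt _) _.
  by rewrite ler_nat ltnS /l !leq_max leqnn !orbT.
- by apply: le_kex xi; exact: leq_maxl.
- move=> k lk tk; apply: nj; exists k => //; apply: leq_trans lk.
  by rewrite /l !leq_max leqnn !orbT.
Qed.

(* The constant of [hausdorff_density] becomes 1 / (2 (i + 1)), half the bound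
   which [theta >= 1 / (i + 1)] gives on [core i]. *)
Definition core_density (i : nat) : R := alpha R m / (2 ^+ m * i.+1%:R * 2).

Lemma core_density_gt0 i : 0 < core_density i.
Proof. by rewrite divr_gt0 ?alpha_gt0// !mulr_gt0// exprn_gt0. Qed.

(** Otherwise the weight restricted to A would have small upper density on A [&] core i, and
    [hausdorff_density] together with [hausdorff_le_weight] would bound the weight of this set by
    half of itself, although it is positive and finite. Restricting to A replaces a density
    theorem. *)
Lemma core_dense i A (s0 : R) : (0 < w (A `&` core i))%E -> 0 < s0 ->
  exists a s, [/\ A a, core i a, 0 < s < s0 &
    ((core_density i * s ^+ m)%:E < w (A `&` eball a s))%E].
Proof.
move=> w0 s00; apply: contrapT => nh.
have h : (w (A `&` core i) <= (core_density i * 2 ^+ m / alpha R m)%:E * H (A `&` core i))%E.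
  have -> : w (A `&` core i) = orestr [the {outer_measure set E -> \bar R} of w] A (A `&` core i).
    by rewrite /orestr setIA setIid.
  apply: (@hausdorff_density _ _ _ m_gt0
    [the {outer_measure set E -> \bar R} of orestr [the {outer_measure set E -> \bar R} of w] A]
    _ _ s0 (core_density_gt0 i) s00).
  move=> a s [Aa ca] s1 s2; rewrite leNgt; apply/negP => h; apply: nh.
  by exists a, s; split => //; apply/andP.
have c0 : 0 < i.+1%:R^-1 :> R by rewrite invr_gt0.
have h2 := @hausdorff_le_weight (A `&` core i) _ c0 (fun x => fun hx : (A `&` core i) x =>
   let: And4 h1 h2 _ _ := hx.2 in conj h1 h2).
have woo : (w (A `&` core i) < +oo)%E.
  apply: (@le_lt_trans _ _ (w (kex U i))); first by apply: le_outer_measure => x [_ []].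
  by apply: (radon_ltoo rw); [exact: compact_kex|exact: kex_sub].
have e1 : core_density i * 2 ^+ m / alpha R m = i.+1%:R^-1 / 2.
  have a0 : alpha R m != 0 by rewrite gt_eqF// alpha_gt0.
  have i0 : 1 + i%:R != 0 :> R by rewrite addrC natr1 pnatr_eq0.
  have p0 : 2 ^+ m != 0 :> R by rewrite expf_neq0.
  by rewrite /core_density; field; rewrite a0 i0 p0.
rewrite e1 mulrC EFinM -muleA in h.
have := le_trans h (lee_wpmul2l (_ : (0 <= 2^-1%:E)%E) h2).
rewrite lee_fin invr_ge0 ler0n => /(_ isT).
case: (w (A `&` core i)) w0 woo => [r| |]//; rewrite lte_fin => r0 _.
by rewrite -EFinM lee_fin; lra.
Qed.

End weight_density.

Lemma derive_lin (R : realType) (V W : normedModType R) (f g : V -> W) (a : R) x v :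
  derivable f x v -> derivable g x v ->
  'D_v (fun y => a *: f y + g y) x = a *: 'D_v f x + 'D_v g x.
Proof.
move=> df dg; rewrite -(deriveZ a df); apply: (@deriveD _ _ _ (a \*: f) g) => //.
exact: derivableZ.
Qed.

(** * The first variation as an integral of the divergence *)

Section first_variation.
Variables (R : realType) (n m : nat).
Local Notation E := 'rV[R]_n.
Local Notation X := ('rV[R]_n * subspaces R n)%type.
Local Notation G := (@grassmann R n m).
Variable U : set E.
Hypothesis oU : open U.
Implicit Types (th : E -> E) (A B : set E) (x : X).

Definition divergence th x : R := bullet (orthoproj x.2) (jacobian th x.1).

Lemma divergenceE th x : Ck 1 th -> divergence th x =
  \sum_i \sum_j ('D_(delta_mx 0 i) th x.1) 0 j * orthoproj x.2 i j.
Proof.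
move=> s; rewrite /divergence /bullet /mxtrace; apply: eq_bigr => i _.
rewrite mxE; apply: eq_bigr => j _; rewrite [(orthoproj _)^T j i]mxE; congr (_ * _).
have df : differentiable th x.1 by exact: C1_differentiable.
by rewrite /jacobian mxE deriveE.
Qed.

Lemma spt_derive th v : spt (fun y => 'D_v th y) `<=` spt th.
Proof.
apply: spt_sub; first exact: closed_spt.
move=> x nx; rewrite (_ : 'D_v th x = 'D_v (fun=> 0) x); first exact: derive_cst.
apply: near_eq_derive.
have : nbhs x (~` spt th) by apply: open_nbhs_nbhs; split => //; exact/closed_openC/closed_spt.
by apply: filterS => y ny; exact: spt_eq0.
Qed.

Lemma test_field_derive th v : test_fields U th -> test_fields U (fun y => 'D_v th y).
Proof.
move=> /test_fieldP[s c u]; apply/test_fieldP; split.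
- exact: Cinf_derive.
- by apply: subclosed_compact c (@spt_derive th v); exact: closed_spt.
- exact: subset_trans (@spt_derive th v) u.
Qed.

Lemma divergence_lin (a : R) th1 th2 x : test_fields U th1 -> test_fields U th2 ->
  divergence (fun y => a *: th1 y + th2 y) x = a * divergence th1 x + divergence th2 x.
Proof.
move=> t1 t2; have t3 := test_field_lin a t1 t2.
have ck th : test_fields U th -> Ck 1 th by move=> /test_fieldP[s _ _]; exact: s.
rewrite !divergenceE; try exact: ck.
rewrite mulr_sumr -big_split/=; apply: eq_bigr => i _.
rewrite mulr_sumr -big_split/=; apply: eq_bigr => j _.
have d th : test_fields U th -> derivable th x.1 (delta_mx 0 i).
  by move=> /test_fieldP[s _ _]; exact: Cinf_derivable.
have e1 : 'D_(delta_mx 0 i) (fun y => a *: th1 y + th2 y) x.1 =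
    a *: 'D_(delta_mx 0 i) th1 x.1 + 'D_(delta_mx 0 i) th2 x.1.
  by apply: derive_lin; exact: d.
by rewrite e1 !mxE mulrDl mulrA.
Qed.

Lemma continuous_divergence th : test_fields U th -> continuous (divergence th).
Proof.
move=> /test_fieldP[s _ _].
rewrite (_ : divergence th = fun x =>
  \sum_i \sum_j ('D_(delta_mx 0 i) th x.1) 0 j * orthoproj x.2 i j); last first.
  by apply/funext => x; apply: divergenceE; exact: s.
apply: continuous_bigsum => i; apply: continuous_bigsum => j; apply: continuous_funM.
  apply: (@continuous_comp_fun _ _ _ fst (fun y => 'D_(delta_mx 0 i) th y 0 j)).
    by move=> x; exact: cvg_fst.
  by apply: Cinf_continuous; apply: Cinf_coord_comp; exact: Cinf_derive.
apply: (@continuous_comp_fun _ _ _ snd (fun P : subspaces R n => orthoproj P i j)).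
  by move=> x; exact: cvg_snd.
exact: continuous_orthoproj_entry.
Qed.

Lemma divergence_eq0 th x : test_fields U th -> ~ spt th x.1 -> divergence th x = 0.
Proof.
move=> /test_fieldP[s _ _] nx; rewrite divergenceE; last exact: s.
rewrite big1// => i _; rewrite big1// => j _.
have -> : 'D_(delta_mx 0 i) th x.1 = 0.
  by apply: (@spt_eq0 _ _ (fun y => 'D_(delta_mx 0 i) th y)) => /spt_derive.
by rewrite mxE mul0r.
Qed.

Lemma divergence_bounded th : test_fields U th ->
  exists2 C, 0 <= C & forall x, `|divergence th x| <= C.
Proof.
move=> t.
have /choice[M hM] : forall i : 'I_n, exists M : R, forall y, enorm ('D_(delta_mx 0 i) th y) <= M.
  by move=> i; apply: test_field_bounded; exact: test_field_derive t.
exists (\sum_(i < n) \sum_(j < n) M i).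
  apply: sumr_ge0 => i _; apply: sumr_ge0 => j _.
  exact: le_trans (enorm_ge0 _) (hM i 0).
move=> x; rewrite divergenceE; last by have /test_fieldP[s _ _] := t; exact: s.
apply: le_trans (ler_norm_sum _ _ _) _; apply: ler_sum => i _.
apply: le_trans (ler_norm_sum _ _ _) _; apply: ler_sum => j _.
rewrite normrM -[leRHS]mulr1; apply: ler_pM => //; last exact: orthoproj_entry.
exact: le_trans (coord_le_enorm _ _) (hM i x.1).
Qed.

Variable V : {outer_measure set X -> \bar R}.
Hypothesis rV : varifold m U V.
Local Notation w := (weight m V).
Let rw : radon_over U [the {outer_measure set E -> \bar R} of weight m V].
Proof. exact: (radon_weight oU rV). Qed.

Let cyl A : <<s open >> A -> V.-caratheodory (A `*` G).
Proof. exact: (cylinder_caratheodory oU rV). Qed.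

Lemma measurable_divergence th : test_fields U th ->
  measurable_fun setT (divergence th : caratheodory_type V -> R).
Proof.
move=> t; apply: continuous_caratheodory; last exact: continuous_divergence.
by move=> O oO; exact: (varifold_open oU rV).
Qed.

Lemma integral_divergence_le th A (C : R) : test_fields U th -> 0 <= C ->
  (forall x, `|divergence th x| <= C) -> V.-caratheodory (A `*` G) ->
  (\int[cmeas V]_(x in A `*` G) `|(divergence th x)%:E| <= C%:E * w (A `&` spt th))%E.
Proof.
move=> t C0 hC cA.
have cS : V.-caratheodory ((A `&` spt th) `*` G).
  rewrite (_ : _ `*` G = (A `*` G) `&` (spt th `*` G)); last first.
    by apply/seteqP; split => -[y P] /=; [move=> [[]]|move=> [[? ?] []]].
  apply: caratheodory_measurable_setI => //; apply: cyl; apply: closed_borel; exact: closed_spt.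
have mS : measurable ((A `&` spt th) `*` G : set (caratheodory_type V)) by exact: cS.
rewrite -[w _]/(cmeas V ((A `&` spt th) `*` G)) -[X in (_ <= _ * _ X)%E]setIT -integral_indic//.
rewrite -ge0_integralZl_EFin//; last by apply/measurable_EFinP; exact: measurable_indic.
have mA : measurable (A `*` G : set (caratheodory_type V)) by exact: cA.
rewrite [leLHS]integral_mkcond; apply: (ge0_le_integral (cmeas V) measurableT).
- by move=> x _; rewrite patchE; case: ifP.
- apply/(measurable_restrictT _ mA); apply: measurable_funTS; apply: measurableT_comp => //.
  by apply/measurable_EFinP; exact: measurable_divergence.
- apply/measurable_EFinP; apply: measurable_funM => //; exact: measurable_indic.
move=> x _; rewrite patchE; case: ifPn => [|_]; last first.
  by rewrite -EFinM lee_fin mulr_ge0// indicE.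
move=> /set_mem[Ax Gx]; rewrite -EFinM/= lee_fin indicE.
have [sx|sx] := pselect (spt th x.1); first by rewrite mem_set ?mulr1.
by rewrite divergence_eq0// normr0 mulr_ge0.
Qed.

Lemma integrable_divergence th A : test_fields U th -> V.-caratheodory (A `*` G) ->
  (cmeas V).-integrable (A `*` G) (EFin \o divergence th).
Proof.
move=> t cA; apply/integrableP; split.
  by apply/measurable_EFinP; apply: measurable_funTS; exact: measurable_divergence.
have [C C0 hC] := divergence_bounded t.
apply: le_lt_trans (integral_divergence_le t C0 hC cA) _.
apply: lte_mul_pinfty; rewrite ?lee_fin//.
apply: (@le_lt_trans _ _ (w (spt th))); first by apply: le_outer_measure; exact: subIsetr.
by have /test_fieldP[_ c u] := t; exact: (radon_ltoo rw).
Qed.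

(** The first variation of V restricted to A, written as an integral for V itself, so that different
    sets A are compared on one sigma-algebra. *)
Definition partial_variation A th : R := \int[cmeas V]_(x in A `*` G) divergence th x.
Local Notation pv := partial_variation.

Lemma first_variation_vrestr A th : V.-caratheodory (A `*` G) -> test_fields U th ->
  first_variation (vrestr m V A) th = pv A th.
Proof.
move=> cA t; rewrite /first_variation /ointegral /Rintegral /partial_variation /Rintegral.
congr fine; apply: integral_orestr => //.
by apply/measurable_EFinP; exact: measurable_divergence.
Qed.

Lemma partial_variation_lin A (a : R) th1 th2 : V.-caratheodory (A `*` G) ->
  test_fields U th1 -> test_fields U th2 ->
  pv A (fun y => a *: th1 y + th2 y) = a * pv A th1 + pv A th2.
Proof.
move=> cA t1 t2; have mA : measurable (A `*` G : set (caratheodory_type V)) by exact: cA.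
transitivity (\int[cmeas V]_(x in A `*` G) (a * divergence th1 x + divergence th2 x)).
  by apply: eq_Rintegral => x _; exact: divergence_lin.
rewrite RintegralD//; [|exact: (integrableZl _ a (integrable_divergence t1 cA))|exact: integrable_divergence].
by rewrite RintegralZl//; exact: integrable_divergence.
Qed.

Lemma partial_variationU A B th : V.-caratheodory (A `*` G) -> V.-caratheodory (B `*` G) ->
  A `&` B = set0 -> test_fields U th -> pv (A `|` B) th = pv A th + pv B th.
Proof.
move=> cA cB AB t.
have eAB : (A `|` B) `*` G = (A `*` G) `|` (B `*` G).
  by apply/seteqP; split => -[y P] /=; [move=> [[? ?|? ?]]; [left|right]|move=> [[? ?]|[? ?]]; split => //; [left|right]].
have mA : measurable (A `*` G : set (caratheodory_type V)) by exact: cA.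
have mB : measurable (B `*` G : set (caratheodory_type V)) by exact: cB.
rewrite /partial_variation eAB; apply: (Rintegral_setU mA mB).
  rewrite -eAB; apply: integrable_divergence => //.
  by rewrite eAB; exact: caratheodory_measurable_setU.
apply/disj_setPS => -[y P] [[/= Ay _] [By _]].
by have : (A `&` B) y by []; rewrite AB.
Qed.

Lemma partial_variation_le th : test_fields U th -> exists2 C, 0 <= C &
  forall A, V.-caratheodory (A `*` G) -> (`|pv A th|%:E <= C%:E * w (A `&` spt th))%E.
Proof.
move=> t; have [C C0 hC] := divergence_bounded t; exists C => // A cA.
apply: le_trans (integral_divergence_le t C0 hC cA).
have mA : measurable (A `*` G : set (caratheodory_type V)) by exact: cA.
have i := integrable_divergence t cA.
by rewrite EFin_normr_Rintegral//; apply: le_abse_integral => //; have /integrableP[] := i.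
Qed.

Lemma partial_variationT th : test_fields U th -> first_variation V th = pv U th.
Proof.
move=> t; have cU : V.-caratheodory (U `*` G) by apply: cyl; exact: sub_gen_smallest.
have cN : V.-caratheodory (~` (U `*` G)) by exact: caratheodory_measurable_setC.
have mN : measurable (~` (U `*` G) : set (caratheodory_type V)) by exact: cN.
have N0 : cmeas V (~` (U `*` G)) = 0%E by case: rV.
have TN : setT `\` ~` (U `*` G) = U `*` G by rewrite setTD setCK.
rewrite /first_variation /ointegral /partial_variation /Rintegral; congr fine.
rewrite -[in RHS]TN; apply: (negligible_integral mN measurableT _ N0).
apply/(negligible_integrable mN measurableT _ N0); last by rewrite TN; exact: integrable_divergence.
by apply/measurable_EFinP; exact: measurable_divergence.
Qed.

Lemma first_variation_lin (a : R) th1 th2 : test_fields U th1 -> test_fields U th2 ->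
  first_variation V (fun y => a *: th1 y + th2 y) =
  a * first_variation V th1 + first_variation V th2.
Proof.
move=> t1 t2; rewrite !partial_variationT//; last exact: test_field_lin.
by apply: partial_variation_lin => //; apply: cyl; exact: sub_gen_smallest.
Qed.

End first_variation.

(** * The distributional boundary as a function of the set *)

Section zero_boundary.
Variables (R : realType) (n m : nat).
Local Notation E := 'rV[R]_n.
Local Notation X := ('rV[R]_n * subspaces R n)%type.
Local Notation G := (@grassmann R n m).
Variable U : set E.
Hypothesis oU : open U.
Variable V : {outer_measure set X -> \bar R}.
Hypothesis rV : varifold m U V.
Hypothesis rdV : radon_variation U V.
Implicit Types (th : E -> E) (A B : set E) (f : E -> E).
Local Notation S := (first_variation V).
Local Notation S' := (L1_extension U S).
Local Notation mu := (Defs.variation U S).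
Local Notation w := (weight m V).
Let rw : radon_over U [the {outer_measure set E -> \bar R} of weight m V].
Proof. exact: (radon_weight oU rV). Qed.
Let Slin := first_variation_lin oU rV.
Let extS : is_L1_extension U S S' := L1_extension_is oU Slin rdV.
Let cyl A : <<s open >> A -> V.-caratheodory (A `*` G).
Proof. exact: (cylinder_caratheodory oU rV). Qed.
Let bmu A : <<s open >> A -> mu.-caratheodory A.
Proof. exact: (radon_borel oU rdV). Qed.

Definition restr_field A th : E -> E := fun x => if x \in A then th x else 0.

Lemma L1_restr_field A th : mu.-caratheodory A -> test_fields U th ->
  L1_fields mu (restr_field A th).
Proof.
move=> cA t; have /test_fieldP[s _ _] := t; split.
  move=> O oO; have oP : open (th @^-1` O).
    by apply: open_comp => // x _; exact: Cinf_continuous.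
  have -> : restr_field A th @^-1` O =
      (A `&` th @^-1` O) `|` (~` A `&` [set x | O 0]).
    apply/seteqP; split => x; rewrite /restr_field /=.
      by case: ifPn => [/set_mem|/negP xA] Ox; [left|right]; split => // /mem_set.
    move=> [[Ax Ox]|[Ax O0]]; first by rewrite mem_set.
    by rewrite memNset.
  apply: caratheodory_measurable_setU; apply: caratheodory_measurable_setI => //.
  - exact: (radon_open oU rdV).
  - exact: caratheodory_measurable_setC.
  - have [h0|h0] := pselect (O 0).
      by rewrite (_ : [set _ | _] = setT)//; [by apply: bmu; apply: sub_gen_smallest; exact: openT|apply/seteqP; split].
    by rewrite (_ : [set _ | _] = set0)//; [by apply: bmu; apply: sub_gen_smallest; exact: open0|apply/seteqP; split].
apply: le_lt_trans (L1norm_test oU rdV t).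
have mt := test_mfield oU rdV t.
apply: L1norm_le => //; first exact: mfield_indic.
by move=> x; rewrite /restr_field; case: ifP => // _; rewrite enorm0 enorm_ge0.
Qed.

Lemma L1_fieldsZ (a : R) f : L1_fields mu f -> L1_fields mu (fun x => a *: f x).
Proof.
move=> Lf; have mf := L1_mfield Lf; have [fo foo] := Lf; split.
  move=> O oO; apply: (fo ((fun y : E => a *: y) @^-1` O)).
  apply: open_comp => // x _; exact: scaler_continuous.
rewrite -[(\int[_]_x _)%E]/(L1norm mu (fun x => a *: f x)) (L1normZ a mf).
by apply: lte_mul_pinfty; rewrite ?lee_fin.
Qed.

(** Continuity at 0 with tolerance 1 yields a radius d, and homogeneity turns it into the constant
    1/d. *)
Lemma L1_extension_bound : exists2 C, 0 < C &
  forall f, L1_fields mu f -> (`|S' f|%:E <= C%:E * L1norm mu f)%E.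
Proof.
have [e1 lin cont] := extS.
have t0 : test_fields U (fun=> 0 : E) := test_field0 U.
have S0 : S (fun=> 0) = 0.
  have := Slin 1 t0 t0; rewrite (_ : (fun x : E => 1 *: (0 : E) + 0) = (fun=> 0)).
    by rewrite mul1r => /(congr1 (fun z => z - S (fun=> 0))); rewrite subrr addrK.
  by apply/funext => x; rewrite scaler0 addr0.
have L0 : L1_fields mu (fun=> 0 : E).
  rewrite (_ : (fun=> 0) = restr_field setT (fun=> 0)).
    by apply: L1_restr_field => //; apply: bmu; apply: sub_gen_smallest; exact: openT.
  by apply/funext => x; rewrite /restr_field; case: ifP.
have S'0 : S' (fun=> 0) = 0 by rewrite e1.
have [d d0 hd] := cont _ L0 1 ltr01.
exists d^-1; first by rewrite invr_gt0.
move=> f Lf; have [_ foo] := Lf.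
have ffin : L1norm mu f \is a fin_num by rewrite ge0_fin_numE// L1norm_ge0.
pose r := fine (L1norm mu f); have fE : L1norm mu f = r%:E by rewrite fineK.
rewrite fE -EFinM lee_fin.
have r0 : 0 <= r by apply/fine_ge0/L1norm_ge0.
rewrite ler_pdivlMl//; apply/ler_addgt0Pr => e e0.
have re : 0 < r + e by rewrite ltr_wpDl.
(* Scales f to norm strictly below d; adding e avoids dividing by 0 when f has norm 0. *)
pose t := d / (r + e).
have tp : 0 < t by rewrite divr_gt0.
have Lt := L1_fieldsZ t Lf.
have := hd _ Lt; rewrite S'0 subr0.
have -> : S' (fun x => t *: f x) = t * S' f.
  have := lin t _ _ Lf L0; rewrite S'0 addr0 => <-; congr S'.
  by apply/funext => x; rewrite addr0.
rewrite (_ : (\int[cmeas mu]_x _)%E = (t * r)%:E); last first.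
  under eq_integral do rewrite subr0.
  rewrite -[LHS]/(L1norm mu (fun x => t *: f x)) (L1normZ t (L1_mfield Lf)) gtr0_norm//.
  by rewrite fE.
rewrite lte_fin normrM (gtr0_norm tp) => h.
have /h : t * r < d.
  by rewrite /t mulrAC ltr_pdivrMr// ltr_pM2l// ltrDl.
rewrite /t mulrAC ltr_pdivrMr// mul1r => /ltW.
by [].
Qed.

Lemma dist_boundaryE A th : V.-caratheodory (A `*` G) -> test_fields U th ->
  dist_boundary m U V A th = S' (restr_field A th) - partial_variation m V A th.
Proof. by move=> cA t; rewrite /dist_boundary (first_variation_vrestr oU rV). Qed.

Lemma dist_boundaryU A B th : <<s open >> A -> <<s open >> B -> A `&` B = set0 ->
  test_fields U th ->
  dist_boundary m U V (A `|` B) th = dist_boundary m U V A th + dist_boundary m U V B th.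
Proof.
move=> bA bB AB t.
have bAB : <<s open >> (A `|` B).
  by rewrite -bigcup2E; apply: sigma_algebra_bigcup => -[|[|i]] //=;
    have [] := smallest_sigma_algebra (@setT E) (@open E).
rewrite !dist_boundaryE//; try exact: cyl.
rewrite (partial_variationU oU rV (cyl bA) (cyl bB))//.
have [_ lin _] := extS.
have := lin 1 _ _ (L1_restr_field (bmu bA) t) (L1_restr_field (bmu bB) t).
rewrite (_ : (fun x => _) = restr_field (A `|` B) th); first by move=> ->; ring.
apply/funext => x; rewrite scale1r /restr_field in_setU.
case: ifPn => xA /=; last by rewrite add0r.
rewrite ifF ?addr0//; apply/negP => xB.
have : (A `&` B) x by split; exact: set_mem.
by rewrite AB.
Qed.

Lemma dist_boundaryT th : test_fields U th -> dist_boundary m U V U th = 0.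
Proof.
move=> t; rewrite dist_boundaryE//; last by apply: cyl; exact: sub_gen_smallest.
rewrite -(partial_variationT oU rV t); have [e1 _ _] := extS.
rewrite (_ : restr_field U th = th) ?e1 ?subrr//.
apply/funext => x; rewrite /restr_field; case: ifPn => // /negP xU.
rewrite (@spt_eq0 _ _ th x)// => sx; apply: xU; apply/mem_set.
by have /test_fieldP[_ _] := t; exact.
Qed.

(** Only the part of A in the support of th matters, and there both measures are finite. This gives
    continuity along sets decreasing to the empty set. *)
Lemma dist_boundary_le th : test_fields U th -> exists2 C, 0 <= C &
  forall A, <<s open >> A ->
    (`|dist_boundary m U V A th|%:E <= C%:E * (mu (A `&` spt th) + w (A `&` spt th)))%E.
Proof.
move=> t; have [C1 C10 h1] := L1_extension_bound.
have [C2 C20 h2] := partial_variation_le oU rV t.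
have [M hM] := test_field_bounded t.
have M0 : 0 <= M by apply: le_trans (hM 0); exact: enorm_ge0.
exists (C1 * M + C2); first by rewrite addr_ge0// mulr_ge0// ltW.
move=> A bA; rewrite dist_boundaryE//; last exact: cyl.
apply: (@le_trans _ _ (`|S' (restr_field A th)|%:E + `|partial_variation m V A th|%:E)%E).
  by rewrite -EFinD lee_fin ler_normB.
have cAS : mu.-caratheodory (A `&` spt th).
  apply: caratheodory_measurable_setI; first exact: bmu.
  by apply: (radon_closed oU rdV); exact: closed_spt.
have i1 : (L1norm mu (restr_field A th) <= M%:E * mu (A `&` spt th))%E.
  have mAS : measurable (A `&` spt th : set (caratheodory_type mu)) by exact: cAS.
  rewrite -[mu (A `&` _)]/(cmeas mu (A `&` spt th)) -[X in (_ <= _ * _ X)%E]setIT -integral_indic//.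
  rewrite -ge0_integralZl_EFin//; last by apply/measurable_EFinP; exact: measurable_indic.
  apply: (ge0_le_integral (cmeas mu) measurableT).
  - by move=> x _; rewrite lee_fin enorm_ge0.
  - by apply: mfield_enormE; apply: L1_mfield; apply: L1_restr_field => //; exact: bmu.
  - by apply/measurable_EFinP; apply: measurable_funM => //; exact: measurable_indic.
  move=> x _; rewrite -EFinM lee_fin indicE /restr_field.
  case: ifPn => [/set_mem xA|_]; last by rewrite enorm0 mulr_ge0.
  have [sx|sx] := pselect (spt th x); first by rewrite mem_set ?mulr1.
  by rewrite (spt_eq0 sx) enorm0 mulr_ge0.
have h := leeD (le_trans (h1 _ (L1_restr_field (bmu bA) t))
  (lee_wpmul2l (_ : (0 <= C1%:E)%E) i1)) (h2 _ (cyl bA)).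
apply: le_trans (h _) _; first by rewrite lee_fin ltW.
rewrite muleA -EFinM.
have a0 := outer_measure_ge0 mu (A `&` spt th).
have b0 : (0 <= w (A `&` spt th))%E by exact: outer_measure_ge0.
rewrite ge0_muleDr//; apply: leeD; apply: lee_wpmul2r => //; rewrite lee_fin.
  by rewrite lerDl.
by rewrite lerDr mulr_ge0// ltW.
Qed.

(** Borel sets are measurable for ||V|| and ||δV||, their cylinders for V, and all this persists for
    restrictions of V. *)
Definition boundaryless A : Prop :=
  [/\ <<s open >> A, A `<=` U & zero_boundary m U V A].

Lemma boundarylessT : boundaryless U.
Proof. by split => //; [exact: sub_gen_smallest|exact: dist_boundaryT]. Qed.

Lemma borelD A B : <<s open >> A -> <<s open >> B -> <<s @open E >> (A `\` B).
Proof.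
have [_ sD sU] := smallest_sigma_algebra (@setT E) (@open E) => bA bB.
rewrite setDE -[A `&` _]setCK setCI setCK -setTD; apply: (sD).
rewrite -bigcup2E; apply: sU => -[|[|i]] //=; first by rewrite -setTD; exact: (sD).
by have [] := smallest_sigma_algebra (@setT E) (@open E).
Qed.

Lemma borelI A B : <<s open >> A -> <<s open >> B -> <<s @open E >> (A `&` B).
Proof.
move=> bA bB; rewrite (_ : A `&` B = A `\` (A `\` B)); first by apply: borelD => //; exact: borelD.
by rewrite setDD.
Qed.

Lemma boundarylessD A B : boundaryless A -> boundaryless B -> A `<=` B ->
  boundaryless (B `\` A).
Proof.
move=> [bA AU zA] [bB BU zB] AB; have bD := borelD bB bA; split => //.
  by move=> x [/BU].
move=> th t; have : dist_boundary m U V (A `|` (B `\` A)) th = 0.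
  rewrite (_ : A `|` (B `\` A) = B); first exact: zB.
  by apply/seteqP; split => x; [move=> [/AB|[]]|have [|] := pselect (A x); [left|right]].
rewrite dist_boundaryU//; first by rewrite zA// add0r.
by apply/seteqP; split => // x [? []].
Qed.

(** By additivity the boundary of the union equals that of each remainder D i, and the remainders
    decrease to the empty set. *)
Lemma boundaryless_bigcup_nd (F : nat -> set E) : (forall i, boundaryless (F i)) ->
  (forall i j, (i <= j)%N -> F i `<=` F j) -> boundaryless (\bigcup_i F i).
Proof.
move=> zF ndF.
have bF : <<s open >> (\bigcup_i F i) by apply: sigma_algebra_bigcup => i; have [] := zF i.
have FU : \bigcup_i F i `<=` U by move=> x [i _]; have [_ + _] := zF i; exact.
split => // th t.
pose D i := (\bigcup_i F i) `\` F i.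
have bD i : <<s open >> (D i) by apply: borelD => //; have [] := zF i.
have e1 i : dist_boundary m U V (\bigcup_i F i) th = dist_boundary m U V (D i) th.
  rewrite [in LHS](_ : \bigcup_i F i = F i `|` D i); last first.
    apply/seteqP; split => x; last by move=> [Fx|[]]; [exists i|].
    by move=> Fx; have [|] := pselect (F i x); [left|right].
  have [b1 _ z1] := zF i.
  rewrite dist_boundaryU//; first by rewrite z1// add0r.
  by apply/seteqP; split => // x [? []].
have [C C0 hC] := dist_boundary_le t.
have /test_fieldP[_ cS SU] := t.
have cv (nu : {outer_measure set E -> \bar R}) : radon_over U nu ->
    nu (D i `&` spt th) @[i --> \oo] --> 0%E.
  move=> rnu; have bn A : <<s open >> A -> nu.-caratheodory A by exact: (radon_borel oU rnu).
  have cD i : nu.-caratheodory (D i `&` spt th).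
    by apply: caratheodory_measurable_setI; [exact: bn|apply: (radon_closed oU rnu); exact: closed_spt].
  have e0 : \bigcap_i (D i `&` spt th) = set0.
    apply/seteqP; split => // x Dx; have [[[i _ Fx] _] _] := Dx 0%N Logic.I.
    by have [[_ []]] := Dx i Logic.I.
  have := @nonincreasing_cvg_mu _ _ _ (cmeas nu) (fun i => D i `&` spt th : set (caratheodory_type nu)).
  rewrite e0 measure0; apply => //.
  - apply: (@le_lt_trans _ _ (nu (spt th))); first by apply: le_outer_measure; exact: subIsetr.
    exact: (radon_ltoo rnu).
  - by move=> i j ij; apply/subsetPset; apply: setSI; apply: setDS; exact: ndF.
have cvC : (C%:E * (mu (D i `&` spt th) + w (D i `&` spt th)) @[i --> \oo] --> 0)%E.
  rewrite -(mule0 C%:E); apply: cvgeZl => //; rewrite -(adde0 0%E).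
  by apply: cvgeD => //; [exact: cv rdV|exact: cv rw].
apply/eqP; rewrite -normr_le0 -lee_fin -[leRHS](cvg_lim _ cvC)//.
apply: lime_ge; first by apply/cvg_ex; eexists; exact: cvC.
by apply: nearW => i; rewrite (e1 i); exact: hC.
Qed.

Lemma boundaryless_bigcap (F : nat -> set E) : (forall i, boundaryless (F i)) ->
  (forall i j, (i <= j)%N -> F j `<=` F i) -> boundaryless (\bigcap_i F i).
Proof.
move=> zF ndF.
have -> : \bigcap_i F i = U `\` \bigcup_i (U `\` F i).
  apply/seteqP; split => x.
    move=> Fx; split; first by have [_ + _] := zF 0%N; apply; exact: Fx.
    by move=> [i _ [_]]; apply; exact: Fx.
  by move=> [Ux nx] i _; apply: contrapT => Fx; apply: nx; exists i.
apply: boundarylessD; [|exact: boundarylessT|by move=> x [i _ []]].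
apply: boundaryless_bigcup_nd => [i|i j ij].
  by apply: boundarylessD; [exact: zF|exact: boundarylessT|have [] := zF i].
by apply: setDS; exact: ndF.
Qed.

End zero_boundary.

(** Trace against Q of the derivative of a radial field f(|y|^2) y: with k = f and g = f', the
    derivative in direction v is k v + 2 g (y . v) y, a multiple of the identity plus a term of rank
    one. *)
Lemma rank_one_trace (R : comNzRingType) (n : nat) (k g : R) (y : 'rV[R]_n) (Q : 'M[R]_n) :
  \sum_i \sum_j (k *: (delta_mx 0 i : 'rV[R]_n) +
    (g * (2 * \sum_l y 0 l * (delta_mx 0 i : 'rV[R]_n) 0 l)) *: y) 0 j * Q i j =
  k * \tr Q + 2 * g * (y *m Q *m y^T) 0 0.
Proof.
rewrite /mxtrace mulr_sumr mxE mulr_sumr.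
transitivity (\sum_i \sum_j (k * ((i == j)%:R * Q i j) + 2 * g * (y 0 i * Q i j * y 0 j))).
  apply: eq_bigr => i _; apply: eq_bigr => j _.
  have -> : \sum_l y 0 l * (delta_mx 0 i : 'rV[R]_n) 0 l = y 0 i.
    rewrite (bigD1 i)//= mxE !eqxx mulr1 big1 ?addr0// => l li.
    by rewrite mxE eqxx (negPf li) mulr0.
  by rewrite !mxE eqxx /= eq_sym; ring.
under eq_bigr do rewrite big_split/=.
rewrite big_split/=; congr (_ + _).
  apply: eq_bigr => i _; rewrite (bigD1 i)//= eqxx mul1r big1 ?addr0// => j ji.
  by rewrite eq_sym (negPf ji) mul0r mulr0.
rewrite exchange_big; apply: eq_bigr => j _.
by rewrite -mulr_sumr; congr (_ * _); rewrite !mxE mulr_suml.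
Qed.

(** * The radial field of the monotonicity inequality *)

Section monotonicity_field.
Variable R : realType.

Lemma powR_half (t : R) (m : nat) : 0 < t -> (t ^+ 2) `^ (- (m%:R / 2)) = t ^- m.
Proof.
move=> t0; rewrite powRN -powR_mulrn ?(ltW t0)// -powRrM.
by rewrite (_ : 2%:R * (m%:R / 2) = m%:R); [rewrite powR_mulrn// ltW|field].
Qed.

Lemma ler_powR_half (z t : R) (m : nat) : 0 < t -> t ^+ 2 <= z ->
  z `^ (- (m%:R / 2)) <= t ^- m.
Proof.
move=> t0 tz; have t20 : 0 < t ^+ 2 by rewrite exprn_gt0.
have z0 : 0 < z by exact: lt_le_trans tz.
rewrite -powR_half// !powRN lef_pV2 ?posrE ?powR_gt0//.
by apply: ge0_ler_powR => //; rewrite ?nnegrE ?ltW.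
Qed.

Lemma ger_powR_half (z t : R) (m : nat) : 0 < z -> 0 < t -> z <= t ^+ 2 ->
  t ^- m <= z `^ (- (m%:R / 2)).
Proof.
move=> z0 t0 tz; have t20 : 0 < t ^+ 2 by rewrite exprn_gt0.
rewrite -powR_half// !powRN lef_pV2 ?posrE ?powR_gt0//.
by apply: ge0_ler_powR => //; rewrite ?nnegrE ?ltW.
Qed.

Variables (n m : nat).
Hypothesis m_gt0 : (0 < m)%N.
Local Notation E := 'rV[R]_n.
Variables (a : E) (r s : R).
Hypotheses (r0 : 0 < r) (s0 : 0 < s) (sr : 2 * s <= r).
Local Notation p := (- (m%:R / 2) : R).

Let z (x : E) : R := sqn (x - a) + s ^+ 2.

Let z0 x : 0 < z x.
Proof. by rewrite ltr_wpDl ?sqn_ge0// exprn_gt0. Qed.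

Definition mono_profile (x : E) : R := z x `^ p * sbump a r x.

(* Smooth version of |x - a|^{-m} (x - a), regularised at scale s and cut off
   at scale r. *)
Definition mono_field (x : E) : E := mono_profile x *: (x - a).

Lemma Cinf_mono_profile : Cinf mono_profile.
Proof.
apply: (@CinfZ _ _ _ (fun x => z x `^ p) (sbump a r)); last exact: Cinf_sbump.
apply: Cinf_powR => //; apply: CinfD; [exact: Cinf_sqn|exact: Cinf_cst].
Qed.

Lemma Cinf_mono_field : Cinf mono_field.
Proof.
by apply: CinfZ; [exact: Cinf_mono_profile|apply: CinfB; [exact: Cinf_id|exact: Cinf_cst]].
Qed.

Lemma mono_field_eq0 x : r <= enorm (x - a) -> mono_field x = 0.
Proof. by move=> h; rewrite /mono_field /mono_profile sbump_eq0// mulr0 scale0r. Qed.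

Let B (v x : E) : R := 2 * \sum_i (x - a) 0 i * v 0 i.

Lemma derive_sqn (x v : E) : 'D_v (fun x => sqn (x - a)) x = B v x.
Proof.
rewrite -derive_line.
pose f (h : R) : R := h *: sqn v + B v x.
rewrite (_ : (fun h : R => _) = (fun h : R => 1 *: (h *: f h) + sqn (x - a))); last first.
  apply/funext => h; rewrite (_ : h *: v + x - a = (x - a) + h *: v); last by rewrite -addrA addrC.
  rewrite sqnD sqnZ (_ : \sum_i _ = h * \sum_i (x - a) 0 i * v 0 i).
    by rewrite scale1r /f /B /GRing.scale/=; ring.
  rewrite mulr_sumr; apply: eq_bigr => i _; rewrite [X in _ * X = _]mxE mulrCA.
  by [].
have Cf : Cinf f by apply: CinfD; [apply: CinfZ; [exact: Cinf_id|exact: Cinf_cst]|exact: Cinf_cst].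
have Ci : Cinf (fun h : R => h) by exact: Cinf_id.
have Cif : Cinf (fun h : R => h *: f h) by exact: CinfZ.
rewrite (@derive_lin _ _ _ (fun h : R => h *: f h) (fun=> sqn (x - a))); last 2 first.
- exact: Cinf_derivable.
- exact: derivable_cst.
rewrite derive_cst addr0 scale1r.
have D := is_derive_scale (Cinf_continuous Ci (x := 0)) (Cinf_derivable (x := 0) (v := 1 : R) Ci) (Cinf_derivable (x := 0) (v := 1 : R) Cf).
rewrite (@derive_val _ _ _ _ _ _ _ D) scale0r add0r.
by rewrite (@derive_id R R^o) /f scale0r add0r scale1r.
Qed.

(** Derivative of [mono_profile] with respect to the squared distance |x - a|^2; the gradient is
    twice this times x - a. *)
Definition mono_slope (x : E) : R :=
  p * z x `^ (p - 1) * sbump a r x + z x `^ p * ('D_1 (@cutoff R) (r ^- 2 * sqn (x - a)) * r ^- 2).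

Lemma derive_mono_profile (x v : E) : 'D_v mono_profile x = mono_slope x * B v x.
Proof.
have Cs : Cinf (fun x => sqn (x - a)) by exact: Cinf_sqn.
have Cz : Cinf z by apply: CinfD => //; exact: Cinf_cst.
have Cp : Cinf (fun x => z x `^ p) by exact: Cinf_powR.
have Cb : Cinf (sbump a r) by exact: Cinf_sbump.
have Dz : 'D_v z x = B v x.
  rewrite (_ : z = (fun x => 1 *: sqn (x - a) + s ^+ 2)); last first.
    by apply/funext => y; rewrite scale1r.
  rewrite (@derive_lin _ _ _ (fun x => sqn (x - a)) (fun=> s ^+ 2)); last 2 first.
  - exact: Cinf_derivable.
  - exact: derivable_cst.
  by rewrite derive_cst addr0 scale1r derive_sqn.
have Dp : 'D_v (fun x => z x `^ p) x = p * z x `^ (p - 1) * B v x.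
  have h := is_derive1_powR p (z0 x).
  have := is_derive_comp1 (Cinf_derivable (x := x) (v := v) Cz) (@ex_derive _ _ _ _ _ _ _ h).
  move=> h2; rewrite (@derive_val _ _ _ _ _ _ _ h2) Dz.
  by rewrite (@derive_val _ _ _ _ _ _ _ h).
have Crs : Cinf (fun x => r ^- 2 * sqn (x - a)).
  by apply: (@CinfZ _ _ _ (fun=> r ^- 2) (fun x => sqn (x - a))) => //; exact: Cinf_cst.
have Db : 'D_v (sbump a r) x = 'D_1 (@cutoff R) (r ^- 2 * sqn (x - a)) * r ^- 2 * B v x.
  have h := is_derive_comp1 (Cinf_derivable (x := x) (v := v) Crs)
    (Cinf_derivable (x := r ^- 2 * sqn (x - a)) (v := 1 : R) (@Cinf_cutoff R)).
  rewrite /sbump (@derive_val _ _ _ _ _ _ _ h) -mulrA; congr (_ * _).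
  rewrite (_ : (fun x => _) = (fun x => r ^- 2 *: sqn (x - a) + 0)); last first.
    by apply/funext => y; rewrite addr0.
  rewrite (@derive_lin _ _ _ (fun x => sqn (x - a)) (fun=> 0)); last 2 first.
  - exact: Cinf_derivable.
  - exact: derivable_cst.
  by rewrite derive_cst addr0 derive_sqn.
have D := is_derive_scale (Cinf_continuous Cp (x := x)) (Cinf_derivable (x := x) (v := v) Cp) (Cinf_derivable (x := x) (v := v) Cb).
rewrite (@derive_val _ _ _ _ _ _ _ D) Dp Db /mono_slope /GRing.scale/=.
ring.
Qed.

Lemma divergence_mono_field (P : subspaces R n) (x : E) : grassmann m P ->
  divergence mono_field (x, P) = m%:R * mono_profile x +
    2 * mono_slope x * ((x - a) *m orthoproj P *m (x - a)^T) 0 0.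
Proof.
move=> GP; rewrite divergenceE; last exact: Cinf_mono_field.
have Ci : Cinf (fun x : E => x - a) by apply: CinfB; [exact: Cinf_id|exact: Cinf_cst].
have dE (v : E) : 'D_v mono_field x = mono_profile x *: v + (mono_slope x * B v x) *: (x - a).
  have D := is_derive_scale (Cinf_continuous Cinf_mono_profile (x := x))
    (Cinf_derivable (x := x) (v := v) Cinf_mono_profile) (Cinf_derivable (x := x) (v := v) Ci).
  rewrite (@derive_val _ _ _ _ _ _ _ D) derive_mono_profile; congr (_ *: _ + _).
  rewrite (_ : (fun x => x - a) = (fun x => 1 *: x + (fun=> - a) x)); last first.
    by apply/funext => y; rewrite scale1r.
  rewrite derive_lin; [|exact: derivable_id|exact: derivable_cst].
  by rewrite derive_cst addr0 scale1r derive_id.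
under eq_bigr do under eq_bigr do rewrite dE.
by rewrite rank_one_trace orthoproj_trace GP mulrC.
Qed.

Let enorm_sqn (x : E) (t : R) : 0 <= t -> (enorm (x - a) <= t) = (sqn (x - a) <= t ^+ 2).
Proof. by move=> t0; rewrite -sqr_enorm ler_pXn2r// nnegrE// enorm_ge0. Qed.

Let powRB1 x : z x `^ (p - 1) = z x `^ p / z x.
Proof.
rewrite powRB; last by apply/implyP => _; rewrite gt_eqF.
by rewrite powRr1// ltW.
Qed.

(** Let T = |P(x - a)|^2, so that T <= |x - a|^2 <= z. Since 2 p = -m, the terms without derivative
    of the cut-off combine to m z^p (1 - T/z) times the bump, which is nonnegative everywhere and
    large on the ball of radius s. The negative contribution comes from the derivative of the
    cut-off, for r/2 < |x - a| < r. *)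
Lemma divergence_mono_field_ge (L : R) (P : subspaces R n) (x : E) :
  (forall t, `|'D_1 (@cutoff R) t| <= L) -> grassmann m P ->
  2 ^- m.+1 * s ^- m * \1_(eball a s) x - 2 ^+ m.+1 * L * r ^- m * \1_(eball a r) x <=
  divergence mono_field (x, P).
Proof.
move=> hL GP; rewrite divergence_mono_field// /mono_profile /mono_slope powRB1.
set T := (_ *m _) 0 0; have T0 : 0 <= T by exact: dot_orthoproj_ge0.
have Tq : T <= sqn (x - a) by exact: dot_orthoproj_le.
clearbody T; have zp0 : 0 < z x `^ p by exact: powR_gt0.
set zp := z x `^ p in zp0 *; have zx0 := z0 x.
have L0 : 0 <= L by apply: le_trans (hL 0).
have r20 : 0 < r ^+ 2 by rewrite exprn_gt0.
have m1 : 1 <= m%:R :> R by rewrite ler1n.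
have C0 : 0 <= 2 ^+ m.+1 * L * r ^- m.
  by apply: divr_ge0; [apply: mulr_ge0 => //; exact: exprn_ge0|apply: exprn_ge0; exact: ltW].
have Tz : T / z x <= 1.
  by rewrite ler_pdivrMr// mul1r; apply: le_trans Tq _; rewrite lerDl sqr_ge0.
have main (c d : R) : m%:R * (zp * c) + 2 * (p * (zp / z x) * c + zp * (d * r ^- 2)) * T =
    m%:R * zp * c * (1 - T / z x) + 2 * zp * (d * (T / r ^+ 2)).
  by field; rewrite gt_eqF ?gt_eqF.
rewrite main.
(* In the inner ball the bump is 1, z <= 2 s^2 <= (2 s)^2 and T/z <= 1/2; this produces the factor
   2^-m s^-m and the further factor 1/2. *)
have [xs|xs] := leP (enorm (x - a)) s.
  have xr : enorm (x - a) <= r.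
    by apply: le_trans xs (le_trans _ sr); rewrite ler_peMl ?ltW// ltr1n.
  have qs : sqn (x - a) <= s ^+ 2 by rewrite -enorm_sqn// ltW.
  rewrite sbump_eq1//; last by rewrite ler_pdivlMr// mulrC; apply: le_trans sr; rewrite ler_pM2l.
  rewrite derive_cutoff_eq0; last first.
    left; rewrite mulrC ler_pdivrMr//.
    apply: le_trans qs _; rewrite -ler_pdivrMl// (_ : (1 / 4)^-1 = 4); last by field.
    rewrite (_ : 4 * s ^+ 2 = (2 * s) ^+ 2); last by ring.
    by apply: lerXn2r => //; rewrite nnegrE ltW// mulr_gt0.
  rewrite mul0r mulr0 addr0 mulr1 !indicE !mem_set// !mulr1.
  apply: (@le_trans _ _ (zp / 2)).
    apply: (@le_trans _ _ (2 ^- m.+1 * s ^- m)).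
      by rewrite gerBl.
    have -> : 2 ^- m.+1 * s ^- m = (2 * s) ^- m / 2.
      by rewrite exprS exprMn; field; rewrite !expf_neq0// gt_eqF.
    rewrite ler_wpM2r//; apply: ger_powR_half => //; first by rewrite mulr_gt0.
    rewrite /z exprMn; have : 0 <= s ^+ 2 by exact: sqr_ge0.
    by move: qs; lra.
  have T2 : T / z x <= 1 / 2.
    rewrite ler_pdivrMr//; apply: le_trans Tq _; rewrite /z; lra.
  have h : zp <= m%:R * zp by rewrite ler_peMl// ltW.
  have : 1 / 2 <= 1 - T / z x by lra.
  move=> /(ler_wpM2l (ltW zp0)); rewrite mul1r => /le_trans; apply.
  by rewrite ler_wpM2r//; lra.
rewrite [in X in X - _]indicE memNset; last by rewrite /eball /=; apply/negP; rewrite -ltNge.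
rewrite mulr0 sub0r.
have [xr|xr] := leP (enorm (x - a)) r; last first.
  rewrite sbump_eq0//; last exact: ltW.
  rewrite derive_cutoff_eq0; last first.
    right; rewrite mulrC ler_pdivlMr// mul1r -sqr_enorm ler_pXn2r ?nnegrE ?enorm_ge0 ?ltW//.
  by rewrite indicE memNset ?mulr0 ?mul0r ?mulr0 ?oppr0 ?addr0//; apply/negP; rewrite -ltNge.
rewrite indicE mem_set// mulr1.
have h1 : 0 <= m%:R * zp * sbump a r x * (1 - T / z x).
  have sb0 : 0 <= sbump a r x by exact: cutoff_ge0.
  apply: mulr_ge0; last by rewrite subr_ge0.
  by apply: mulr_ge0 => //; rewrite mulr_ge0// ltW.
apply: le_trans (_ : 2 * zp * ('D_1 (@cutoff R) (r ^- 2 * sqn (x - a)) * (T / r ^+ 2)) <= _); last first.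
  by rewrite lerDr.
have [q4|q4] := leP (r ^- 2 * sqn (x - a)) (1 / 4).
  rewrite derive_cutoff_eq0; last by left.
  by rewrite mul0r mulr0 oppr_le0 !mulr_ge0// ?invr_ge0 ?exprn_ge0 ?ltW.
(* Here |x - a| > r/2, and z^p is at most (r/2)^-m. *)
have zpr : zp <= 2 ^+ m * r ^- m.
  rewrite (_ : 2 ^+ m * r ^- m = (r / 2) ^- m); last by rewrite exprMn exprVn; field; rewrite !expf_neq0// gt_eqF.
  apply: ler_powR_half; first by rewrite divr_gt0.
  move: q4; rewrite (mulrC (r ^- 2)) ltr_pdivlMr// => q4.
  apply: (@le_trans _ _ (sqn (x - a))); last by rewrite lerDl sqr_ge0.
  by apply: le_trans (ltW q4); rewrite (_ : (r / 2) ^+ 2 = 1 / 4 * r ^+ 2)//; field.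
have Tr : T / r ^+ 2 <= 1.
  by rewrite ler_pdivrMr// mul1r; apply: le_trans Tq _; rewrite -enorm_sqn// ltW.
rewrite lerNl -mulrN -mulNr.
have hD : - 'D_1 (@cutoff R) (r ^- 2 * sqn (x - a)) <= L.
  by apply: le_trans (hL (r ^- 2 * sqn (x - a))); rewrite -normrN ler_norm.
have D0 : 0 <= - 'D_1 (@cutoff R) (r ^- 2 * sqn (x - a)) by rewrite oppr_ge0 derive_cutoff_le0.
have Tr0 : 0 <= T / r ^+ 2 by rewrite divr_ge0// ltW.
have h2 := ler_pM D0 Tr0 hD Tr.
rewrite (_ : 2 ^+ m.+1 * L * r ^- m = 2 * (2 ^+ m * r ^- m) * (L * 1)); last by rewrite exprS; ring.
apply: ler_pM h2; last by rewrite ler_pM2l.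
  by rewrite mulr_ge0// ltW.
exact: mulr_ge0.
Qed.

(** The radius t is adapted to the point and bounds the field by t^-m t; tau is the smaller dyadic
    radius in terms of which the bounds are summed. *)
Lemma mono_field_le (x : E) (t tau : R) : 0 < tau -> tau <= t -> enorm (x - a) <= t ->
  t ^+ 2 <= z x -> enorm (mono_field x) <= tau ^- m.-1.
Proof.
move=> tau0 taut xt tz; have t0 : 0 < t by exact: lt_le_trans taut.
have zp0 : 0 <= z x `^ p by exact: powR_ge0.
have sb0 : 0 <= sbump a r x by exact: cutoff_ge0.
have pr0 := mulr_ge0 zp0 sb0.
rewrite /mono_field enormZ /mono_profile (ger0_norm pr0).
apply: (@le_trans _ _ (t ^- m * t)).
  apply: (ler_pM pr0 (enorm_ge0 _)) => //.
  apply: (@le_trans _ _ (z x `^ p)); first by rewrite ler_piMr// cutoff_le1.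
  exact: ler_powR_half.
have -> : t ^- m * t = t ^- m.-1.
  by rewrite -[in LHS](prednK m_gt0) exprS invfM mulrAC mulVf ?mul1r// gt_eqF.
by rewrite lef_pV2 ?posrE ?exprn_gt0// lerXn2r// nnegrE ltW.
Qed.

End monotonicity_field.

Lemma geometric34 (R : realFieldType) (p q : nat) :
  \sum_(p <= k < q) (3 / 4) ^+ k <= 4 * (3 / 4) ^+ p :> R.
Proof.
have h j : \sum_(p <= k < p + j) (3 / 4) ^+ k = 4 * ((3 / 4) ^+ p - (3 / 4) ^+ (p + j)) :> R.
  elim: j => [|j IH]; first by rewrite addn0 big_geq// subrr mulr0.
  by rewrite addnS big_nat_recr ?leq_addr//= IH exprS; field.
have [pq|pq] := leqP p q; last by rewrite big_geq ?(ltnW pq)// mulr_ge0// exprn_ge0// divr_ge0.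
by rewrite -(subnKC pq) h ler_pM2l// gerBl exprn_ge0// divr_ge0.
Qed.

Lemma dyadic_shell (R : realType) (p l : nat) (t : R) : t < 2^-p -> 2^-l < t ->
  exists k, [/\ (p <= k < l)%N, 2^-k.+1 <= t & t <= 2^-k].
Proof.
move=> tp lt; have ex : exists j, 2^-j < t by exists l.
case: (ex_minnP ex) => j jt jmin.
have pj : (p < j)%N.
  rewrite ltnNge; apply/negP => jp; have := lt_trans jt tp.
  by rewrite ltNge lef_pV2 ?posrE ?exprn_gt0// ler_weXn2l// ler1n.
have j0 : (0 < j)%N by exact: leq_ltn_trans pj.
exists j.-1; rewrite prednK//; split; last 2 first.
- exact: ltW.
- rewrite leNgt; apply/negP => /jmin; lia.
by have := jmin _ lt; lia.
Qed.

(** * Lower mass bounds for parts *)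

Section mass_bound.
Variables (R : realType) (n m : nat).
Hypothesis m_gt0 : (0 < m)%N.
Local Notation E := 'rV[R]_n.
Local Notation X := ('rV[R]_n * subspaces R n)%type.
Local Notation G := (@grassmann R n m).
Variable U : set E.
Hypothesis oU : open U.
Variable V : {outer_measure set X -> \bar R}.
Hypothesis rV : varifold m U V.
Hypothesis rdV : radon_variation U V.
Local Notation S := (first_variation V).
Local Notation mu := (Defs.variation U S).
Local Notation w := (weight m V).
Let rw : radon_over U [the {outer_measure set E -> \bar R} of weight m V].
Proof. exact: (radon_weight oU rV). Qed.
Let cyl A : <<s open >> A -> V.-caratheodory (A `*` G).
Proof. exact: (cylinder_caratheodory oU rV). Qed.

Let p0 (j : nat) : 0 < 2^-j :> R. Proof. by rewrite invr_gt0 exprn_gt0. Qed.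
Let le2 (i j : nat) : (i <= j)%N -> 2^-j <= 2^-i :> R.
Proof. by move=> ab; rewrite lef_pV2 ?posrE ?exprn_gt0// ler_weXn2l// ler1n. Qed.

Section at_point.
Variables (i p l : nat) (a : E).
Hypotheses (ai : kex U i a) (ip : (i < p)%N) (pl : (p < l)%N).
Hypothesis thin : forall k, (i <= k)%N -> ~ thick m mu k a.
Local Notation r := (2^-p : R).
Local Notation s := (2^-l : R).
Local Notation Phi := (mono_field m a r s).

Let sr : 2 * s <= r.
Proof.
apply: (@le_trans _ _ (2 * 2^-p.+1)); first by rewrite ler_pM2l// le2.
by rewrite exprS invfM mulrA divff// mul1r.
Qed.

Let ball_sub : eball a r `<=` kex U i.+1.
Proof. by move=> x xa; apply: kexS_eball ai _; apply: le_trans xa _; exact: le2. Qed.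

Lemma test_mono_field : test_fields U Phi.
Proof.
apply: (@test_field_sub _ _ _ _ (eball a r)).
- exact: Cinf_mono_field.
- exact: compact_eball.
- by apply: subset_trans ball_sub _; exact: kex_sub.
- by move=> x /negP; rewrite -ltNge => h; apply: mono_field_eq0 => //; exact: ltW.
Qed.

(** On the shell between the radii 2^-(k+1) and 2^-k the field is at most 2^((k+1)(m-1)), and
    thinness bounds ||δV|| of the ball by (3/4)^k 2^(-k(m-1)). The product is 2^(m-1) (3/4)^k, with
    a sum independent of l. The inner ball of radius 2^-l is counted with k = l. *)
Lemma L1norm_mono_field : (L1norm mu Phi <= (2 ^+ m.-1 * 4 * (3 / 4) ^+ p)%:E)%E.
Proof.
have mB k : measurable (eball a (2^-k) : set (caratheodory_type mu)).
  have : mu.-caratheodory (eball a (2^-k)) by apply: (radon_closed oU rdV); exact: closed_eball.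
  by [].
apply: (@le_trans _ _ (\int[cmeas mu]_x
    \sum_(p <= k < l.+1) (((2 ^+ k.+1) ^+ m.-1)%:E * (\1_(eball a (2^-k)) x)%:E))%E).
  apply: (ge0_le_integral (cmeas mu) measurableT).
  - by move=> x _; rewrite lee_fin enorm_ge0.
  - by apply: mfield_enormE; apply: (test_mfield oU rdV); exact: test_mono_field.
  - apply: emeasurable_sum => k; apply: emeasurable_funM => //.
    by apply/measurable_EFinP; exact: measurable_indic.
  move=> x _; have term k : (p <= k < l.+1)%N -> enorm (x - a) <= 2^-k ->
      enorm (Phi x) <= (2 ^+ k.+1) ^+ m.-1 ->
      ((enorm (Phi x))%:E <= \sum_(p <= k < l.+1)
        (((2 ^+ k.+1) ^+ m.-1)%:E * (\1_(eball a (2^-k)) x)%:E))%E.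
    move=> pkl xk hk; rewrite (bigD1_seq k) ?mem_index_iota ?iota_uniq//=.
    apply: (@le_trans _ _ (((2 ^+ k.+1) ^+ m.-1)%:E * (\1_(eball a (2^-k)) x)%:E)%E).
      by rewrite indicE mem_set// mule1 lee_fin.
    rewrite leeDl//; apply: sume_ge0 => j _.
    by rewrite -EFinM lee_fin mulr_ge0// exprn_ge0// exprn_ge0.
  have e1 k : (2 ^+ k.+1) ^+ m.-1 = (2^-k.+1) ^- m.-1 :> R by rewrite exprVn invrK.
  have [xl|xl] := leP (enorm (x - a)) s.
    apply: (term l) => //; first by rewrite (ltnW pl) /=.
    rewrite e1; apply: (@mono_field_le _ _ _ m_gt0 a r s x s (2^-l.+1)) => //.
    - exact: le2.
    - by rewrite lerDr sqn_ge0.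
  have [xr|xr] := leP r (enorm (x - a)).
    rewrite mono_field_eq0// enorm0; apply: sume_ge0 => k _.
    by rewrite -EFinM lee_fin mulr_ge0// exprn_ge0// exprn_ge0.
  have [k [/andP[pk kl] k1 k2]] := dyadic_shell xr xl.
  apply: (term k) => //; first by rewrite pk ltnS ltnW.
  rewrite e1; apply: (@mono_field_le _ _ _ m_gt0 a r s x (enorm (x - a)) (2^-k.+1)) => //.
    by rewrite sqr_enorm lerDl sqr_ge0.
rewrite ge0_integral_sum//; last first.
  by move=> k; apply: emeasurable_funM => //; apply/measurable_EFinP; exact: measurable_indic.
apply: (@le_trans _ _ (\sum_(p <= k < l.+1) (2 ^+ m.-1 * (3 / 4) ^+ k)%:E)%E); last first.
  rewrite sumEFin lee_fin -mulr_sumr -mulrA ler_pM2l ?exprn_gt0//; exact: geometric34.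
rewrite big_seq [leRHS]big_seq; apply: lee_sum => k.
rewrite mem_index_iota => /andP[pk _].
rewrite ge0_integralZl_EFin//; last by apply/measurable_EFinP; exact: measurable_indic.
rewrite integral_indic// setIT.
have : (mu (eball a (2^-k)) <= ((3 / 4) ^+ k * (2^-k) ^+ m.-1)%:E)%E.
  by rewrite leNgt; apply/negP/thin; exact: leq_trans (ltnW ip) pk.
have q0 : (0 <= ((2 ^+ k.+1) ^+ m.-1)%:E :> \bar R)%E by rewrite lee_fin exprn_ge0// exprn_ge0.
move=> /(lee_wpmul2l q0) /le_trans; apply; rewrite -EFinM lee_fin.
rewrite le_eqVlt; apply/orP; left; apply/eqP.
rewrite exprS exprMn exprVn; field.
by rewrite !expf_neq0.
Qed.

(** Zero boundary equates the integral of the divergence over B x G with the extension of δV at the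
    field restricted to B, which the L_1 norm controls. The pointwise lower bound of the divergence
    does the rest. *)
Lemma mass_monotonicity (B : set E) (C L : R) : boundaryless m U V B -> 0 <= C ->
  (forall f, L1_fields mu f -> (`|L1_extension U S f|%:E <= C%:E * L1norm mu f)%E) ->
  (forall t, `|'D_1 (@cutoff R) t| <= L) ->
  ((2 ^- m.+1 * s ^- m)%:E * w (B `&` eball a s) <=
   (2 ^+ m.+1 * L * r ^- m)%:E * w (B `&` eball a r) +
   (C * (2 ^+ m.-1 * 4 * (3 / 4) ^+ p))%:E)%E.
Proof.
move=> [bB BU zB] C0 hC hL; have tPhi := test_mono_field.
have cB := cyl bB; have mB : measurable (B `*` G : set (caratheodory_type V)) by exact: cB.
have L0 : 0 <= L by apply: le_trans (hL 0).
have bmuB : mu.-caratheodory B by exact: (radon_borel oU rdV).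
have up : ((partial_variation m V B Phi)%:E <= (C * (2 ^+ m.-1 * 4 * (3 / 4) ^+ p))%:E)%E.
  have /eqP := zB _ tPhi; rewrite (dist_boundaryE oU rV cB tPhi) subr_eq0 => /eqP <-.
  have Lf := L1_restr_field oU rdV bmuB tPhi.
  apply: le_trans (_ : (`|L1_extension U S (restr_field B Phi)|%:E <= _)%E).
    by rewrite lee_fin ler_norm.
  apply: le_trans (hC _ Lf) _; rewrite EFinM lee_wpmul2l//.
  apply: le_trans L1norm_mono_field.
  apply: (L1norm_le (L1_mfield Lf) (test_mfield oU rdV tPhi)) => x.
  by rewrite /restr_field; case: ifP => // _; rewrite enorm0 enorm_ge0.
pose c1 := 2 ^- m.+1 * s ^- m; pose c2 := 2 ^+ m.+1 * L * r ^- m.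
have c10 : 0 <= c1 by rewrite mulr_ge0 ?invr_ge0 ?exprn_ge0// ltW.
have c20 : 0 <= c2.
  by apply: divr_ge0; [apply: mulr_ge0 => //; exact: exprn_ge0|apply: exprn_ge0; exact: ltW].
have cb (q : R) : V.-caratheodory (eball a q `*` G).
  by apply: cyl; apply: closed_borel; exact: closed_eball.
have mb (q : R) : measurable (eball a q `*` G : set (caratheodory_type V)) by exact: cb.
have iE (q : R) : (\int[cmeas V]_(x in B `*` G) (\1_(eball a q `*` G) x)%:E)%E = w (B `&` eball a q).
  rewrite integral_indic//; congr (V _).
  by apply/seteqP; split => -[y P] /=; [move=> [[? ?] [? ?]]|move=> [[? ?] ?]].
have mi (q : R) : measurable_fun (B `*` G : set (caratheodory_type V))
    (fun x : X => (\1_(eball a q `*` G) x : R)%:E).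
  by apply/measurable_EFinP; exact: measurable_indic.
have fr : w (B `&` eball a r) \is a fin_num.
  rewrite ge0_fin_numE ?outer_measure_ge0//.
  apply: (@le_lt_trans _ _ (w (kex U i.+1))).
    by apply: le_outer_measure => x [_ /ball_sub].
  by apply: (radon_ltoo rw); [exact: compact_kex|exact: kex_sub].
have iD := integrable_divergence oU rV tPhi cB.
have i2 : (cmeas V).-integrable (B `*` G) (EFin \o (fun x : X => c2 * \1_(eball a r `*` G) x)).
  apply/integrableP; split.
    by apply/measurable_EFinP; apply: measurable_funM => //; exact/measurable_EFinP.
  rewrite (_ : (\int[_]_(x in _) _)%E =
      (\int[cmeas V]_(x in B `*` G) (c2%:E * (\1_(eball a r `*` G) x)%:E))%E); last first.
    by apply: eq_integral => x _; rewrite /= ger0_norm ?EFinM// mulr_ge0// indicE.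
  rewrite ge0_integralZl_EFin//.
  by rewrite iE lte_mul_pinfty// ?lee_fin// -ge0_fin_numE ?outer_measure_ge0.
(* The [c2] term is moved to the side of the divergence, so that the smaller integrand is
   nonnegative. *)
apply: (@le_trans _ _ (\int[cmeas V]_(x in B `*` G)
   ((divergence Phi x)%:E + (c2 * \1_(eball a r `*` G) x)%:E))%E).
  rewrite -iE -ge0_integralZl_EFin//.
  have mD : measurable_fun (B `*` G : set (caratheodory_type V)) (divergence Phi).
    by apply: measurable_funTS; exact: (measurable_divergence oU rV).
  apply: (ge0_le_integral (cmeas V) mB).
  - by move=> x _; rewrite -EFinM lee_fin mulr_ge0// indicE.
  - by apply: emeasurable_funM => //; exact: mi.
  - apply: emeasurable_funD; apply/measurable_EFinP => //.
    by apply: measurable_funM => //; exact/measurable_EFinP.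
  move=> [x P] [/= Bx GP]; rewrite -EFinM -EFinD lee_fin -lerBlDr.
  have iGE (q : R) : \1_(eball a q `*` G) (x, P) = \1_(eball a q) x :> R.
    rewrite !indicE; congr (_%:R); congr (nat_of_bool _).
    by apply/idP/idP => /set_mem; [move=> [/= h _]|move=> h]; exact/mem_set.
  by rewrite !iGE; exact: (divergence_mono_field_ge m_gt0 a (p0 p) (p0 l) sr x hL GP).
rewrite (integralD mB iD i2) addeC.
rewrite [X in (X + _ <= _)%E](_ : _ = (c2%:E * w (B `&` eball a r))%E); last first.
  under eq_integral do rewrite /= EFinM.
  by rewrite ge0_integralZl_EFin// iE.
apply: leeD => //; apply: le_trans up.
rewrite /partial_variation /Rintegral fineK//.
exact: integrable_fin_num iD.
Qed.

End at_point.
Lemma mass_monotonicity_uniform : exists2 C : R, 0 < C & forall i p l a (B : set E),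
  kex U i a -> (i < p)%N -> (p < l)%N -> (forall k, (i <= k)%N -> ~ thick m mu k a) ->
  boundaryless m U V B ->
  (((2 ^+ l) ^+ m)%:E * w (B `&` eball a (2^-l)) <=
   (C * (2 ^+ p) ^+ m)%:E * w (B `&` eball a (2^-p)) + (C * (3 / 4) ^+ p)%:E)%E.
Proof.
have [C C0 hC] := L1_extension_bound oU rV rdV.
have [L L0 hL] := @derive_cutoff_bound R.
(* Clears the coefficient on the left-hand side. *)
pose D : R := 2 ^+ m.+1.
have D0 : 0 < D by rewrite exprn_gt0.
exists (Num.max (D * (2 ^+ m.+1 * L)) (D * (C * (2 ^+ m.-1 * 4)))).
  by rewrite lt_max !mulr_gt0// exprn_gt0.
move=> i p l a B ai ip pl thin zB.
have := mass_monotonicity ai ip pl thin zB (ltW C0) hC hL.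
have D0E : (0 <= D%:E)%E by rewrite lee_fin ltW.
move=> /(lee_wpmul2l D0E).
have w0 A : (0 <= w A)%E by exact: outer_measure_ge0.
rewrite muleA -EFinM.
have -> : D * (2 ^- m.+1 * (2^-l) ^- m) = (2 ^+ l) ^+ m.
  by rewrite exprVn invrK mulrA divff ?mul1r// gt_eqF.
move=> /le_trans; apply.
have f1 : (0 <= (2 ^+ m.+1 * L * (2^-p) ^- m)%:E * w (B `&` eball a (2^-p)))%E.
  apply: mule_ge0 => //; rewrite lee_fin; apply: divr_ge0; last by rewrite exprn_ge0// ltW.
  by rewrite mulr_ge0 ?exprn_ge0// ltW.
have f2 : 0 <= C * (2 ^+ m.-1 * 4 * (3 / 4) ^+ p).
  by rewrite !mulr_ge0 ?exprn_ge0 ?divr_ge0// ltW.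
rewrite ge0_muleDr//; apply: leeD.
  rewrite muleA -EFinM; apply: lee_wpmul2r => //; rewrite lee_fin exprVn invrK mulrA.
  rewrite [leLHS](_ : _ = D * (2 ^+ m.+1 * L) * (2 ^+ p) ^+ m); last by rewrite mulrA.
  by apply: ler_wpM2r; [rewrite !exprn_ge0|rewrite le_max lexx].
rewrite -EFinM lee_fin [leLHS](_ : _ = D * (C * (2 ^+ m.-1 * 4)) * (3 / 4) ^+ p); last first.
  by rewrite !mulrA.
by apply: ler_wpM2r; [rewrite exprn_ge0// divr_ge0|rewrite le_max lexx orbT].
Qed.

Variables (M : set E) (theta : E -> R) (T : E -> subspaces R n).
Hypotheses (MU : M `<=` U) (cM : (@hausdorff R n m).-caratheodory M).
Hypothesis theta0 : forall x, M x -> 0 < theta x.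
Hypothesis mtheta : measurable_fun (M : set (caratheodory_type (@hausdorff R n m))) theta.
Hypothesis TG : forall x, M x -> G (T x).
Hypothesis VE : forall k : X -> R, Kspace (U `*` G) k ->
  (ointegral V k)%:E = (\int[cmeas (@hausdorff R n m)]_(x in M) (k (x, T x) * theta x)%:E)%E.
Local Notation core := (core m U M theta mu).

Lemma exp34_small (e : R) (i : nat) : 0 < e -> exists2 p, (i < p)%N & (3 / 4) ^+ p <= e.
Proof.
move=> e0; have : (3 / 4 : R) ^+ p @[p --> \oo] --> 0 by apply: cvg_expr; rewrite ger0_norm; lra.
move=> /cvgrPdist_le /(_ e e0) [N _ hN]; exists (maxn N i.+1); first exact: leq_maxr.
have := hN (maxn N i.+1) (leq_maxl _ _); rewrite sub0r normrN; apply: le_trans.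
exact: ler_norm.
Qed.

(** [core_dense] gives a small ball about a point of the core in which B has mass at least t s^m,
    and monotonicity carries this to the fixed radius 2^-p, whose ball lies in [kex U i.+1].
    Rounding s to a dyadic radius costs 2^m; p depends only on i and makes the error at most half of
    t 2^-m. *)
Lemma boundaryless_mass (i : nat) : exists2 d : R, 0 < d & forall B : set E,
  boundaryless m U V B -> (0 < w (B `&` core i))%E -> (d%:E <= w (B `&` kex U i.+1))%E.
Proof.
have [C C0 hC] := mass_monotonicity_uniform.
pose t := core_density R m i; have t0 : 0 < t by exact: core_density_gt0.
have tm0 : 0 < t * 2 ^- m by rewrite mulr_gt0// invr_gt0 exprn_gt0.
have e0 : 0 < t * 2 ^- m / (2 * C) by rewrite divr_gt0// mulr_gt0.
have [p ip hp] := exp34_small i e0.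
have C2 : 0 < C * (2 ^+ p) ^+ m by rewrite mulr_gt0// !exprn_gt0.
pose d := t * 2 ^- m / 2 / (C * (2 ^+ p) ^+ m).
have d0 : 0 < d by apply: divr_gt0 => //; exact: divr_gt0.
exists d => // B zB wB.
have [a [s [Ba [Ma ta ai thin] /andP[s0 sp] hs]]] :=
  core_dense oU rV MU cM theta0 mtheta TG VE m_gt0 wB (p0 p.+1).
(* N only bounds the search for the dyadic exponent l of s. As s < 2^-(p+1), this exponent exceeds
   p. *)
have [N Ns] := exp2N_small (divr_gt0 s0 (ltr0n R 2)).
have s2 : s / 2 < s by rewrite ltr_pdivrMr// ltr_pMr// ltr1n.
have [l [/andP[pl _] l1 l2]] := dyadic_shell sp (le_lt_trans Ns s2).
apply: (@le_trans _ _ (w (B `&` eball a (2^-p)))); last first.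
  apply: le_outer_measure; apply: setIS => x xa; apply: kexS_eball ai _.
  by apply: le_trans xa _; exact: le2.
have h := hC _ _ _ _ _ ai ip pl thin zB.
have h2 : ((t * 2 ^- m)%:E <= ((2 ^+ l) ^+ m)%:E * w (B `&` eball a (2^-l)))%E.
  have q0 : (0 <= ((2 ^+ l) ^+ m)%:E :> \bar R)%E by rewrite lee_fin !exprn_ge0.
  apply: (@le_trans _ _ (((2 ^+ l) ^+ m)%:E * (t * s ^+ m)%:E)%E); last first.
    apply: lee_wpmul2l => //; apply: le_trans (ltW hs) _.
    by apply: le_outer_measure; apply: setIS => x xa; exact: le_trans xa l2.
  rewrite -EFinM lee_fin mulrCA ler_pM2l//.
  rewrite -ler_pdivrMl ?exprn_gt0// mulrC.
  rewrite (_ : 2 ^- m * ((2 ^+ l) ^+ m)^-1 = (2^-l.+1) ^+ m); last first.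
    by rewrite exprS exprVn exprMn invfM.
  by apply: lerXn2r l1; rewrite nnegrE ltW.
have := le_trans h2 h.
have hp2 : C * (3 / 4) ^+ p <= t * 2 ^- m / 2.
  rewrite mulrC -ler_pdivlMr//; apply: le_trans hp _.
  by rewrite invfM mulrA.
have dE : C * (2 ^+ p) ^+ m * d = t * 2 ^- m / 2.
  by rewrite /d mulrC divfK// gt_eqF.
case: (w _) => [x| |]; last 2 first.
- by rewrite leey.
- by rewrite gt0_muleNy ?lte_fin// addNye leeNy_eq.
rewrite -EFinM -EFinD !lee_fin => h3.
by rewrite -(ler_pM2l C2) dE; lra.
Qed.

End mass_bound.

(** * Atoms in an abstract class of parts *)

Section atoms.
Variables (R : realType) (T : pointedType) (w : {outer_measure set T -> \bar R}).
Variables (U : set T) (zb : set T -> Prop).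
Hypothesis zb_sub : forall A, zb A -> A `<=` U.
Hypothesis zb_caratheodory : forall A, zb A -> w.-caratheodory A.
Hypothesis zbT : zb U.
Hypothesis zbD : forall A B, zb A -> zb B -> A `<=` B -> zb (B `\` A).
Hypothesis zb_bigcap : forall F : nat -> set T, (forall i, zb (F i)) ->
  (forall i j, (i <= j)%N -> F j `<=` F i) -> zb (\bigcap_i F i).
Variable K : nat -> set T.
Hypothesis Koo : forall i, (w (K i) < +oo)%E.
Hypothesis bigcup_K : \bigcup_i K i = U.
Variables (C N : nat -> set T) (dl : nat -> R).
Hypothesis Noo : forall i, (w (N i) < +oo)%E.
Hypothesis dl0 : forall i, 0 < dl i.
Hypothesis mass : forall i B, zb B -> (0 < w (B `&` C i))%E -> ((dl i)%:E <= w (B `&` N i))%E.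
Hypothesis C0 : w (U `\` \bigcup_i C i) = 0%E.
Implicit Types (A B F : set T).

Let fin A i : w (A `&` K i) \is a fin_num.
Proof.
rewrite ge0_fin_numE ?outer_measure_ge0//; apply: le_lt_trans (Koo i).
by apply: le_outer_measure; exact: subIsetr.
Qed.

(* A finite substitute for [w] with the same null sets in [U], which can be
   minimised even if [w U] is infinite. *)
Definition fin_mass A : \bar R :=
  (\sum_(i <oo) ((2^-i.+1 / (1 + fine (w (K i))))%:E * w (A `&` K i)))%E.

Let coef_gt0 i : 0 < 2^-i.+1 / (1 + fine (w (K i))) :> R.
Proof.
rewrite divr_gt0 ?invr_gt0 ?exprn_gt0// ltr_wpDr//.
exact/fine_ge0/outer_measure_ge0.
Qed.

Let term_ge0 A i : (0 <= (2^-i.+1 / (1 + fine (w (K i))))%:E * w (A `&` K i))%E.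
Proof. by rewrite mule_ge0 ?outer_measure_ge0// lee_fin ltW. Qed.

Lemma fin_mass_ge0 A : (0 <= fin_mass A)%E.
Proof. by apply: nneseries_ge0 => i _ _. Qed.

Lemma fin_mass_ltoo A : (fin_mass A < +oo)%E.
Proof.
apply: (@le_lt_trans _ _ 1%E); last by rewrite ltry.
apply: lime_le; first by apply: is_cvg_nneseries => i _ _.
apply: nearW => k; apply: (@le_trans _ _ (\sum_(0 <= i < k) (2^-i.+1)%:E)%E).
  apply: lee_sum => i _; rewrite -(fineK (fin A i)) -EFinM lee_fin.
  have f0 : 0 <= fine (w (K i)) by exact/fine_ge0/outer_measure_ge0.
  rewrite -mulrA ler_piMr ?invr_ge0 ?exprn_ge0// mulrC ler_pdivrMr ?ltr_pwDl// mul1r.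
  apply: (@le_trans _ _ (fine (w (K i)))); last by rewrite lerDr.
  rewrite fine_le ?fin//; last by apply: le_outer_measure; exact: subIsetr.
  by rewrite ge0_fin_numE ?outer_measure_ge0.
rewrite sumEFin lee_fin.
suff -> : \sum_(0 <= i < k) 2^-i.+1 = 1 - 2^-k :> R by rewrite gerBl invr_ge0 exprn_ge0.
elim: k => [|k IH]; first by rewrite big_geq// expr0 invr1 subrr.
by rewrite big_nat_recr//= IH exprS; field; rewrite expf_neq0.
Qed.

Let d A : R := fine (fin_mass A).

Let d_fin A : fin_mass A \is a fin_num.
Proof. by rewrite ge0_fin_numE ?fin_mass_ge0// fin_mass_ltoo. Qed.

Let d_ge0 A : 0 <= d A. Proof. exact/fine_ge0/fin_mass_ge0. Qed.

Let dD A B : zb A -> A `<=` B -> d B = d A + d (B `\` A).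
Proof.
move=> zA AB; rewrite /d -fineD//; congr fine.
rewrite /fin_mass -nneseriesD; [|by move=> i _ _|by move=> i _ _].
apply: eq_eseriesr => i _; rewrite -ge0_muleDr ?outer_measure_ge0//; congr (_ * _)%E.
have := zb_caratheodory zA (B `&` K i) => ->; congr (w _ + w _)%E.
  by apply/seteqP; split => x; [move=> [[? ?] ?]|move=> [? ?]; split => //; split => //; exact: AB].
by apply/seteqP; split => x [[? ?] ?].
Qed.

Let d_null A : A `<=` U -> d A = 0 -> w A = 0%E.
Proof.
move=> AU dA; have e0 : fin_mass A = 0%E by rewrite -(fineK (d_fin A)) -/(d A) dA.
rewrite -(setIidl AU) -bigcup_K setI_bigcupr.
apply/eqP; rewrite eq_le outer_measure_ge0 andbT.
apply: le_trans (outer_measure_sigma_subadditive w _) _.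
rewrite eseries0// => i _ _; apply/eqP; rewrite eq_le outer_measure_ge0 andbT.
have : ((2^-i.+1 / (1 + fine (w (K i))))%:E * w (A `&` K i) <= 0)%E.
  rewrite -e0 /fin_mass (nneseries_split 0%N i.+1) => [|k _]; last by [].
  rewrite big_nat_recr//=; apply: (@le_trans _ _ _ _ _ (leeDr _ _) (leeDl _ _)).
    by apply: sume_ge0 => k _.
  by apply: nneseries_ge0 => k _ _.
by rewrite -(fineK (fin A i)) -EFinM !lee_fin pmulr_rle0.
Qed.

Let le_d A B : zb A -> A `<=` B -> d A <= d B.
Proof. by move=> zA AB; rewrite (dD zA AB) lerDl. Qed.

Definition atom A := [/\ zb A, (0 < w A)%E &
  forall B, zb B -> B `<=` A -> w B = 0%E \/ w (A `\` B) = 0%E].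

(** Indivisible only as seen from C i: F may still contain parts of positive weight that miss C i,
    which [ex_atom] removes by minimising. *)
Let unsplittable i F := [/\ zb F, (0 < w (F `&` C i))%E &
  forall B, zb B -> B `<=` F -> w (B `&` C i) = 0%E \/ w ((F `\` B) `&` C i) = 0%E].

(** Every genuine splitting removes a part B charging C i, hence with mass at least [dl i] in N i.
    Continuing with F \ B, the mass in N i drops by that amount, so the number k of possible steps
    is bounded in advance. *)
Let ex_unsplittable i F : zb F -> (0 < w (F `&` C i))%E ->
  exists2 F0, F0 `<=` F & unsplittable i F0.
Proof.
move=> zF wF.
have Nfin A : w (A `&` N i) \is a fin_num.
  rewrite ge0_fin_numE ?outer_measure_ge0//; apply: le_lt_trans (Noo i).
  by apply: le_outer_measure; exact: subIsetr.
have [k hk] : exists k : nat, fine (w (F `&` N i)) < k%:R * dl i.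
  exists (Num.truncn (fine (w (F `&` N i)) / dl i)).+1.
  by rewrite -ltr_pdivrMr// truncnS_gt.
elim: k F zF wF hk => [|k IH] F zF wF hk.
  by exfalso; move: hk; rewrite mul0r ltNge fine_ge0// outer_measure_ge0.
have [un|] := pselect (unsplittable i F); first by exists F.
move=> nun; have [B [zB BF w1 w2]] : exists B, [/\ zb B, B `<=` F,
    (0 < w (B `&` C i))%E & (0 < w ((F `\` B) `&` C i))%E].
  apply: contrapT => nB; apply: nun; split => // B zB BF.
  have [e|e] := eqVneq (w (B `&` C i)) 0%E; [by left|right].
  apply/eqP; apply: contrapT => /negP e2; apply: nB; exists B; split => //.
    by rewrite lt_neqAle eq_sym e outer_measure_ge0.
  by rewrite lt_neqAle eq_sym e2 outer_measure_ge0.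
have zFB := zbD zB zF BF.
have [|F0 F0s un] := IH (F `\` B) zFB w2; last first.
  by exists F0 => //; apply: subset_trans F0s _; exact: subDsetl.
have e : w (F `&` N i) = (w (B `&` N i) + w ((F `\` B) `&` N i))%E.
  have := zb_caratheodory zB (F `&` N i) => ->; congr (w _ + w _)%E.
    by apply/seteqP; split => x; [move=> [[? ?] ?]|move=> [? ?]; split => //; split => //; exact: BF].
  by apply/seteqP; split => x [[? ?] ?].
have := mass zB w1; rewrite -(fineK (Nfin B)) lee_fin => h.
move: hk; rewrite e fineD// -natr1 mulrDl mul1r => hk.
by move: h hk; lra.
Qed.

(** Among the parts of an unsplittable F that carry all of F [&] C i, a decreasing sequence of
    nearly minimal ones has a minimal intersection B. For a part B' of B, one of B' and B \ B'
    carries all of F [&] C i, and minimality makes the other null. *)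
Lemma ex_atom A : zb A -> (0 < w A)%E -> exists2 B, B `<=` A & atom B.
Proof.
move=> zA wA.
have [i wi] : exists i, (0 < w (A `&` C i))%E.
  apply: contrapT => ni; move: wA; rewrite lt_neqAle => /andP[/eqP + _]; apply; apply/esym.
  apply: (@null_subset _ _ _ _ ((\bigcup_i (A `&` C i)) `|` (U `\` \bigcup_i C i))).
    move=> x Ax; have [[j _ Cx]|nC] := pselect ((\bigcup_i C i) x); first by left; exists j.
    by right; split => //; exact: zb_sub Ax.
  apply: null_setU => //; apply: null_bigcup => i; apply/eqP; apply: contrapT => /negP h.
  by apply: ni; exists i; rewrite lt_neqAle eq_sym h outer_measure_ge0.
have [F FA [zF wF un]] := ex_unsplittable zA wi.
pose Q B := [/\ zb B, B `<=` F & w ((F `\` B) `&` C i) = 0%E].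
have QF : Q F by split => //; rewrite setDv set0I outer_measure0.
(* The step of the minimisation: within B, a member of Q whose d is within 2^-k of the infimum. The
   value [set0] is a dummy for B not in Q. *)
have /choice[h hh] : forall p : nat * set T, exists B', Q p.2 -> [/\ Q B', B' `<=` p.2 &
    forall B, Q B -> B `<=` p.2 -> d B' <= d B + 2^-p.1].
  move=> [k B] /=; have [QB|] := pselect (Q B); last by exists set0.
  pose D := [set d B' | B' in [set B' | Q B' /\ B' `<=` B]].
  have hD : has_inf D.
    split; first by exists (d B); exists B => //; split.
    by exists 0 => _ [B' _ <-].
  have e0 : 0 < 2^-k :> R by rewrite invr_gt0 exprn_gt0.
  have [_ [B' [QB' B'B] <-] hB'] := inf_adherent e0 hD.
  exists B' => _; split => // B2 QB2 B2B; apply: (le_trans (ltW hB')); rewrite lerD2r.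
  by apply: ge_inf; [exact: hD.2|exists B2].
pose S := fix S k := if k is k'.+1 then h (k', S k') else F.
have QS k : Q (S k) by elim: k => [//|k IH]; have [] := hh (k, S k) IH.
have ndS i' j : (i' <= j)%N -> S j `<=` S i'.
  move=> /subnKC <-; elim: (j - i')%N => [|k IH]; first by rewrite addn0.
  by rewrite addnS; apply: subset_trans IH; have [_ + _] := hh ((i' + k)%N, S (i' + k)%N) (QS _).
pose B := \bigcap_k S k.
have BS k : B `<=` S k by move=> x; exact.
have zB : zb B by apply: zb_bigcap => // k; have [] := QS k.
have QB : Q B.
  split => //; first exact: (BS 0%N).
  apply: (@null_subset _ _ _ _ (\bigcup_k ((F `\` S k) `&` C i))).
    move=> x [[Fx nB] Cx]; apply: contrapT => nx; apply: nB => k _.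
    by apply: contrapT => nS; apply: nx; exists k.
  by apply: null_bigcup => k; have [] := QS k.
have Bmin B' : Q B' -> B' `<=` B -> w (B `\` B') = 0%E.
  move=> QB' B'B; have [zB' _ _] := QB'.
  apply: d_null; first by apply: subset_trans (@subDsetl _ _ _) _; exact: zb_sub.
  have := dD zB' B'B => e1.
  apply/eqP; rewrite eq_le d_ge0 andbT; apply/ler_addgt0Pr => e e0; rewrite add0r.
  have [k ke] := exp2N_small e0.
  have [_ _ /(_ B' QB')] := hh (k, S k) (QS k).
  move=> /(_ (subset_trans B'B (BS k))) h1.
  (* B lies in every S k, so it inherits near-minimality with error 2^-k for all k. *)
  have h2 : d B <= d (S k.+1) by apply: le_d.
  by move: h1 h2 ke; rewrite /= e1; lra.
exists B; first by apply: subset_trans (BS 0%N) FA.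
have wBF : (0 < w (B `&` C i))%E.
  apply: (lt_le_trans wF); apply: (@le_trans _ _ (w (B `&` C i) + w ((F `\` B) `&` C i))%E).
    apply: le_trans (outer_measureU2 _ _ _); apply: le_outer_measure => x [Fx Cx].
    by have [|] := pselect (B x); [left|right].
  by have [_ _ ->] := QB; rewrite adde0.
split => //.
  by apply: lt_le_trans wBF _; apply: le_outer_measure; exact: subIsetl.
move=> B' zB' B'B; have B'F : B' `<=` F by apply: subset_trans B'B _; exact: (BS 0%N).
have [h1|h1] := un B' zB' B'F; last by right; apply: Bmin.
(* B' misses C i, so B \ B' still belongs to Q; minimality applied to it says that B' is null. *)
left; have e : B' = B `\` (B `\` B') by rewrite setDD setIidr.
rewrite e; apply: Bmin; last exact: subDsetl.
split; [exact: zbD|by apply: subset_trans (@subDsetl _ _ _) (BS 0%N)|].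
apply: (@null_subset _ _ _ _ (((F `\` B) `&` C i) `|` (B' `&` C i))).
  move=> x [[Fx /not_andP h2] Cx]; have [B'x|B'x] := pselect (B' x); first by right.
  by left; split => //; split => // Bx; case: h2.
by apply: null_setU => //; have [] := QB.
Qed.

(** Each step removes from the remainder an atom of at least half the largest available [fin_mass].
    An atom B inside the final remainder would have been available throughout, so every step would
    remove at least half of its mass, against finiteness of the total. *)
Lemma atomic_decomposition : exists F : nat -> set T,
  [/\ forall k, F k = set0 \/ atom (F k), forall i j, (i < j)%N -> F i `&` F j = set0 &
      w (U `\` \bigcup_k F k) = 0%E].
Proof.
have z0 : zb set0 by rewrite -(setDv U); exact: zbD.
have d0 : d set0 = 0.
  by have := dD z0 (@subset_refl _ set0); rewrite setD0 => /(congr1 (fun y => y - d set0)); rewrite subrr addrK.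
have /choice[g hg] : forall Y : set T, exists A, zb Y -> [/\ zb A, A `<=` Y,
    A = set0 \/ atom A & forall B, atom B -> B `<=` Y -> d B <= 2 * d A].
  move=> Y; have [zY|] := pselect (zb Y); last by exists set0.
  pose D := [set d B | B in [set B | atom B /\ B `<=` Y]].
  have [[B [aB BY]]|nB] := pselect (exists B, atom B /\ B `<=` Y); last first.
    exists set0 => _; split => //; first by left.
    by move=> B aB BY; exfalso; apply: nB; exists B.
  have hD : has_sup D.
    split; first by exists (d B), B.
    by exists (d Y) => _ [B' [[zB' _ _] B'Y] <-]; exact: le_d.
  have dB0 : 0 < d B.
    rewrite lt_neqAle d_ge0 andbT eq_sym; apply/eqP => dB.
    have [zB wB _] := aB; move: wB; rewrite d_null ?ltxx//; exact: zb_sub.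
  have sB : d B <= sup D by apply: ub_le_sup; [exact: hD.2|exists B].
  have s0 : 0 < sup D / 2 by rewrite divr_gt0// (lt_le_trans dB0).
  have [_ [A [aA AY] <-] hA] := sup_adherent s0 hD.
  exists A => _; split => //; [by case: aA|by right|].
  move=> B' aB' B'Y; have : d B' <= sup D by apply: ub_le_sup; [exact: hD.2|exists B'].
  by move: hA; lra.
pose Y := fix Y k := if k is k'.+1 then Y k' `\` g (Y k') else U.
have zY k : zb (Y k).
  by elim: k => [//|k IH]; have [? ? _ _] := hg _ IH; exact: zbD.
have ndY i j : (i <= j)%N -> Y j `<=` Y i.
  move=> /subnKC <-; elim: (j - i)%N => [|k IH]; first by rewrite addn0.
  by rewrite addnS; apply: subset_trans IH; exact: subDsetl.
exists (fun k => g (Y k)); split.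
- by move=> k; have [] := hg _ (zY k).
- move=> i j ij; apply/seteqP; split => // x [gi gj].
  have [_ gY _ _] := hg _ (zY j); have := ndY _ _ ij _ (gY _ gj).
  by move=> [_].
have UE : U `\` \bigcup_k g (Y k) = \bigcap_k Y k.
  apply/seteqP; split => x.
    move=> [Ux nx] k _; elim: k => [//|k IH]; split => // gx; apply: nx; by exists k.
  move=> hx; split; first exact: (hx 0%N).
  by move=> [k _ gx]; have [_] := hx k.+1 Logic.I.
rewrite UE; apply/eqP; apply: contrapT => /negP nz.
have wY : (0 < w (\bigcap_k Y k))%E by rewrite lt_neqAle eq_sym nz outer_measure_ge0.
have zYY : zb (\bigcap_k Y k) by exact: zb_bigcap.
have [B BY aB] := ex_atom zYY wY; have [zB wB _] := aB.
have dB0 : 0 < d B.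
  rewrite lt_neqAle d_ge0 andbT eq_sym; apply/eqP => dB.
  by move: wB; rewrite d_null ?ltxx//; exact: zb_sub.
have step k : d (Y k.+1) + d B / 2 <= d (Y k).
  have [zg gY _ /(_ B aB)] := hg _ (zY k).
  move=> /(_ (subset_trans BY _)) h; rewrite (dD zg gY).
  by have : d B <= 2 * d (g (Y k)); [apply: h => x; exact|rewrite /=; lra].
have bound k : d (Y k) + k%:R * (d B / 2) <= d U.
  elim: k => [|k IH]; first by rewrite mul0r addr0.
  apply: le_trans IH; have h := step k.
  have -> : k.+1%:R * (d B / 2) = k%:R * (d B / 2) + d B / 2 by rewrite -[X in X * _]natr1 mulrDl mul1r.
  by rewrite addrCA addrC lerD2r.
have dB2 : 0 < d B / 2 by rewrite divr_gt0.
have := bound (Num.truncn (d U / (d B / 2))).+1.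
have := truncnS_gt (d U / (d B / 2)); rewrite ltr_pdivrMr//.
by move: (d_ge0 (Y (Num.truncn (d U / (d B / 2))).+1)); lra.
Qed.

End atoms.

(** On X [&] K k both measures are finite, and subtracting subadditivity of [nu] from the splitting
    identity of the sum leaves superadditivity of [mu]. Continuity from below along K then reaches
    every X. Applied to the two measures in [vmeasurable]. *)
Lemma caratheodory_summand (R : realType) (T : pointedType)
    (mu nu : {outer_measure set T -> \bar R}) (K : nat -> set T) (A : set T) :
  (forall i, mu.-caratheodory (K i)) -> (forall i j, (i <= j)%N -> K i `<=` K j) ->
  (forall i, (mu (K i) < +oo)%E) -> (forall i, (nu (K i) < +oo)%E) ->
  mu (~` \bigcup_i K i) = 0%E ->
  (fun X => mu X + nu X)%E.-caratheodory A -> mu.-caratheodory A.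
Proof.
move=> cK ndK muoo nuoo K0 cA; apply: le_caratheodory_measurable => X.
have [Xoo|Xoo] := eqVneq (mu X) +oo%E; first by rewrite Xoo leey.
have fsub (rho : {outer_measure set T -> \bar R}) Y Z :
    (rho Z < +oo)%E -> Y `<=` Z -> rho Y \is a fin_num.
  move=> Zoo YZ; rewrite ge0_fin_numE ?outer_measure_ge0//.
  exact: le_lt_trans (le_outer_measure _ _ _ YZ) Zoo.
have Xlt : (mu X < +oo)%E by rewrite ltey.
have loc k : (mu (X `&` A `&` K k) + mu (X `&` ~` A `&` K k) <= mu X)%E.
  apply: (@le_trans _ _ (mu (X `&` K k))); last by apply: le_outer_measure; exact: subIsetl.
  have e := cA (X `&` K k); rewrite !(setIAC X (K k)) in e.
  have f1 := fsub mu _ _ (muoo k) (@subIsetr _ X (K k)).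
  have g1 := fsub nu _ _ (nuoo k) (@subIsetr _ X (K k)).
  have f2 := fsub mu _ _ (muoo k) (@subIsetr _ (X `&` A) (K k)).
  have g2 := fsub nu _ _ (nuoo k) (@subIsetr _ (X `&` A) (K k)).
  have f3 := fsub mu _ _ (muoo k) (@subIsetr _ (X `&` ~` A) (K k)).
  have g3 := fsub nu _ _ (nuoo k) (@subIsetr _ (X `&` ~` A) (K k)).
  have s : (nu (X `&` K k) <= nu (X `&` A `&` K k) + nu (X `&` ~` A `&` K k))%E.
    apply: le_trans (outer_measureU2 _ _ _); apply: le_outer_measure => x [Xx Kx].
    by have [|] := pselect (A x); [left|right].
  move: e s; rewrite /= -(fineK f1) -(fineK g1) -(fineK f2) -(fineK g2) -(fineK f3) -(fineK g3).
  by rewrite -!EFinD !lee_fin => -[]; lra.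
have sup Y (c : \bar R) : (forall i, (mu (Y `&` K i) <= c)%E) -> (mu Y <= c)%E.
  move=> h; apply: (@le_trans _ _ (mu (Y `&` \bigcup_i K i))).
    apply: (@le_trans _ _ (mu (Y `&` \bigcup_i K i) + mu (~` \bigcup_i K i))%E).
      apply: le_trans (outer_measureU2 _ _ _); apply: le_outer_measure => x Yx.
      by have [|] := pselect ((\bigcup_i K i) x); [left|right].
    by rewrite K0 adde0.
  apply: le_trans (nondecreasing_outer_measure _ cK ndK) _.
  by apply: ge_ereal_sup => _ [i _ <-].
have fc := fsub mu _ _ Xlt (@subIsetl _ X (~` A)).
rewrite -leeBrDr//; apply: (sup) => i.
have fi : mu (X `&` A `&` K i) \is a fin_num by apply: fsub Xlt _ => x [[]].
rewrite leeBrDr// addeC -leeBrDr//; apply: sup => j.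
rewrite leeBrDr// addeC; apply: le_trans (loc (maxn i j)); apply: leeD.
  by apply: le_outer_measure; apply: setIS; apply: ndK; exact: leq_maxl.
by apply: le_outer_measure; apply: setIS; apply: ndK; exact: leq_maxr.
Qed.

(** * The restriction of a varifold to a part *)

Section component.
Variables (R : realType) (n m : nat).
Local Notation E := 'rV[R]_n.
Local Notation X := ('rV[R]_n * subspaces R n)%type.
Local Notation G := (@grassmann R n m).
Variable U : set E.
Hypothesis oU : open U.
Variable V : {outer_measure set X -> \bar R}.
Hypothesis rV : varifold m U V.
Hypothesis rdV : radon_variation U V.
Local Notation S := (first_variation V).
Local Notation mu := (Defs.variation U S).
Local Notation w := (weight m V).
Let rw : radon_over U [the {outer_measure set E -> \bar R} of weight m V].
Proof. exact: (radon_weight oU rV). Qed.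
Let cyl A : <<s open >> A -> V.-caratheodory (A `*` G).
Proof. exact: (cylinder_caratheodory oU rV). Qed.

Variable B : set E.
Hypothesis zB : boundaryless m U V B.
Let bB : <<s open >> B. Proof. by case: zB. Qed.
Local Notation W := (vrestr m V B).

Lemma varifold_vrestr : varifold m U W.
Proof.
have h := radon_orestr (@open_setXG R n m U oU) (@compact_kexG R n m U) (@closed_kexG R n m U)
   (@bigcup_kexG R n m U oU) (@le_kexG R n m U) rV (cyl bB).
exact: h.
Qed.

Lemma weight_vrestr A : weight m W A = w (B `&` A).
Proof.
rewrite /weight /= /orestr; congr (V _).
by apply/seteqP; split => -[x P] /=; [move=> [[? ?] [? ?]]|move=> [[? ?] ?]].
Qed.

(** Restatement of V∂B = 0: the first variation of the restricted varifold is a restriction of that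
    of V. *)
Lemma first_variation_vrestrE th : test_fields U th ->
  first_variation W th = L1_extension U S (restr_field B th).
Proof.
move=> t; rewrite (first_variation_vrestr oU rV (cyl bB) t).
have [_ _ /(_ th t)/eqP] := zB; rewrite (dist_boundaryE oU rV (cyl bB) t) subr_eq0.
by move=> /eqP.
Qed.

Local Notation muW := (Defs.variation U (first_variation W)).
Let linW := first_variation_lin oU varifold_vrestr.

Lemma L1norm_le_set (nu : {outer_measure set E -> \bar R}) (f : E -> E) (P : set E) (b : R) :
  mfield nu f -> nu.-caratheodory P -> 0 <= b ->
  (forall x, P x -> enorm (f x) <= b) -> (forall x, ~ P x -> f x = 0) ->
  (L1norm nu f <= b%:E * nu P)%E.
Proof.
move=> mf cP b0 h1 h2; have mP : measurable (P : set (caratheodory_type nu)) by exact: cP.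
rewrite -[nu P]/(cmeas nu P) -[X in (_ <= _ * _ X)%E]setIT -integral_indic//.
rewrite -ge0_integralZl_EFin//; last by apply/measurable_EFinP; exact: measurable_indic.
apply: (ge0_le_integral (cmeas nu) measurableT).
- by move=> x _; rewrite lee_fin enorm_ge0.
- exact: mfield_enormE.
- by apply/measurable_EFinP; apply: measurable_funM => //; exact: measurable_indic.
move=> x _; rewrite -EFinM lee_fin indicE.
have [Px|Px] := pselect (P x); first by rewrite mem_set// mulr1 h1.
by rewrite h2// enorm0 mulr_ge0.
Qed.

(** By the previous lemma the first variation of W is the extension of δV at fields cut off to B;
    the constant is that of [L1_extension_bound]. *)
Lemma variation_vrestr_open : exists2 C, 0 < C & forall Q, open Q -> Q `<=` U ->
  (muW Q <= C%:E * mu Q)%E.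
Proof.
have [C C0 hC] := L1_extension_bound oU rV rdV; exists C => // Q oQ QU.
rewrite (variationE oU linW) voute_open//; apply: ge_ereal_sup => _ [th [t sQ t1] <-].
rewrite first_variation_vrestrE//.
have cB : mu.-caratheodory B by exact: (radon_borel oU rdV).
have L := L1_restr_field oU rdV cB t.
apply: (@le_trans _ _ (`|L1_extension U S (restr_field B th)|%:E)); first by rewrite lee_fin ler_norm.
apply: le_trans (hC _ L) _; apply: lee_wpmul2l; first by rewrite lee_fin ltW.
rewrite -[leRHS]mul1e; apply: L1norm_le_set => //; first exact: L1_mfield.
- exact: (radon_open oU rdV).
- by move=> x _; rewrite /restr_field; case: ifP => // _; rewrite enorm0.
- move=> x nQ; rewrite /restr_field; case: ifP => // _.
  by apply: spt_eq0 => /sQ.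
Qed.

Lemma radon_variation_vrestr : radon_variation U W.
Proof.
apply: (radon_variationP oU linW) => K cK KU.
have [C C0 hC] := variation_vrestr_open.
have [j Kj] := compact_sub_kex oU cK KU.
have QU : (kex U j.+1)° `<=` U by apply: subset_trans (@interior_subset _ _) _; exact: kex_sub.
apply: (@le_lt_trans _ _ (muW (kex U j.+1)°)).
  by apply: le_outer_measure; apply: subset_trans Kj _; exact: kex_interior.
apply: (le_lt_trans (hC _ (@open_interior _ _) QU)); apply: lte_mul_pinfty; rewrite ?lee_fin ?(ltW C0)//.
apply: (@le_lt_trans _ _ (mu (kex U j.+1))); first by apply: le_outer_measure; exact: interior_subset.
by apply: (radon_ltoo rdV); [exact: compact_kex|exact: kex_sub].
Qed.

Let rdW := radon_variation_vrestr.

Lemma vmeasurable_borel A : <<s open >> A -> A `<=` U -> vmeasurable m U V A.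
Proof.
move=> bA AU; split => // Y.
have c1 : mu.-caratheodory A by exact: (radon_borel oU rdV).
have c2 : w.-caratheodory A by exact: (radon_borel oU rw).
by rewrite (c1 Y) (c2 Y) addeACA.
Qed.

(* The same smooth field approximates in L_1 of ||δV|| and of ||δ(V restricted
   to B)||: these live on different Caratheodory sigma-algebras, but the error
   is carried by an open set, on which the two are compared. *)
Lemma restr_field_approx A th : <<s open >> A -> test_fields U th ->
  exists2 b : R, 0 <= b & forall e : R, 0 < e -> exists th' P,
    [/\ test_fields U th', open P, P `<=` U, (mu P <= e%:E)%E &
     (forall x, P x -> enorm (th' x - restr_field A th x) <= b) /\
     (forall x, ~ P x -> th' x - restr_field A th x = 0)].
Proof.
move=> bA t; have [b hb] := test_field_bounded t.
have b0 : 0 <= b by apply: le_trans (hb 0); exact: enorm_ge0.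
exists b => // e e0; have [st ct ut] := (test_fieldP U th).1 t.
have cA0 : mu.-caratheodory (A `&` spt th).
  apply: caratheodory_measurable_setI; first exact: (radon_borel oU rdV).
  by apply: (radon_closed oU rdV); exact: closed_spt.
have A0U : A `&` spt th `<=` U by move=> x [_ /ut].
have A0oo : (mu (A `&` spt th) < +oo)%E.
  apply: (@le_lt_trans _ _ (mu (spt th))); first by apply: le_outer_measure; exact: subIsetr.
  exact: (radon_ltoo rdV).
have e2 : 0 < e / 2 by rewrite divr_gt0.
have [D [cD clD DA De]] := radon_inner oU (@compact_kex _ _ U) (@closed_kex _ _ U)
   (bigcup_kex oU) (@le_kex _ _ U) rdV cA0 A0U A0oo e2.
have [Q [oQ AQ QU Qe]] := radon_outerD oU (@compact_kex _ _ U) (@closed_kex _ _ U)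
   (bigcup_kex oU) rdV cA0 A0U e2.
have [phi [cphi phi01 [N' oN [DN N1]] _ s1]] := smooth_urysohn cD oQ (subset_trans DA AQ).
exists (fun x => phi x *: th x), (Q `\` D); split.
- exact: test_field_mul.
- by rewrite setDE; apply: openI => //; exact: closed_openC.
- by move=> x [/QU].
- rewrite [e]splitr EFinD; apply: le_trans (leeD Qe De).
  apply: le_trans (outer_measureU2 _ _ _); apply: le_outer_measure => x [Qx Dx].
  by have [|] := pselect ((A `&` spt th) x); [right|left].
split=> x Px.
  have /andP[p0 p1] := phi01 x; apply: le_trans (hb x); rewrite /restr_field; case: ifP => _.
    rewrite -{2}(scale1r (th x)) -scalerBl enormZ -[leRHS]mul1r ler_wpM2r ?enorm_ge0//.
    by rewrite ler_norml; apply/andP; split; lra.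
  by rewrite subr0 enormZ ger0_norm// -[leRHS]mul1r ler_wpM2r ?enorm_ge0.
have [Dx|nDx] := pselect (D x).
  have [Ax _] := DA _ Dx; rewrite /restr_field mem_set// N1 ?scale1r ?subrr//; exact: DN.
have nQ : ~ Q x by move=> Qx; exact: Px.
rewrite (@spt_eq0 _ _ phi x) ?scale0r; last by move=> /s1.
rewrite /restr_field; case: ifPn => [/set_mem Ax|_]; last by rewrite subr0.
by rewrite (@spt_eq0 _ _ th x) ?subr0// => sx; apply: nQ; apply: AQ.
Qed.

Let bmu A : <<s open >> A -> mu.-caratheodory A.
Proof. exact: (radon_borel oU rdV). Qed.
Let bmuW A : <<s open >> A -> muW.-caratheodory A.
Proof. exact: (radon_borel oU rdW). Qed.

(** A test field th' is chosen near th restricted to A in L_1 of ||δW||, with its restriction to B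
    near th restricted to B [&] A in L_1 of ||δV||. The two sides agree for th' by
    [first_variation_vrestrE], and continuity of both extensions closes the gap. *)
Lemma L1_extension_vrestr A th : <<s open >> A -> test_fields U th ->
  L1_extension U (first_variation W) (restr_field A th) =
  L1_extension U S (restr_field (B `&` A) th).
Proof.
move=> bA t; have bBA : <<s open >> (B `&` A) by exact: borelI.
have [b b0 approx] := restr_field_approx bA t.
have [C C0 hC] := variation_vrestr_open.
have [eW _ contW] := L1_extension_is oU linW rdW.
have [_ _ cont] := L1_extension_is oU (first_variation_lin oU rV) rdV.
have LfW := L1_restr_field oU rdW (bmuW bA) t.
have Lf := L1_restr_field oU rdV (bmu bBA) t.
apply/eqP; rewrite -subr_eq0 -normr_le0; apply/ler_addgt0Pr => e e0; rewrite add0r.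
have e2 : 0 < e / 2 by rewrite divr_gt0.
have [dW dW0 hW] := contW _ LfW _ e2; have [d d0 hd] := cont _ Lf _ e2.
have c1 : 0 < 1 + b * C by rewrite ltr_pwDl// mulr_ge0// ltW.
have c2 : 0 < 1 + b by rewrite ltr_pwDl.
(* The error is at most b on a set P with ||δV||(P) <= e' and ||δW||(P) <= C e'; this makes the L_1
   errors smaller than d and dW. *)
pose e' := Num.min (dW / (2 * (1 + b * C))) (d / (2 * (1 + b))).
have e'0 : 0 < e' by rewrite lt_min !divr_gt0// mulr_gt0.
have [th' [P [t' oP PU muP [P1 P2]]]] := approx _ e'0.
have Lt'W : L1_fields muW th'.
  have := L1_restr_field oU rdW (bmuW (sub_gen_smallest (@openT _))) t'.
  by rewrite (_ : restr_field _ _ = th')//; apply/funext => x; rewrite /restr_field mem_set.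
have LBt' := L1_restr_field oU rdV (bmu bB) t'.
have h1 : `|L1_extension U (first_variation W) th' -
    L1_extension U (first_variation W) (restr_field A th)| < e / 2.
  apply: hW => //; apply: (@le_lt_trans _ _ (b%:E * muW P)%E).
    apply: (@L1norm_le_set muW (fun x => th' x - restr_field A th x)) => //.
      by apply: mfieldB; exact: L1_mfield.
    exact: (radon_open oU rdW).
  apply: (@le_lt_trans _ _ (b * (C * e'))%:E).
    rewrite !EFinM lee_wpmul2l//; apply: le_trans (hC _ oP PU) _.
    by apply: lee_wpmul2l => //; rewrite lee_fin ltW.
  rewrite lte_fin; apply: (@le_lt_trans _ _ (dW / 2)); last by rewrite ltr_pdivrMr// ltr_pMr// ltr1n.
  rewrite mulrA; apply: (@le_trans _ _ (b * C * (dW / (2 * (1 + b * C))))).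
    by apply: ler_wpM2l; [rewrite mulr_ge0// ltW|rewrite ge_min lexx].
  by apply: half_frac; [rewrite mulr_ge0// ltW|exact: ltW].
have h2 : `|L1_extension U S (restr_field B th') -
    L1_extension U S (restr_field (B `&` A) th)| < e / 2.
  apply: hd => //; apply: (@le_lt_trans _ _ (b%:E * mu P)%E).
    apply: (@L1norm_le_set mu (fun x => restr_field B th' x - restr_field (B `&` A) th x)) => //.
    - by apply: mfieldB; exact: L1_mfield.
    - exact: (radon_open oU rdV).
    - move=> x /P1; rewrite /restr_field in_setI; case: (x \in B) => //=.
      by rewrite subr0 enorm0.
    - by move=> x /P2; rewrite /restr_field in_setI; case: (x \in B) => //=; rewrite subr0.
  apply: (@le_lt_trans _ _ (b * e')%:E); first by rewrite EFinM lee_wpmul2l.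
  rewrite lte_fin; apply: (@le_lt_trans _ _ (d / 2)); last by rewrite ltr_pdivrMr// ltr_pMr// ltr1n.
  apply: (@le_trans _ _ (b * (d / (2 * (1 + b))))).
    by rewrite ler_wpM2l// ge_min lexx orbT.
  by apply: half_frac => //; exact: ltW.
have h3 : L1_extension U (first_variation W) th' = L1_extension U S (restr_field B th').
  by rewrite eW// first_variation_vrestrE.
rewrite h3 in h1; rewrite [e]splitr.
by apply: le_trans (ler_dist_dist (L1_extension U S (restr_field B th')) _ _) _; rewrite addrC lerD// ltW.
Qed.

Lemma L1_extension_ae A A' th : muW.-caratheodory A -> muW.-caratheodory A' ->
  A `<=` A' -> muW (A' `\` A) = 0%E -> test_fields U th ->
  L1_extension U (first_variation W) (restr_field A th) =
  L1_extension U (first_variation W) (restr_field A' th).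
Proof.
move=> cA cA' AA' z t; have [_ _ cont] := L1_extension_is oU linW rdW.
have Lf := L1_restr_field oU rdW cA t; have Lf' := L1_restr_field oU rdW cA' t.
have [b hb] := test_field_bounded t.
have b0 : 0 <= b by apply: le_trans (hb 0); exact: enorm_ge0.
apply/eqP; rewrite -subr_eq0 -normr_le0; apply/ler_addgt0Pr => e e0; rewrite add0r.
have [d d0 hd] := cont _ Lf' _ e0; apply/ltW/hd => //.
apply: (@le_lt_trans _ _ (b%:E * muW (A' `\` A))%E); last by rewrite z mule0 lte_fin.
apply: (@L1norm_le_set muW (fun x => restr_field A th x - restr_field A' th x)) => //.
- by apply: mfieldB; exact: L1_mfield.
- exact: caratheodory_measurable_setD.
- by move=> x [A'x Ax]; rewrite /restr_field (mem_set A'x) (memNset Ax) sub0r enormN.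
- move=> x nx; rewrite /restr_field; have [Ax|Ax] := pselect (A x).
    by rewrite (mem_set Ax) (mem_set (AA' _ Ax)) subrr.
  have A'x : ~ A' x by move=> A'x; exact: nx.
  by rewrite (memNset Ax) (memNset A'x) subrr.
Qed.

(** A set A that decomposes W is replaced by a Borel set A' containing it, equal to it up to null
    sets of both ||W|| and ||δW||. Then B [&] A' is a part of V inside the atom B, and either
    alternative for it contradicts the positivity of ||W||(A) or of ||W||(U \ A). *)
Lemma component_vrestr : atom w (boundaryless m U V) B -> component m U V W.
Proof.
move=> [_ wB atomB]; have [_ BU zbB] := zB.
split; [exact: varifold_vrestr|by exists setT; rewrite /= /orestr setIT; apply/eqP; rewrite gt_eqF| |].
  split; first exact: rdW.
  move=> [A [[AU cA] wA wUA zA]].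
  have rwW := radon_weight oU varifold_vrestr.
  have Koo (nu : {outer_measure set E -> \bar R}) i : radon_over U nu -> (nu (kex U i) < +oo)%E.
    by move=> rnu; apply: (radon_ltoo rnu); [exact: compact_kex|exact: kex_sub].
  have kc (nu : {outer_measure set E -> \bar R}) i : radon_over U nu -> nu.-caratheodory (kex U i).
    by move=> rnu; apply: (radon_closed oU rnu); exact: closed_kex.
  have c1 : (weight m W).-caratheodory A.
    apply: (@caratheodory_summand _ _ [the {outer_measure set E -> \bar R} of weight m W] muW (kex U)) => //.
    - by move=> i; exact: kc.
    - by move=> i j; exact: le_kex.
    - by move=> i; exact: Koo.
    - by move=> i; exact: Koo.
    - by rewrite bigcup_kex//; case: rwW.
  have c2 : muW.-caratheodory A.
    apply: (@caratheodory_summand _ _ muW [the {outer_measure set E -> \bar R} of weight m W] (kex U)) => //.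
    - by move=> i; exact: kc.
    - by move=> i j; exact: le_kex.
    - by move=> i; exact: Koo.
    - by move=> i; exact: Koo.
    - by rewrite bigcup_kex//; case: rdW.
    - rewrite (_ : (fun Y => _) = (fun Y => weight m W Y + muW Y)%E)//.
      by apply/funext => Y; exact: addeC.
  have [B1 [bB1 AB1 B1U z1]] := radon_hull oU (@compact_kex _ _ U) (@closed_kex _ _ U)
     (bigcup_kex oU) rwW c1 AU.
  have [B2 [bB2 AB2 B2U z2]] := radon_hull oU (@compact_kex _ _ U) (@closed_kex _ _ U)
     (bigcup_kex oU) rdW c2 AU.
  pose A' := B1 `&` B2; have bA' : <<s open >> A' by exact: borelI.
  have AA' : A `<=` A' by move=> x Ax; split; [exact: AB1|exact: AB2].
  have z1' : weight m W (A' `\` A) = 0%E.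
    by apply: (@null_subset _ _ [the {outer_measure set E -> \bar R} of weight m W] _ (B1 `\` A)) => // x [[]].
  have z2' : muW (A' `\` A) = 0%E by apply: (@null_subset _ _ muW _ (B2 `\` A)) => // x [[]].
  have eW : vrestr m W A = vrestr m W A'.
    apply: outer_measure_eq => Y; apply: eq_outer_measure_ae.
      rewrite (_ : _ `\` _ = set0) ?outer_measure0//.
      by apply/seteqP; split => // -[x P] [[/= Ax GP] []]; split => //; exact: AA'.
    apply: (@null_subset _ _ W _ ((A' `\` A) `*` G)); last exact: z1'.
    move=> -[x P] [[/= Ax GP] nA]; split => //; split => // Ax'.
    by apply: nA.
  have eV : vrestr m V (B `&` A') = vrestr m W A'.
    apply: outer_measure_eq => Y; congr (V _).
    by apply/seteqP; split => -[x P] /=; [move=> [[[? ?] ?] ?]|move=> [[? ?] [[? ?] ?]]].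
  have zBA : boundaryless m U V (B `&` A').
    split; [exact: borelI|by move=> x [/BU]|].
    move=> th t; have := zA th t; rewrite /dist_boundary eV eW; move=> <-; congr (_ - _).
    rewrite /functional_restr -[LHS]/(L1_extension U S (restr_field (B `&` A') th)).
    by rewrite -L1_extension_vrestr//; apply/esym/L1_extension_ae => //; exact: bmuW.
  have wAB : (0 < w (B `&` A))%E by rewrite -weight_vrestr.
  have [h|h] := atomB _ zBA (@subIsetl _ _ _).
    move: wAB; rewrite lt_neqAle eq_sym => /andP[/eqP + _]; apply.
    by apply: (@null_subset _ _ [the {outer_measure set E -> \bar R} of w] _ (B `&` A')) => // x [Bx /AA'].
  move: wUA; rewrite weight_vrestr lt_neqAle eq_sym => /andP[/eqP + _]; apply.
  apply: (@null_subset _ _ [the {outer_measure set E -> \bar R} of w] _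
    ((B `\` (B `&` A')) `|` (B `&` (A' `\` A)))).
    move=> x [Bx [Ux nA]]; have [A'x|A'x] := pselect (A' x); first by right.
    by left; split => // -[_].
  by apply: null_setU => //; rewrite -[LHS]weight_vrestr.
exists B; split => //; exact: vmeasurable_borel.
Qed.

End component.

(** * Summation over the pieces of a partition *)

Section decomposition_sum.
Variables (R : realType) (n m : nat).
Local Notation E := 'rV[R]_n.
Local Notation X := ('rV[R]_n * subspaces R n)%type.
Local Notation G := (@grassmann R n m).
Variable U : set E.
Hypothesis oU : open U.
Variable V : {outer_measure set X -> \bar R}.
Hypothesis rV : varifold m U V.
Local Notation w := (weight m V).
Let cyl A : <<s open >> A -> V.-caratheodory (A `*` G).
Proof. exact: (cylinder_caratheodory oU rV). Qed.

Variable k : X -> R.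
Hypothesis Kk : Kspace (U `*` G) k.

Lemma Kspace_measurable : measurable_fun setT (k : caratheodory_type V -> R).
Proof.
have [ck _ _] := Kk; apply: continuous_caratheodory => // O oO.
exact: (varifold_open oU rV).
Qed.

Lemma Kspace_integrable : (cmeas V).-integrable setT (EFin \o k).
Proof.
have [ck cs sU] := Kk.
have clS : closed (spt k) by exact: closed_closure.
have cS : V.-caratheodory (spt k).
  by rewrite -[spt k]setCK; apply: caratheodory_measurable_setC; apply: (varifold_open oU rV); exact: closed_openC.
have mS : measurable (spt k : set (caratheodory_type V)) by exact: cS.
have /compact_bounded[M [_ hM]] : compact (k @` spt k).
  by apply: continuous_compact => //; exact: continuous_subspaceT.
have Voo : (V (spt k) < +oo)%E by case: rV => _ h _ _ _; exact: h.
have M1 : forall x, spt k x -> `|k x| <= `|M + 1|.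
  by move=> x sx; apply: le_trans (ler_norm _); apply: hM; [rewrite ltrDl|exists x].
apply/integrableP; split; first by apply/measurable_EFinP; exact: Kspace_measurable.
apply: (@le_lt_trans _ _ (\int[cmeas V]_x (`|M + 1|%:E * (\1_(spt k) x)%:E))%E).
  apply: (ge0_le_integral (cmeas V) measurableT).
  - by move=> x _.
  - by apply: measurableT_comp => //; apply/measurable_EFinP; exact: Kspace_measurable.
  - by apply/measurable_EFinP; apply: measurable_funM => //; exact: measurable_indic.
  move=> x _; rewrite -EFinM /= lee_fin indicE.
  have [sx|sx] := pselect (spt k x); first by rewrite mem_set// mulr1 M1.
  by rewrite (spt_eq0 sx) normr0 mulr_ge0.
rewrite ge0_integralZl_EFin//; last by apply/measurable_EFinP; exact: measurable_indic.
by rewrite integral_indic// setIT lte_mul_pinfty.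
Qed.

Lemma ointegral_vrestr A : V.-caratheodory (A `*` G) ->
  ointegral (vrestr m V A) k = \int[cmeas V]_(x in A `*` G) k x.
Proof.
move=> cA; rewrite /ointegral /Rintegral; congr fine; apply: integral_orestr => //.
by apply/measurable_EFinP; exact: Kspace_measurable.
Qed.

Variable F : nat -> set E.
Hypothesis bF : forall i, <<s open >> (F i).
Hypothesis FU : forall i, F i `<=` U.
Hypothesis dF : forall i j, (i < j)%N -> F i `&` F j = set0.
Hypothesis wF : w (U `\` \bigcup_i F i) = 0%E.
Let a i : R := ointegral (vrestr m V (F i)) k.

Let mF i : measurable (F i `*` G : set (caratheodory_type V)).
Proof. exact: cyl. Qed.

Let iF i : (cmeas V).-integrable (F i `*` G) (EFin \o k).
Proof. by apply: integrableS Kspace_integrable. Qed.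

Let aE i : (a i)%:E = (\int[cmeas V]_(x in F i `*` G) (k x)%:E)%E.
Proof.
rewrite /a ointegral_vrestr; last exact: cyl.
by rewrite /Rintegral fineK//; exact: integrable_fin_num (iF i).
Qed.

Let tF : trivIset [set: nat] (fun i => F i `*` G : set (caratheodory_type V)).
Proof.
apply/trivIsetP => i j _ _; rewrite neq_ltn => /orP[] ij; apply/seteqP; split => // -[x P] [[/= h1 _] [h2 _]].
  by have : (F i `&` F j) x by []; rewrite dF.
by have : (F j `&` F i) x by []; rewrite dF.
Qed.

Lemma summable_pieces : summable [set: nat] (EFin \o a).
Proof.
rewrite /summable -nneseries_esumT; last by move=> i; rewrite abse_ge0.
have [mk koo] := integrableP _ _ _ Kspace_integrable.
have mU : measurable (\bigcup_i (F i `*` G) : set (caratheodory_type V)) by exact: bigcup_measurable.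
apply: le_lt_trans koo.
apply: (@le_trans _ _ (\int[cmeas V]_(x in \bigcup_i (F i `*` G)) `|(k x)%:E|)%E); last first.
  apply: ge0_subset_integral => //; exact: measurableT_comp.
rewrite ge0_integral_bigcup//; last first.
  by apply: measurable_funTS; exact: measurableT_comp.
apply: lee_nneseries => [i _ _|i _]; first by rewrite abse_ge0.
rewrite -[(EFin \o a) i]/((a i)%:E) aE; apply: le_abse_integral => //; exact: measurable_funTS.
Qed.

Lemma ointegral_pieces : (ointegral V k)%:E = (\sum_(i <oo) (a i)%:E)%E.
Proof.
have iV := Kspace_integrable.
have mU : measurable (\bigcup_i (F i `*` G) : set (caratheodory_type V)) by exact: bigcup_measurable.
have z : cmeas V (~` \bigcup_i (F i `*` G)) = 0%E.
  apply: (@null_subset _ _ V _ (~` (U `*` G) `|` ((U `\` \bigcup_i F i) `*` G))).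
    move=> [x P] nF; have [[Ux GP]|] := pselect ((U `*` G) (x, P)); last by left.
    right; split => //; split => // -[i _ Fx]; apply: nF; by exists i.
  by apply: null_setU; [case: rV|exact: wF].
rewrite /ointegral /Rintegral fineK; last exact: integrable_fin_num iV.
rewrite (negligible_integral _ measurableT iV z); last exact: measurableC.
rewrite setTD setCK integral_bigcup//; last exact: integrableS iV.
by apply: eq_eseriesr => i _; rewrite aE.
Qed.

Let e i := vrestr m V (F i).
Let P : set nat := [set i | (0 < w (F i))%E].

(** A piece of positive weight is told apart from a disjoint one by its own cylinder. All null
    pieces give the zero measure, whence the set [P]. *)
Lemma vrestr_inj : set_inj P e.
Proof.
suff h i j : (i < j)%N -> P i -> e i = e j -> False.
  move=> i j /set_mem Pi /set_mem Pj eij.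
  by have [ij|ij|//] := ltngtP i j; exfalso; [exact: (h i j)|exact: (h j i)].
move=> ij Pi eij.
have : e i (F i `*` G) = e j (F i `*` G) by rewrite eij.
rewrite /= /orestr setIid => h; move: Pi; rewrite /P /= /weight h (_ : _ `&` _ = set0).
  by rewrite outer_measure0 ltxx.
apply/seteqP; split => // -[x Q] [[/= h1 _] [h2 _]].
by have : (F i `&` F j) x by []; rewrite dF.
Qed.

(** [numsum] runs over a set of measures, which [vrestr_inj] indexes by [P]; pieces outside [P]
    contribute 0. The series converges absolutely, so positive and negative parts can be summed
    apart. *)
Lemma ointegral_numsum :
  (ointegral V k)%:E = numsum (e @` P) (fun W => ointegral W k).
Proof.
rewrite ointegral_pieces (@summable_eseries _ (EFin \o a) xpredT); last first.
  by rewrite (_ : (fun _ => _) = setT)//; [exact: summable_pieces|apply/seteqP; split].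
have a0 i : i \notin P -> a i = 0.
  move=> iP; have w0 : w (F i) = 0%E.
    apply/eqP; apply: contrapT => /negP h; move/negP: iP; apply; apply/mem_set.
    by rewrite /P /= lt_neqAle eq_sym h; exact: outer_measure_ge0.
  rewrite /a ointegral_vrestr; last exact: cyl.
  rewrite /Rintegral null_set_integral//.
  by apply: measurable_funTS; apply/measurable_EFinP; exact: Kspace_measurable.
(* Used twice, with g the positive and the negative part. *)
have main (g : R -> R) : g 0 = 0 -> (forall x, 0 <= g x) ->
    (\esum_(W in e @` P) (g (ointegral W k))%:E = \sum_(i <oo) (g (a i))%:E)%E.
  move=> g0 gge; rewrite (@esum_set_image _ _ (fun W => (g (ointegral W k))%:E) e P); last 2 first.
  - by move=> i _; rewrite lee_fin.
  - exact: vrestr_inj.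
  rewrite eseries_mkcond; apply: eq_eseriesr => i _; case: ifPn => // iP.
  by rewrite a0// g0.
rewrite /numsum (main (fun x => Num.max x 0)); last 2 first.
- by rewrite maxxx.
- by move=> x; rewrite le_max lexx orbT.
rewrite (main (fun x => Num.max (- x) 0)); last 2 first.
- by rewrite oppr0 maxxx.
- by move=> x; rewrite le_max lexx orbT.
congr (_ - _)%E; apply: eq_eseriesr => i _.
  by rewrite funeposE /= EFin_max.
by rewrite funenegE /= EFin_max.
Qed.

End decomposition_sum.

Theorem mainTheorem1 (R : realType) (m n : nat) (m_gt0 : (0 < m)%N)
    (n_gt0 : (0 < n)%N) (le_mn : (m <= n)%N) (U : set 'rV[R]_n) (openU : open U)
    (V : {outer_measure set ('rV[R]_n * subspaces R n)%type -> \bar R})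
    (rectV : rectifiable_varifold m U V) (radonV : radon_variation U V) :
  exists Xi : set {outer_measure set ('rV[R]_n * subspaces R n)%type -> \bar R},
    decomposition m U V Xi.
Proof.
have [rV [M [theta [T [[MU _ cM] [theta0 mtheta [TG _] VE]]]]]] := rectV.
have rw := radon_weight openU rV.
pose mu := Defs.variation U (first_variation V).
pose w : {outer_measure set 'rV[R]_n -> \bar R} :=
  [the {outer_measure set 'rV[R]_n -> \bar R} of weight m V].
have /choice[dl hdl] : forall i, exists d : R, 0 < d /\ forall B, boundaryless m U V B ->
    (0 < w (B `&` core m U M theta mu i) -> d%:E <= w (B `&` kex U i.+1))%E.
  move=> i; have [d d0 hd] := boundaryless_mass m_gt0 openU rV radonV MU cM theta0 mtheta TG VE i.
  by exists d; split.
have koo i : (w (kex U i) < +oo)%E.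
  by apply: (radon_ltoo rw); [exact: compact_kex|exact: kex_sub].
have [F [aF dF wF]] : exists F : nat -> set 'rV[R]_n,
    [/\ forall k, F k = set0 \/ atom w (boundaryless m U V) (F k),
      forall i j, (i < j)%N -> F i `&` F j = set0 & w (U `\` \bigcup_k F k) = 0%E].
  (* C_i is the i-th core; N_i is [kex U i.+1], which contains the balls of fixed radius 2^-p about
     the points of C_i. *)
  apply: (@atomic_decomposition _ _ w U (boundaryless m U V) _ _ _ _ _ (kex U) _ _
    (core m U M theta mu) (fun i => kex U i.+1) dl) => //.
  - by move=> A [].
  - by move=> A [bA _ _]; exact: (radon_borel openU rw).
  - exact: boundarylessT.
  - by move=> A B; exact: boundarylessD.
  - by move=> G; exact: boundaryless_bigcap.
  - exact: bigcup_kex.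
  - by move=> i; have [] := hdl i.
  - by move=> i; have [] := hdl i.
  - exact: (weight_core openU rV MU cM theta0 mtheta TG VE radonV m_gt0).
have zF k : boundaryless m U V (F k).
  have [->|[]//] := aF k; rewrite -(setDv U).
  by apply: boundarylessD => //; exact: boundarylessT.
have bF k : <<s open >> (F k) by have [] := zF k.
pose P : set nat := [set k | (0 < w (F k))%E].
have atomF k : P k -> atom w (boundaryless m U V) (F k).
  by rewrite /P /=; have [->|//] := aF k; rewrite outer_measure0 ltxx.
(* Null members of the sequence, among them the empty ones, are dropped: they restrict V to zero,
   which is not a component. *)
exists ((fun k => vrestr m V (F k)) @` P); split.
- move=> _ [k Pk <-]; apply: component_vrestr => //; exact: atomF.
- move=> _ _ [i Pi <-] [j Pj <-] WY; exists (F i), (F j).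
  have vm k : vmeasurable m U V (F k).
    by apply: vmeasurable_borel => //; have [] := zF k.
  have zb k : zero_boundary m U V (F k) by have [] := zF k.
  split => //.
  have [ij|ij|e] := ltngtP i j; [exact: dF|by rewrite setIC; exact: dF|].
  by case: WY; rewrite e.
- move=> k Kk; apply: (ointegral_numsum openU rV Kk bF) => //.
Qed.
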